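(* Let $\mathfrak g$ be a $\mathbb Z$-graded quadratic color Lie algebra with form $B$. The square of the cubic Dirac operator $\mathrm D'=\sum_ae^a\otimes e_a+1\otimes\phi'\in\widehat{\mathcal W}_\varepsilon(\mathfrak g)$ is $$(\mathrm D')^2=\Omega'_{\mathfrak g}\otimes1+1\otimes\widehat q(\psi^\sharp_{\mathrm{KP}})+\tfrac1{24}\operatorname{tr}_\varepsilon\bigl(\mathrm{ad}_{\mathfrak g_0}(\Omega_{\mathfrak g_0})\bigr)(1\otimes1).$$
   Context: Fix an abelian group $\Gamma$ (neutral element $0_\Gamma$) and a commutation factor $\varepsilon:\Gamma\times\Gamma\to\mathbb C^\times$ (multiplicative in each variable, $\varepsilon(\alpha,\beta)\varepsilon(\beta,\alpha)=1$); $\varepsilon(x,y)=\varepsilon(|x|,|y|)$, $\varepsilon(x)=\varepsilon(x,x)$. A color Lie algebra is a $\Gamma$-graded complex vector space with graded bracket, $[x,y]=-\varepsilon(x,y)[y,x]$, $[x,[y,z]]=[[x,y],z]+\varepsilon(x,y)[y,[x,z]]$. $\mathbb Z$-graded quadratic color Lie algebra: $\mathfrak g=\bigoplus_{i\in\mathbb Z}\mathfrak g_i$, each $\mathfrak g_i$ finite-dimensional and $\Gamma$-graded, $[\mathfrak g_i,\mathfrak g_j]\subseteq\mathfrak g_{i+j}$, with a nondegenerate, $\varepsilon$-symmetric, invariant form $B$ with $B(x,y)=0$ unless $\deg x+\deg y=0$ and $|x|+|y|=0_\Gamma$. $\mathfrak g_+=\bigoplus_{i>0}\mathfrak g_i$,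 $\mathfrak g_-=\bigoplus_{i\le0}\mathfrak g_i$, projections $\pi_\pm$. $(e_a)$ is a homogeneous basis, $(e^a)$ its dual basis, $B(e_a,e^b)=\delta_{ab}$. $\operatorname{tr}_\varepsilon(T)=\sum_a\varepsilon(e_a)B(T(e_a),e^a)$ for finite-rank $T$ (analogously on $\mathfrak g_0$). Algebras generated by $\mathfrak g$: $S_\varepsilon$ ($xy=\varepsilon(x,y)yx$), $\mathfrak U_\varepsilon$ ($xy-\varepsilon(x,y)yx=[x,y]$), $\bigwedge_\varepsilon$ ($x\wedge y=-\varepsilon(x,y)y\wedge x$), $\mathrm{Cl}_\varepsilon$ ($xy+\varepsilon(x,y)yx=2B(x,y)$); $\mathcal W_\varepsilon(\mathfrak g)=\mathfrak U_\varepsilon(\mathfrak g)\otimes\mathrm{Cl}_\varepsilon(\mathfrak g)$ with $(a\otimes b)(c\otimes d)=\varepsilon(b,c)ac\otimes bd$. For each such $F$, $\widehat F(\mathfrak g)$ is the direct sum over $(i,\gamma)\in\mathbb Z\times\Gamma$ of $\prod_{r\ge0}\bigoplus_{\alpha+\beta=\gamma}F(\mathfrak g_-)_{(i-r,\alpha)}\otimes F(\mathfrak g_+)_{(r,\beta)}$, with product extended. Quantization $q:\bigwedge_\varepsilon\to\mathrm{Cl}_\varepsilon$: $q(x_1\wedge\dots\wedge x_k)=\frac1{k!}\sum_\sigma\operatorname{sgn}(\sigma)p'(\sigma)x_{\sigma(1)}\cdots x_{\sigma(k)}$; symmetrization $Q:S_\varepsilon\to\mathfrak U_\varepsilon$: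 $Q(x_1\cdots x_k)=\frac1{k!}\sum_\sigma p'(\sigma)x_{\sigma(1)}\cdots x_{\sigma(k)}$; here $p'(\sigma)=\prod_{i<j,\,\sigma^{-1}(i)>\sigma^{-1}(j)}\varepsilon(x_i,x_j)$. The normal-ordered maps $\widehat q:\widehat{\bigwedge}_\varepsilon(\mathfrak g)\to\widehat{\mathrm{Cl}}_\varepsilon(\mathfrak g)$ and $\widehat Q:\widehat S_\varepsilon(\mathfrak g)\to\widehat{\mathfrak U}_\varepsilon(\mathfrak g)$ are induced componentwise by $q\otimes q$ and $Q\otimes Q$ on the $\mathfrak g_-$ and $\mathfrak g_+$ factors. Contraction on $\widehat{\bigwedge}_\varepsilon$: $\iota_xy=B(x,y)$, $\iota_x(\omega\wedge\eta)=\iota_x\omega\wedge\eta+(-1)^k\varepsilon(x,\omega)\omega\wedge\iota_x\eta$ for $\omega$ of exterior degree $k$. $\lambda(T)=-\tfrac12\sum_aT(e^a)\wedge e_a$. The structure constants tensor $\phi\in\widehat{\bigwedge}{}^3_\varepsilon(\mathfrak g)_{(0,0_\Gamma)}$ is characterized by $2\iota_x\phi=-\lambda(\mathrm{ad}_x)$ for all $x$; $\phi'=\widehat q(\phi)$. $\Omega'_{\mathfrak g}=\widehat Q(\sum_ae^ae_a)$. Kac--Peterson cocycle: $\psi_{\mathrm{KP}}(x,y)=\tfrac12\operatorname{tr}_\varepsilon(\mathrm{ad}_x\pi_-\mathrm{ad}_y\pi_+)-\tfrac12\varepsilon(x,y)\operatorname{tr}_\varepsilon(\mathrm{ad}_y\pi_-\mathrm{ad}_x\pi_+)$;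 $\psi^\sharp_{\mathrm{KP}}\in\widehat{\bigwedge}{}^2_\varepsilon(\mathfrak g)$ is defined by $\psi_{\mathrm{KP}}(x,y)=B(\iota_x\psi^\sharp_{\mathrm{KP}},y)$. $\Omega_{\mathfrak g_0}=\sum e^ae_a\in\mathfrak U_\varepsilon(\mathfrak g_0)$ (sum over a basis of $\mathfrak g_0$) is the Casimir element of the finite-dimensional color Lie algebra $(\mathfrak g_0,B|_{\mathfrak g_0})$ and $\mathrm{ad}_{\mathfrak g_0}(\Omega_{\mathfrak g_0})$ its image in $\mathrm{End}(\mathfrak g_0)$. *)

(* Defs.v *)
From HB Require Import structures.
From mathcomp Require Import fingroup perm.
From mathcomp Require Import all_boot all_order all_algebra.
From mathcomp Require Import boolp classical_sets functions cardinality fsbigop.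

Set Implicit Arguments.
Unset Strict Implicit.
Unset Printing Implicit Defensive.
Import GRing.Theory.
Local Open Scope quotient_scope.
Local Open Scope classical_set_scope.
Local Open Scope ring_scope.

Section Linear.
Variables (K : fieldType) (V : lmodType K).

Definition subspace (S : set V) :=
  S 0 /\ forall (a : K) x y, S x -> S y -> S (a *: x + y).

Definition spanS (S : set V) : set V :=
  [set x | exists n (c : 'I_n -> K) (v : 'I_n -> V),
     (forall i, S (v i)) /\ x = \sum_(i < n) c i *: v i].

Definition decomposes (D : choiceType) (gr : D -> set V) (u : D -> V) (x : V) :=
  [/\ finite_set [set d | u d != 0], forall d, gr d (u d)
    & x = \sum_(d \in [set: D]) u d].

Definition direct_sum (D : choiceType) (gr : D -> set V) :=
  (forall d, subspace (gr d)) /\ forall x, exists! u, decomposes gr u x.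

Definition components (D : choiceType) (gr : D -> set V) (x : V) : D -> V :=
  xget (fun=> 0) [set u | decomposes gr u x].

End Linear.

(* The associative unital K-algebra generated by X subject to the relations   *)
(* rel: expressions modulo the smallest congruence containing rel and the     *)
(* axioms of an algebra. No assumption 1 != 0 is made, hence pzRingType.      *)
Section PresentedAlgebra.
Variables (K : fieldType) (X : Type).

Inductive aterm :=
| Agen of X | Azero | Aone
| Aadd of aterm & aterm | Amul of aterm & aterm | Ascale of K & aterm.

HB.instance Definition _ := gen_eqMixin aterm.
HB.instance Definition _ := gen_choiceMixin aterm.

Variable rel : aterm -> aterm -> Prop.

Inductive acong : aterm -> aterm -> Prop :=
| acong_rel s t of rel s t : acong s t
| acong_refl s : acong s s
| acong_sym s t of acong s t : acong t s
| acong_trans t s u of acong s t & acong t u : acong s u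
| acong_add s s' t t' of acong s s' & acong t t' :
    acong (Aadd s t) (Aadd s' t')
| acong_mul s s' t t' of acong s s' & acong t t' :
    acong (Amul s t) (Amul s' t')
| acong_scale a s s' of acong s s' : acong (Ascale a s) (Ascale a s')
| acong_addA s t u : acong (Aadd s (Aadd t u)) (Aadd (Aadd s t) u)
| acong_addC s t : acong (Aadd s t) (Aadd t s)
| acong_add0 s : acong (Aadd Azero s) s
| acong_addN s : acong (Aadd (Ascale (-1) s) s) Azero
| acong_mulA s t u : acong (Amul s (Amul t u)) (Amul (Amul s t) u)
| acong_mul1l s : acong (Amul Aone s) s
| acong_mul1r s : acong (Amul s Aone) s
| acong_mulDl s t u : acong (Amul (Aadd s t) u) (Aadd (Amul s u) (Amul t u))
| acong_mulDr s t u : acong (Amul s (Aadd t u)) (Aadd (Amul s t) (Amul s u))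
| acong_scaleA a b s : acong (Ascale a (Ascale b s)) (Ascale (a * b) s)
| acong_scale1 s : acong (Ascale 1 s) s
| acong_scaleDr a s t :
    acong (Ascale a (Aadd s t)) (Aadd (Ascale a s) (Ascale a t))
| acong_scaleDl a b s :
    acong (Ascale (a + b) s) (Aadd (Ascale a s) (Ascale b s))
| acong_scaleAl a s t : acong (Ascale a (Amul s t)) (Amul (Ascale a s) t)
| acong_scaleAr a s t : acong (Ascale a (Amul s t)) (Amul s (Ascale a t)).

Definition acongb s t := `[< acong s t >].

Lemma acongb_equiv : equiv_class_of acongb.
Proof.
split=> [s|s t|t s u]; rewrite /acongb.
- by apply/asboolP; exact: acong_refl.
- by apply/asboolP/asboolP => h; exact: acong_sym.
- by move=> /asboolP h1 /asboolP h2; apply/asboolP; exact: acong_trans h1 h2.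
Qed.

Canonical acong_equivRel := EquivRelPack acongb_equiv.

Definition palg := {eq_quot acong_equivRel}.
HB.instance Definition _ := Choice.on palg.
HB.instance Definition _ := EqQuotient.on palg.

Definition pcls (t : aterm) : palg := \pi_palg t.

Lemma pclsP s t : pcls s = pcls t <-> acong s t.
Proof.
split=> [/eqP|h]; first by rewrite eqmodE => /asboolP.
by apply/eqP; rewrite eqmodE; apply/asboolP.
Qed.

Lemma pclsK (x : palg) : pcls (repr x) = x.
Proof. exact: reprK. Qed.

Lemma acong_repr t : acong (repr (pcls t)) t.
Proof. by apply/pclsP; exact: pclsK. Qed.

Definition pzero : palg := pcls Azero.
Definition pone : palg := pcls Aone.
Definition padd (x y : palg) : palg := pcls (Aadd (repr x) (repr y)).
Definition popp (x : palg) : palg := pcls (Ascale (-1) (repr x)).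
Definition pmul (x y : palg) : palg := pcls (Amul (repr x) (repr y)).
Definition pscale (a : K) (x : palg) : palg := pcls (Ascale a (repr x)).

Lemma paddE s t : padd (pcls s) (pcls t) = pcls (Aadd s t).
Proof. by apply/pclsP; apply: acong_add; exact: acong_repr. Qed.
Lemma pmulE s t : pmul (pcls s) (pcls t) = pcls (Amul s t).
Proof. by apply/pclsP; apply: acong_mul; exact: acong_repr. Qed.
Lemma pscaleE a s : pscale a (pcls s) = pcls (Ascale a s).
Proof. by apply/pclsP; apply: acong_scale; exact: acong_repr. Qed.
Lemma poppE s : popp (pcls s) = pcls (Ascale (-1) s).
Proof. exact: pscaleE. Qed.

Lemma paddA : associative padd.
Proof.
move=> x y z; rewrite -(pclsK x) -(pclsK y) -(pclsK z) !paddE.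
by apply/pclsP; exact: acong_addA.
Qed.
Lemma paddC : commutative padd.
Proof.
by move=> x y; rewrite -(pclsK x) -(pclsK y) !paddE; apply/pclsP; exact: acong_addC.
Qed.
Lemma padd0 : left_id pzero padd.
Proof. by move=> x; rewrite -(pclsK x) paddE; apply/pclsP; exact: acong_add0. Qed.
Lemma paddN : left_inverse pzero popp padd.
Proof.
by move=> x; rewrite -(pclsK x) poppE paddE; apply/pclsP; exact: acong_addN.
Qed.

HB.instance Definition _ := GRing.isZmodule.Build palg paddA paddC padd0 paddN.

Lemma pmulA : associative pmul.
Proof.
move=> x y z; rewrite -(pclsK x) -(pclsK y) -(pclsK z) !pmulE.
by apply/pclsP; exact: acong_mulA.
Qed.
Lemma pmul1l : left_id pone pmul.
Proof. by move=> x; rewrite -(pclsK x) pmulE; apply/pclsP; exact: acong_mul1l. Qed.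
Lemma pmul1r : right_id pone pmul.
Proof. by move=> x; rewrite -(pclsK x) pmulE; apply/pclsP; exact: acong_mul1r. Qed.
Lemma pmulDl : left_distributive pmul padd.
Proof.
move=> x y z; rewrite -(pclsK x) -(pclsK y) -(pclsK z).
move: (repr x) (repr y) (repr z) => s t u.
rewrite (paddE s t) (pmulE (Aadd s t) u) (pmulE s u) (pmulE t u) paddE.
by apply/pclsP; exact: acong_mulDl.
Qed.
Lemma pmulDr : right_distributive pmul padd.
Proof.
move=> x y z; rewrite -(pclsK x) -(pclsK y) -(pclsK z).
move: (repr x) (repr y) (repr z) => s t u.
rewrite (paddE t u) (pmulE s (Aadd t u)) (pmulE s t) (pmulE s u) paddE.
by apply/pclsP; exact: acong_mulDr.
Qed.

HB.instance Definition _ :=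
  GRing.Zmodule_isPzRing.Build palg pmulA pmul1l pmul1r pmulDl pmulDr.

Lemma pscaleA a b x : pscale a (pscale b x) = pscale (a * b) x.
Proof. by rewrite -(pclsK x) !pscaleE; apply/pclsP; exact: acong_scaleA. Qed.
Lemma pscale1 : left_id 1 pscale.
Proof. by move=> x; rewrite -(pclsK x) pscaleE; apply/pclsP; exact: acong_scale1. Qed.
Lemma pscaleDr : right_distributive pscale padd.
Proof.
move=> a x y; rewrite -(pclsK x) -(pclsK y); move: (repr x) (repr y) => s t.
rewrite (paddE s t) (pscaleE a (Aadd s t)) (pscaleE a s) (pscaleE a t) paddE.
by apply/pclsP; exact: acong_scaleDr.
Qed.
Lemma pscaleDl x a b : pscale (a + b) x = padd (pscale a x) (pscale b x).
Proof.
rewrite -(pclsK x); move: (repr x) => s.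
rewrite !pscaleE paddE.
by apply/pclsP; exact: acong_scaleDl.
Qed.

HB.instance Definition _ := GRing.Zmodule_isLmodule.Build K palg
  pscaleA pscale1 pscaleDr pscaleDl.

Lemma pcls_lin a s t : a *: pcls s + pcls t = pcls (Aadd (Ascale a s) t).
Proof. by rewrite -[_ *: _]/(pscale a (pcls s)) pscaleE; exact: paddE. Qed.
Lemma pcls_mul s t : pcls s * pcls t = pcls (Amul s t).
Proof. exact: pmulE. Qed.
Lemma pcls_scale a s : a *: pcls s = pcls (Ascale a s).
Proof. exact: pscaleE. Qed.

Lemma palg_scalerAl a (x y : palg) : a *: (x * y) = (a *: x) * y.
Proof.
rewrite -(pclsK x) -(pclsK y) !(pcls_mul, pcls_scale).
by apply/pclsP; exact: acong_scaleAl.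
Qed.
Lemma palg_scalerAr a (x y : palg) : a *: (x * y) = x * (a *: y).
Proof.
rewrite -(pclsK x) -(pclsK y) !(pcls_mul, pcls_scale).
by apply/pclsP; exact: acong_scaleAr.
Qed.

Definition pgen (x : X) : palg := pcls (Agen x).

End PresentedAlgebra.

(* The morphism of presented algebras extending f, when f maps the defining   *)
(* relations of the source to identities in the target (see pmapP).           *)
Section PresentedMorphism.
Variables (K : fieldType) (X Y : Type).
Variables (rel : aterm K X -> aterm K X -> Prop).
Variables (rel' : aterm K Y -> aterm K Y -> Prop).
Variable f : X -> palg rel'.

Fixpoint aeval (t : aterm K X) : palg rel' :=
  match t with
  | Agen x => f x
  | Azero => 0
  | Aone => 1
  | Aadd s t => aeval s + aeval t
  | Amul s t => aeval s * aeval t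
  | Ascale a s => a *: aeval s
  end.

Definition pmap_alg (x : palg rel) : palg rel' := aeval (repr x).

Hypothesis f_rel : forall s t, rel s t -> aeval s = aeval t.

Lemma aeval_cong s t : acong rel s t -> aeval s = aeval t.
Proof.
elim=> //= {s t}; try by move=> *; congruence.
- by move=> *; rewrite addrA.
- by move=> *; rewrite addrC.
- by move=> *; rewrite add0r.
- by move=> *; rewrite scaleN1r addNr.
- by move=> *; rewrite mulrA.
- by move=> *; rewrite mul1r.
- by move=> *; rewrite mulr1.
- by move=> *; rewrite mulrDl.
- by move=> *; rewrite mulrDr.
- by move=> *; rewrite scalerA.
- by move=> *; rewrite scale1r.
- by move=> *; rewrite scalerDr.
- by move=> *; rewrite scalerDl.
- by move=> *; rewrite palg_scalerAl.
- by move=> *; rewrite palg_scalerAr.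
Qed.

Lemma pmapE t : pmap_alg (pcls rel t) = aeval t.
Proof. by apply: aeval_cong; exact: acong_repr. Qed.

Lemma pmapP :
  [/\ linear pmap_alg, pmap_alg 1 = 1, {morph pmap_alg : x y / x * y}
    & forall x, pmap_alg (pgen rel x) = f x].
Proof.
split=> [a x y||x y|x].
- by rewrite -(pclsK x) -(pclsK y) pcls_lin !pmapE.
- exact: (pmapE (Aone K X)).
- by rewrite -(pclsK x) -(pclsK y) pcls_mul !pmapE.
- exact: (pmapE (Agen K x)).
Qed.

End PresentedMorphism.

Section Tensor.
Variables (K : fieldType) (A B : lmodType K).

Inductive tterm :=
| Tgen of A & B | Tzero | Tadd of tterm & tterm | Tscale of K & tterm.

HB.instance Definition _ := gen_eqMixin tterm.
HB.instance Definition _ := gen_choiceMixin tterm.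

Inductive tcong : tterm -> tterm -> Prop :=
| tcong_linl k a a' b :
    tcong (Tgen (k *: a + a') b) (Tadd (Tscale k (Tgen a b)) (Tgen a' b))
| tcong_linr k a b b' :
    tcong (Tgen a (k *: b + b')) (Tadd (Tscale k (Tgen a b)) (Tgen a b'))
| tcong_refl s : tcong s s
| tcong_sym s t of tcong s t : tcong t s
| tcong_trans t s u of tcong s t & tcong t u : tcong s u
| tcong_add s s' t t' of tcong s s' & tcong t t' :
    tcong (Tadd s t) (Tadd s' t')
| tcong_scale k s s' of tcong s s' : tcong (Tscale k s) (Tscale k s')
| tcong_addA s t u : tcong (Tadd s (Tadd t u)) (Tadd (Tadd s t) u)
| tcong_addC s t : tcong (Tadd s t) (Tadd t s)
| tcong_add0 s : tcong (Tadd Tzero s) s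
| tcong_addN s : tcong (Tadd (Tscale (-1) s) s) Tzero
| tcong_scaleA k l s : tcong (Tscale k (Tscale l s)) (Tscale (k * l) s)
| tcong_scale1 s : tcong (Tscale 1 s) s
| tcong_scaleDr k s t :
    tcong (Tscale k (Tadd s t)) (Tadd (Tscale k s) (Tscale k t))
| tcong_scaleDl k l s :
    tcong (Tscale (k + l) s) (Tadd (Tscale k s) (Tscale l s)).

Definition tcongb s t := `[< tcong s t >].

Lemma tcongb_equiv : equiv_class_of tcongb.
Proof.
split=> [s|s t|t s u]; rewrite /tcongb.
- by apply/asboolP; exact: tcong_refl.
- by apply/asboolP/asboolP => h; exact: tcong_sym.
- by move=> /asboolP h1 /asboolP h2; apply/asboolP; exact: tcong_trans h1 h2.
Qed.

Canonical tcong_equivRel := EquivRelPack tcongb_equiv.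

Definition tens := {eq_quot tcong_equivRel}.
HB.instance Definition _ := Choice.on tens.
HB.instance Definition _ := EqQuotient.on tens.

Definition tcls (t : tterm) : tens := \pi_tens t.

Lemma tclsP s t : tcls s = tcls t <-> tcong s t.
Proof.
split=> [/eqP|h]; first by rewrite eqmodE => /asboolP.
by apply/eqP; rewrite eqmodE; apply/asboolP.
Qed.

Lemma tclsK (x : tens) : tcls (repr x) = x.
Proof. exact: reprK. Qed.

Lemma tcong_repr t : tcong (repr (tcls t)) t.
Proof. by apply/tclsP; exact: tclsK. Qed.

Definition tzero : tens := tcls Tzero.
Definition tadd (x y : tens) : tens := tcls (Tadd (repr x) (repr y)).
Definition topp (x : tens) : tens := tcls (Tscale (-1) (repr x)).
Definition tscale (k : K) (x : tens) : tens := tcls (Tscale k (repr x)).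

Lemma taddE s t : tadd (tcls s) (tcls t) = tcls (Tadd s t).
Proof. by apply/tclsP; apply: tcong_add; exact: tcong_repr. Qed.
Lemma tscaleE k s : tscale k (tcls s) = tcls (Tscale k s).
Proof. by apply/tclsP; apply: tcong_scale; exact: tcong_repr. Qed.
Lemma toppE s : topp (tcls s) = tcls (Tscale (-1) s).
Proof. exact: tscaleE. Qed.

Lemma taddA : associative tadd.
Proof.
move=> x y z; rewrite -(tclsK x) -(tclsK y) -(tclsK z) !taddE.
by apply/tclsP; exact: tcong_addA.
Qed.
Lemma taddC : commutative tadd.
Proof.
by move=> x y; rewrite -(tclsK x) -(tclsK y) !taddE; apply/tclsP; exact: tcong_addC.
Qed.
Lemma tadd0 : left_id tzero tadd.
Proof. by move=> x; rewrite -(tclsK x) taddE; apply/tclsP; exact: tcong_add0. Qed.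
Lemma taddN : left_inverse tzero topp tadd.
Proof.
by move=> x; rewrite -(tclsK x) toppE taddE; apply/tclsP; exact: tcong_addN.
Qed.

HB.instance Definition _ := GRing.isZmodule.Build tens taddA taddC tadd0 taddN.

Lemma tscaleA k l x : tscale k (tscale l x) = tscale (k * l) x.
Proof. by rewrite -(tclsK x) !tscaleE; apply/tclsP; exact: tcong_scaleA. Qed.
Lemma tscale1 : left_id 1 tscale.
Proof. by move=> x; rewrite -(tclsK x) tscaleE; apply/tclsP; exact: tcong_scale1. Qed.
Lemma tscaleDr : right_distributive tscale tadd.
Proof.
move=> a x y; rewrite -(tclsK x) -(tclsK y); move: (repr x) (repr y) => s t.
rewrite (taddE s t) (tscaleE a (Tadd s t)) (tscaleE a s) (tscaleE a t) taddE.
by apply/tclsP; exact: tcong_scaleDr.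
Qed.
Lemma tscaleDl x k l : tscale (k + l) x = tadd (tscale k x) (tscale l x).
Proof.
rewrite -(tclsK x); move: (repr x) => s.
rewrite !tscaleE taddE.
by apply/tclsP; exact: tcong_scaleDl.
Qed.

HB.instance Definition _ := GRing.Zmodule_isLmodule.Build K tens
  tscaleA tscale1 tscaleDr tscaleDl.

Lemma tcls_lin k s t : k *: tcls s + tcls t = tcls (Tadd (Tscale k s) t).
Proof. by rewrite -[_ *: _]/(tscale k (tcls s)) tscaleE; exact: taddE. Qed.

Definition tpure (a : A) (b : B) : tens := tcls (Tgen a b).

(* The linear map a (x) b |-> f a b, when f is bilinear (see tliftP).         *)
Section Lift.
Variables (V : lmodType K) (f : A -> B -> V).

Fixpoint teval (t : tterm) : V :=
  match t with
  | Tgen a b => f a b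
  | Tzero => 0
  | Tadd s t => teval s + teval t
  | Tscale k s => k *: teval s
  end.

Definition tlift (x : tens) : V := teval (repr x).

Hypothesis f_linl : forall b, linear (f^~ b).
Hypothesis f_linr : forall a, linear (f a).

Lemma teval_cong s t : tcong s t -> teval s = teval t.
Proof.
elim=> //= {s t}; try by move=> *; congruence.
- by move=> k a a' b; rewrite (f_linl b).
- by move=> k a b b'; rewrite (f_linr a).
- by move=> *; rewrite addrA.
- by move=> *; rewrite addrC.
- by move=> *; rewrite add0r.
- by move=> *; rewrite scaleN1r addNr.
- by move=> *; rewrite scalerA.
- by move=> *; rewrite scale1r.
- by move=> *; rewrite scalerDr.
- by move=> *; rewrite scalerDl.
Qed.

Lemma tliftE t : tlift (tcls t) = teval t.
Proof. by apply: teval_cong; exact: tcong_repr. Qed.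

Lemma tliftP : linear tlift /\ forall a b, tlift (tpure a b) = f a b.
Proof.
split=> [k x y|a b]; last by rewrite tliftE.
by rewrite -(tclsK x) -(tclsK y) tcls_lin !tliftE.
Qed.

End Lift.

End Tensor.

Definition tmap (K : fieldType) (A B A' B' : lmodType K)
    (f : A -> A') (h : B -> B') : tens A B -> tens A' B' :=
  tlift (fun a b => tpure (f a) (h b)).

Record commutation_factor (K : fieldType) (Gam : zmodType) := CommutationFactor {
  cfac :> Gam -> Gam -> K;
  cfacDl : forall a b c, cfac (a + b) c = cfac a c * cfac b c;
  cfacDr : forall a b c, cfac a (b + c) = cfac a b * cfac a c;
  cfacV : forall a b, cfac a b * cfac b a = 1
}.

Section Degrees.
Variables (K : fieldType) (Gam : zmodType) (eps : commutation_factor K Gam).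

(* The first component is the Z-degree, the second one the color.             *)
Definition bideg : zmodType := (int * Gam)%type.

Definition ep (d d' : bideg) : K := eps d.2 d'.2.

(* qgr (i, gamma) is the homogeneous component of Z-degree i and color gamma; *)
(* as all the maps are bilinear, it is enough to require the identities for   *)
(* bihomogeneous elements.                                                    *)
Record quadColorLie := QuadColorLie {
  qcar :> lmodType K;
  qgr : bideg -> set qcar;
  qbr : qcar -> qcar -> qcar;
  qfm : qcar -> qcar -> K;
  qgr_sum : direct_sum qgr;
  qgr_fin : forall i : int, exists s : seq qcar,
    spanS (\bigcup_(c in [set: Gam]) qgr (i, c)) `<=` spanS [set x | x \in s];
  qbr_linl : forall y, linear (qbr^~ y);
  qbr_linr : forall x, linear (qbr x);
  qbr_gr : forall d d' x y, qgr d x -> qgr d' y -> qgr (d + d') (qbr x y);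
  qbr_skew : forall d d' x y, qgr d x -> qgr d' y ->
    qbr x y = - (ep d d' *: qbr y x);
  qbr_jacobi : forall d d' d'' x y z, qgr d x -> qgr d' y -> qgr d'' z ->
    qbr x (qbr y z) = qbr (qbr x y) z + ep d d' *: qbr y (qbr x z);
  qfm_linl : forall y, scalar (qfm^~ y);
  qfm_linr : forall x, scalar (qfm x);
  qfm_sym : forall d d' x y, qgr d x -> qgr d' y ->
    qfm x y = ep d d' * qfm y x;
  qfm_inv : forall x y z, qfm (qbr x y) z = qfm x (qbr y z);
  qfm_gr : forall d d' x y, qgr d x -> qgr d' y -> d + d' <> 0 -> qfm x y = 0;
  qfm_nondeg : forall x, (forall y, qfm x y = 0) -> x = 0
}.

Variable g : quadColorLie.

Definition gpart (D : set bideg) : set g := spanS (\bigcup_(d in D) qgr d).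
Definition degP : set bideg := [set d | 0 < d.1].
Definition degM : set bideg := [set d | d.1 <= 0].
Definition deg0 : set bideg := [set d | d.1 = 0].
Definition gP := gpart degP.
Definition gM := gpart degM.
Definition g0 := gpart deg0.

Definition gproj (D : set bideg) (x : g) : g :=
  \sum_(d \in D) components (@qgr g) x d.

Record hbasis := HBasis {
  bidx : choiceType;
  bvec : bidx -> g;
  bdual : bidx -> g;
  bdeg : bidx -> bideg;
  bvec_gr : forall a, qgr (bdeg a) (bvec a);
  bvec_basis : forall x, exists! c : bidx -> K,
    finite_set [set a | c a != 0] /\ x = \sum_(a \in [set: bidx]) c a *: bvec a;
  bdualP : forall a b, qfm (bvec a) (bdual b) = (a == b)%:R
}.

Variant algkind := Sym | Env | Ext | Cliff.

Inductive grel (P : set g) : algkind -> aterm K P -> aterm K P -> Prop :=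
| grel_lin k a (x y z : P) of val z = a *: val x + val y :
    grel k (Agen K z) (Aadd (Ascale a (Agen K x)) (Agen K y))
| grel_sym d d' (x y : P) of qgr d (val x) & qgr d' (val y) :
    grel Sym (Amul (Agen K x) (Agen K y))
      (Ascale (ep d d') (Amul (Agen K y) (Agen K x)))
| grel_env d d' (x y z : P) of qgr d (val x) & qgr d' (val y)
    & val z = qbr (val x) (val y) :
    grel Env (Amul (Agen K x) (Agen K y))
      (Aadd (Ascale (ep d d') (Amul (Agen K y) (Agen K x))) (Agen K z))
| grel_ext d d' (x y : P) of qgr d (val x) & qgr d' (val y) :
    grel Ext (Amul (Agen K x) (Agen K y))
      (Ascale (- ep d d') (Amul (Agen K y) (Agen K x)))
| grel_cliff d d' (x y : P) of qgr d (val x) & qgr d' (val y) :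
    grel Cliff (Aadd (Amul (Agen K x) (Agen K y))
                  (Ascale (ep d d') (Amul (Agen K y) (Agen K x))))
      (Ascale (2 * qfm (val x) (val y)) (Aone K P)).

Definition FA (k : algkind) (P : set g) := palg (@grel P k).

(* The generator attached to x; the value outside P is irrelevant.            *)
Definition gen (k : algkind) (P : set g) (x : g) : FA k P :=
  oapp (fun z : P => pgen (@grel P k) z) 0 (insub x).

Definition FAincl k (P Q : set g) : FA k P -> FA k Q :=
  pmap_alg (fun x : P => gen k Q (val x)).

Definition homog (P : set g) n (x : 'I_n -> g) (delta : 'I_n -> bideg) :=
  forall i, P (x i) /\ qgr (delta i) (x i).

Definition FAk_gr k (P : set g) (n : nat) (d : bideg) : set (FA k P) :=
  spanS [set y | exists (x : 'I_n -> g) (delta : 'I_n -> bideg),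
    [/\ homog P x delta, \sum_(i < n) delta i = d
      & y = \prod_(i < n) gen k P (x i)]].

Definition FA_gr k (P : set g) (d : bideg) : set (FA k P) :=
  spanS (\bigcup_(n in [set: nat]) @FAk_gr k P n d).

Definition WA (P : set g) := tens (FA Env P) (FA Cliff P).

Definition WA_gr (P : set g) (d : bideg) : set (WA P) :=
  spanS [set w | exists a b d1 d2, [/\ @FA_gr Env P d1 a,
    @FA_gr Cliff P d2 b, d1 + d2 = d & w = tpure a b]].

(* The product of the eps-graded tensor product; as every element of U and Cl *)
(* is a sum of homogeneous ones, m is unique. The maps quantization,          *)
(* symmetrization and iota below are singled out by their defining properties *)
(* in the same way.                                                           *)
Definition WA_mul (P : set g) : WA P -> WA P -> WA P :=
  xget (fun _ _ => 0) [set m | [/\ forall v, linear (m^~ v),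
    forall w, linear (m w)
    & forall (a c : FA Env P) (b e : FA Cliff P) d d',
        @FA_gr Cliff P d b -> @FA_gr Env P d' c ->
        m (tpure a b) (tpure c e) = ep d d' *: tpure (a * c) (b * e)]].

Definition WA_one (P : set g) : WA P :=
  tpure (1 : FA Env P) (1 : FA Cliff P).

Definition WAincl (P Q : set g) : WA P -> WA Q :=
  tmap (@FAincl Env P Q) (@FAincl Cliff P Q).

(* The data (F(g_-), F(g_+), F(g)) out of which the completion of F(g) is     *)
(* built.                                                                     *)
Record triangular := Triangular {
  tm : lmodType K; tp : lmodType K; tg : lmodType K;
  tmul : tg -> tg -> tg;
  tinm : tm -> tg; tinp : tp -> tg;
  tgrm : bideg -> set tm; tgrp : bideg -> set tp
}.

Definition triF (k : algkind) : triangular := @Triangular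
  (FA k gM) (FA k gP) (FA k setT) *%R
  (@FAincl k gM setT) (@FAincl k gP setT) (@FA_gr k gM) (@FA_gr k gP).

Definition triW : triangular := @Triangular
  (WA gM) (WA gP) (WA setT) (@WA_mul setT)
  (@WAincl gM setT) (@WAincl gP setT) (@WA_gr gM) (@WA_gr gP).

Section Completion.
Variable F : triangular.

(* An element of the completion is the family of its components               *)
(* u (i, gamma, r) in (F(g_-) (x) F(g_+))_(i, gamma, r).                      *)
Definition hidx : choiceType := (bideg * nat)%type.
Definition hfam : lmodType K := hidx -> tens (tm F) (tp F).

Definition hcomp (c : hidx) : set (tens (tm F) (tp F)) :=
  spanS [set w | exists al be a b, [/\ al + be = c.1.2,
    tgrm (c.1.1 - c.2%:Z, al) a, tgrp (c.2%:Z, be) b & w = tpure a b]].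

Definition hat : set hfam := [set u | (forall c, hcomp c (u c)) /\
  finite_set [set d | exists r, u (d, r) != 0]].

Definition tmu : tens (tm F) (tp F) -> tg F :=
  tlift (fun a b => tmul (tinm a) (tinp b)).

(* The embedding of F(g) into its completion: by the triangular decomposition *)
(* the multiplication map tmu : F(g_-) (x) F(g_+) -> F(g) is bijective, and   *)
(* hin y is the family of the components of the preimage of y.                *)
Definition hin (y : tg F) : hfam := xget (fun=> 0) [set u : hfam |
  [/\ finite_set [set c | u c != 0], forall c, hcomp c (u c)
    & y = \sum_(c \in [set: hidx]) tmu (u c)]].

(* In each of the following sums only finitely many terms have a nonzero      *)
(* component of index c, when the arguments are as indicated: u and v in the  *)
(* completion, y one of the sums over a homogeneous basis below, and f a      *)
(* finite sum of maps homogeneous with respect to bideg.                      *)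
Definition hmul (u v : hfam) : hfam := fun c =>
  \sum_(p \in [set: hidx * hidx]) hin (tmul (tmu (u p.1)) (tmu (v p.2))) c.

Definition hsum (I : choiceType) (y : I -> tg F) : hfam := fun c =>
  \sum_(a \in [set: I]) hin (y a) c.

Definition hext (f : tg F -> tg F) (u : hfam) : hfam := fun c =>
  \sum_(c' \in [set: hidx]) hin (f (tmu (u c'))) c.

End Completion.

Arguments hat F : clear implicits.
Arguments hin F y : clear implicits.
Arguments hmul F u v : clear implicits.
Arguments hsum F {I} y.
Arguments hext F f u : clear implicits.

Definition hatS := hfam (triF Sym).
Definition hatU := hfam (triF Env).
Definition hatL := hfam (triF Ext).
Definition hatC := hfam (triF Cliff).
Definition hatW := hfam triW.

Definition pfac n (delta : 'I_n -> bideg) (s : 'S_n) : K :=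
  \prod_(i < n) \prod_(j < n | (i < j)%N && ((s^-1)%g j < (s^-1)%g i)%N)
    ep (delta i) (delta j).

Definition quantization (P : set g) : FA Ext P -> FA Cliff P :=
  xget (fun=> 0) [set f | linear f /\
    forall n (x : 'I_n -> g) delta, homog P x delta ->
      f (\prod_(i < n) gen Ext P (x i)) =
      (n`!)%:R^-1 *: \sum_(s : 'S_n)
        ((-1) ^+ s * pfac delta s) *: \prod_(i < n) gen Cliff P (x (s i))].

Definition symmetrization (P : set g) : FA Sym P -> FA Env P :=
  xget (fun=> 0) [set f | linear f /\
    forall n (x : 'I_n -> g) delta, homog P x delta ->
      f (\prod_(i < n) gen Sym P (x i)) =
      (n`!)%:R^-1 *: \sum_(s : 'S_n)
        pfac delta s *: \prod_(i < n) gen Env P (x (s i))].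

Definition hq (u : hatL) : hatC := fun c =>
  tmap (@quantization gM) (@quantization gP) (u c).
Definition hQ (u : hatS) : hatU := fun c =>
  tmap (@symmetrization gM) (@symmetrization gP) (u c).

(* u |-> u (x) 1 and v |-> 1 (x) v.                                           *)
Definition hinU (u : hatU) : hatW := fun c =>
  tmap (fun a : FA Env gM => tpure a (1 : FA Cliff gM))
       (fun b : FA Env gP => tpure b (1 : FA Cliff gP)) (u c).
Definition hinC (v : hatC) : hatW := fun c =>
  tmap (fun a : FA Cliff gM => tpure (1 : FA Env gM) a)
       (fun b : FA Cliff gP => tpure (1 : FA Env gP) b) (v c).

Definition iota : g -> FA Ext setT -> FA Ext setT :=
  xget (fun _ _ => 0) [set f | [/\ forall w, linear (f^~ w),
    forall x, linear (f x),
    forall x y, f x (gen Ext setT y) = qfm x y *: (1 : FA Ext setT)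
    & forall d n d' x (w v : FA Ext setT), qgr d x -> @FAk_gr Ext setT n d' w ->
        f x (w * v) = f x w * v + ((-1) ^+ n * ep d d') *: (w * f x v)]].

Definition hiota (x : g) (u : hatL) : hatL := hext (triF Ext) (iota x) u.

Definition hatLk (n : nat) : set hatL :=
  [set u : hatL | hat (triF Ext) u /\ forall c : hidx,
  spanS [set w | exists k l al be a b, [/\ (k + l)%N = n, al + be = c.1.2,
    @FAk_gr Ext gM k (c.1.1 - c.2%:Z, al) a,
    @FAk_gr Ext gP l (c.2%:Z, be) b & w = tpure a b]] (u c)].

Variable E : hbasis.
Notation I := (bidx E).
Notation e := (@bvec E).
Notation e' := (@bdual E).

Definition trEps (J : set I) (T : g -> g) : K :=
  \sum_(a \in J) ep (bdeg a) (bdeg a) * qfm (T (e a)) (e' a).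

Definition lam (T : g -> g) : hatL :=
  (- 2^-1) *: hsum (triF Ext)
    (fun a => gen Ext setT (T (e' a)) * gen Ext setT (e a)).

Definition structure_tensor (phi : hatL) :=
  [/\ hatLk 3 phi, forall d r, d != 0 -> phi (d, r) = 0
    & forall x : g, 2 *: hiota x phi = - lam (qbr x)].

(* psi_KP x y for x in qgr d and y in qgr d'.                                 *)
Definition psiKP (d d' : bideg) (x y : g) : K :=
  2^-1 * trEps setT (qbr x \o gproj degM \o qbr y \o gproj degP)
  - 2^-1 * ep d d' * trEps setT (qbr y \o gproj degM \o qbr x \o gproj degP).

Definition KP_sharp (psi : hatL) := hatLk 2 psi /\
  forall d x, qgr d x ->
    exists2 z : g, hiota x psi = hin (triF Ext) (gen Ext setT z)
      & forall d' y, qgr d' y -> psiKP d d' x y = qfm z y.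

Definition Omega' : hatU := hQ (hsum (triF Sym)
  (fun a => gen Sym setT (e' a) * gen Sym setT (e a))).

Definition dirac (phi : hatL) : hatW :=
  hsum triW (fun a => tpure (gen Env setT (e' a)) (gen Cliff setT (e a)))
  + hinC (hq phi).

Definition I0 : set I := [set a | deg0 (bdeg a)].

Definition Omega0 : FA Env g0 :=
  \sum_(a \in I0) gen Env g0 (e' a) * gen Env g0 (e a).

(* The representation of U_eps(g_0) extending ad; it acts on the whole of g,  *)
(* and only its restriction to g_0 is used.                                   *)
Fixpoint ad_term (t : aterm K g0) (y : g) : g :=
  match t with
  | Agen x => qbr (val x) y
  | Azero => 0
  | Aone => y
  | Aadd s t => ad_term s y + ad_term t y
  | Amul s t => ad_term s (ad_term t y)
  | Ascale a s => a *: ad_term s y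
  end.

Definition adU0 (u : FA Env g0) : g -> g := ad_term (repr u).

End Degrees.

Arguments hat {K Gam} F.
Arguments hin {K Gam} F y.
Arguments hmul {K Gam} F u v.
Arguments hsum {K Gam} F {I} y.
Arguments hext {K Gam} F f u.
Arguments WA_one {K Gam eps} g P.
Arguments structure_tensor {K Gam eps g} E phi.
Arguments KP_sharp {K Gam eps g} E psi.
Arguments dirac {K Gam eps g} E phi.
Arguments Omega' {K Gam eps g} E.
Arguments Omega0 {K Gam eps g} E.
Arguments I0 {K Gam eps g} E.

(* Main.v *)
(* Write D' = A + 1 (x) phi' with A = sum_a e^a (x) e_a, and truncate all      *)
(* sums to finite balls of Z-degrees: the identity to be proved then holds     *)
(* modulo elements tending to 0 in the topology defined by the left ideals     *)
(* generated by the F(g_+)_r, r large.                                         *)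
(*                                                                             *)
(* By the definition of phi, the anticommutator of x with phi' is              *)
(* gamma(x) = 1/2 sum_a :[x, e^a] e_a:, where :yz: = yz - <yz> and <.> is the  *)
(* vacuum functional of a Fock module. One has [gamma(x), y] = 2 [x, y], so    *)
(* that [gamma(x), gamma(y)] - 2 gamma([x, y]) commutes with g; it is thus a   *)
(* scalar, namely its vacuum value 4 psi_KP(x, y). The Jacobi identity gives   *)
(* [gamma(x), phi'] = 2 psi^#(x), hence phi'^2 - q^(psi^#) commutes with g and *)
(* is a scalar. As only the part of phi' in Cl(g_0) contributes to its vacuum  *)
(* value, this scalar is the finite-dimensional one,                           *)
(* 1/24 tr_eps(ad Omega_(g_0)).                                                *)
(*                                                                             *)
(* The mixed terms of D'^2 are sum_c e^c (x) gamma(e_c). In A^2, the vacuum    *)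
(* part of e_a e_b yields Omega' (x) 1, while the normal ordered part is       *)
(* 1/2 sum_(a,b) eps(b, a) [e^a, e^b] (x) :e_a e_b:, which cancels the mixed   *)
(* terms by the invariance of B.                                               *)

From HB Require Import structures.
From mathcomp Require Import fingroup perm.
From mathcomp Require Import all_boot all_order all_algebra ring zify complex.
From mathcomp Require Import boolp classical_sets functions cardinality fsbigop reals.
Require Import Defs.

Set Implicit Arguments.
Unset Strict Implicit.
Unset Printing Implicit Defensive.
Import Order.TTheory GRing.Theory Num.Theory.
Local Open Scope classical_set_scope.
Local Open Scope ring_scope.

(** * Linear algebra over the basis of g *)

(** Equality in the completion is proved through polynomial truncations over balls of Z-degrees.
    [approx] expresses convergence of a sequence to an element of the completion, [null] convergence
    to zero, and by [approx_eq] two limits agree when the difference of their truncations is null.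
    This rests on the bijectivity of the multiplication F(g_-) (x) F(g_+) -> F(g) ([split_tmuK],
    [tmu_splitK]; [tmuWK], [splitWK] for W), obtained by letting F(g) act on the tensor product.

    For the pure Clifford part, quantization turns contraction into half a graded commutator
    ([symm_comm], [qgL_comm]), so the tensors phi and psi^# are known through the commutators of
    their quantizations with g ([phi_comm], [psi_comm]). Conversely, an element whose graded
    commutators with g are all small is small up to a scalar ([cm_crit]): half the sum of e^c
    [e_c, u] is an Euler operator, multiplying a word by its length up to shorter words. The scalar
    vanishes in odd parity or nonzero degree ([crit_null]), and otherwise it is the vacuum value
    ([crit_vac]).

    This criterion is applied three times. It gives [gamma(x), gamma(y)] = 2 gamma([x, y]) + 4
    psi_KP(x, y) ([Gam_bracket_null]), the anomaly being computed in [KP_vac]; then [gamma(x), phi']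
    = 2 psi^#(x) ([Theta_null]), where psi^#(x) denotes the vector dual to psi_KP(x, .); and finally
    that phi'^2 is the quantized psi^# plus its own vacuum value ([Phi_square_null]). Only words in
    g_0 contribute to that value, and the Euler identity for a cubic element ([Phi1_euler]) yields 3
    <phi'^2> = 1/2 1/4 tr, hence the factor 1/24 ([vac_Phi_square]).

    In the remaining part of the square, each e_a e_b is split into its vacuum value and its normal
    ordered part. The vacuum values assemble the normal ordered Casimir element ([casimir_qg]). The
    normal ordered parts give a triple sum over structure constants that is opposite to the one
    coming from the mixed terms ([diracA_square], [cross_gam]); the two sums are truncated
    differently, and the discrepancy tends to zero ([triple_null]). *)

Section LinearPreliminaries.
Variable K : fieldType.

Section SquareZero.
Variable V : lmodType K.

(* The square-zero extension K (+) V is a commutative ring containing V, in   *)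
(* which identities between linear combinations can be proved by ring.        *)
Definition sqz := (K * V)%type.
HB.instance Definition _ := GRing.Zmodule.on sqz.
Definition sqz_mul (x y : sqz) : sqz := (x.1 * y.1, x.1 *: y.2 + y.1 *: x.2).
Definition sqz_one : sqz := (1, 0).

Lemma sqz_mulA : associative sqz_mul.
Proof.
move=> [a u] [b v] [c w]; rewrite /sqz_mul /= mulrA; congr pair.
by rewrite !scalerDr !scalerA addrA (mulrC c a) (mulrC c b).
Qed.
Lemma sqz_mulC : commutative sqz_mul.
Proof. by move=> [a u] [b v]; rewrite /sqz_mul /= mulrC addrC. Qed.
Lemma sqz_mul1 : left_id sqz_one sqz_mul.
Proof. by move=> [a u]; rewrite /sqz_mul /= mul1r scale1r scaler0 addr0. Qed.
Lemma sqz_mulDl : left_distributive sqz_mul +%R.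
Proof.
move=> [a u] [b v] [c w]; rewrite /sqz_mul /= mulrDl; congr pair.
by rewrite scalerDl scalerDr addrACA.
Qed.
Lemma sqz_one_neq0 : sqz_one != 0.
Proof. by apply/eqP => -[] /eqP; rewrite oner_eq0. Qed.
HB.instance Definition _ := GRing.Zmodule_isComNzRing.Build sqz
  sqz_mulA sqz_mulC sqz_mul1 sqz_mulDl sqz_one_neq0.

Definition sqzV (v : V) : sqz := (0, v).
Definition sqzK (a : K) : sqz := (a, 0).

Lemma sqzV_inj : injective sqzV. Proof. by move=> u v []. Qed.

Fact sqzK_additive : zmod_morphism sqzK.
Proof. by move=> a b; congr pair; rewrite /= subr0. Qed.
HB.instance Definition _ := GRing.isZmodMorphism.Build K sqz sqzK sqzK_additive.
Fact sqzK_multiplicative : monoid_morphism sqzK.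
Proof. by split=> // a b; congr pair; rewrite /= !scaler0 addr0. Qed.
HB.instance Definition _ :=
  GRing.isMonoidMorphism.Build K sqz sqzK sqzK_multiplicative.

Lemma sqzVZ a v : sqzV (a *: v) = sqzK a * sqzV v.
Proof. by congr pair; rewrite /= ?mulr0 // scale0r addr0. Qed.
Lemma sqzV0 : sqzV 0 = 0. Proof. by []. Qed.
Lemma sqzVD u v : sqzV (u + v) = sqzV u + sqzV v.
Proof. by congr pair; rewrite /= addr0. Qed.
Lemma sqzVN v : sqzV (- v) = - sqzV v.
Proof. by congr pair; rewrite /= oppr0. Qed.
Lemma sqzVMn v n : sqzV (v *+ n) = sqzV v *+ n.
Proof. by elim: n => [|n IH]; rewrite ?mulr0n ?mulrS ?sqzVD ?IH. Qed.

End SquareZero.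

Definition sqzVE V :=
  (@sqzVZ V, @sqzV0 V, @sqzVD V, @sqzVN V, @sqzVMn V).

End LinearPreliminaries.

(** Coefficients are compared as formal polynomials only; relations between them, such as [epV] or
    the invertibility of 2, are supplied through [cert0]. *)
Ltac module := apply: sqzV_inj; rewrite ?sqzVE; ring.

(** * Linear maps, spans and finitely supported sums *)

Section Span.
Variable K : fieldType.

Section LinearMaps.
Variables (V W : lmodType K) (f : V -> W).
Hypothesis fl : linear f.
Lemma lin0 : f 0 = 0.
Proof. by have := fl (-1) 0 0; rewrite scaler0 addr0 scaleN1r addNr. Qed.
Lemma linD x y : f (x + y) = f x + f y.
Proof. by have := fl 1 x y; rewrite !scale1r. Qed.
Lemma linZ a x : f (a *: x) = a *: f x.
Proof. by have := fl a x 0; rewrite lin0 !addr0. Qed.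
Lemma linN x : f (- x) = - f x.
Proof. by rewrite -scaleN1r linZ scaleN1r. Qed.
Lemma linB x y : f (x - y) = f x - f y.
Proof. by rewrite linD linN. Qed.
Lemma linsum (J : Type) (r : seq J) (P : pred J) (F : J -> V) :
  f (\sum_(i <- r | P i) F i) = \sum_(i <- r | P i) f (F i).
Proof. exact: (big_morph f linD lin0). Qed.
Lemma linsumZ (J : Type) (r : seq J) (P : pred J) (c : J -> K) (F : J -> V) :
  f (\sum_(i <- r | P i) c i *: F i) = \sum_(i <- r | P i) c i *: f (F i).
Proof. by rewrite linsum; apply: eq_bigr => i _; rewrite linZ. Qed.
End LinearMaps.

Lemma lin_id (V : lmodType K) : linear (@id V). Proof. by []. Qed.
Lemma lin_comp (U V W : lmodType K) (f : V -> W) (h : U -> V) :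
  linear f -> linear h -> linear (f \o h).
Proof. by move=> fl hl a x y /=; rewrite hl fl. Qed.

Lemma scalar0 (V : lmodType K) (f : V -> K) (fl : scalar f) : f 0 = 0.
Proof. exact: (@lin0 V K^o). Qed.
Lemma scalarD (V : lmodType K) (f : V -> K) (fl : scalar f) x y :
  f (x + y) = f x + f y.
Proof. exact: (@linD V K^o). Qed.
Lemma scalarN (V : lmodType K) (f : V -> K) (fl : scalar f) x : f (- x) = - f x.
Proof. exact: (@linN V K^o). Qed.
Lemma scalarB (V : lmodType K) (f : V -> K) (fl : scalar f) x y :
  f (x - y) = f x - f y.
Proof. exact: (@linB V K^o). Qed.
Lemma scalarZl (V : lmodType K) (f : V -> K) (fl : scalar f) a x :
  f (a *: x) = a * f x.
Proof. exact: (@linZ V K^o). Qed.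
Lemma scalarsum (V : lmodType K) (f : V -> K) (fl : scalar f)
    (J : Type) (r : seq J) (P : pred J) (F : J -> V) :
  f (\sum_(i <- r | P i) F i) = \sum_(i <- r | P i) f (F i).
Proof. exact: (@linsum V K^o). Qed.

Variable V : lmodType K.
Implicit Types (S Q : set V).

Lemma subs0 Q : subspace Q -> Q 0. Proof. by case. Qed.
Lemma subsD Q : subspace Q -> forall x y, Q x -> Q y -> Q (x + y).
Proof. by case=> _ H x y Qx Qy; rewrite -[x]scale1r; exact: H. Qed.
Lemma subsZ Q : subspace Q -> forall a x, Q x -> Q (a *: x).
Proof. by case=> Q0 H a x Qx; rewrite -[_ *: _]addr0; exact: H. Qed.
Lemma subsN Q : subspace Q -> forall x, Q x -> Q (- x).
Proof. by move=> H x Qx; rewrite -scaleN1r; exact: subsZ. Qed.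
Lemma subsB Q : subspace Q -> forall x y, Q x -> Q y -> Q (x - y).
Proof. by move=> H x y Qx Qy; apply: subsD => //; exact: subsN. Qed.
Lemma subssum Q : subspace Q -> forall (J : Type) (r : seq J) (P : pred J) F,
  (forall i, P i -> Q (F i)) -> Q (\sum_(i <- r | P i) F i).
Proof.
by move=> H J r P F HF; apply: big_ind => //; [exact: subs0|exact: subsD].
Qed.
Lemma subs_seq Q : subspace Q -> forall (J : eqType) (r : seq J) F,
  (forall i, i \in r -> Q (F i)) -> Q (\sum_(i <- r) F i).
Proof.
by move=> H J r F HF; rewrite big_seq_cond; apply: subssum => // i /andP[/HF].
Qed.

Lemma spanS_sub S x : S x -> spanS S x.
Proof.
move=> Sx; exists 1%N, (fun=> 1), (fun=> x); split=> //.
by rewrite big_ord1 scale1r.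
Qed.
Lemma spanS_subspace S : subspace (spanS S).
Proof.
split; first by exists 0%N, (fun=> 0), (fun=> 0); split; [case|rewrite big_ord0].
move=> a x y [n [c [v [Sv ->]]]] [m [c' [v' [Sv' ->]]]].
exists (n + m)%N, (fun i => match fintype.split i with inl j => a * c j | inr j => c' j end),
  (fun i => match fintype.split i with inl j => v j | inr j => v' j end).
split=> [i|]; first by case: fintype.split.
rewrite big_split_ord /= scaler_sumr; congr (_ + _); apply: eq_bigr => i _.
  by rewrite -[lshift m i]/(unsplit (inl i)) unsplitK scalerA.
by rewrite -[rshift n i]/(unsplit (inr i)) unsplitK.
Qed.
Lemma spanS_ind S Q : subspace Q -> (forall x, S x -> Q x) ->
  forall x, spanS S x -> Q x.
Proof.
move=> sQ SQ x [n [c [v [Sv ->]]]]; apply: subssum => // i _.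
by apply: subsZ => //; exact: SQ.
Qed.
Lemma spanS_mono S S' : (forall x, S x -> S' x) ->
  forall x, spanS S x -> spanS S' x.
Proof.
move=> SS'; apply: spanS_ind; first exact: spanS_subspace.
by move=> x /SS' /spanS_sub.
Qed.
Lemma subspace_0 : subspace [set (0 : V)].
Proof. by split=> // a x y /= -> ->; rewrite scaler0 addr0. Qed.

Lemma subspace_pre (W : lmodType K) (f : W -> V) Q :
  linear f -> subspace Q -> subspace [set x | Q (f x)].
Proof.
move=> fl sQ; split=> [|a x y Qx Qy] /=; first by rewrite lin0 //; exact: subs0.
by rewrite fl; apply: subsD => //; exact: subsZ.
Qed.
Lemma subspace_eq (W : lmodType K) (f h : W -> V) :
  linear f -> linear h -> subspace [set x | f x = h x].
Proof.
move=> fl hl; split=> [|a x y /= Hx Hy]; first by rewrite /= !lin0.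
by rewrite fl hl Hx Hy.
Qed.
Lemma subspaceI (P Q : set V) : subspace P -> subspace Q ->
  subspace [set x | P x /\ Q x].
Proof.
move=> sP sQ; split=> [|a x y [Px Qx] [Py Qy]]; first by split; exact: subs0.
by split; apply: subsD => //; exact: subsZ.
Qed.
Lemma subspace_all (J : Type) (Q : J -> set V) (P : J -> Prop) :
  (forall j, P j -> subspace (Q j)) -> subspace [set x | forall j, P j -> Q j x].
Proof.
move=> H; split=> [j Pj|a x y Qx Qy j Pj]; first exact: (subs0 (H j Pj)).
apply: (subsD (H j Pj)); last exact: Qy.
by apply: (subsZ (H j Pj)); exact: Qx.
Qed.

Lemma big_supp (J : eqType) (s t : seq J) (F : J -> V) :
  uniq s -> uniq t -> (forall i, i \notin s -> F i = 0) ->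
  (forall i, i \notin t -> F i = 0) -> \sum_(i <- s) F i = \sum_(i <- t) F i.
Proof.
move=> us ut Fs Ft.
have red (r : seq J) : \sum_(i <- r) F i = \sum_(i <- [seq i <- r | F i != 0]) F i.
  by rewrite big_filter [RHS]big_mkcond; apply: eq_bigr => i _; case: eqP.
rewrite red [RHS]red; apply: perm_big; apply: uniq_perm; rewrite ?filter_uniq //.
move=> i; rewrite !mem_filter; case: eqP => //= /eqP Fi.
have -> : i \in s by apply: contraNT Fi => /Fs ->.
by apply/esym; apply: contraNT Fi => /Ft ->.
Qed.

Lemma fsbig_supp_seq (J : choiceType) (s : seq J) (F : J -> V) :
  uniq s -> (forall i, i \notin s -> F i = 0) ->
  \sum_(i \in [set: J]) F i = \sum_(i <- s) F i.
Proof.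
move=> us Fs; rewrite (fsbigE s) //; last by move=> i _; exact: Fs.
by apply: eq_bigl => i; rewrite in_setT.
Qed.

Lemma supp_seq (J : choiceType) (F : J -> V) :
  finite_set [set i | F i != 0] ->
  exists2 s : seq J, uniq s & forall i, i \notin s -> F i = 0.
Proof.
move=> fin; exists (finmap.enum_fset (fset_set [set i | F i != 0])).
  exact: finmap.fset_uniq.
move=> i; rewrite in_fset_set // => /negP H.
by apply: contrapT => /eqP Fi; apply: H; rewrite inE.
Qed.

Lemma finite_supp (J : choiceType) (s : seq J) (F : J -> V) :
  (forall i, i \notin s -> F i = 0) -> finite_set [set i | F i != 0].
Proof.
move=> H; apply: (sub_finite_set _ (finite_seq s)) => i /= Fi.
by apply: contraNT Fi => /H ->.
Qed.

Lemma linear_fun0 (W : lmodType K) : linear (fun _ : W => (0 : V)).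
Proof. by move=> a x y; rewrite scaler0 addr0. Qed.
Lemma linear_funD (W : lmodType K) (f h : W -> V) :
  linear f -> linear h -> linear (fun x => f x + h x).
Proof. by move=> fl hl a x y; rewrite fl hl scalerDr addrACA. Qed.
Lemma linear_funZ (W : lmodType K) c (f : W -> V) :
  linear f -> linear (fun x => c *: f x).
Proof. by move=> fl a x y; rewrite fl scalerDr !scalerA mulrC. Qed.
Lemma linear_funN (W : lmodType K) (f : W -> V) :
  linear f -> linear (fun x => - f x).
Proof. by move=> fl a x y; rewrite fl opprD scalerN. Qed.
Lemma linear_funB (W : lmodType K) (f h : W -> V) :
  linear f -> linear h -> linear (fun x => f x - h x).
Proof. by move=> fl hl; apply: linear_funD => //; exact: linear_funN. Qed.
Lemma linear_funsum (W : lmodType K) (J : Type) (r : seq J) (P : pred J) (f : J -> W -> V) :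
  (forall i, linear (f i)) -> linear (fun x => \sum_(i <- r | P i) f i x).
Proof.
move=> fl a x y; rewrite scaler_sumr -big_split /=.
by apply: eq_bigr => i _; rewrite fl.
Qed.
Lemma linear_scal (W : lmodType K) (f : W -> K) (v : V) :
  scalar f -> linear (fun x => f x *: v).
Proof. by move=> fl a x y; rewrite fl scalerDl scalerA. Qed.
End Span.

Section CommutationFactor.
Variables (K : fieldType) (Gam : zmodType) (eps : commutation_factor K Gam).
Implicit Types d : bideg Gam.

Lemma epDl d d' d'' : ep eps (d + d') d'' = ep eps d d'' * ep eps d' d''.
Proof. exact: cfacDl. Qed.
Lemma epDr d d' d'' : ep eps d (d' + d'') = ep eps d d' * ep eps d d''.
Proof. exact: cfacDr. Qed.
Lemma epV d d' : ep eps d d' * ep eps d' d = 1. Proof. exact: cfacV. Qed.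
Lemma ep_neq0 d d' : ep eps d d' != 0.
Proof.
by apply/eqP => h; have := epV d d'; rewrite h mul0r => /esym/eqP; rewrite oner_eq0.
Qed.
Lemma ep0l d : ep eps 0 d = 1.
Proof.
by apply: (mulfI (ep_neq0 0 d)); rewrite mulr1 -epDl addr0.
Qed.
Lemma ep0r d : ep eps d 0 = 1.
Proof. by apply: (mulfI (ep_neq0 d 0)); rewrite mulr1 -epDr addr0. Qed.
Lemma epNl d d' : ep eps (- d) d' = ep eps d' d.
Proof.
by apply: (mulfI (ep_neq0 d d')); rewrite -epDl subrr ep0l epV.
Qed.
Lemma epNr d d' : ep eps d (- d') = ep eps d' d.
Proof.
by apply: (mulfI (ep_neq0 d d')); rewrite -epDr subrr ep0r epV.
Qed.
Lemma ep_sqr d : ep eps d d * ep eps d d = 1. Proof. exact: epV. Qed.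
End CommutationFactor.

Definition epE K Gam (eps : commutation_factor K Gam) :=
  (epDl eps, epDr eps, epNl eps, epNr eps, ep0l eps, ep0r eps).

(** * Homogeneous bases, dual bases and linear extension *)

Section HomogeneousBasis.
Variables (K : fieldType) (Gam : zmodType) (eps : commutation_factor K Gam).
Variables (g : quadColorLie eps) (E : hbasis g).
Notation I := (bidx E).
Notation e := (@bvec _ _ _ _ E).
Notation e' := (@bdual _ _ _ _ E).
Notation B := (@qfm _ _ _ g).
Notation deg := (@bdeg _ _ _ _ E).
Notation gr := (@qgr _ _ _ g).
Notation ep := (ep eps).
Implicit Types (x y z : g) (a b c : I) (d : bideg Gam).

Lemma gr_subspace d : subspace (gr d).
Proof. exact: (qgr_sum g).1. Qed.
Lemma gr0 d : gr d 0. Proof. exact: subs0 (gr_subspace d). Qed.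
Lemma grZ d k x : gr d x -> gr d (k *: x).
Proof. exact: (subsZ (gr_subspace d)). Qed.

Lemma formDl x y z : B (x + y) z = B x z + B y z.
Proof. exact: (scalarD (qfm_linl z)). Qed.
Lemma formDr x y z : B z (x + y) = B z x + B z y.
Proof. exact: (scalarD (qfm_linr z)). Qed.
Lemma formZl k x z : B (k *: x) z = k * B x z.
Proof. exact: (scalarZl (qfm_linl z)). Qed.
Lemma formZr k x z : B z (k *: x) = k * B z x.
Proof. exact: (scalarZl (qfm_linr z)). Qed.
Lemma formNl x z : B (- x) z = - B x z.
Proof. exact: (scalarN (qfm_linl z)). Qed.
Lemma formNr x z : B z (- x) = - B z x.
Proof. exact: (scalarN (qfm_linr z)). Qed.
Lemma form0l z : B 0 z = 0. Proof. exact: (scalar0 (qfm_linl z)). Qed.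
Lemma form0r z : B z 0 = 0. Proof. exact: (scalar0 (qfm_linr z)). Qed.
Lemma form_suml (J : Type) (r : seq J) (P : pred J) (F : J -> g) z :
  B (\sum_(i <- r | P i) F i) z = \sum_(i <- r | P i) B (F i) z.
Proof. exact: (scalarsum (qfm_linl z)). Qed.
Lemma form_sumr (J : Type) (r : seq J) (P : pred J) (F : J -> g) z :
  B z (\sum_(i <- r | P i) F i) = \sum_(i <- r | P i) B z (F i).
Proof. exact: (scalarsum (qfm_linr z)). Qed.

(** Pairing with [e' a] reads off the coefficient of [e a], so the abstract coordinates of
    [bvec_basis] are the numbers [B x (e' a)]. *)
Lemma basis_exp x : exists s : seq I, [/\ uniq s,
  forall a, a \notin s -> B x (e' a) = 0 & x = \sum_(a <- s) B x (e' a) *: e a].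
Proof.
have [c [[fin xE] _]] := bvec_basis E x.
have [s us Hs] : exists2 s : seq I, uniq s & forall a, a \notin s -> c a = 0.
  exact: (supp_seq (V := K^o) fin).
have xE' : x = \sum_(a <- s) c a *: e a.
  by rewrite {1}xE (fsbig_supp_seq us) // => a /Hs ->; rewrite scale0r.
have cE a : B x (e' a) = c a.
  rewrite xE' form_suml; under eq_bigr do rewrite formZl bdualP.
  case: (boolP (a \in s)) => as_; last first.
    rewrite Hs // big_seq big1 // => b bs; case: eqP => [bE|]; last by rewrite mulr0.
    by rewrite -bE bs in as_.
  rewrite (bigD1_seq a) //= eqxx mulr1 big1 ?addr0 // => b /negbTE ->.
  by rewrite mulr0.
exists s; split => // [a /Hs|]; first by rewrite cE.
by rewrite {1}xE'; apply: eq_bigr => a _; rewrite cE.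
Qed.

Lemma basis_expE x (s : seq I) : uniq s ->
  (forall a, a \notin s -> B x (e' a) = 0) -> \sum_(a <- s) B x (e' a) *: e a = x.
Proof.
move=> us Hs; have [t [ut Ht xE]] := basis_exp x; rewrite [RHS]xE.
by apply: big_supp => // a; [move=> /Hs|move=> /Ht] => ->; rewrite scale0r.
Qed.

Lemma basis_ind (Q : set g) : subspace Q -> (forall a, Q (e a)) -> forall x, Q x.
Proof.
move=> sQ Qe x; have [s [_ _ ->]] := basis_exp x.
by apply: subssum => // a _; apply: subsZ.
Qed.

Lemma linear_eq_basis (V : lmodType K) (f h : g -> V) :
  linear f -> linear h -> (forall a, f (e a) = h (e a)) -> f =1 h.
Proof. by move=> fl hl H; apply: basis_ind => //; exact: subspace_eq. Qed.

Lemma form_nondeg x : (forall a, B x (e a) = 0) -> x = 0.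
Proof.
move=> H; apply: qfm_nondeg => y.
have [s [_ _ ->]] := basis_exp y.
by rewrite form_sumr big1 // => a _; rewrite formZr H mulr0.
Qed.

(** The homogeneous components of [e' a] are tested against the basis: the component of degree [d]
    can pair only with basis vectors of degree [- d], and for [d] other than [- deg a] these
    pairings are zero by duality, so nondegeneracy kills it. *)
Lemma bdual_gr a : gr (- deg a) (e' a).
Proof.
have [u [[fin ugr uE] _]] := (qgr_sum g).2 (e' a).
have [s us Hs] := supp_seq fin.
have {}uE : e' a = \sum_(d <- s) u d by rewrite uE (fsbig_supp_seq us).
have Beu b d : deg b = - d -> B (e b) (u d) = (b == a)%:R.
  move=> bd; rewrite -(bdualP b a) uE form_sumr.
  have other d' : d' != d -> B (e b) (u d') = 0.
    move=> nd; apply: (qfm_gr (bvec_gr b) (ugr d')) => H.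
    by case/eqP: nd; rewrite -[d]opprK -bd; apply/eqP; rewrite -addr_eq0 addrC H.
  case: (boolP (d \in s)) => ds.
    by rewrite (bigD1_seq d) //= [X in _ = _ + X]big1 ?addr0 // => d' /other.
  rewrite Hs // form0r big_seq big1 // => d' d's; apply: other.
  by apply: contraNneq ds => <-.
have u0 d : d != - deg a -> u d = 0.
  move=> nd; apply: form_nondeg => b.
  have [H|H] := eqVneq (d + deg b) 0; last first.
    by apply: (qfm_gr (ugr d) (bvec_gr b)) => /eqP; rewrite (negbTE H).
  rewrite (qfm_sym (ugr d) (bvec_gr b)).
  have bd : deg b = - d by apply/eqP; rewrite -addr_eq0 addrC H.
  rewrite Beu //; case: eqP => [ba|]; last by rewrite mulr0.
  by case/eqP: nd; rewrite -ba bd opprK.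
rewrite uE; apply: (subs_seq (gr_subspace _)) => d _.
by case: (eqVneq d (- deg a)) => [->|/u0 ->] //; exact: gr0.
Qed.

Lemma form_grP d d' x y : gr d x -> gr d' y -> B x y != 0 -> d + d' = 0.
Proof.
move=> gx gy; apply: contra_neq_eq => /eqP H; exact: (qfm_gr gx gy).
Qed.

Lemma grP d x : gr d x <-> (forall a, B x (e' a) != 0 -> deg a = d).
Proof.
split=> [gx a|H].
  by move=> /(form_grP gx (bdual_gr a)) /eqP; rewrite subr_eq0 => /eqP ->.
have [s [_ _ ->]] := basis_exp x.
apply: (subssum (gr_subspace d)) => a _.
have [->|/H <-] := eqVneq (B x (e' a)) 0; first by rewrite scale0r; exact: gr0.
by apply: grZ; exact: bvec_gr.
Qed.

(* Both sides have the same pairings with the e b.                            *)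
Lemma dual_expE x (s : seq I) : uniq s ->
  (forall a, a \notin s -> B (e a) x = 0) -> \sum_(a <- s) B (e a) x *: e' a = x.
Proof.
move=> us Hs; apply/eqP; rewrite -subr_eq0; apply/eqP; apply: form_nondeg => b.
(* Duality controls pairings with [y] on the right, nondegeneracy needs them on the left. Symmetry
   holds only for homogeneous vectors, so the component of [y] of degree [- deg b], the only one
   that matters, is isolated. *)
have pair y : (forall c, B (e c) y = 0) -> B y (e b) = 0.
  move=> H; have [t [_ _ yE]] := basis_exp y.
  have [u [[fin ugr uE] _]] := (qgr_sum g).2 y.
  have [r ur Hr] := supp_seq fin.
  have {}uE : y = \sum_(d <- r) u d by rewrite uE (fsbig_supp_seq ur).
  have other d : d != - deg b -> B (u d) (e b) = 0 /\ B (e b) (u d) = 0.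
    move=> nd; split.
      apply: (qfm_gr (ugr d) (bvec_gr b)) => /eqP; rewrite addr_eq0.
      by rewrite (negbTE nd).
    apply: (qfm_gr (bvec_gr b) (ugr d)) => /eqP; rewrite addrC addr_eq0.
    by rewrite (negbTE nd).
  have H' := H b; rewrite uE form_suml; rewrite uE form_sumr in H'.
  case: (boolP (- deg b \in r)) => bs; last first.
    rewrite big_seq big1 // => d ds; apply: (other _ _).1.
    by apply: contraNneq bs => <-.
  move: H'; rewrite (bigD1_seq (- deg b)) //= [X in _ + X]big1; last by move=> d /other[].
  rewrite addr0 => H'; rewrite (bigD1_seq (- deg b)) //= [X in _ + X]big1; last by move=> d /other[].
  by rewrite addr0 (qfm_sym (ugr _) (bvec_gr b)) H' mulr0.
apply: pair => c; rewrite formDr formNr form_sumr.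
under eq_bigr do rewrite formZr bdualP.
case: (boolP (c \in s)) => cs.
  rewrite (bigD1_seq c) //= eqxx mulr1 big1 ?addr0 ?subrr // => a ac.
  by rewrite eq_sym (negbTE ac) mulr0.
rewrite Hs // subr0 big_seq big1 // => a as_; case: eqP => [H|]; last by rewrite mulr0.
by rewrite H as_ in cs.
Qed.

(** The slice of Z-degree [i] lies in the span of a finite list, whose members have finitely many
    nonzero coordinates altogether. A basis vector in this span must be one of those occurring. *)
Lemma finite_slice (i : int) : finite_set [set a | (deg a).1 = i].
Proof.
have [s Hs] := qgr_fin g i.
have [t Ht] : exists t : seq I, forall x, x \in s -> forall a, a \notin t -> B x (e' a) = 0.
  elim: s {Hs} => [|x s [t Ht]]; first by exists [::].
  have [r [_ Hr _]] := basis_exp x; exists (r ++ t) => y; rewrite inE => ys a.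
  rewrite mem_cat negb_or => /andP[ar at_].
  by case/orP: ys => [/eqP ->|ys]; [exact: Hr|exact: (Ht y)].
apply: (sub_finite_set _ (finite_seq t)) => a /= ai.
have Hsp : spanS [set x | x \in s] (e a).
  apply: Hs; apply: spanS_sub; exists (deg a).2 => //=.
  by rewrite -ai -surjective_pairing; exact: bvec_gr.
apply/negPn/negP => nat_.
suff /(_ a nat_)/eqP : forall b, b \notin t -> B (e a) (e' b) = 0.
  by rewrite bdualP eqxx oner_eq0.
apply: (spanS_ind (Q := [set x | forall b, b \notin t -> B x (e' b) = 0]) _ Ht Hsp).
split=> [b _|k x y /= Hx Hy b bt]; first exact: form0l.
by rewrite formDl formZl Hx // Hy // mulr0 addr0.
Qed.

Lemma finite_ball (n : nat) : finite_set [set a | (`|(deg a).1| <= n)%N].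
Proof.
elim: n => [|n IH].
  apply: (sub_finite_set _ (finite_slice 0)) => a /=.
  by rewrite leqn0 absz_eq0 => /eqP.
have f1 := finite_slice n.+1%:Z; have f2 := finite_slice (- n.+1%:Z).
apply: (@sub_finite_set _ _ ([set a | (`|(deg a).1| <= n)%N] `|`
  ([set a | (deg a).1 = n.+1%:Z] `|` [set a | (deg a).1 = - n.+1%:Z]))) => [a /=|].
  move: (deg a).1 => m ?; have [?|?] := leqP `|m|%N n; first by left.
  have : m = n.+1%:Z \/ m = - n.+1%:Z by lia.
  by move=> [->|->]; right; [left|right].
by rewrite !finite_setU.
Qed.

(** All infinite sums over the basis are truncated to these finite lists of indices; [ball 0]
    indexes the basis of g_0. *)
Definition ball (n : nat) : seq I :=
  finmap.enum_fset (fset_set [set a | (`|(deg a).1| <= n)%N]).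

Lemma mem_ball n a : (a \in ball n) = (`|(deg a).1| <= n)%N.
Proof. by rewrite in_fset_set ?inE //; [apply/asboolP/idP|exact: finite_ball]. Qed.
Lemma ball_uniq n : uniq (ball n). Proof. exact: finmap.fset_uniq. Qed.

Lemma ball_exp d x n : gr d x -> (`|d.1| <= n)%N ->
  \sum_(a <- ball n) B x (e' a) *: e a = x.
Proof.
move=> /grP gx dn; apply: basis_expE; first exact: ball_uniq.
by move=> a; rewrite mem_ball; apply: contraNeq => /gx ->.
Qed.

Lemma ball_dual_exp d x n : gr d x -> (`|d.1| <= n)%N ->
  \sum_(a <- ball n) B (e a) x *: e' a = x.
Proof.
move=> gx dn; apply: dual_expE; first exact: ball_uniq.
move=> a; rewrite mem_ball; apply: contraNeq => /(form_grP (bvec_gr a) gx) /eqP.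
by rewrite addr_eq0 => /eqP ->; rewrite /= abszN.
Qed.

(* The canonical element of B is eps-symmetric.                               *)
Lemma canonical_sym (V : lmodType K) (f : g -> g -> V) (P P' : pred int) n :
  (forall y, linear (f^~ y)) -> (forall x, linear (f x)) ->
  (forall i, (`|i| <= n)%N -> P' i = P (- i)) ->
  \sum_(a <- ball n | P (deg a).1) ep (deg a) (deg a) *: f (e a) (e' a) =
  \sum_(a <- ball n | P' (deg a).1) f (e' a) (e a).
Proof.
move=> fl fr PP'.
have bn a : a \in ball n -> (`|(deg a).1| <= n)%N by rewrite mem_ball.
(* Expanding [e a] on the left, and later [e b] on the right, in the dual basis turns both sides
   into one double sum over [f (e' b) (e' a)]. The form pairs only opposite Z-degrees, which matches
   [P] with [P']. *)
transitivity (\sum_(a <- ball n | P (deg a).1) \sum_(b <- ball n | P' (deg b).1)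
  (ep (deg a) (deg a) * B (e b) (e a)) *: f (e' b) (e' a)).
  rewrite big_seq_cond [RHS]big_seq_cond; apply: eq_bigr => a /andP[/bn an Pa].
  rewrite -{1}(ball_dual_exp (bvec_gr a) an) (linsumZ (fl _)) scaler_sumr.
  rewrite (bigID (fun b => P' (deg b).1)) /= [X in _ + X]big_seq_cond.
  rewrite [X in _ + X]big1 ?addr0; last first.
    move=> b /andP[/bn bb P'b].
    have [->|Bab] := eqVneq (B (e b) (e a)) 0; first by rewrite scale0r scaler0.
    have /eqP := form_grP (bvec_gr b) (bvec_gr a) Bab.
    rewrite addr_eq0 => /eqP ba.
    by move: P'b; rewrite PP' // ba /= opprK Pa.
  by apply: eq_bigr => b _; rewrite scalerA.
rewrite exchange_big /= big_seq_cond [RHS]big_seq_cond.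
apply: eq_bigr => b /andP[/bn bb P'b].
rewrite -{2}(ball_dual_exp (bvec_gr b) bb) (linsumZ (fr _)).
rewrite [RHS](bigID (fun a => P (deg a).1)) /= [X in _ = _ + X]big_seq_cond.
rewrite [X in _ = _ + X]big1 ?addr0; last first.
  move=> a /andP[/bn an Pa].
  have [->|Bab] := eqVneq (B (e a) (e b)) 0; first by rewrite scale0r.
  have /eqP := form_grP (bvec_gr a) (bvec_gr b) Bab.
  rewrite addr_eq0 => /eqP ba.
  by move: Pa; rewrite ba /= -PP' // P'b.
apply: eq_bigr => a _; congr (_ *: _).
rewrite (qfm_sym (bvec_gr a) (bvec_gr b)).
have [->|Bab] := eqVneq (B (e b) (e a)) 0; first by rewrite !mulr0.
have /eqP := form_grP (bvec_gr b) (bvec_gr a) Bab.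
by rewrite addr_eq0 => /eqP ->; rewrite epNr.
Qed.

(** The linear map with value [f a] at [e a]; the sum is finite because a vector has finitely many
    nonzero coordinates. *)
Definition lext (V : lmodType K) (f : I -> V) (x : g) : V :=
  \sum_(a \in [set: I]) B x (e' a) *: f a.

Section LinearExtension.
Variable V : lmodType K.
Implicit Types f h : I -> V.

Lemma lextE f x (s : seq I) : uniq s ->
  (forall a, a \notin s -> B x (e' a) = 0) ->
  lext f x = \sum_(a <- s) B x (e' a) *: f a.
Proof. by move=> us Hs; rewrite /lext (fsbig_supp_seq us) // => a /Hs ->; rewrite scale0r. Qed.

Lemma lext_linear f : linear (lext f).
Proof.
move=> k x y; have [s [_ Hs _]] := basis_exp x; have [t [_ Ht _]] := basis_exp y.
set r := undup (s ++ t).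
have ur : uniq r by exact: undup_uniq.
have Hx a : a \notin r -> B x (e' a) = 0.
  by rewrite mem_undup mem_cat negb_or => /andP[/Hs].
have Hy a : a \notin r -> B y (e' a) = 0.
  by rewrite mem_undup mem_cat negb_or => /andP[_ /Ht].
rewrite !(lextE f ur) => //; last first.
  by move=> a ar; rewrite formDl formZl Hx // Hy // mulr0 addr0.
rewrite scaler_sumr -big_split /=; apply: eq_bigr => a _.
by rewrite formDl formZl scalerDl scalerA.
Qed.

Lemma lext_basis f a : lext f (e a) = f a.
Proof.
rewrite (@lextE _ _ [:: a]) //; last first.
  by move=> b; rewrite inE bdualP eq_sym => /negbTE ->.
by rewrite big_seq1 bdualP eqxx scale1r.
Qed.

Lemma lext_linE (h : g -> V) : linear h -> lext (h \o e) =1 h.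
Proof.
move=> hl; apply: linear_eq_basis => // [|a]; first exact: lext_linear.
by rewrite lext_basis.
Qed.

Lemma lext_eq f h x : (forall a, B x (e' a) != 0 -> f a = h a) ->
  lext f x = lext h x.
Proof.
move=> fh; have [s [us Hs _]] := basis_exp x.
rewrite !(lextE _ us Hs); apply: eq_bigr => a _.
by have [->|/fh ->] := eqVneq (B x (e' a)) 0; rewrite ?scale0r.
Qed.

End LinearExtension.

Lemma lext_comp (V W : lmodType K) (L : V -> W) (f : I -> V) x : linear L ->
  L (lext f x) = lext (L \o f) x.
Proof.
move=> Ll; have [s [us Hs _]] := basis_exp x.
by rewrite !(lextE _ us Hs) (linsumZ Ll).
Qed.

Section LinearExtensionBis.
Variable V : lmodType K.
Implicit Types f h : I -> V.

Lemma lext_subspace (Q : set V) f x : subspace Q ->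
  (forall a, B x (e' a) != 0 -> Q (f a)) -> Q (lext f x).
Proof.
move=> sQ Hf; have [s [us Hs _]] := basis_exp x.
rewrite (lextE _ us Hs); apply: subssum => // a _.
have [->|/Hf Qf] := eqVneq (B x (e' a)) 0; last exact: subsZ.
by rewrite scale0r; exact: subs0.
Qed.

Lemma lext_fZ k f x : lext (fun a => k *: f a) x = k *: lext f x.
Proof. by rewrite (lext_comp _ _ (L := fun v => k *: v)) // => a u v; module. Qed.

Lemma lext_fD f h x : lext (fun a => f a + h a) x = lext f x + lext h x.
Proof.
have [s [us Hs _]] := basis_exp x; rewrite !(lextE _ us Hs) -big_split /=.
by apply: eq_bigr => a _; rewrite scalerDr.
Qed.
End LinearExtensionBis.

Section GradedPart.

(** A common description of g, g_-, g_+ and g_0 as graded subspaces, so that the algebras they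
    generate are studied together. *)
Definition span_of (P : set g) (D : set (bideg Gam)) :=
  forall x, P x <-> (forall a, B x (e' a) != 0 -> D (deg a)).

Lemma span_of_gpart D : span_of (gpart D) D.
Proof.
move=> x; split=> [|H].
  apply: (@spanS_ind _ _ _ [set y | forall a, B y (e' a) != 0 -> D (deg a)]).
    split=> [a|k y z Hy Hz a]; first by rewrite form0l eqxx.
    rewrite formDl formZl.
    have [->|/Hz //] := eqVneq (B z (e' a)) 0; rewrite addr0 mulf_eq0 negb_or.
    by move=> /andP[_ /Hy].
  by move=> y [d Dd gy] a /((grP _ _).1 gy a) ->.
have [s [_ _ ->]] := basis_exp x.
apply: subssum => [|a _]; first exact: spanS_subspace.
have [->|/H Da] := eqVneq (B x (e' a)) 0.
  by rewrite scale0r; exact: subs0 (spanS_subspace _).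
apply: (subsZ (spanS_subspace _)); apply: spanS_sub.
by exists (deg a) => //; exact: bvec_gr.
Qed.

Lemma span_ofT : span_of [set: g] [set: bideg Gam].
Proof. by move=> x; split. Qed.

Variables (P : set g) (D : set (bideg Gam)) (HP : span_of P D).

Lemma span_of_subspace : subspace P.
Proof.
split; first by apply/HP => a; rewrite form0l eqxx.
move=> k x y /HP Hx /HP Hy; apply/HP => a; rewrite formDl formZl.
have [->|/Hy //] := eqVneq (B y (e' a)) 0; rewrite addr0 mulf_eq0 negb_or.
by move=> /andP[_ /Hx].
Qed.

Lemma span_of_vec a : P (e a) <-> D (deg a).
Proof.
split=> [/HP/(_ a)|Da]; first by rewrite bdualP eqxx oner_eq0; apply.
by apply/HP => b; rewrite bdualP; case: (eqVneq a b) => [<-|_] //; rewrite eqxx.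
Qed.

Lemma span_of_gr d x : D d -> gr d x -> P x.
Proof. by move=> Dd /grP gx; apply/HP => a /gx ->. Qed.

End GradedPart.

Lemma br0l x : qbr (0 : g) x = 0. Proof. exact: (lin0 (qbr_linl x)). Qed.
Lemma br0r x : qbr x (0 : g) = 0. Proof. exact: (lin0 (qbr_linr x)). Qed.

End HomogeneousBasis.

(** * The algebras generated by g *)

Lemma pclsD (K : fieldType) (X : Type) (rel : aterm K X -> aterm K X -> Prop) s t :
  pcls rel s + pcls rel t = pcls rel (Aadd s t).
Proof. exact: paddE. Qed.

Section KindData.
Variables (K : fieldType) (Gam : zmodType) (eps : commutation_factor K Gam).
Variable g : quadColorLie eps.

(* In all four kinds of algebras the generators satisfy                       *)
(* x y = sg ep(x, y) y x + kbr x y + kfm x y.                                 *)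
Definition sg (k : algkind) : K :=
  match k with Sym | Env => 1 | Ext | Cliff => -1 end.
Definition kbr (k : algkind) (x y : g) : g := if k is Env then qbr x y else 0.
Definition kfm (k : algkind) (x y : g) : K := if k is Cliff then 2 * qfm x y else 0.

Lemma sg_sqr k : sg k * sg k = 1.
Proof. by case: k; rewrite /= ?mulrNN mulr1. Qed.
Lemma kbr_linl k y : linear ((kbr k)^~ y).
Proof. by case: k; rewrite /kbr; try exact: linear_fun0; exact: qbr_linl. Qed.
Lemma kbr_linr k x : linear (kbr k x).
Proof. by case: k; rewrite /kbr; try exact: linear_fun0; exact: qbr_linr. Qed.
Lemma kfm_linl k y : scalar ((kfm k)^~ y).
Proof.
case: k => a x x'; rewrite /kfm ?mulr0 ?addr0 //.
by rewrite formDl formZl; ring.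
Qed.
Lemma kfm_linr k x : scalar (kfm k x).
Proof.
case: k => a y y'; rewrite /kfm ?mulr0 ?addr0 //.
by rewrite formDr formZr; ring.
Qed.
Lemma kbr_gr k d d' (x y : g) : qgr d x -> qgr d' y -> qgr (d + d') (kbr k x y).
Proof. by case: k => gx gy; rewrite /kbr; try exact: gr0; exact: qbr_gr. Qed.
Lemma kfm_gr k d d' (x y : g) : qgr d x -> qgr d' y -> d + d' != 0 -> kfm k x y = 0.
Proof.
case: k => // gx gy /eqP H; rewrite /kfm (qfm_gr gx gy) ?mulr0 //.
Qed.
Lemma kbr_sym k d d' (x y : g) : qgr d x -> qgr d' y ->
  kbr k x y = - (sg k * ep eps d d') *: kbr k y x.
Proof.
by case: k => gx gy; rewrite /kbr ?scaler0 // (qbr_skew gx gy) mul1r scaleNr.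
Qed.
Lemma kfm_sym k d d' (x y : g) : qgr d x -> qgr d' y ->
  kfm k x y = - (sg k * ep eps d d') * kfm k y x.
Proof.
by case: k => gx gy; rewrite /kfm ?mulr0 // (qfm_sym gx gy) /=; ring.
Qed.
End KindData.

Section FormsAlgebra.
Variables (K : fieldType) (Gam : zmodType) (eps : commutation_factor K Gam).
Variables (g : quadColorLie eps) (E : hbasis g).
Notation I := (bidx E).
Notation e := (@bvec _ _ _ _ E).
Notation e' := (@bdual _ _ _ _ E).
Notation B := (@qfm _ _ _ g).
Notation deg := (@bdeg _ _ _ _ E).
Notation gr := (@qgr _ _ _ g).
Notation ep := (ep eps).
Notation lext := (@lext _ _ _ g E _).

Lemma lext_exch (V : lmodType K) (F : I -> I -> V) x y :
  lext (fun a => lext (F a) y) x = lext (fun b => lext (F^~ b) x) y.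
Proof.
have [s [us Hs _]] := basis_exp E x; have [t [ut Ht _]] := basis_exp E y.
rewrite (lextE _ us Hs) (lextE _ ut Ht).
under eq_bigr => a _ do rewrite (lextE _ ut Ht) scaler_sumr.
rewrite exchange_big /=; apply: eq_bigr => b _.
rewrite (lextE _ us Hs) scaler_sumr; apply: eq_bigr => a _.
by rewrite !scalerA mulrC.
Qed.

Variables (P : set g) (D : set (bideg Gam)) (HP : span_of E P D).
Let sP : subspace P := span_of_subspace HP.

Section Kind.
Variable k : algkind.
Notation F := (FA k P).
Notation gn := (gen k P).

Lemma genE x (Px : P x) : gn x = pgen (@grel _ _ _ _ P k) (exist _ x (mem_set Px)).
Proof.
rewrite /gen; case: insubP => [z _ zx|]; last by rewrite mem_set.
by congr pgen; apply: val_inj.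
Qed.

Lemma gen_out x : ~ P x -> gn x = 0.
Proof.
move=> nPx; rewrite /gen; case: insubP => // z.
by rewrite in_setE.
Qed.

Lemma gen_lin c x y : P x -> P y -> gn (c *: x + y) = c *: gn x + gn y.
Proof.
move=> Px Py; have Pz : P (c *: x + y) by apply: (subsD sP) => //; exact: subsZ.
rewrite !genE pcls_lin; apply/pclsP; apply: acong_rel.
exact: grel_lin.
Qed.
Lemma gen0 : gn 0 = 0.
Proof.
by have := gen_lin (-1) (subs0 sP) (subs0 sP); rewrite scaler0 addr0 scaleN1r addNr.
Qed.
Lemma genZ c x : P x -> gn (c *: x) = c *: gn x.
Proof. by move=> Px; have := gen_lin c Px (subs0 sP); rewrite gen0 !addr0. Qed.
Lemma genD x y : P x -> P y -> gn (x + y) = gn x + gn y.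
Proof. by move=> Px Py; have := gen_lin 1 Px Py; rewrite !scale1r. Qed.
Lemma gen_sum (J : eqType) (r : seq J) (f : J -> g) :
  (forall i, i \in r -> P (f i)) -> gn (\sum_(i <- r) f i) = \sum_(i <- r) gn (f i).
Proof.
elim: r => [|i r IH] H; first by rewrite !big_nil gen0.
rewrite !big_cons genD ?IH //; first by move=> j jr; apply: H; rewrite inE jr orbT.
  by apply: H; rewrite inE eqxx.
by apply: (subs_seq sP) => j jr; apply: H; rewrite inE jr orbT.
Qed.

Lemma gen_lext x : P x -> gn x = lext (fun a => gn (e a)) x.
Proof.
move=> Px; have [s [us Hs xE]] := basis_exp E x.
have Pt a : P (B x (e' a) *: e a).
  have [->|H] := eqVneq (B x (e' a)) 0; first by rewrite scale0r; exact: subs0.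
  by apply: (subsZ sP); apply/(span_of_vec HP); apply: ((HP x).1 Px).
rewrite {1}xE gen_sum // (lextE _ us Hs); apply: eq_bigr => a _.
have [->|H] := eqVneq (B x (e' a)) 0; first by rewrite !scale0r gen0.
by apply: genZ; apply/(span_of_vec HP); apply: ((HP x).1 Px).
Qed.

End Kind.

Section KindBis.
Variable k : algkind.
Notation F := (FA k P).
Notation gn := (gen k P).

Lemma gen_comm d d' x y : P x -> P y -> P (kbr k x y) -> gr d x -> gr d' y ->
  gn x * gn y = (sg K k * ep d d') *: (gn y * gn x) + gn (kbr k x y)
                + kfm k x y *: (1 : F).
Proof.
move=> Px Py Pz gx gy; have gen0' := gen0 k.
move: k Pz gen0' => [] Pz gen0'; rewrite /kbr /kfm /=.
- rewrite gen0' scale0r !addr0 mul1r (genE _ Px) (genE _ Py) !pcls_mul pcls_scale.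
  by apply/pclsP; apply: acong_rel; exact: grel_sym.
- rewrite scale0r !addr0 mul1r (genE _ Px) (genE _ Py) (genE _ Pz) !pcls_mul pcls_lin.
  by apply/pclsP; apply: acong_rel; exact: grel_env.
- rewrite gen0' scale0r !addr0 mulN1r (genE _ Px) (genE _ Py) !pcls_mul pcls_scale.
  by apply/pclsP; apply: acong_rel; exact: grel_ext.
- rewrite gen0' addr0 mulN1r.
  have <- : gen Cliff P x * gen Cliff P y + ep d d' *: (gen Cliff P y * gen Cliff P x) =
      (2 * B x y) *: (1 : FA Cliff P).
    rewrite (genE _ Px) (genE _ Py) !pcls_mul pcls_scale.
    rewrite -[(1 : FA Cliff P)]/(pcls _ (Aone _ _)) pcls_scale pclsD.
    by apply/pclsP; apply: acong_rel; exact: grel_cliff.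
  by module.
Qed.

(** Induction on terms proves the stronger claim that left multiplication by any term preserves [Q];
    an arbitrary generator is a finite combination of generators attached to the basis. *)
Lemma FA_ind (Q : set F) : subspace Q -> Q 1 ->
  (forall a u, D (deg a) -> Q u -> Q (gn (e a) * u)) -> forall u, Q u.
Proof.
move=> sQ Q1 Qg u; rewrite -[u]mulr1.
suff H (t : aterm K P) w : Q w -> Q (pcls (@grel _ _ _ _ P k) t * w).
  by rewrite -(pclsK u); exact: H.
elim: t w => [x|||s IHs t IHt|s IHs t IHt|c s IHs] w Qw.
- have Px : P (val x) by have := valP x; rewrite in_setE.
  have -> : pcls (@grel _ _ _ _ P k) (Agen K x) = gn (val x).
    by rewrite genE; congr pgen; exact: val_inj.
  rewrite gen_lext // (lext_comp (L := fun v : F => v * w)); last first.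
    by move=> c v v'; rewrite mulrDl palg_scalerAl.
  apply: lext_subspace => // a /((HP _).1 Px) Da; exact: Qg.
- by rewrite -[pcls _ _]/(0 : F) mul0r; exact: subs0.
- by rewrite -[pcls _ _]/(1 : F) mul1r.
- rewrite -pclsD mulrDl; apply: (subsD sQ); [exact: IHs|exact: IHt].
- by rewrite -pcls_mul -mulrA; apply: IHs; exact: IHt.
- by rewrite -pcls_scale -palg_scalerAl; apply: (subsZ sQ); exact: IHs.
Qed.

Lemma FA_mull_lin (w : F) : linear (fun u : F => w * u).
Proof. by move=> c u v; rewrite mulrDr palg_scalerAr. Qed.
Lemma FA_mulr_lin (w : F) : linear (fun u : F => u * w).
Proof. by move=> c u v; rewrite mulrDl palg_scalerAl. Qed.

End KindBis.

(* To let FA k P act on V it suffices to let the basis of P act by operators  *)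
(* satisfying the defining relations.                                         *)
Section Action.
Variables (k : algkind) (V : lmodType K) (rho : I -> V -> V).
Hypothesis rho_lin : forall a, linear (rho a).
Hypothesis rho_rel : forall a b v, D (deg a) -> D (deg b) ->
  rho a (rho b v) = (sg K k * ep (deg a) (deg b)) *: rho b (rho a v)
    + lext (rho^~ v) (kbr k (e a) (e b)) + kfm k (e a) (e b) *: v.

Lemma rho_rel_hom d d' x y v : P x -> P y -> gr d x -> gr d' y ->
  lext (fun a => rho a (lext (rho^~ v) y)) x =
  (sg K k * ep d d') *: lext (fun b => rho b (lext (rho^~ v) x)) y
    + lext (rho^~ v) (kbr k x y) + kfm k x y *: v.
Proof.
move=> Px Py gx gy.
transitivity (lext (fun a => lext (fun b => rho a (rho b v)) y) x).
  by apply: lext_eq => a _; rewrite (lext_comp _ _ (rho_lin a)).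
transitivity (lext (fun a => lext (fun b =>
    (sg K k * ep d d') *: rho b (rho a v) + lext (rho^~ v) (kbr k (e a) (e b))
      + kfm k (e a) (e b) *: v) y) x).
  apply: lext_eq => a Ba; apply: lext_eq => b Bb.
  rewrite rho_rel; [|exact: ((HP _).1 Px)|exact: ((HP _).1 Py)].
  by rewrite ((grP E _ _).1 gx _ Ba) ((grP E _ _).1 gy _ Bb).
have kl a : linear (fun y => lext (rho^~ v) (kbr k (e a) y)).
  by apply: (lin_comp (f := lext (rho^~ v))); [exact: lext_linear|exact: kbr_linr].
have kl' z : linear (fun x => lext (rho^~ v) (kbr k x z)).
  by apply: (lin_comp (f := lext (rho^~ v))); [exact: lext_linear|exact: kbr_linl].
transitivity (lext (fun a => (sg K k * ep d d') *: lext (fun b => rho b (rho a v)) y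
    + lext (rho^~ v) (kbr k (e a) y) + kfm k (e a) y *: v) x).
  apply: lext_eq => a _; rewrite !lext_fD lext_fZ; congr (_ + _ + _).
    by rewrite -(lext_linE E (kl a)).
  by rewrite -(lext_linE E (linear_scal v (kfm_linr k (e a)))).
rewrite !lext_fD lext_fZ; congr (_ *: _ + _ + _).
- rewrite lext_exch; apply: lext_eq => b _.
  by rewrite (lext_comp _ _ (rho_lin b)).
- by rewrite -(lext_linE E (kl' y)).
- by rewrite -(lext_linE E (linear_scal v (kfm_linl k y))).
Qed.

Fixpoint act_term (t : aterm K P) (v : V) : V :=
  match t with
  | Agen x => lext (rho^~ v) (val x)
  | Azero => 0
  | Aone => v
  | Aadd s t => act_term s v + act_term t v
  | Amul s t => act_term s (act_term t v)
  | Ascale c s => c *: act_term s v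
  end.

Lemma act_term_lin t : linear (act_term t).
Proof.
elim: t => [x|||s IHs t IHt|s IHs t IHt|c s IHs] /=.
- move=> c u v; rewrite -lext_fZ -lext_fD; apply: lext_eq => a _.
  exact: rho_lin.
- exact: linear_fun0.
- exact: lin_id.
- exact: linear_funD.
- exact: (lin_comp IHs IHt).
- exact: linear_funZ.
Qed.

Lemma act_term_rel s t v : @grel _ _ _ _ P k s t -> act_term s v = act_term t v.
Proof.
have PX (x : P) : P (val x) by have := valP x; rewrite in_setE.
move=> r; have hom := rho_rel_hom; case: k s t / r hom => /=.
- by move=> k' c x y z -> _; rewrite lext_linear.
- move=> d d' x y gx gy hom; rewrite (hom _ _ _ _ v (PX x) (PX y) gx gy) /=.
  by rewrite (lin0 (lext_linear _)) scale0r !addr0 mul1r.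
- move=> d d' x y z gx gy zE hom; rewrite (hom _ _ _ _ v (PX x) (PX y) gx gy) /=.
  by rewrite scale0r addr0 mul1r zE.
- move=> d d' x y gx gy hom; rewrite (hom _ _ _ _ v (PX x) (PX y) gx gy) /=.
  by rewrite (lin0 (lext_linear _)) scale0r !addr0 mulN1r.
- move=> d d' x y gx gy hom; rewrite (hom _ _ _ _ v (PX x) (PX y) gx gy) /=.
  rewrite (lin0 (lext_linear _)) addr0 mulN1r scaleNr addrAC addNr add0r //.
Qed.

Lemma act_term_cong s t : acong (@grel _ _ _ _ P k) s t ->
  forall v, act_term s v = act_term t v.
Proof.
elim=> {s t} /=.
- by move=> s t r v; exact: act_term_rel.
- by [].
- by move=> s t _ H v; rewrite H.
- by move=> t s u _ H1 _ H2 v; rewrite H1 H2.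
- by move=> s s' t t' _ H1 _ H2 v; rewrite H1 H2.
- by move=> s s' t t' _ H1 _ H2 v; rewrite H1 H2.
- by move=> c s s' _ H v; rewrite H.
- by move=> *; rewrite addrA.
- by move=> *; rewrite addrC.
- by move=> *; rewrite add0r.
- by move=> *; rewrite scaleN1r addNr.
- by [].
- by [].
- by [].
- by [].
- by move=> s t u v; rewrite (linD (act_term_lin s)).
- by move=> *; rewrite scalerA.
- by move=> *; rewrite scale1r.
- by move=> *; rewrite scalerDr.
- by move=> *; rewrite scalerDl.
- by [].
- by move=> c s t v; rewrite (linZ (act_term_lin s)).
Qed.

Definition act (u : FA k P) (v : V) : V := act_term (repr u) v.

Lemma actE t v : act (pcls (@grel _ _ _ _ P k) t) v = act_term t v.
Proof. by apply: act_term_cong; exact: acong_repr. Qed.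
Lemma act_linr u : linear (act u). Proof. exact: act_term_lin. Qed.
Lemma act_linl v : linear (act^~ v).
Proof. by move=> c x y; rewrite -(pclsK x) -(pclsK y) pcls_lin !actE. Qed.
Lemma act1 v : act 1 v = v. Proof. exact: (actE (Aone _ _)). Qed.
Lemma actM x y v : act (x * y) v = act x (act y v).
Proof. by rewrite -(pclsK x) -(pclsK y) pcls_mul !actE. Qed.
Lemma act_gen x v : P x -> act (gen k P x) v = lext (rho^~ v) x.
Proof. by move=> Px; rewrite (genE k Px) actE. Qed.
Lemma act_basis a v : D (deg a) -> act (gen k P (e a)) v = rho a v.
Proof. by move=> Da; rewrite act_gen ?lext_basis //; apply/(span_of_vec HP). Qed.

End Action.
End FormsAlgebra.

(** * Tensor products of vector spaces *)

Section TensorProduct.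
Variable K : fieldType.

Section Basics.
Variables A B : lmodType K.
Implicit Types (a : A) (b : B) (w : tens A B).

Lemma tpure_linl b : linear (fun a => tpure a b).
Proof. by move=> k a a'; rewrite tcls_lin; apply/tclsP; exact: tcong_linl. Qed.
Lemma tpure_linr a : linear (fun b => tpure a b).
Proof. by move=> k b b'; rewrite tcls_lin; apply/tclsP; exact: tcong_linr. Qed.

Lemma tens_ind (Q : set (tens A B)) : subspace Q ->
  (forall a b, Q (tpure a b)) -> forall w, Q w.
Proof.
move=> sQ Qp w; rewrite -(tclsK w); elim: (repr w) => {w} [a b||s Hs t Ht|k s Hs].
- exact: Qp.
- exact: subs0 sQ.
- have -> : tcls (Tadd s t) = tcls s + tcls t by rewrite -taddE.
  exact: subsD.
- have -> : tcls (Tscale k s) = k *: tcls s by rewrite -tscaleE.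
  exact: subsZ.
Qed.

Lemma tens_eq (V : lmodType K) (f h : tens A B -> V) : linear f -> linear h ->
  (forall a b, f (tpure a b) = h (tpure a b)) -> f =1 h.
Proof. by move=> fl hl H; apply: tens_ind => //; exact: subspace_eq. Qed.

Lemma tpure0l b : tpure (0 : A) b = 0. Proof. exact: (lin0 (tpure_linl b)). Qed.
Lemma tpure0r a : tpure a (0 : B) = 0. Proof. exact: (lin0 (tpure_linr a)). Qed.
Lemma tpureZl k a b : tpure (k *: a) b = k *: tpure a b.
Proof. exact: (linZ (tpure_linl b)). Qed.
Lemma tpureZr k a b : tpure a (k *: b) = k *: tpure a b.
Proof. exact: (linZ (tpure_linr a)). Qed.
Lemma tpureDl a a' b : tpure (a + a') b = tpure a b + tpure a' b.
Proof. exact: (linD (tpure_linl b)). Qed.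
Lemma tpureDr a b b' : tpure a (b + b') = tpure a b + tpure a b'.
Proof. exact: (linD (tpure_linr a)). Qed.

Section Lift.
Variables (V : lmodType K) (f : A -> B -> V).
Hypotheses (fl : forall b, linear (f^~ b)) (fr : forall a, linear (f a)).
Lemma tlift_lin : linear (tlift f). Proof. exact: (tliftP fl fr).1. Qed.
Lemma tlift_pure a b : tlift f (tpure a b) = f a b.
Proof. exact: (tliftP fl fr).2. Qed.
End Lift.
End Basics.

Lemma tmap_bil (A B A' B' : lmodType K) (f : A -> A') (h : B -> B') :
  linear f -> linear h ->
  (forall b, linear (fun a => tpure (f a) (h b))) /\
  (forall a, linear (fun b => tpure (f a) (h b))).
Proof.
move=> fl hl; split=> [b|a] k u v.
  by rewrite fl tpure_linl.
by rewrite hl tpure_linr.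
Qed.
Lemma tmap_lin (A B A' B' : lmodType K) (f : A -> A') (h : B -> B') :
  linear f -> linear h -> linear (tmap f h).
Proof. by move=> fl hl; have [? ?] := tmap_bil fl hl; exact: tlift_lin. Qed.
Lemma tmap_pure (A B A' B' : lmodType K) (f : A -> A') (h : B -> B') :
  linear f -> linear h -> forall a b, tmap f h (tpure a b) = tpure (f a) (h b).
Proof. by move=> fl hl a b; have [? ?] := tmap_bil fl hl; exact: tlift_pure. Qed.

End TensorProduct.

(** * Gradings given by projections *)

Section Gradings.
Variable K : fieldType.

(** A direct sum decomposition presented by its projections. Directness is contained in [gpr_id]; by
    [mk_grading] it is enough to construct linear maps with this property when the homogeneous
    elements span. *)
Record grading (V : lmodType K) (J : choiceType) (gr : J -> set V) := Grading {
  gpr : J -> V -> V;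
  gpr_lin : forall j, linear (gpr j);
  gpr_in : forall j v, gr j (gpr j v);
  gpr_id : forall i j v, gr j v -> gpr i v = if i == j then v else 0;
  gpr_fin : forall v, exists s : seq J, [/\ uniq s,
    forall j, j \notin s -> gpr j v = 0 & v = \sum_(j <- s) gpr j v]
}.

Section Make.
Variables (V : lmodType K) (J : choiceType) (gr : J -> set V) (pr : J -> V -> V).
Hypothesis gr_sub : forall j, subspace (gr j).
Hypothesis pr_lin : forall j, linear (pr j).
Hypothesis pr_id : forall i j v, gr j v -> pr i v = if i == j then v else 0.
Hypothesis spanning : forall v, spanS [set w | exists j, gr j w] v.

Lemma mk_pr_in j v : gr j (pr j v).
Proof.
apply: (spanS_ind (Q := [set w | gr j (pr j w)]) _ _ (spanning v)).
  exact: (subspace_pre (pr_lin j) (gr_sub j)).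
move=> w [i gw] /=; rewrite (pr_id _ gw); case: eqP => [->|_] //.
exact: subs0 (gr_sub j).
Qed.

Lemma mk_pr_fin v : exists s : seq J, [/\ uniq s,
  forall j, j \notin s -> pr j v = 0 & v = \sum_(j <- s) pr j v].
Proof.
pose Q := [set v | exists s : seq J, [/\ uniq s,
  forall j, j \notin s -> pr j v = 0 & v = \sum_(j <- s) pr j v]].
apply: (spanS_ind (Q := Q) _ _ (spanning v)).
  split=> [|k x y [s [us Hs xE]] [t [ut Ht yE]]].
    by exists [::]; split=> // [j _|]; rewrite ?big_nil // lin0.
  pose r := undup (s ++ t); have ur : uniq r by exact: undup_uniq.
  have Hx j : j \notin r -> pr j x = 0.
    by rewrite mem_undup mem_cat negb_or => /andP[/Hs].
  have Hy j : j \notin r -> pr j y = 0.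
    by rewrite mem_undup mem_cat negb_or => /andP[_ /Ht].
  exists r; split=> // [j jr|]; first by rewrite pr_lin Hx // Hy // scaler0 addr0.
  under eq_bigr => j _ do rewrite pr_lin.
  rewrite big_split -scaler_sumr /=; congr (_ *: _ + _).
    by rewrite {1}xE; exact: big_supp.
  by rewrite {1}yE; exact: big_supp.
move=> w [j gw]; exists [:: j]; split=> // [i|].
  by rewrite inE (pr_id _ gw) => /negbTE ->.
by rewrite big_seq1 (pr_id _ gw) eqxx.
Qed.

Definition mk_grading : grading gr :=
  Grading pr_lin mk_pr_in pr_id mk_pr_fin.
End Make.

Section TensorGrading.
Variables (A B : lmodType K) (J1 J2 J : choiceType).
Variables (gA : J1 -> set A) (gB : J2 -> set B).
Variables (GA : grading gA) (GB : grading gB) (h : J1 -> J2 -> J).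

(** The way [h] of combining degrees is left free: it is addition for the grading of W, and [hdeg]
    for the components of the completion. *)
Definition tens_gr (j : J) : set (tens A B) :=
  spanS [set w | exists j1 j2 a b,
    [/\ h j1 j2 = j, gA j1 a, gB j2 b & w = tpure a b]].

Definition tens_pr (j : J) : tens A B -> tens A B :=
  tlift (fun a b => \sum_(i \in [set: J1 * J2])
    if h i.1 i.2 == j then tpure (gpr GA i.1 a) (gpr GB i.2 b) else 0).

Lemma tens_pr_supp a b : exists2 r : seq (J1 * J2), uniq r & forall i, i \notin r ->
  gpr GA i.1 a = 0 \/ gpr GB i.2 b = 0.
Proof.
have [s [us Hs _]] := gpr_fin GA a; have [t [ut Ht _]] := gpr_fin GB b.
exists (undup [seq (x, y) | x <- s, y <- t]); first exact: undup_uniq.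
move=> [x y]; rewrite mem_undup => H /=.
case: (boolP (x \in s)) => xs; last by left; exact: Hs.
right; apply: Ht; apply: contra H => yt; apply/allpairsP.
by exists (x, y).
Qed.

Lemma tens_pr_bil j :
  let f := (fun a b => \sum_(i \in [set: J1 * J2])
    if h i.1 i.2 == j then tpure (gpr GA i.1 a) (gpr GB i.2 b) else 0) in
  (forall b, linear (f^~ b)) /\ (forall a, linear (f a)).
Proof.
move=> f; have fE a b (r : seq (J1 * J2)) : uniq r ->
    (forall i, i \notin r -> gpr GA i.1 a = 0 \/ gpr GB i.2 b = 0) ->
    f a b = \sum_(i <- r) if h i.1 i.2 == j then tpure (gpr GA i.1 a) (gpr GB i.2 b) else 0.
  move=> ur Hr; apply: fsbig_supp_seq => // i /Hr [] ->; case: ifP => // _.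
    exact: tpure0l.
  exact: tpure0r.
split=> [b|a] k x y.
  have [r1 ur1 H1] := tens_pr_supp x b; have [r2 ur2 H2] := tens_pr_supp y b.
  pose r := undup (r1 ++ r2); have ur : uniq r by exact: undup_uniq.
  have sub1 i : i \notin r -> i \notin r1 by rewrite mem_undup mem_cat negb_or => /andP[].
  have sub2 i : i \notin r -> i \notin r2 by rewrite mem_undup mem_cat negb_or => /andP[].
  rewrite !(fE _ _ r) //.
  - rewrite scaler_sumr -big_split; apply: eq_bigr => i _ /=.
    by case: ifP => _; rewrite ?scaler0 ?addr0 // (gpr_lin GA) tpure_linl.
  - by move=> i /sub2 /H2.
  - by move=> i /sub1 /H1.
  - move=> i ir; case: (H1 i (sub1 i ir)) => [H1'|]; last by right.
    case: (H2 i (sub2 i ir)) => [H2'|]; last by right.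
    by left; rewrite (gpr_lin GA) H1' H2' scaler0 addr0.
have [r1 ur1 H1] := tens_pr_supp a x; have [r2 ur2 H2] := tens_pr_supp a y.
pose r := undup (r1 ++ r2); have ur : uniq r by exact: undup_uniq.
have sub1 i : i \notin r -> i \notin r1 by rewrite mem_undup mem_cat negb_or => /andP[].
have sub2 i : i \notin r -> i \notin r2 by rewrite mem_undup mem_cat negb_or => /andP[].
rewrite !(fE _ _ r) //.
- rewrite scaler_sumr -big_split; apply: eq_bigr => i _ /=.
  by case: ifP => _; rewrite ?scaler0 ?addr0 // (gpr_lin GB) tpure_linr.
- by move=> i /sub2 /H2.
- by move=> i /sub1 /H1.
- move=> i ir; case: (H1 i (sub1 i ir)) => [|H1']; first by left.
  case: (H2 i (sub2 i ir)) => [|H2']; first by left.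
  by right; rewrite (gpr_lin GB) H1' H2' scaler0 addr0.
Qed.

Lemma tens_pr_lin j : linear (tens_pr j).
Proof. by have [? ?] := tens_pr_bil j; exact: tlift_lin. Qed.

Lemma tens_pr_id i j w : tens_gr j w -> tens_pr i w = if i == j then w else 0.
Proof.
apply: (spanS_ind (Q := [set w | tens_pr i w = if i == j then w else 0])).
  apply: subspace_eq; first exact: tens_pr_lin.
  by case: eqP => _ //; exact: linear_fun0.
move=> {}w [j1 [j2 [a [b [hj ga gb ->]]]]] /=.
have [Bl Br] := tens_pr_bil i; rewrite /tens_pr (tlift_pure Bl Br).
rewrite (fsbig_supp_seq (s := [:: (j1, j2)])) //; last first.
  move=> [i1 i2]; rewrite inE xpair_eqE /= (gpr_id GA _ ga) (gpr_id GB _ gb).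
  by case: (i1 == j1) (i2 == j2) => [] [] //= _; rewrite ?tpure0l ?tpure0r; case: ifP.
rewrite big_seq1 /= hj eq_sym; case: ifP => // _.
by rewrite (gpr_id GA _ ga) (gpr_id GB _ gb) !eqxx.
Qed.

Lemma tens_gr_spanning w : spanS [set w | exists j, tens_gr j w] w.
Proof.
apply: (tens_ind (spanS_subspace _)) => a b.
have [s [_ _ ->]] := gpr_fin GA a; have [t [_ _ ->]] := gpr_fin GB b.
rewrite (linsum (tpure_linl _)); apply: (subssum (spanS_subspace _)) => i _.
rewrite (linsum (tpure_linr _)); apply: (subssum (spanS_subspace _)) => j _.
apply: spanS_sub; exists (h i j); apply: spanS_sub.
by exists i, j, (gpr GA i a), (gpr GB j b); split=> //; exact: gpr_in.
Qed.

Definition tens_grading : grading tens_gr :=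
  mk_grading (fun j => spanS_subspace _) tens_pr_lin tens_pr_id tens_gr_spanning.

End TensorGrading.
End Gradings.

(** * Gradings of the algebras generated by a graded subspace *)

Section FormsAlgebraGrading.
Variables (K : fieldType) (Gam : zmodType) (eps : commutation_factor K Gam).
Variables (g : quadColorLie eps) (E : hbasis g).
Notation I := (bidx E).
Notation e := (@bvec _ _ _ _ E).
Notation deg := (@bdeg _ _ _ _ E).
Notation gr := (@qgr _ _ _ g).
Notation ep := (ep eps).
Notation lext := (@lext _ _ _ g E _).

Section Words.
Variables (P : set g) (D : set (bideg Gam)) (HP : span_of E P D).
Variable k : algkind.
Notation F := (FA k P).
Notation gn := (gen k P).
Let sP : subspace P := span_of_subspace HP.

Lemma FAk_gr_subspace n d : subspace (@FAk_gr _ _ _ g k P n d).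
Proof. exact: spanS_subspace. Qed.
Lemma FA_gr_subspace d : subspace (@FA_gr _ _ _ g k P d).
Proof. exact: spanS_subspace. Qed.
Lemma FAk_gr_FA n d (u : F) : FAk_gr n d u -> FA_gr d u.
Proof. by move=> H; apply: spanS_sub; exists n. Qed.

Lemma FAk_gr1 : @FAk_gr _ _ _ g k P 0 0 1.
Proof.
apply: spanS_sub; exists (fun _ => 0), (fun _ => 0).
by split; rewrite ?big_ord0 //; case.
Qed.
Lemma FA_gr1 : @FA_gr _ _ _ g k P 0 1.
Proof. exact: FAk_gr_FA FAk_gr1. Qed.

Lemma FAk_gr_cons n d d' x (u : F) : gr d' x -> FAk_gr n d u ->
  FAk_gr n.+1 (d' + d) (gn x * u).
Proof.
move=> gx; have [Px|nPx] := pselect (P x); last first.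
  by move=> _; rewrite (gen_out k nPx) mul0r; exact: subs0 (FAk_gr_subspace _ _).
apply: (spanS_ind (Q := [set u | FAk_gr n.+1 (d' + d) (gn x * u)])).
  exact: (subspace_pre (FA_mull_lin _) (FAk_gr_subspace _ _)).
move=> {}u [y [delta [hy <- ->]]] /=; apply: spanS_sub.
exists (fun i => if unlift ord0 i is Some j then y j else x),
  (fun i => if unlift ord0 i is Some j then delta j else d'); split.
- move=> i; case: unliftP => [j _|_] //; exact: hy.
- rewrite big_ord_recl unlift_none; congr (_ + _).
  by apply: eq_bigr => i _; rewrite liftK.
- rewrite big_ord_recl unlift_none; congr (_ * _).
  by apply: eq_bigr => i _; rewrite liftK.
Qed.

Lemma FAk_gr_gen d x : gr d x -> @FAk_gr _ _ _ g k P 1 d (gn x).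
Proof. by move=> gx; have := FAk_gr_cons gx FAk_gr1; rewrite mulr1 addr0. Qed.
Lemma FA_gr_gen d x : gr d x -> @FA_gr _ _ _ g k P d (gn x).
Proof. by move=> gx; exact: FAk_gr_FA (FAk_gr_gen gx). Qed.
Lemma FA_gr_cons d d' x (u : F) : gr d' x -> FA_gr d u -> FA_gr (d' + d) (gn x * u).
Proof.
move=> gx; apply: (spanS_ind (Q := [set u | FA_gr (d' + d) (gn x * u)])).
  exact: (subspace_pre (FA_mull_lin _) (FA_gr_subspace _)).
by move=> {}u [n _ Hu] /=; apply: (FAk_gr_FA (n := n.+1)); exact: FAk_gr_cons.
Qed.

Lemma FAk_ind_hom (Q : nat -> bideg Gam -> set F) : (forall n d, subspace (Q n d)) ->
  Q 0%N 0 1 ->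
  (forall n d d' x u, P x -> gr d' x -> Q n d u -> Q n.+1 (d' + d) (gn x * u)) ->
  forall n d u, FAk_gr n d u -> Q n d u.
Proof.
move=> sQ Q0 QS n d; apply: spanS_ind => // u [x [delta [hx <- ->]]].
elim: n x delta hx => [|n IH] x delta hx; first by rewrite !big_ord0.
rewrite !big_ord_recl; apply: QS; [exact: (hx _).1|exact: (hx _).2|].
by apply: IH => i; exact: hx.
Qed.

Lemma FAk_ind (Q : nat -> bideg Gam -> set F) : (forall n d, subspace (Q n d)) ->
  Q 0%N 0 1 ->
  (forall n d a u, D (deg a) -> Q n d u -> Q n.+1 (deg a + d) (gn (e a) * u)) ->
  forall n d u, FAk_gr n d u -> Q n d u.
Proof.
move=> sQ Q0 QS; apply: FAk_ind_hom => // n d d' x u Px gx Qu.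
rewrite (gen_lext HP k Px) (lext_comp _ _ (FA_mulr_lin u)).
apply: lext_subspace => // a Ba /=.
by rewrite -((grP E _ _).1 gx _ Ba); apply: QS => //; exact: ((HP _).1 Px).
Qed.

Lemma FA_gr_ind (Q : bideg Gam -> set F) : (forall d, subspace (Q d)) -> Q 0 1 ->
  (forall d a u, D (deg a) -> Q d u -> Q (deg a + d) (gn (e a) * u)) ->
  forall d u, FA_gr d u -> Q d u.
Proof.
move=> sQ Q0 QS d; apply: spanS_ind => // u [n _ Hu].
exact: (FAk_ind (Q := fun _ => Q) (fun _ => sQ) Q0 (fun _ => QS) Hu).
Qed.

Lemma FAk_grM n d n' d' (u v : F) : FAk_gr n d u -> FAk_gr n' d' v ->
  FAk_gr (n + n') (d + d') (u * v).
Proof.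
move=> Hu Hv; apply: (FAk_ind_hom (Q := fun n d => [set u |
  FAk_gr (n + n') (d + d') (u * v)]) _ _ _ Hu).
- by move=> *; exact: (subspace_pre (FA_mulr_lin _) (FAk_gr_subspace _ _)).
- by rewrite /= mul1r add0r.
- by move=> m c c' x w Px gx /= H; rewrite -mulrA -addrA addSn; exact: FAk_gr_cons.
Qed.

Lemma FA_grM d d' (u v : F) : FA_gr d u -> FA_gr d' v -> FA_gr (d + d') (u * v).
Proof.
move=> Hu; apply: (spanS_ind (Q := [set v | FA_gr (d + d') (u * v)])).
  exact: (subspace_pre (FA_mull_lin _) (FA_gr_subspace _)).
move=> {}v [n' _ Hv].
apply: (spanS_ind (Q := [set u | FA_gr (d + d') (u * v)]) _ _ Hu).
  exact: (subspace_pre (FA_mulr_lin _) (FA_gr_subspace _)).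
by move=> u' [n _ Hu'] /=; apply: (FAk_gr_FA (n := n + n')); exact: FAk_grM.
Qed.

Lemma FA_gr_spanning (u : F) : spanS [set w | exists d, FA_gr d w] u.
Proof.
apply: (FA_ind HP (spanS_subspace _)).
  by apply: spanS_sub; exists 0; exact: FA_gr1.
move=> a {}u Da; apply: (spanS_ind (Q := [set u | spanS _ (gn (e a) * u)])).
  exact: (subspace_pre (FA_mull_lin _) (spanS_subspace _)).
move=> w [d Hw]; apply: spanS_sub; exists (deg a + d).
by apply: FA_gr_cons => //; exact: bvec_gr.
Qed.

Hypothesis DD : forall d d', D d -> D d' -> D (d + d').

Lemma kbr_in a b : D (deg a) -> D (deg b) -> P (kbr k (e a) (e b)).
Proof.
move=> Da Db; apply: (span_of_gr HP (DD Da Db)).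
by apply: kbr_gr; exact: bvec_gr.
Qed.

Lemma gen_commE a b : D (deg a) -> D (deg b) ->
  gn (e a) * gn (e b) = (sg K k * ep (deg a) (deg b)) *: (gn (e b) * gn (e a))
    + gn (kbr k (e a) (e b)) + kfm k (e a) (e b) *: (1 : F).
Proof.
move=> Da Db; apply: (gen_comm HP); [exact/(span_of_vec HP)|exact/(span_of_vec HP)|
  exact: kbr_in|exact: bvec_gr|exact: bvec_gr].
Qed.

(** The homogeneous projections come from an action on families indexed by degrees, in which [e a]
    multiplies and shifts by [deg a]. The relations are respected because they are homogeneous, and
    letting [u] act on the family with value 1 in degree 0 sorts [u] by degree ([FA_pr]). *)
Definition shift_rho (a : I) (f : bideg Gam -> F) : bideg Gam -> F :=
  fun d => gn (e a) * f (d - deg a).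

Lemma shift_rho_lin a : linear (shift_rho a).
Proof. by move=> c f h; apply/funext => d; rewrite /shift_rho; exact: FA_mull_lin. Qed.

Lemma shift_rho_rel a b f : D (deg a) -> D (deg b) ->
  shift_rho a (shift_rho b f) = (sg K k * ep (deg a) (deg b)) *: shift_rho b (shift_rho a f)
    + lext (shift_rho^~ f) (kbr k (e a) (e b)) + kfm k (e a) (e b) *: f.
Proof.
move=> Da Db; apply/funext => d.
rewrite [RHS]/(_ *: (shift_rho b (shift_rho a f) d) + lext _ _ d + _ *: f d).
rewrite (lext_comp (L := fun h : bideg Gam -> F => h d)) // /shift_rho !mulrA.
rewrite gen_commE // !mulrDl; congr (_ + _ + _).
- by rewrite -palg_scalerAl addrAC.
- rewrite (gen_lext HP k (kbr_in Da Db)) (lext_comp _ _ (FA_mulr_lin _)).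
  apply: lext_eq => c Bc; congr (_ * f _); rewrite -addrA -opprD; congr (_ - _).
  have := (grP E _ _).1 (kbr_gr k (bvec_gr a) (bvec_gr b)) _ Bc.
  by move=> ->; rewrite addrC.
- rewrite -palg_scalerAl mul1r.
  have [->|H] := eqVneq (kfm k (e a) (e b)) 0; first by rewrite !scale0r.
  congr (_ *: f _); rewrite -addrA -opprD.
  have [->|/(kfm_gr k (bvec_gr a) (bvec_gr b)) H0] := eqVneq (deg a + deg b) 0.
    by rewrite subr0.
  by rewrite H0 eqxx in H.
Qed.

Definition FA_pr (d : bideg Gam) (u : F) : F :=
  act shift_rho u (fun d => if d == 0 then 1 else 0) d.

Lemma FA_pr_lin d : linear (FA_pr d).
Proof.
move=> c u v; rewrite /FA_pr (act_linl HP shift_rho_lin shift_rho_rel) //.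
Qed.

Lemma FA_pr_gen d a u : D (deg a) -> FA_pr d (gn (e a) * u) = gn (e a) * FA_pr (d - deg a) u.
Proof.
move=> Da; rewrite /FA_pr (actM HP shift_rho_lin shift_rho_rel).
by rewrite (act_basis HP shift_rho_lin shift_rho_rel).
Qed.

Lemma FA_pr_id d d' u : FA_gr d' u -> FA_pr d u = if d == d' then u else 0.
Proof.
move=> Hu; apply: (FA_gr_ind (Q := fun d' => [set u | forall d,
  FA_pr d u = if d == d' then u else 0]) _ _ _ Hu d) => [c'||c'].
- split=> [c|c x y Hx Hy d0]; first by rewrite lin0 ?if_same //; exact: FA_pr_lin.
  by rewrite FA_pr_lin Hx Hy; case: eqP; rewrite ?scaler0 ?addr0.
- by move=> c; rewrite /FA_pr (act1 HP shift_rho_lin shift_rho_rel).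
- move=> a v Da Hv c; rewrite FA_pr_gen // Hv subr_eq addrC.
  by case: eqP => // _; rewrite mulr0.
Qed.

Definition FA_grading : grading (@FA_gr _ _ _ g k P) :=
  mk_grading FA_gr_subspace FA_pr_lin FA_pr_id FA_gr_spanning.

End Words.

Section Inclusion.
Variables (P Q : set g) (D D' : set (bideg Gam)).
Hypotheses (HP : span_of E P D) (HQ : span_of E Q D') (DQ : forall d, D d -> D' d).
Variable k : algkind.
Notation inc := (@FAincl _ _ _ g k P Q).

Let PQ x : P x -> Q x.
Proof. by move=> /HP H; apply/HQ => a /H /DQ. Qed.

Lemma FAincl_rel s t : @grel _ _ _ _ P k s t ->
  aeval (fun x : P => gen k Q (val x)) s = aeval (fun x : P => gen k Q (val x)) t.
Proof.
have PX (x : P) : Q (val x) by apply: PQ; have := valP x; rewrite in_setE.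
case: k s t / => [k' c x y z zE|d d' x y gx gy|d d' x y z gx gy zE|d d' x y gx gy|
    d d' x y gx gy] /=.
- by rewrite zE (gen_lin HQ).
- rewrite (gen_comm HQ (PX x) (PX y) _ gx gy) /=; last exact: subs0 (span_of_subspace HQ).
  by rewrite (gen0 HQ) scale0r !addr0 mul1r.
- rewrite (gen_comm HQ (PX x) (PX y) _ gx gy) /=; last by rewrite -zE.
  by rewrite zE scale0r addr0 mul1r.
- rewrite (gen_comm HQ (PX x) (PX y) _ gx gy) /=; last exact: subs0 (span_of_subspace HQ).
  by rewrite (gen0 HQ) scale0r !addr0 mulN1r.
- rewrite (gen_comm HQ (PX x) (PX y) _ gx gy) /=; last exact: subs0 (span_of_subspace HQ).
  by rewrite (gen0 HQ) addr0 mulN1r scaleNr addrAC addNr add0r.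
Qed.

Lemma FAincl_lin : linear inc. Proof. by have [] := pmapP FAincl_rel. Qed.
Lemma FAincl1 : inc 1 = 1. Proof. by have [] := pmapP FAincl_rel. Qed.
Lemma FAinclM u v : inc (u * v) = inc u * inc v.
Proof. by have [_ _ H _] := pmapP FAincl_rel; exact: H. Qed.
Lemma FAincl_gen x : P x -> inc (gen k P x) = gen k Q x.
Proof. by move=> Px; rewrite (genE k Px); have [_ _ _ H] := pmapP FAincl_rel; exact: (H (exist _ x (mem_set Px))). Qed.
Lemma FAincl_gr n d u : FAk_gr n d u -> FAk_gr n d (inc u).
Proof.
apply: (FAk_ind_hom (Q := fun n d => [set u | FAk_gr n d (inc u)])).
- by move=> *; apply: (subspace_pre FAincl_lin); exact: spanS_subspace.
- by rewrite /= FAincl1; exact: FAk_gr1.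
- move=> m c c' x w Px gx /= H; rewrite FAinclM FAincl_gen //.
  exact: FAk_gr_cons.
Qed.
Lemma FAincl_FA_gr d u : FA_gr d u -> FA_gr d (inc u).
Proof.
apply: (spanS_ind (Q := [set u | FA_gr d (inc u)])).
  by apply: (subspace_pre FAincl_lin); exact: spanS_subspace.
by move=> {}u [n _ Hu]; exact: FAk_gr_FA (FAincl_gr Hu).
Qed.
End Inclusion.

End FormsAlgebraGrading.

(** * Consistency of the defining relations *)

Section Relations.
Variables (K : fieldType) (Gam : zmodType) (eps : commutation_factor K Gam).
Variables (g : quadColorLie eps) (E : hbasis g).
Notation I := (bidx E).
Notation e := (@bvec _ _ _ _ E).
Notation deg := (@bdeg _ _ _ _ E).
Notation gr := (@qgr _ _ _ g).
Notation ep := (ep eps).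
Notation lext := (@lext _ _ _ g E _).
Variable k : algkind.

Lemma kbr_jacobi d d' d'' (x y z : g) : gr d x -> gr d' y -> gr d'' z ->
  kbr k x (kbr k y z) = kbr k (kbr k x y) z + ep d d' *: kbr k y (kbr k x z).
Proof.
case: k => gx gy gz; rewrite /kbr ?scaler0 ?addr0 //; exact: qbr_jacobi gx gy gz.
Qed.

Variables (V : lmodType K) (rho : I -> V -> V).
Hypothesis rho_lin : forall a, linear (rho a).
Notation R x v := (lext (rho^~ v) x).

(** The relation is stated at a single vector, so that it can be propagated by induction on the
    vector. *)
Definition Rel a b v := rho a (rho b v) =
  (sg K k * ep (deg a) (deg b)) *: rho b (rho a v) + R (kbr k (e a) (e b)) v
  + kfm k (e a) (e b) *: v.

Lemma R_linr x : linear (fun v => R x v).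
Proof.
by move=> c u v; rewrite -lext_fZ -lext_fD; apply: lext_eq => a _; exact: rho_lin.
Qed.
Lemma R_linl v : linear (fun x => R x v). Proof. exact: lext_linear. Qed.

(** A certificate: [Z] is a combination of coefficients that vanish by [epV], [sg_sqr] or the
    grading of the form. [module] checks the first equality with formal coefficients, and the second
    is rewriting. *)
Lemma cert0 (X Y Z : V) : X - Y = Z -> Z = 0 -> X = Y.
Proof. by move=> <- /eqP; rewrite subr_eq0 => /eqP. Qed.

Lemma Rel_sym a b v : Rel a b v -> Rel b a v.
Proof.
rewrite /Rel => ->; rewrite (kbr_sym k (bvec_gr a) (bvec_gr b)).
rewrite (kfm_sym k (bvec_gr a) (bvec_gr b)) (linZ (R_linl v)).
set c := sg K k * ep (deg a) (deg b); set c' := sg K k * ep (deg b) (deg a).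
have H : c' * c = 1 by rewrite mulrACA sg_sqr epV mulr1.
transitivity ((c' * c) *: rho b (rho a v)); first by rewrite H scale1r.
transitivity ((c' * c) *: rho b (rho a v) - (c' * c - 1) *: (R (kbr k (e b) (e a)) v +
  kfm k (e b) (e a) *: v)); first by rewrite H subrr scale0r subr0.
by module.
Qed.

Lemma Rel_hom d x b v : gr d x -> (forall a, Rel a b v) ->
  R x (rho b v) = (sg K k * ep d (deg b)) *: rho b (R x v) + R (kbr k x (e b)) v
    + kfm k x (e b) *: v.
Proof.
move=> gx H.
transitivity (lext (fun a => (sg K k * ep d (deg b)) *: rho b (rho a v)
    + R (kbr k (e a) (e b)) v + kfm k (e a) (e b) *: v) x).
  by apply: lext_eq => a Ba; rewrite H ((grP E _ _).1 gx _ Ba).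
rewrite !lext_fD lext_fZ (lext_comp _ _ (rho_lin b)); congr (_ + _ + _).
  have kl : linear (fun y => R (kbr k y (e b)) v).
    by apply: (lin_comp (f := lext (rho^~ v))); [exact: R_linl|exact: kbr_linl].
  by rewrite -(lext_linE E kl).
by rewrite -(lext_linE E (linear_scal v (kfm_linl k (e b)))).
Qed.

(** Moving [a] to the left past [b] and [b'] reduces the relation on [rho a w] to relations on [w].
    The brackets created on the way cancel by the Jacobi identity. *)
Lemma Rel_step a b b' w : (forall c v, Rel c a v) -> (forall c c', Rel c c' w) ->
  Rel b b' (rho a w).
Proof.
move=> Ra Rw.
have gv c : gr (deg c) (e c) by exact: bvec_gr.
have g1 := kbr_gr k (gv b) (gv a); have g2 := kbr_gr k (gv b') (gv a).
have g3 := kbr_gr k (gv b) (gv b').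
rewrite /Rel (Ra b' w) (Ra b w) !(linD (rho_lin _)) !(linZ (rho_lin _)).
rewrite (Ra b (rho b' w)) (Ra b' (rho b w)) (Rel_hom g1 (Rw^~ b')) (Rel_hom g2 (Rw^~ b)).
rewrite (Rel_hom g3 (Ra^~ w)) (Rw b b') !(linD (rho_lin a)) !(linZ (rho_lin a)).
have jac : kbr k (kbr k (e b) (e b')) (e a) = kbr k (e b) (kbr k (e b') (e a))
    - ep (deg b) (deg b') *: kbr k (e b') (kbr k (e b) (e a)).
  by rewrite (kbr_jacobi (gv b) (gv b') (gv a)) addrK.
rewrite jac (linB (R_linl w)) (linZ (R_linl w)).
rewrite (kbr_sym k (gv b) g2) (kbr_sym k (gv b') g1) !(linZ (R_linl w)).
(* The form pairs only opposite degrees, so in front of a value of [kfm] the commutation factors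
   simplify; these are the vanishing coefficients of the certificate below. *)
have F1 : kfm k (e b) (e b') * (ep (deg b') (deg a) * ep (deg b) (deg a) - 1) = 0.
  have [H|/(kfm_gr k (gv b) (gv b')) ->] := eqVneq (deg b + deg b') 0; last by rewrite mul0r.
  by rewrite -epDl (addrC (deg b')) H ep0l subrr mulr0.
have F2 : kfm k (e b) (e a) * (ep (deg b') (deg a) - ep (deg b) (deg b')) = 0.
  have [/eqP H|/(kfm_gr k (gv b) (gv a)) ->] := eqVneq (deg b + deg a) 0; last by rewrite mul0r.
  by rewrite addr_eq0 in H; rewrite (eqP H) epNl subrr mulr0.
have F3 : kfm k (e b') (e a) * (1 - ep (deg b) (deg b') * ep (deg b) (deg a)) = 0.
  have [H|/(kfm_gr k (gv b') (gv a)) ->] := eqVneq (deg b' + deg a) 0; last by rewrite mul0r.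
  by rewrite -epDr H ep0r subrr mulr0.
have pp := epV eps (deg b) (deg b'); have qq := epV eps (deg b) (deg a).
have rr := epV eps (deg b') (deg a).
move: pp qq rr F1 F2 F3; rewrite !(epDl, epDr) {jac}.
set p := ep (deg b) (deg b'); set p' := ep (deg b') (deg b).
set q := ep (deg b) (deg a); set q' := ep (deg a) (deg b).
set r := ep (deg b') (deg a); set r' := ep (deg a) (deg b').
move=> pp qq rr F1 F2 F3.
have R0 : R 0 w = 0 := lin0 (R_linl w).
set X1 := rho b' (R (kbr k (e b) (e a)) w); set X2 := R (kbr k (kbr k (e b) (e a)) (e b')) w.
set X3 := rho b (R (kbr k (e b') (e a)) w).
apply: cert0 (_ : _ = (r * r' - 1) *: (sg K k * sg K k * sg K k * p *: X1)
  - (p * p' - 1) *: (sg K k * r *: X2 + (q * q') *: X3)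
  - (q * q' - 1) *: X3 + (kfm k (e b) (e b') * (r * q - 1)) *: rho a w
  + (kfm k (e b) (e a) * (r - p)) *: (sg K k *: rho b' w)
  + (kfm k (e b') (e a) * (1 - p * q)) *: rho b w) _; last first.
  by rewrite pp qq rr F1 F2 F3 !subrr !scale0r !addr0 subr0 oppr0 addr0.
rewrite /X1 /X2 /X3; case: (k) => /=; rewrite /kbr /kfm ?R0 ?br0l ?br0r ?form0l ?(lin0 (rho_lin _)) ?mulr0.
- by module.
- by module.
- by module.
- by module.
Qed.
End Relations.

(** * Triangular decomposition *)

Lemma eval_snd_lin (K : fieldType) (U V : lmodType K) (A B : Type) (a : A) (b : B) :
  linear (fun x : U * (A -> B -> V) => x.2 a b).
Proof. by []. Qed.

(** Bracket and form corrections never occur together, so a computation common to the four kinds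
    falls into two cases. *)
Lemma kind_cases (K : fieldType) (Gam : zmodType) (eps : commutation_factor K Gam)
    (g : quadColorLie eps) (k : algkind) :
  (sg K k = 1 /\ forall x y : g, kfm k x y = 0) \/
  (sg K k = -1 /\ forall x y : g, kbr k x y = 0).
Proof. by case: k; [left|left|right|right]. Qed.

Section TriangularDecomposition.
Variables (K : fieldType) (Gam : zmodType) (eps : commutation_factor K Gam).
Variables (g : quadColorLie eps) (E : hbasis g).
Notation I := (bidx E).
Notation e := (@bvec _ _ _ _ E).
Notation B := (@qfm _ _ _ g).
Notation deg := (@bdeg _ _ _ _ E).
Notation gr := (@qgr _ _ _ g).
Notation ep := (ep eps).
Notation lext := (@lext _ _ _ g E _).
Notation gM := (@gM _ _ _ g).
Notation gP := (@gP _ _ _ g).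

Lemma span_M : span_of E gM (@degM Gam). Proof. exact: span_of_gpart. Qed.
Lemma span_P : span_of E gP (@degP Gam). Proof. exact: span_of_gpart. Qed.
Lemma degM_add (d d' : bideg Gam) : degM d -> degM d' -> degM (d + d').
Proof. by rewrite /degM /= => H H'; rewrite -[0]addr0 lerD. Qed.
Lemma degP_add (d d' : bideg Gam) : degP d -> degP d' -> degP (d + d').
Proof. by rewrite /degP /= => H H'; rewrite addr_gt0. Qed.
Lemma degT_add (d d' : bideg Gam) : setT d -> setT d' -> setT (d + d').
Proof. by []. Qed.
Lemma degMP (d : bideg Gam) : ~ degM d -> degP d.
Proof. by rewrite /degM /degP /= => /negP; rewrite -ltNge. Qed.

Variable k : algkind.
Notation Fm := (FA k gM).
Notation Fp := (FA k gP).
Notation T := (tens Fm Fp).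
Notation gm a := (gen k gM (e a)).

Definition Lm (a : I) : T -> T := tmap (fun s : Fm => gm a * s) id.

Lemma Lm_pure a s v : Lm a (tpure s v) = tpure (gm a * s) v.
Proof. by apply: tmap_pure; [exact: FA_mull_lin|exact: lin_id]. Qed.
Lemma Lm_lin a : linear (Lm a).
Proof. by apply: tmap_lin; [exact: FA_mull_lin|exact: lin_id]. Qed.

Lemma Lm_rel a b w : degM (deg a) -> degM (deg b) -> Rel k Lm a b w.
Proof.
move=> Da Db; apply: (tens_eq (f := fun w => Lm a (Lm b w))
  (h := fun w => (sg K k * ep (deg a) (deg b)) *: Lm b (Lm a w)
   + lext (Lm^~ w) (kbr k (e a) (e b)) + kfm k (e a) (e b) *: w)).
- by apply: (lin_comp (f := Lm a) (h := Lm b)); exact: Lm_lin.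
- apply: linear_funD; last exact: linear_funZ.
  apply: linear_funD; last by apply: R_linr => c; exact: Lm_lin.
  by apply: linear_funZ; apply: (lin_comp (f := Lm b) (h := Lm a)); exact: Lm_lin.
move=> s v; rewrite !Lm_pure mulrA (gen_commE span_M k degM_add Da Db).
rewrite !mulrDl !tpureDl -!palg_scalerAl !tpureZl mul1r mulrA; congr (_ + _ + _).
rewrite (gen_lext span_M k (kbr_in span_M k degM_add Da Db)).
rewrite (lext_comp (L := fun u : Fm => tpure (u * s) v)).
  by apply: lext_eq => c _ /=; rewrite Lm_pure.
exact: (lin_comp (tpure_linl v) (FA_mulr_lin s)).
Qed.

(* To define the action of y in g_+ on F(g_-) (x) F(g_+) by moving y past the *)
(* generators of F(g_-), F(g_-) acts on pairs (s, f) in which f b v stands    *)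
(* for the action of e_b on s (x) v.                                          *)
Definition mvX : lmodType K := (Fm * (I -> Fp -> T))%type.
Definition mvY (x : mvX) (y : g) (v : Fp) : T :=
  lext (fun c => if (deg c).1 <= 0 then tpure (gm c * x.1) v else x.2 c v) y.
Definition mv (a : I) (x : mvX) : mvX :=
  (gm a * x.1, fun b v => (sg K k * ep (deg b) (deg a)) *: Lm a (x.2 b v)
    + mvY x (kbr k (e b) (e a)) v + kfm k (e b) (e a) *: tpure x.1 v).

Lemma mvY_lin y v : linear (fun x => mvY x y v).
Proof.
move=> c x x'; rewrite /mvY -lext_fZ -lext_fD; apply: lext_eq => a _.
case: ifP => _ //=.
exact: (lin_comp (tpure_linl v) (FA_mull_lin _)).
Qed.

Lemma mvX_eq (x y : mvX) : x.1 = y.1 -> (forall b v, x.2 b v = y.2 b v) -> x = y.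
Proof.
case: x y => [s f] [s' f'] /= -> H; congr pair.
by apply/funext => b; apply/funext.
Qed.
Lemma mvX_lin1 : linear (fun x : mvX => x.1). Proof. by []. Qed.
Lemma mvX_lin2 b v : linear (fun x : mvX => x.2 b v).
Proof. exact: eval_snd_lin. Qed.

Lemma mvE1 a (x : mvX) : (mv a x).1 = gm a * x.1. Proof. by []. Qed.
Lemma mvE2 a (x : mvX) b v : (mv a x).2 b v =
  (sg K k * ep (deg b) (deg a)) *: Lm a (x.2 b v)
    + mvY x (kbr k (e b) (e a)) v + kfm k (e b) (e a) *: tpure x.1 v.
Proof. by []. Qed.

Lemma mv_lin a : linear (mv a).
Proof.
move=> c x x'; apply: mvX_eq => [|b v].
  by rewrite mvX_lin1; exact: FA_mull_lin.
by rewrite mvX_lin2 !mvE2 mvX_lin2 mvY_lin Lm_lin mvX_lin1 tpure_linl; module.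
Qed.

Lemma mvY_mv a x d y v : degM (deg a) -> gr d y ->
  mvY (mv a x) y v = (sg K k * ep d (deg a)) *: Lm a (mvY x y v)
    + mvY x (kbr k y (e a)) v + kfm k y (e a) *: tpure x.1 v.
Proof.
move=> Da gy.
transitivity (lext (fun c => (sg K k * ep d (deg a)) *:
    Lm a (if (deg c).1 <= 0 then tpure (gm c * x.1) v else x.2 c v)
    + mvY x (kbr k (e c) (e a)) v + kfm k (e c) (e a) *: tpure x.1 v) y).
  apply: lext_eq => c Bc; rewrite -((grP E _ _).1 gy _ Bc).
  case: ifP => // Dc; rewrite /= Lm_pure !mulrA.
  rewrite (gen_commE span_M k degM_add Dc Da).
  rewrite !mulrDl !tpureDl -!palg_scalerAl !tpureZl mul1r; congr (_ + _ + _).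
  rewrite (gen_lext span_M k (kbr_in span_M k degM_add Dc Da)).
  rewrite (lext_comp (L := fun u : Fm => tpure (u * x.1) v)); last first.
    exact: (lin_comp (tpure_linl v) (FA_mulr_lin _)).
  apply: lext_eq => c' Bc'; case: ifP => // /negbT/negP H; case: H.
  have := (grP E _ _).1 (kbr_gr k (bvec_gr c) (bvec_gr a)) _ Bc'.
  by move=> ->; apply: degM_add.
rewrite !lext_fD lext_fZ (lext_comp _ _ (Lm_lin a)); congr (_ + _ + _).
  have kl : linear (fun y => mvY x (kbr k y (e a)) v).
    by apply: (lin_comp (f := fun z => mvY x z v)); [exact: lext_linear|exact: kbr_linl].
  by rewrite -(lext_linE E kl).
by rewrite -(lext_linE E (linear_scal _ (kfm_linl k (e a)))).
Qed.

(** Moving [e b] past [e a] and [e a'] in the two possible orders gives compatible results by the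
    Jacobi identity, which is the same cancellation as in [Rel_step]. *)
Lemma mv_rel a a' x : degM (deg a) -> degM (deg a') ->
  mv a (mv a' x) = (sg K k * ep (deg a) (deg a')) *: mv a' (mv a x)
    + lext (mv^~ x) (kbr k (e a) (e a')) + kfm k (e a) (e a') *: x.
Proof.
move=> Da Da'.
have gv c : gr (deg c) (e c) by exact: bvec_gr.
apply: mvX_eq => [|b v].
  rewrite !(linD mvX_lin1) !(linZ mvX_lin1) !mvE1 mulrA (gen_commE span_M k degM_add Da Da') !mulrDl -!palg_scalerAl mul1r mulrA.
  congr (_ + _ + _).
  rewrite (gen_lext span_M k (kbr_in span_M k degM_add Da Da')).
  rewrite (lext_comp (L := fun u : Fm => u * x.1)); last exact: FA_mulr_lin.
  by rewrite (lext_comp _ _ mvX_lin1).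
rewrite !(linD (mvX_lin2 b v)) !(linZ (mvX_lin2 b v)) (lext_comp _ _ (mvX_lin2 b v)).
have -> : lext ((fun y : mvX => y.2 b v) \o mv^~ x) (kbr k (e a) (e a')) =
    (sg K k * (ep (deg b) (deg a) * ep (deg b) (deg a'))) *:
      lext (Lm^~ (x.2 b v)) (kbr k (e a) (e a'))
    + mvY x (kbr k (e b) (kbr k (e a) (e a'))) v
    + kfm k (e b) (kbr k (e a) (e a')) *: tpure x.1 v.
  have ga := kbr_gr k (gv a) (gv a').
  transitivity (lext (fun c => (sg K k * (ep (deg b) (deg a) * ep (deg b) (deg a'))) *:
      Lm c (x.2 b v) + mvY x (kbr k (e b) (e c)) v + kfm k (e b) (e c) *: tpure x.1 v)
      (kbr k (e a) (e a'))).
    by apply: lext_eq => c Bc /=; rewrite ((grP E _ _).1 ga _ Bc) epDr.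
  rewrite !lext_fD lext_fZ; congr (_ + _ + _).
    have kl : linear (fun y => mvY x (kbr k (e b) y) v).
      by apply: (lin_comp (f := fun z => mvY x z v)); [exact: lext_linear|exact: kbr_linr].
    by rewrite -(lext_linE E kl).
  by rewrite -(lext_linE E (linear_scal _ (kfm_linr k (e b)))).
have g1 := kbr_gr k (gv b) (gv a); have g2 := kbr_gr k (gv b) (gv a').
rewrite (kbr_jacobi k (gv b) (gv a) (gv a')) (kbr_sym k (gv a) g2).
rewrite !mvE2 !mvE1 (mvY_mv x v Da' g1) (mvY_mv x v Da g2).
rewrite !(linD (Lm_lin _)) !(linZ (Lm_lin _)) !Lm_pure (Lm_rel (x.2 b v) Da Da').
have Yl : linear (fun y => mvY x y v) by exact: lext_linear.
rewrite !(linD Yl) !(linZ Yl).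
have F1 : kfm k (e a) (e a') * (ep (deg b) (deg a) * ep (deg b) (deg a') - 1) = 0.
  have [H|/(kfm_gr k (gv a) (gv a')) ->] := eqVneq (deg a + deg a') 0; last by rewrite mul0r.
  by rewrite -epDr H ep0r subrr mulr0.
have F2 : kfm k (e b) (e a') * (ep (deg a) (deg a') - ep (deg b) (deg a)) = 0.
  have [/eqP H|/(kfm_gr k (gv b) (gv a')) ->] := eqVneq (deg b + deg a') 0; last by rewrite mul0r.
  by rewrite addr_eq0 in H; rewrite (eqP H) epNl subrr mulr0.
have F3 : kfm k (e b) (e a) * (1 - ep (deg a) (deg a') * ep (deg b) (deg a')) = 0.
  have [H|/(kfm_gr k (gv b) (gv a)) ->] := eqVneq (deg b + deg a) 0; last by rewrite mul0r.
  by rewrite -epDl addrC (addrC (deg a)) H ep0l addrC subrr mulr0.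
have pp := epV eps (deg a) (deg a'); have qq := epV eps (deg b) (deg a).
move: pp qq F1 F2 F3; rewrite !(epDl, epDr).
set p := ep (deg a) (deg a'); set p' := ep (deg a') (deg a).
set q := ep (deg b) (deg a); set q' := ep (deg a) (deg b).
set r := ep (deg b) (deg a').
move=> pp qq F1 F2 F3.
apply: (cert0 (Z := (kfm k (e a) (e a') * (q * r - 1)) *: x.2 b v
  - (p * p' - 1) *: (q *: Lm a (mvY x (kbr k (e b) (e a')) v))
  + (q * q' - 1) *: (p *: mvY x (kbr k (kbr k (e b) (e a')) (e a)) v)
  + (kfm k (e b) (e a') * (p - q)) *: tpure (gm a * x.1) v
  + (kfm k (e b) (e a) * (1 - p * r)) *: tpure (gm a' * x.1) v)); last first.
  by rewrite pp qq F1 F2 F3 !subrr !scale0r !(addr0, subr0).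
have Y0 : mvY x 0 v = 0 := lin0 Yl.
have [[-> kf0]|[-> kb0]] := kind_cases g k.
  by rewrite !kf0; module.
rewrite !kb0 Y0 !(lin0 (Lm_lin _)) (lin0 (R_linl _ _)).
have kf0 z : kfm k z 0 = 0 by exact: (scalar0 (kfm_linr k z)).
have kf0' z : kfm k 0 z = 0 by exact: (scalar0 (kfm_linl k z)).
by rewrite ?kf0 ?kf0'; module.
Qed.

End TriangularDecomposition.

Section TriangularDecompositionBis.
Variables (K : fieldType) (Gam : zmodType) (eps : commutation_factor K Gam).
Variables (g : quadColorLie eps) (E : hbasis g).
Notation I := (bidx E).
Notation e := (@bvec _ _ _ _ E).
Notation deg := (@bdeg _ _ _ _ E).
Notation ep := (ep eps).
Notation lext := (@lext _ _ _ g E _).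
Notation gM := (@gM _ _ _ g).
Notation gP := (@gP _ _ _ g).

Variable k : algkind.
Notation Fm := (FA k gM).
Notation Fp := (FA k gP).
Notation Fg := (FA k [set: g]).
Notation T := (tens Fm Fp).
Notation gm a := (gen k gM (e a)).
Notation gp a := (gen k gP (e a)).
Notation gg a := (gen k [set: g] (e a)).

Notation Lm := (@Lm K Gam eps g E k).
Notation degM_add := (@degM_add Gam).
Notation degP_add := (@degP_add Gam).
Notation degT_add := (@degT_add Gam).
Notation mvX := (mvX E k).
Notation mv := (@mv K Gam eps g E k).
Notation mv_lin := (@mv_lin K Gam eps g E k).
Notation mv_rel := (@mv_rel K Gam eps g E k).
Notation span_M := (span_M E).
Notation span_P := (span_P E).
Notation mvX_lin1 := (@mvX_lin1 _ _ _ _ E k).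
Notation mvX_lin2 := (@mvX_lin2 _ _ _ _ E k).

(** The initial state: past an empty left factor a letter of g_+ simply multiplies the right
    factor. *)
Definition st0 : mvX := (1 : Fm, fun b (v : Fp) => tpure (1 : Fm) (gp b * v)).
Definition st (s : Fm) : mvX := act mv s st0.
Definition mvb (b : I) (s : Fm) (v : Fp) : T := (st s).2 b v.

Lemma st_gen a s : degM (deg a) -> st (gm a * s) = mv a (st s).
Proof.
move=> Da; rewrite /st (actM span_M mv_lin mv_rel).
by rewrite (act_basis span_M mv_lin mv_rel).
Qed.
Lemma st1 : st 1 = st0. Proof. exact: (act1 span_M mv_lin mv_rel). Qed.
Lemma st_lin : linear st. Proof. exact: (act_linl span_M mv_lin mv_rel). Qed.

Lemma st_fst s : (st s).1 = s.
Proof.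
apply: (FA_ind span_M (Q := [set s | (st s).1 = s])) => [||a u Da Hu].
- by apply: subspace_eq; [exact: (lin_comp mvX_lin1 st_lin)|exact: lin_id].
- by rewrite /= st1.
- by rewrite /= st_gen // mvE1 Hu.
Qed.

Lemma mvb_linl b v : linear (fun s => mvb b s v).
Proof. exact: (lin_comp (mvX_lin2 b v) st_lin). Qed.

Lemma mvb_gen b a s v : degM (deg a) -> mvb b (gm a * s) v =
  (sg K k * ep (deg b) (deg a)) *: Lm a (mvb b s v)
    + lext (fun c => if (deg c).1 <= 0 then tpure (gm c * s) v else mvb c s v)
        (kbr k (e b) (e a))
    + kfm k (e b) (e a) *: tpure s v.
Proof. by move=> Da; rewrite /mvb st_gen // mvE2 /mvY st_fst. Qed.

Lemma mvb1 b v : mvb b 1 v = tpure (1 : Fm) (gp b * v).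
Proof. by rewrite /mvb st1. Qed.

Lemma mvb_linr b s : linear (mvb b s).
Proof.
move: b; apply: (FA_ind span_M (Q := [set s | forall b, linear (mvb b s)])) => /=.
- split=> [b c x y|c s1 s2 H1 H2 b c' x y].
    by rewrite !(lin0 (mvb_linl _ _)) scaler0 addr0.
  rewrite (mvb_linl b (c' *: x + y) c s1 s2) (mvb_linl b x c s1 s2) (mvb_linl b y c s1 s2).
  by rewrite H1 H2; module.
- by move=> b c x y; rewrite !mvb1 mulrDr -palg_scalerAr tpure_linr.
- move=> a u Da IH b c x y; rewrite !mvb_gen // IH Lm_lin tpure_linr.
  have -> : lext (fun c0 => if (deg c0).1 <= 0 then tpure (gm c0 * u) (c *: x + y)
      else mvb c0 u (c *: x + y)) (kbr k (e b) (e a)) =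
    c *: lext (fun c => if (deg c).1 <= 0 then tpure (gm c * u) x else mvb c u x)
        (kbr k (e b) (e a)) +
    lext (fun c => if (deg c).1 <= 0 then tpure (gm c * u) y else mvb c u y)
        (kbr k (e b) (e a)).
    rewrite -lext_fZ -lext_fD; apply: lext_eq => c' _; case: ifP => _; last exact: IH.
    exact: tpure_linr.
  by module.
Qed.

Definition rhoT (a : I) : T -> T := if (deg a).1 <= 0 then Lm a else tlift (mvb a).

Lemma rhoT_lin a : linear (rhoT a).
Proof.
rewrite /rhoT; case: ifP => _; first exact: Lm_lin.
by apply: tlift_lin => [v|s]; [exact: mvb_linl|exact: mvb_linr].
Qed.
Lemma rhoT_M a w : degM (deg a) -> rhoT a w = Lm a w.
Proof. by rewrite /rhoT /degM /= => ->. Qed.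
Lemma rhoT_pure b s v :
  rhoT b (tpure s v) = if (deg b).1 <= 0 then tpure (gm b * s) v else mvb b s v.
Proof.
rewrite /rhoT; case: ifP => _; first exact: Lm_pure.
by apply: tlift_pure => [w|w]; [exact: mvb_linl|exact: mvb_linr].
Qed.

Lemma Rel_lin (rho : I -> T -> T) a b : (forall a, linear (rho a)) ->
  (forall s v, Rel k rho a b (tpure s v)) -> forall w, Rel k rho a b w.
Proof.
move=> rl H w; apply: (tens_eq (f := fun w => rho a (rho b w))
  (h := fun w => (sg K k * ep (deg a) (deg b)) *: rho b (rho a w)
   + lext (rho^~ w) (kbr k (e a) (e b)) + kfm k (e a) (e b) *: w)) => //.
- by apply: (lin_comp (f := rho a) (h := rho b)); exact: rl.
- apply: linear_funD; last exact: linear_funZ.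
  apply: linear_funD; last exact: R_linr.
  by apply: linear_funZ; apply: (lin_comp (f := rho b) (h := rho a)); exact: rl.
Qed.

Lemma rhoT_relM c a w : degM (deg a) -> Rel k rhoT c a w.
Proof.
move=> Da; apply: (Rel_lin rhoT_lin) => s v.
rewrite /Rel !(rhoT_M _ Da) Lm_pure !rhoT_pure.
have [Dc|/degMP Dc] := pselect (degM (deg c)).
  rewrite (_ : _ <= 0 = true) // -!Lm_pure (Lm_rel _ Dc Da) Lm_pure.
  congr (_ + _ + _); apply: lext_eq => b Bb; rewrite rhoT_M //.
  have -> := (grP E _ _).1 (kbr_gr k (bvec_gr c) (bvec_gr a)) _ Bb.
  exact: degM_add.
rewrite (_ : _ <= 0 = false); last by apply/negbTE; rewrite -ltNge.
rewrite mvb_gen //; congr (_ + _ + _).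
by apply: lext_eq => b Bb; rewrite rhoT_pure.
Qed.

(** Induction on the left factor. For the left factor 1 and two letters of g_+ this is a relation of
    F(g_+), and if one letter lies in g_- it holds by the construction of [mv] ([rhoT_relM]).
    [Rel_step] adds one letter of g_- to the left factor. *)
Lemma rhoT_rel a b w : Rel k rhoT a b w.
Proof.
move: a b; apply: (tens_ind (Q := [set w | forall a b, Rel k rhoT a b w])) w.
  rewrite (_ : [set w | _] = [set w | forall ab : I * I, True -> Rel k rhoT ab.1 ab.2 w]).
    apply: (@subspace_all K T _ (fun ab => [set w | Rel k rhoT ab.1 ab.2 w])) => -[a b] _.
    apply: subspace_eq; first by apply: (lin_comp (f := rhoT a) (h := rhoT b)); exact: rhoT_lin.
    apply: linear_funD; last exact: linear_funZ.
    apply: linear_funD; last exact: (R_linr rhoT_lin).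
    apply: linear_funZ; apply: (lin_comp (f := rhoT b) (h := rhoT a)); exact: rhoT_lin.
  by apply/seteqP; split=> [w H [a b] _|w H a b]; [exact: H|exact: (H (a, b))].
move=> s v; apply: (FA_ind span_M (Q := [set s | forall a b, Rel k rhoT a b (tpure s v)])).
- rewrite (_ : [set w | _] = [set s | forall ab : I * I, True ->
      Rel k rhoT ab.1 ab.2 (tpure s v)]).
    apply: (@subspace_all K Fm _ (fun ab => [set s | Rel k rhoT ab.1 ab.2 (tpure s v)])) => -[a b] _.
    have tl := tpure_linl v (A := Fm).
    apply: subspace_eq.
      exact: (lin_comp (f := rhoT a) (rhoT_lin a) (lin_comp (rhoT_lin b) tl)).
    apply: linear_funD; last exact: linear_funZ.
    apply: linear_funD; last exact: (lin_comp (R_linr rhoT_lin _) tl).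
    apply: linear_funZ.
    exact: (lin_comp (f := rhoT b) (rhoT_lin b) (lin_comp (rhoT_lin a) tl)).
  by apply/seteqP; split=> [w H [a b] _|w H a b]; [exact: H|exact: (H (a, b))].
- move=> a b.
  have [Db|/degMP Db] := pselect (degM (deg b)); first exact: rhoT_relM.
  have [Da|/degMP Da] := pselect (degM (deg a)).
    by apply: Rel_sym; exact: rhoT_relM.
  have nM c : degP (deg c) -> ((deg c).1 <= 0) = false.
    by move=> Dc; apply/negbTE; rewrite -ltNge.
  rewrite /Rel !rhoT_pure !nM // !mvb1 !rhoT_pure !nM // !mvb1 !mulrA.
  rewrite (gen_commE span_P k degP_add Da Db) !mulrDl !tpureDr -!palg_scalerAl.
  rewrite !tpureZr mul1r; congr (_ + _ + _).
  rewrite (gen_lext span_P k (kbr_in span_P k degP_add Da Db)).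
  rewrite (lext_comp (L := fun u : Fp => tpure (1 : Fm) (u * v))); last first.
    exact: (lin_comp (tpure_linr _) (FA_mulr_lin _)).
  apply: lext_eq => c Bc /=; rewrite rhoT_pure nM ?mvb1 //.
  have -> := (grP E _ _).1 (kbr_gr k (bvec_gr a) (bvec_gr b)) _ Bc.
  exact: degP_add.
- move=> a u Da IH b b' /=; rewrite -Lm_pure -rhoT_M //.
  apply: Rel_step => //; first exact: rhoT_lin.
  by move=> c w; exact: rhoT_relM.
Qed.

(** The inverse of the multiplication map: applying [u] to 1 (x) 1 writes it in normal order. For
    [Env] this is the Poincare-Birkhoff-Witt factorization along g_- and g_+. *)
Definition split (u : Fg) : T := act rhoT u (tpure (1 : Fm) (1 : Fp)).

Let HT : span_of E [set: g] [set: bideg Gam] := @span_ofT _ _ _ g E.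
Let rhoT_relT a b w : [set: bideg Gam] (deg a) -> [set: bideg Gam] (deg b) ->
  rhoT a (rhoT b w) = (sg K k * ep (deg a) (deg b)) *: rhoT b (rhoT a w)
   + lext (rhoT^~ w) (kbr k (e a) (e b)) + kfm k (e a) (e b) *: w.
Proof. by move=> _ _; exact: rhoT_rel. Qed.

Lemma split_lin : linear split.
Proof. exact: (act_linl HT rhoT_lin rhoT_relT). Qed.

Lemma incM_gen a : degM (deg a) -> FAincl [set: g] (gm a) = gg a.
Proof. by move=> Da; apply: (FAincl_gen span_M HT) => //; exact/(span_of_vec span_M). Qed.
Lemma incP_gen a : degP (deg a) -> FAincl [set: g] (gp a) = gg a.
Proof. by move=> Da; apply: (FAincl_gen span_P HT) => //; exact/(span_of_vec span_P). Qed.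
Lemma incM_lin : linear (@FAincl _ _ _ g k gM [set: g]).
Proof. exact: (FAincl_lin span_M HT). Qed.
Lemma incP_lin : linear (@FAincl _ _ _ g k gP [set: g]).
Proof. exact: (FAincl_lin span_P HT). Qed.
Lemma incMM u v : @FAincl _ _ _ g k gM setT (u * v) = FAincl setT u * FAincl setT v.
Proof. exact: (FAinclM span_M HT). Qed.
Lemma incPM u v : @FAincl _ _ _ g k gP setT (u * v) = FAincl setT u * FAincl setT v.
Proof. exact: (FAinclM span_P HT). Qed.

Notation tmuF := (@tmu _ _ (triF g k)).

Lemma tmuF_bil : (forall v : Fp, linear (fun s : Fm => FAincl [set: g] s * FAincl [set: g] v)) /\
  (forall s : Fm, linear (fun v : Fp => FAincl [set: g] s * FAincl [set: g] v)).
Proof.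
split=> [v|s]; first exact: (lin_comp (FA_mulr_lin _) incM_lin).
exact: (lin_comp (FA_mull_lin _) incP_lin).
Qed.
Lemma tmuF_lin : linear tmuF.
Proof. by have [? ?] := tmuF_bil; exact: tlift_lin. Qed.
Lemma tmuF_pure s v : tmuF (tpure s v) = FAincl [set: g] s * FAincl [set: g] v.
Proof. by have [H1 H2] := tmuF_bil; exact: (tlift_pure H1 H2). Qed.

(** For a letter of g_- this is associativity. For a letter of g_+ both sides obey the same exchange
    relation with the letters of the left factor, which allows an induction starting from the left
    factor 1. *)
Lemma tmuF_rhoT a w : tmuF (rhoT a w) = gg a * tmuF w.
Proof.
have HM b v : degM (deg b) -> tmuF (rhoT b v) = gg b * tmuF v.
  move=> Db; rewrite rhoT_M //.
  apply: (tens_eq (f := fun v => tmuF (Lm b v)) (h := fun v => gg b * tmuF v)).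
  - exact: (lin_comp tmuF_lin (Lm_lin b)).
  - exact: (lin_comp (FA_mull_lin _) tmuF_lin).
  - by move=> s u; rewrite Lm_pure !tmuF_pure incMM incM_gen // mulrA.
move: a; apply: (tens_ind (Q := [set w | forall a, tmuF (rhoT a w) = gg a * tmuF w])) w.
  rewrite (_ : [set w | _] = [set w | forall a, True -> tmuF (rhoT a w) = gg a * tmuF w]).
    apply: (@subspace_all K T _ (fun a => [set w | tmuF (rhoT a w) = gg a * tmuF w])) => a _.
    apply: subspace_eq; first exact: (lin_comp tmuF_lin (rhoT_lin a)).
    exact: (lin_comp (FA_mull_lin _) tmuF_lin).
  by apply/seteqP; split=> [w H a _|w H a]; [exact: H|exact: (H a)].
move=> s v; apply: (FA_ind span_M (Q := [set s | forall a,
  tmuF (rhoT a (tpure s v)) = gg a * tmuF (tpure s v)])).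
- rewrite (_ : [set w | _] = [set s | forall a, True ->
     tmuF (rhoT a (tpure s v)) = gg a * tmuF (tpure s v)]).
    apply: (@subspace_all K Fm _ (fun a => [set s |
      tmuF (rhoT a (tpure s v)) = gg a * tmuF (tpure s v)])) => a _.
    have tl := tpure_linl v (A := Fm).
    apply: subspace_eq.
      exact: (lin_comp (f := tmuF) tmuF_lin (lin_comp (rhoT_lin a) tl)).
    exact: (lin_comp (f := fun u => gg a * u) (FA_mull_lin _) (lin_comp tmuF_lin tl)).
  by apply/seteqP; split=> [w H a _|w H a]; [exact: H|exact: (H a)].
- move=> a; have [Da|/degMP Da] := pselect (degM (deg a)); first exact: HM.
  rewrite rhoT_pure (_ : _ <= 0 = false); last by apply/negbTE; rewrite -ltNge.
  by rewrite mvb1 !tmuF_pure (FAincl1 span_M HT) // !mul1r incPM incP_gen.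
- move=> b u Db IH a /=; rewrite -Lm_pure -rhoT_M // (rhoT_rel a b).
  rewrite !(linD tmuF_lin) !(linZ tmuF_lin) !(HM b _ Db) IH.
  rewrite !mulrA (gen_commE HT k degT_add (a := a) (b := b)) // !mulrDl -!palg_scalerAl.
  rewrite mul1r; congr (_ + _ + _).
  rewrite (lext_comp _ _ tmuF_lin) (gen_lext HT k (x := kbr k (e a) (e b)) Logic.I).
  rewrite (lext_comp (L := fun z : Fg => z * tmuF (tpure u v))); last exact: FA_mulr_lin.
  by apply: lext_eq => c _ /=; exact: IH.
Qed.

Lemma split_gen a u : split (gg a * u) = rhoT a (split u).
Proof.
by rewrite /split (actM HT rhoT_lin rhoT_relT) (act_basis HT rhoT_lin rhoT_relT).
Qed.
Lemma split1 : split 1 = tpure (1 : Fm) (1 : Fp).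
Proof. exact: (act1 HT rhoT_lin rhoT_relT). Qed.

Lemma split_tmuK (u : Fg) : tmuF (split u) = u.
Proof.
apply: (FA_ind HT (Q := [set u | tmuF (split u) = u])).
- by apply: subspace_eq; [exact: (lin_comp tmuF_lin split_lin)|exact: lin_id].
- by rewrite /= split1 tmuF_pure (FAincl1 span_M HT) // (FAincl1 span_P HT) // mulr1.
- by move=> a v _ /= H; rewrite split_gen tmuF_rhoT H.
Qed.

Lemma tmu_splitK (w : T) : split (tmuF w) = w.
Proof.
apply: (tens_eq (f := split \o tmuF) (h := id)) => //.
  exact: (lin_comp split_lin tmuF_lin).
move=> s v /=; rewrite tmuF_pure.
apply: (FA_ind span_M (Q := [set s | split (FAincl setT s * FAincl setT v) = tpure s v])).
- apply: subspace_eq; last exact: tpure_linl.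
  exact: (lin_comp split_lin (lin_comp (FA_mulr_lin _) incM_lin)).
- rewrite /= (FAincl1 span_M HT) // mul1r.
  apply: (FA_ind span_P (Q := [set v | split (FAincl setT v) = tpure (1 : Fm) v])).
  + by apply: subspace_eq; [exact: (lin_comp split_lin incP_lin)|exact: tpure_linr].
  + by rewrite /= (FAincl1 span_P HT) // split1.
  + move=> a u Da /= IH; rewrite incPM incP_gen // split_gen IH rhoT_pure.
    by rewrite (_ : _ <= 0 = false) ?mvb1 //; apply/negbTE; rewrite -ltNge.
- move=> a u Da /= IH; rewrite incMM incM_gen // -mulrA split_gen IH.
  by rewrite rhoT_M // Lm_pure.
Qed.

End TriangularDecompositionBis.

(** * Completions *)

Lemma bidegD (Gam : zmodType) (d d' : bideg Gam) : d + d' = (d.1 + d'.1, d.2 + d'.2).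
Proof. by []. Qed.

Section Completion.
Variables (K : fieldType) (Gam : zmodType) (F : triangular K Gam).
Notation bideg := (bideg Gam).
Notation TT := (tens (tm F) (tp F)).
Notation tmu := (@tmu K Gam F).
Notation hcomp := (@hcomp K Gam F).
Notation hin := (@hin K Gam F).
Infix "**" := (@tmul K Gam F) (at level 40, left associativity).

(** What the completion requires of a triangular decomposition, so that limits are treated once for
    the four algebras and for W. As [triangular] carries no product on [tp], closure under products
    is asked of the image of F(g_+) ([inp_mul]). *)
Record tri_good := TriGood {
  spl : tg F -> TT;
  spl_lin : linear spl;
  tmuK : forall u, tmu (spl u) = u;
  splK : forall w, spl (tmu w) = w;
  Gm : grading (@tgrm K Gam F);
  Gp : grading (@tgrp K Gam F);
  tgrm_le : forall d a, tgrm d a -> ~~ (d.1 <= 0) -> a = 0 :> tm F;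
  tgrp_ge : forall d b, tgrp d b -> ~~ (0 <= d.1) -> b = 0 :> tp F;
  inm_lin : linear (@tinm K Gam F);
  inp_lin : linear (@tinp K Gam F);
  mul_linl : forall v, linear (fun u => u ** v);
  mul_linr : forall u, linear (fun v => u ** v);
  mul_assoc : forall u v w, u ** (v ** w) = u ** v ** w;
  tgr : bideg -> set (tg F);
  Gg : grading tgr;
  inm_gr : forall d a, tgrm d a -> tgr d (tinm a);
  inp_gr : forall d b, tgrp d b -> tgr d (tinp b);
  mul_gr : forall d d' u v, tgr d u -> tgr d' v -> tgr (d + d') (u ** v);
  inp_mul : forall d d' (b b' : tp F), tgrp d b -> tgrp d' b' ->
    exists2 b'' : tp F, tgrp (d + d') b'' & tinp b ** tinp b' = tinp b''
}.

Variable G : tri_good.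

Lemma tmu_bil : (forall b, linear (fun a => tinm a ** tinp b :> tg F)) /\
  (forall a, linear (fun b => tinm a ** tinp b : tg F)).
Proof.
split=> [b|a]; first exact: (lin_comp (mul_linl G _) (inm_lin G)).
exact: (lin_comp (mul_linr G _) (inp_lin G)).
Qed.
Lemma tmu_lin : linear tmu.
Proof. by have [? ?] := tmu_bil; exact: tlift_lin. Qed.
Lemma tmu_pure a b : tmu (tpure a b) = tinm a ** tinp b.
Proof. by have [H1 H2] := tmu_bil; exact: (tlift_pure H1 H2). Qed.

(** The absolute value loses nothing, since the components of F(g_+) of negative Z-degree vanish
    ([tgrp_ge]). *)
Definition hdeg (d1 d2 : bideg) : hidx Gam := ((d1.1 + d2.1, d1.2 + d2.2), `|d2.1|%N).

Lemma hcompE c w : hcomp c w <-> tens_gr (@tgrm K Gam F) (@tgrp K Gam F) hdeg c w.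
Proof.
split.
  apply: spanS_mono => {}w [al [be [a [b [H1 Ha Hb ->]]]]].
  exists (c.1.1 - c.2%:Z, al), (c.2%:Z, be), a, b; split=> //.
  by case: c H1 Ha Hb => [[i x] r] /= <- _ _; rewrite /hdeg /= subrK.
apply: (spanS_ind (spanS_subspace _)) => {}w [d1 [d2 [a [b [<- Ha Hb ->]]]]].
case: (boolP (0 <= d2.1)) => H; last first.
  by rewrite (tgrp_ge G Hb H) tpure0r; exact: subs0 (spanS_subspace _).
apply: spanS_sub; exists d1.2, d2.2, a, b; split=> //=.
  by rewrite gez0_abs // addrK -surjective_pairing.
by rewrite gez0_abs // -surjective_pairing.
Qed.

Definition hpr : hidx Gam -> TT -> TT := tens_pr (Gm G) (Gp G) hdeg.
Lemma hpr_lin c : linear (hpr c). Proof. exact: tens_pr_lin. Qed.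
Lemma hpr_id c c' w : hcomp c' w -> hpr c w = if c == c' then w else 0.
Proof. by move/hcompE; exact: tens_pr_id. Qed.
Lemma hcomp_subspace c : subspace (hcomp c). Proof. exact: spanS_subspace. Qed.
Lemma hcomp_spanning w : spanS [set w | exists c, hcomp c w] w.
Proof.
apply: spanS_mono (tens_gr_spanning (Gm G) (Gp G) hdeg w) => {}w [c /hcompE H].
by exists c.
Qed.
Definition hG : grading hcomp := mk_grading hcomp_subspace hpr_lin hpr_id hcomp_spanning.

(** The family defining [hin] is unique: [spl] recovers a tensor from its product, and the
    projections [hpr] separate its components. *)
Lemma hinE y c : hin y c = hpr c (spl G y).
Proof.
suff -> : hin y = (fun c => hpr c (spl G y)) by [].
rewrite /Defs.hin; apply: xget_unique.
  have [s [us Hs yE]] := gpr_fin hG (spl G y); split.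
  - by apply: (finite_supp (s := s)); exact: Hs.
  - by move=> c'; exact: (gpr_in hG).
  - rewrite (fsbig_supp_seq us); last by move=> i /Hs /= ->; rewrite (lin0 tmu_lin).
    by rewrite -(linsum tmu_lin) -[in LHS](tmuK G y) {1}yE.
move=> u [fin hu yE]; apply/funext => c'.
have [s us Hs] := supp_seq fin.
rewrite yE (fsbig_supp_seq us); last by move=> i /Hs ->; rewrite (lin0 tmu_lin).
rewrite (linsum (spl_lin G)) (linsum (hpr_lin c')).
under eq_bigr => i _ do rewrite (splK G) (hpr_id _ (hu i)).
case: (boolP (c' \in s)) => cs.
  rewrite (bigD1_seq c') //= eqxx big1 ?addr0 // => i /negbTE.
  by rewrite eq_sym => ->.
rewrite Hs // big_seq big1 // => i is_; case: eqP => // E.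
by rewrite -E (negbTE cs) in is_.
Qed.

Lemma hin_lin c : linear (fun y => hin y c).
Proof. by move=> k x y; rewrite !hinE (spl_lin G) hpr_lin. Qed.

Lemma hin_tmu c c' w : hcomp c' w -> hin (tmu w) c = if c == c' then w else 0.
Proof. by move=> hw; rewrite hinE (splK G) (hpr_id _ hw). Qed.

Lemma hin_sum y : exists s : seq (hidx Gam), [/\ uniq s,
  forall c, c \notin s -> hin y c = 0 & y = \sum_(c <- s) tmu (hin y c)].
Proof.
have [s [us Hs yE]] := gpr_fin hG (spl G y); exists s; split=> // [c /Hs|].
  by rewrite hinE.
rewrite -[LHS](tmuK G) {1}yE (linsum tmu_lin); apply: eq_bigr => c _.
by rewrite hinE.
Qed.

Lemma hin_comp y c : hcomp c (hin y c).
Proof. by rewrite hinE; exact: (gpr_in hG). Qed.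

(* The left ideal generated by the F(g_+)_r with r >= n (see J_span); these   *)
(* ideals define the topology of the completion.                              *)
Definition J (n : int) : set (tg F) := [set y | forall c, c.2%:Z < n -> hin y c = 0].

Lemma J_hin n c y : J n y -> c.2%:Z < n -> hin y c = 0.
Proof. exact. Qed.

Lemma J_subspace n : subspace (J n).
Proof.
split=> [c _|k x y Jx Jy c cn]; first exact: (lin0 (hin_lin c)).
by rewrite hin_lin Jx // Jy // scaler0 addr0.
Qed.

Lemma J_mono n m y : n <= m -> J m y -> J n y.
Proof. by move=> nm H c cn; apply: H; exact: lt_le_trans nm. Qed.

Lemma J_le0 n y : n <= 0 -> J n y.
Proof. by move=> n0 c /lt_le_trans -/(_ _ n0). Qed.

Lemma J_tmu n c w : n <= c.2%:Z -> hcomp c w -> J n (tmu w).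
Proof.
move=> nc hw c' c'n; rewrite (hin_tmu _ hw); case: eqP => // E.
by move: c'n; rewrite E ltNge nc.
Qed.

Lemma J_pure n d a b : tgrp d b -> n <= d.1 -> J n (tinm a ** tinp b).
Proof.
move=> hb nd; have [d0|d0] := boolP (0 <= d.1); last first.
  rewrite (tgrp_ge G hb d0) (lin0 (inp_lin G)) (lin0 (mul_linr G _)).
  exact: subs0 (J_subspace n).
have [s [_ _ ->]] := gpr_fin (Gm G) a; rewrite (linsum (tmu_bil.1 b)).
apply: (subssum (J_subspace n)) => d' _; rewrite -tmu_pure.
apply: (@J_tmu _ ((d'.1 + d.1, d'.2 + d.2), `|d.1|%N)); first by rewrite /= gez0_abs.
apply/hcompE; apply: spanS_sub; exists d', d, (gpr (Gm G) d' a), b.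
by split=> //; exact: gpr_in.
Qed.

Lemma J_mulp n d z b : tgrp d b -> n <= d.1 -> J n (z ** tinp b).
Proof.
move=> hb nd; rewrite -(tmuK G z).
apply: (tens_ind (Q := [set w | J n (tmu w ** tinp b)])).
  exact: (subspace_pre (lin_comp (mul_linl G _) tmu_lin) (J_subspace n)).
move=> a b0; rewrite /= tmu_pure.
have [s [_ _ ->]] := gpr_fin (Gp G) b0.
rewrite (linsum (tmu_bil.2 a)) (linsum (mul_linl G _)).
apply: (subssum (J_subspace n)) => d' _; rewrite -(mul_assoc G).
have hb0 := gpr_in (Gp G) d' b0.
have [d0|d0] := boolP (0 <= d'.1); last first.
  rewrite (tgrp_ge G hb0 d0) (lin0 (inp_lin G)) (lin0 (mul_linl G _)).
  by rewrite (lin0 (mul_linr G _)); exact: subs0 (J_subspace n).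
have [b'' hb'' ->] := inp_mul G hb0 hb.
by apply: (J_pure a hb''); rewrite /= (le_trans nd) // lerDr.
Qed.

Definition Jgen n : set (tg F) := [set y | exists z d b,
  [/\ tgrp d b, n <= d.1 & y = z ** tinp b]].

Lemma J_span n y : 0 <= n -> J n y -> spanS (Jgen n) y.
Proof.
move=> n0 Jy; have [s [_ _ ->]] := hin_sum y.
apply: (subssum (spanS_subspace _)) => c _.
have [cn|nc] := ltP c.2%:Z n.
  by rewrite Jy // (lin0 tmu_lin); exact: subs0 (spanS_subspace _).
apply: (spanS_ind (Q := [set w | spanS (Jgen n) (tmu w)]) _ _ (hin_comp y c)).
  exact: (subspace_pre tmu_lin (spanS_subspace _)).
move=> w [al [be [a [b [_ _ hb ->]]]]] /=; rewrite tmu_pure.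
by apply: spanS_sub; exists (tinm a), (c.2%:Z, be), b.
Qed.

Lemma J_ideal n z y : J n y -> J n (z ** y).
Proof.
have [n0|/ltW n0] := lerP 0 n; last by move=> _; exact: J_le0.
move=> /(J_span n0); apply: (spanS_ind (Q := [set y | J n (z ** y)])).
  exact: (subspace_pre (mul_linr G z) (J_subspace n)).
move=> {}y [a [d [b [hb nd ->]]]] /=; rewrite (mul_assoc G).
exact: J_mulp hb nd.
Qed.

Lemma hcomp_tgr c w : hcomp c w -> tgr G c.1 (tmu w).
Proof.
have sub : subspace (tgr G c.1).
  split; first by rewrite -(lin0 (gpr_lin (Gg G) c.1)); exact: gpr_in.
  move=> k x y hx hy; have := gpr_in (Gg G) c.1 (k *: x + y).
  by rewrite gpr_lin !(gpr_id _ _ hx) !(gpr_id _ _ hy) eqxx.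
apply: (spanS_ind (Q := [set w | tgr G c.1 (tmu w)])).
  exact: (subspace_pre tmu_lin sub).
move=> {}w [al [be [a [b [E ha hb ->]]]]] /=; rewrite tmu_pure.
have := mul_gr (inm_gr G ha) (inp_gr G hb).
have -> : (c.1.1 - c.2%:Z, al) + (c.2%:Z, be) = c.1 :> bideg; last by [].
by rewrite bidegD /= subrK E -surjective_pairing.
Qed.

Lemma tgr_subspace d : subspace (tgr G d).
Proof.
split; first by rewrite -(lin0 (gpr_lin (Gg G) d)); exact: gpr_in.
move=> k x y hx hy; have := gpr_in (Gg G) d (k *: x + y).
by rewrite gpr_lin !(gpr_id _ _ hx) !(gpr_id _ _ hy) eqxx.
Qed.

Lemma hin_hom d y c : tgr G d y -> c.1 != d -> hin y c = 0.
Proof.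
move=> hy cd; have [s [us Hs yE]] := hin_sum y.
have yE' : y = \sum_(c <- s) if c.1 == d then tmu (hin y c) else 0.
  have gy := gpr_id (Gg G) d hy; rewrite eqxx in gy; rewrite -[LHS]gy {1}yE.
  rewrite (linsum (gpr_lin (Gg G) d)).
  apply: eq_bigr => c' _; rewrite (gpr_id _ _ (hcomp_tgr (hin_comp y c'))).
  by rewrite eq_sym.
rewrite {1}yE' (linsum (hin_lin c)) big1 // => c' _.
case: eqP => [E|_]; last exact: (lin0 (hin_lin c)).
rewrite (hin_tmu _ (hin_comp y c')); case: eqP => // E'.
by rewrite E' E eqxx in cd.
Qed.

Lemma hcomp_neg c w : c.2%:Z < c.1.1 -> hcomp c w -> w = 0.
Proof.
move=> H; apply: (spanS_ind (subspace_0 _)) => {}w [al [be [a [b [_ ha _ ->]]]]] /=.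
by rewrite (tgrm_le G ha) ?tpure0l //= -ltNge subr_gt0.
Qed.

(** F(g_-) lives in nonpositive Z-degrees, so the factor in F(g_+) must carry at least the total
    Z-degree. *)
Lemma J_hom d y : tgr G d y -> J d.1 y.
Proof.
move=> hy c cd; have [E|E] := eqVneq c.1 d; last exact: hin_hom E.
by apply: (hcomp_neg _ (hin_comp y c)); rewrite E.
Qed.

(** The factor of F(g_+) at the right end of [y], multiplied by [v], is homogeneous of Z-degree at
    least [n + d.1], and [J_hom] applies. This shift is why null sequences are multiplied on the
    right only by sequences of a fixed degree ([null_mulr]). *)
Lemma J_mulr n d y v : J n y -> tgr G d v -> J (n + d.1) (y ** v).
Proof.
have [n0|n0] := lerP 0 n; last first.
  move=> _ hv; apply: (@J_mono _ d.1); last by apply: J_ideal; exact: J_hom.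
  by rewrite gerDr ltW.
move=> /(J_span n0) H hv; move: y H.
apply: (spanS_ind (Q := [set y | J (n + d.1) (y ** v)])).
  exact: (subspace_pre (mul_linl G v) (J_subspace _)).
move=> y [a [d' [b [hb nd ->]]]] /=; rewrite -(mul_assoc G); apply: J_ideal.
apply: (@J_mono _ (d' + d).1); first by rewrite lerD2r.
by apply: J_hom; apply: mul_gr => //; exact: inp_gr.
Qed.

Implicit Types (z y : nat -> tg F) (u : hfam F).

Definition null z := forall n : int, exists N0, forall N, (N0 <= N)%N -> J n (z N).

Lemma nullD z y : null z -> null y -> null (fun N => z N + y N).
Proof.
move=> nz ny n; have [N0 H0] := nz n; have [N1 H1] := ny n.
exists (maxn N0 N1) => N; rewrite geq_max => /andP[/H0 Jz /H1 Jy].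
exact: (subsD (J_subspace n)).
Qed.
Lemma nullZ k z : null z -> null (fun N => k *: z N).
Proof.
move=> nz n; have [N0 H0] := nz n; exists N0 => N /H0 Jz.
exact: (subsZ (J_subspace n)).
Qed.
Lemma nullN z : null z -> null (fun N => - z N).
Proof.
move=> nz n; have [N0 H0] := nz n; exists N0 => N /H0 Jz.
exact: (subsN (J_subspace n)).
Qed.
Lemma nullB z y : null z -> null y -> null (fun N => z N - y N).
Proof. by move=> nz ny; apply: nullD => //; exact: nullN. Qed.
Lemma null_mull z y : null y -> null (fun N => z N ** y N).
Proof.
move=> ny n; have [N0 H0] := ny n; exists N0 => N /H0 Jy; exact: J_ideal.
Qed.
Lemma null_mulr d z y : null z -> (forall N, tgr G d (y N)) -> null (fun N => z N ** y N).
Proof.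
move=> nz hy n; have [N0 H0] := nz (n - d.1); exists N0 => N /H0 Jz.
by rewrite -[n](subrK d.1); exact: J_mulr Jz (hy N).
Qed.
Lemma null_eq0 z N0 : (forall N, (N0 <= N)%N -> z N = 0) -> null z.
Proof. by move=> H n; exists N0 => N /H ->; exact: subs0 (J_subspace n). Qed.
Lemma null_ext z y N0 : (forall N, (N0 <= N)%N -> z N = y N) -> null y -> null z.
Proof.
move=> E ny n; have [N1 H1] := ny n; exists (maxn N0 N1) => N.
by rewrite geq_max => /andP[/E -> /H1].
Qed.

Definition approx z u := forall n : int, exists N0, forall N, (N0 <= N)%N ->
  forall c, c.2%:Z < n -> hin (z N) c = u c.

(** The component of index [c] is blind to [J n] once [n] exceeds [c.2], hence the choice of
    [c.2 + 1]. *)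
Lemma approx_eq z y u u' : approx z u -> approx y u' ->
  null (fun N => z N - y N) -> u = u'.
Proof.
move=> az ay n0; apply/funext => c.
have [N0 H0] := az (c.2%:Z + 1); have [N1 H1] := ay (c.2%:Z + 1).
have [N2 H2] := n0 (c.2%:Z + 1); pose N := maxn N0 (maxn N1 N2).
have lt : c.2%:Z < c.2%:Z + 1 by rewrite ltrDl.
rewrite -(H0 N) ?leq_maxl // -(H1 N) //; last by rewrite /N; lia.
have /H2 := leq_trans (leq_maxr N1 N2) (leq_maxr N0 (maxn N1 N2)).
move=> /(_ c lt) /eqP; rewrite (linB (hin_lin c)) subr_eq0 => /eqP.
by [].
Qed.

Lemma approx_null z y u : approx z u -> approx y u -> null (fun N => z N - y N).
Proof.
move=> az ay n; have [N0 H0] := az n; have [N1 H1] := ay n.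
exists (maxn N0 N1) => N; rewrite geq_max => /andP[N0N N1N] c cn.
by rewrite (linB (hin_lin c)) H0 // H1 // subrr.
Qed.

Lemma approx_ext z y u : approx z u -> null (fun N => z N - y N) -> approx y u.
Proof.
move=> az nz n; have [N0 H0] := az n; have [N1 H1] := nz n.
exists (maxn N0 N1) => N; rewrite geq_max => /andP[N0N N1N] c cn.
have /eqP := H1 N N1N c cn; rewrite (linB (hin_lin c)) subr_eq0 => /eqP <-.
exact: H0.
Qed.

Lemma approxD z y u u' : approx z u -> approx y u' -> approx (fun N => z N + y N) (u + u').
Proof.
move=> az ay n; have [N0 H0] := az n; have [N1 H1] := ay n.
exists (maxn N0 N1) => N; rewrite geq_max => /andP[N0N N1N] c cn.
by rewrite (linD (hin_lin c)) H0 // H1.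
Qed.
Lemma approxZ k z u : approx z u -> approx (fun N => k *: z N) (k *: u).
Proof.
move=> az n; have [N0 H0] := az n; exists N0 => N NN c cn.
by rewrite (linZ (hin_lin c)) H0.
Qed.
Lemma approx_hin x : approx (fun=> x) (hin x).
Proof. by move=> n; exists 0%N. Qed.

Definition hom_fam (d : bideg) (u : hfam F) :=
  (forall c, hcomp c (u c)) /\ forall c, c.1 != d -> u c = 0.

Definition trunc (d : bideg) (u : hfam F) (N : nat) : tg F :=
  \sum_(r <- seq.iota 0 N) tmu (u (d, r)).

Lemma trunc_gr d u N : hom_fam d u -> tgr G d (trunc d u N).
Proof.
by move=> [hu _]; apply: (subssum (tgr_subspace d)) => r _; exact: hcomp_tgr (hu (d, r)).
Qed.

Lemma approx_trunc d u : hom_fam d u -> approx (trunc d u) u.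
Proof.
move=> [hu du] n; exists `|n|%N => N nN c cn.
rewrite /trunc (linsum (hin_lin c)).
under eq_bigr => r _ do rewrite (hin_tmu c (hu (d, r))).
have [E|E] := eqVneq c.1 d; last first.
  rewrite du // big1 // => r _; case: eqP => // H.
  by rewrite H eqxx in E.
have cN : c.2 \in seq.iota 0 N by rewrite seq.mem_iota; lia.
rewrite (bigD1_seq c.2) ?seq.iota_uniq //= -E -surjective_pairing eqxx big1 ?addr0 // => r rc.
by case: eqP => // H; rewrite H eqxx in rc.
Qed.

Lemma hom_fam_J d u r : hom_fam d u -> J r%:Z (tmu (u (d, r))).
Proof. by move=> [hu _]; exact: (J_tmu _ (hu (d, r))). Qed.

(** A product of components (0, r1) and (0, r2) lies in [J r2] by the left ideal property and in
    [J r1] because the right factor has degree 0. Hence only finitely many pairs contribute to a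
    given component. *)
Lemma approx_hmul u v : hom_fam 0 u -> hom_fam 0 v ->
  approx (fun N => trunc 0 u N ** trunc 0 v N) (hmul F u v).
Proof.
move=> hu hv n; exists `|n|%N => N nN c cn; rewrite /hmul.
pose s := [seq (((0, r1), (0, r2)) : hidx Gam * hidx Gam) | r1 <- seq.iota 0 N, r2 <- seq.iota 0 N].
have us : uniq s.
  by apply: allpairs_uniq; rewrite ?seq.iota_uniq // => -[x1 x2] [y1 y2] _ _ /= [-> ->].
rewrite (fsbig_supp_seq us); last first.
  move=> [[d1 r1] [d2 r2]] ns /=.
  have [E1|E1] := eqVneq d1 0; last first.
    by rewrite hu.2 // (lin0 tmu_lin) (lin0 (mul_linl G _)) (lin0 (hin_lin c)).
  have [E2|E2] := eqVneq d2 0; last first.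
    by rewrite hv.2 // (lin0 tmu_lin) (lin0 (mul_linr G _)) (lin0 (hin_lin c)).
  move: ns; rewrite E1 E2 => ns.
  have [r2N|r2N] := ltnP r2 N; last first.
    by apply: (J_hin (J_ideal (n := r2%:Z) _ (hom_fam_J hv))); lia.
  have [r1N|r1N] := ltnP r1 N; last first.
    have := J_mulr (hom_fam_J (r := r1) hu) (hcomp_tgr (hv.1 (0, r2))).
    by rewrite /= addr0 => /J_hin; apply; lia.
  case/negP: ns; apply/allpairsP; exists (r1, r2).
  by rewrite !seq.mem_iota.
rewrite /trunc (linsum (mul_linl G _)) (linsum (hin_lin c)) big_allpairs_dep /=.
apply: eq_bigr => r1 _.
by rewrite (linsum (mul_linr G _)) (linsum (hin_lin c)).
Qed.

Lemma approx_hsum (A : choiceType) (f : A -> tg F) (b : nat -> seq A) :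
  (forall N, uniq (b N)) ->
  (forall n, exists N0, forall N a, (N0 <= N)%N -> a \notin b N -> J n (f a)) ->
  approx (fun N => \sum_(a <- b N) f a) (hsum F f).
Proof.
move=> ub H n; have [N0 HN] := H n; exists N0 => N NN c cn.
rewrite /hsum (fsbig_supp_seq (ub N)); first by rewrite (linsum (hin_lin c)).
by move=> a /(HN _ _ NN) /J_hin; apply.
Qed.

Lemma approx_hext d u (f : tg F -> tg F) (j : int) : hom_fam d u -> linear f ->
  (forall n x, J n x -> J (n - j) (f x)) -> approx (fun N => f (trunc d u N)) (hext F f u).
Proof.
move=> hu fl fJ n; exists (`|n|%N + `|j|%N)%N => N nN c cn; rewrite /hext.
pose s := [seq ((d, r) : hidx Gam) | r <- seq.iota 0 N].
have us : uniq s by rewrite map_inj_uniq ?seq.iota_uniq // => x y [].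
rewrite (fsbig_supp_seq us) ?big_map.
  by rewrite /trunc (linsum fl) (linsum (hin_lin c)).
move=> [d' r] ns.
have [E|E] := eqVneq d' d; last first.
  by rewrite hu.2 // (lin0 tmu_lin) (lin0 fl) (lin0 (hin_lin c)).
move: ns; rewrite E => ns; have [rN|rN] := ltnP r N.
  by case/negP: ns; apply/mapP; exists r => //; rewrite seq.mem_iota.
by apply: (J_hin (fJ _ _ (hom_fam_J (r := r) hu))); lia.
Qed.

End Completion.

(** * Triangular decompositions of the four algebras *)

Section TriangularFormsAlgebra.
Variables (K : fieldType) (Gam : zmodType) (eps : commutation_factor K Gam).
Variables (g : quadColorLie eps) (E : hbasis g).
Notation gM := (@gM _ _ _ g).
Notation gP := (@gP _ _ _ g).
Notation degM_add := (@degM_add Gam).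
Notation degP_add := (@degP_add Gam).
Notation degT_add := (@degT_add Gam).
Notation span_M := (span_M E).
Notation span_P := (span_P E).
Let HT : span_of E [set: g] [set: bideg Gam] := @span_ofT _ _ _ g E.
Variable k : algkind.

Lemma FA_gr_M d (u : FA k gM) : FA_gr d u -> ~~ (d.1 <= 0) -> u = 0.
Proof.
apply: (FA_gr_ind span_M (Q := fun d => [set u | ~~ (d.1 <= 0) -> u = 0])) => //.
- move=> c; split=> // a x y Hx Hy H.
  by rewrite Hx // Hy // scaler0 addr0.
- move=> c a v Da IH /=; rewrite /degM /= in Da; move=> H.
  by rewrite IH ?mulr0 //; apply: contra H => H; rewrite -[0]addr0 lerD.
Qed.

Lemma FA_gr_P d (u : FA k gP) : FA_gr d u -> ~~ (0 <= d.1) -> u = 0.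
Proof.
apply: (FA_gr_ind span_P (Q := fun d => [set u | ~~ (0 <= d.1) -> u = 0])) => //.
- move=> c; split=> // a x y Hx Hy H.
  by rewrite Hx // Hy // scaler0 addr0.
- move=> c a v Da IH /=; rewrite /degP /= in Da; move=> H.
  by rewrite IH ?mulr0 //; apply: contra H => H; rewrite addr_ge0 // ltW.
Qed.

(** Left transparent so that the fields compute; in particular [tgr] of this record is later
    identified with [FA_gr] by conversion. *)
Definition triF_good : tri_good (triF g k).
Proof.
apply: (@TriGood K Gam (triF g k) (@split K Gam eps g E k)).
- exact: split_lin.
- exact: split_tmuK.
- exact: tmu_splitK.
- exact: (FA_grading span_M k degM_add).
- exact: (FA_grading span_P k degP_add).
- exact: FA_gr_M.
- exact: FA_gr_P.
- exact: incM_lin.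
- exact: incP_lin.
- exact: FA_mulr_lin.
- exact: FA_mull_lin.
- exact: mulrA.
- exact: (FA_grading HT k degT_add).
- by move=> d a; exact: (FAincl_FA_gr span_M HT).
- by move=> d a; exact: (FAincl_FA_gr span_P HT).
- by move=> d d' u v; exact: FA_grM.
- move=> d d' b b' hb hb'; exists (b * b'); first exact: FA_grM.
  exact: esym (incPM E b b').
Defined.

End TriangularFormsAlgebra.

(** * Contractions and symmetrization *)

Section Contraction.
Variables (K : fieldType) (Gam : zmodType) (eps : commutation_factor K Gam).
Variables (g : quadColorLie eps) (E : hbasis g).
Notation I := (bidx E).
Notation e := (@bvec _ _ _ _ E).
Notation B := (@qfm _ _ _ g).
Notation deg := (@bdeg _ _ _ _ E).
Notation gr := (@qgr _ _ _ g).
Notation ep := (ep eps).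
Notation lext := (@lext _ _ _ g E _).
Notation gv := (@bvec_gr _ _ _ _ E).

Definition twist (d : bideg Gam) (y : g) : g := lext (fun c => ep d (deg c) *: e c) y.
Lemma twist_lin d : linear (twist d). Proof. exact: lext_linear. Qed.
Lemma twist_gr d d' y : gr d' y -> twist d y = ep d d' *: y.
Proof.
move=> gy; rewrite /twist (lext_eq (h := fun c => ep d d' *: e c)); last first.
  by move=> a Ba; rewrite ((grP E _ _).1 gy _ Ba).
by rewrite lext_fZ (lext_linE E (@lin_id K g)).
Qed.

Lemma gr_expand (Q : set g) : subspace Q -> (forall d x, gr d x -> Q x) -> forall x, Q x.
Proof. by move=> sQ H; apply: (basis_ind (E := E)) => // a; exact: H (gv a). Qed.

Variables (P : set g) (D : set (bideg Gam)) (HP : span_of E P D).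
Hypothesis DD : forall d d', D d -> D d' -> D (d + d').
Variable k : algkind.
Hypothesis kbr0 : forall x y : g, kbr k x y = 0.
Hypothesis kfm0 : forall x y : g, kfm k x y = 0.
Notation F := (FA k P).
Notation gn := (gen k P).
Notation s := (sg K k).
Notation TP := (tens g F).
Let sP : subspace P := span_of_subspace HP.

Lemma gen_swap d d' x y : gr d x -> gr d' y -> gn x * gn y = (s * ep d d') *: (gn y * gn x).
Proof.
move=> gx gy; have [Px|nPx] := pselect (P x); last first.
  by rewrite (gen_out k nPx) mul0r mulr0 scaler0.
have [Py|nPy] := pselect (P y); last first.
  by rewrite (gen_out k nPy) mul0r mulr0 scaler0.
rewrite (gen_comm HP Px Py _ gx gy) kbr0; last exact: subs0.
by rewrite kfm0 scale0r (gen0 HP) !addr0.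
Qed.

(** The universal derivation [pd] sends a word to the signed sum of (letter) (x) (remaining word).
    It is the second component of an action on pairs whose first component is ordinary
    multiplication, so it is well defined on the quotient algebra once the relations are checked. *)
Definition pdX : lmodType K := (F * TP)%type.
Definition pdT (a : I) : TP -> TP := tmap (twist (deg a)) (fun u : F => gn (e a) * u).
Definition pdr (a : I) (x : pdX) : pdX :=
  (gn (e a) * x.1, tpure (e a) x.1 + s *: pdT a x.2).

Lemma pdX_eq (x y : pdX) : x.1 = y.1 -> x.2 = y.2 -> x = y.
Proof. by case: x y => [? ?] [? ?] /= -> ->. Qed.
Lemma pdX_lin1 : linear (fun x : pdX => x.1). Proof. by []. Qed.
Lemma pdX_lin2 : linear (fun x : pdX => x.2). Proof. by []. Qed.
Lemma pdT_lin a : linear (pdT a).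
Proof. by apply: tmap_lin; [exact: twist_lin|exact: FA_mull_lin]. Qed.
Lemma pdT_pure a y u : pdT a (tpure y u) = tpure (twist (deg a) y) (gn (e a) * u).
Proof. by apply: tmap_pure; [exact: twist_lin|exact: FA_mull_lin]. Qed.

Lemma pdrE1 a x : (pdr a x).1 = gn (e a) * x.1. Proof. by []. Qed.
Lemma pdrE2 a x : (pdr a x).2 = tpure (e a) x.1 + s *: pdT a x.2. Proof. by []. Qed.

Lemma pdr_lin a : linear (pdr a).
Proof.
move=> c x y; apply: pdX_eq.
  by rewrite pdX_lin1 !pdrE1 pdX_lin1; exact: FA_mull_lin.
by rewrite pdX_lin2 !pdrE2 pdX_lin2 pdX_lin1 pdT_lin tpure_linr; module.
Qed.

Lemma pdT_comm a b t : pdT a (pdT b t) = (s * ep (deg a) (deg b)) *: pdT b (pdT a t).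
Proof.
apply: (tens_eq (f := pdT a \o pdT b)
    (h := fun t => (s * ep (deg a) (deg b)) *: pdT b (pdT a t))).
- exact: (lin_comp (pdT_lin a) (pdT_lin b)).
- by apply: linear_funZ; exact: (lin_comp (pdT_lin b) (pdT_lin a)).
move=> y u /=; rewrite !pdT_pure !mulrA (gen_swap (gv a) (gv b)) -palg_scalerAl tpureZr.
congr (_ *: tpure _ _); move: y; apply: gr_expand.
  by apply: subspace_eq; apply: lin_comp; exact: twist_lin.
move=> d x gx /=; rewrite !(twist_gr _ gx) !(linZ (twist_lin _)) !(twist_gr _ gx).
by rewrite !scalerA mulrC.
Qed.

Lemma pdr_rel a b x : D (deg a) -> D (deg b) ->
  pdr a (pdr b x) = (s * ep (deg a) (deg b)) *: pdr b (pdr a x)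
    + lext (pdr^~ x) (kbr k (e a) (e b)) + kfm k (e a) (e b) *: x.
Proof.
move=> _ _; rewrite kbr0 kfm0 (lin0 (lext_linear _)) scale0r !addr0.
apply: pdX_eq.
  by rewrite (linZ pdX_lin1) !pdrE1 !mulrA (gen_swap (gv a) (gv b)) -palg_scalerAl.
rewrite (linZ pdX_lin2) !pdrE2 !pdrE1 !(linD (pdT_lin _)) !(linZ (pdT_lin _)).
rewrite !pdT_pure (twist_gr _ (gv a)) (twist_gr _ (gv b)) !tpureZl pdT_comm.
set X := tpure (e a) _; set Y := tpure (e b) _; set Z := pdT b _.
have H : ep (deg a) (deg b) * ep (deg b) (deg a) - 1 = 0 by rewrite epV subrr.
have S : s * s - 1 = 0 by rewrite sg_sqr subrr.
apply: (cert0 (Z := - (((s * s - 1) * (ep (deg a) (deg b) * ep (deg b) (deg a))) *: X) -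
   (ep (deg a) (deg b) * ep (deg b) (deg a) - 1) *: X)).
  by module.
by rewrite H S mul0r !scale0r !oppr0 addr0.
Qed.

Definition pd (u : F) : TP := (act pdr u (1 : F, 0 : TP)).2.

Lemma pd_lin : linear pd.
Proof. exact: (lin_comp pdX_lin2 (act_linl HP pdr_lin pdr_rel _)). Qed.
Lemma pd1 : pd 1 = 0. Proof. by rewrite /pd (act1 HP pdr_lin pdr_rel). Qed.
Lemma pd_fst u : (act pdr u (1 : F, 0 : TP)).1 = u.
Proof.
apply: (FA_ind HP (Q := [set u | (act pdr u (1 : F, 0 : TP)).1 = u])).
- apply: subspace_eq; last exact: lin_id.
  exact: (lin_comp pdX_lin1 (act_linl HP pdr_lin pdr_rel _)).
- by rewrite /= (act1 HP pdr_lin pdr_rel).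
- move=> a v Da /= H; rewrite (actM HP pdr_lin pdr_rel).
  by rewrite (act_basis HP pdr_lin pdr_rel) // pdrE1 H.
Qed.
Lemma pd_gen a u : D (deg a) -> pd (gn (e a) * u) = tpure (e a) u + s *: pdT a (pd u).
Proof.
move=> Da; rewrite /pd (actM HP pdr_lin pdr_rel).
by rewrite (act_basis HP pdr_lin pdr_rel) // pdrE2 pd_fst.
Qed.

Lemma pd_gen_hom d x u : gr d x -> P x ->
  pd (gn x * u) = tpure x u + s *: tmap (twist d) (fun w : F => gn x * w) (pd u).
Proof.
move=> gx Px; rewrite (gen_lext HP k Px) (lext_comp _ _ (FA_mulr_lin u)).
rewrite (lext_comp _ _ pd_lin).
transitivity (lext (fun a => tpure (e a) u + s *: tmap (twist d) (fun w : F => gn (e a) * w) (pd u)) x).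
  apply: lext_eq => a Ba /=; rewrite pd_gen; last exact: ((HP _).1 Px).
  by rewrite /pdT ((grP E _ _).1 gx _ Ba).
rewrite lext_fD lext_fZ; congr (_ + s *: _).
  exact: (lext_linE E (tpure_linl u)).
move: (pd u) => t.
apply: (tens_eq (f := fun t => lext (fun a => tmap (twist d) (fun w : F => gn (e a) * w) t) x)
  (h := fun t => tmap (twist d) (fun w : F => lext (fun a => gn (e a)) x * w) t)).
- move=> c u1 u2; rewrite -lext_fZ -lext_fD; apply: lext_eq => a _.
  by apply: tmap_lin; [exact: twist_lin|exact: FA_mull_lin].
- by apply: tmap_lin; [exact: twist_lin|exact: FA_mull_lin].
- move=> y w; rewrite tmap_pure; [|exact: twist_lin|exact: FA_mull_lin].
  rewrite (lext_comp _ _ (FA_mulr_lin w)) (lext_comp _ _ (tpure_linr (twist d y))).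
  apply: lext_eq => a _; rewrite tmap_pure //; [exact: twist_lin|exact: FA_mull_lin].
Qed.

(** Contraction pairs the letter split off by [pd] with [x]. Keeping [pd] separate is useful because
    it also drives the recursion for symmetrization. *)
Definition contr (x : g) (u : F) : F := tlift (fun y w => B x y *: w) (pd u).

Lemma contr_bil x : (forall w : F, linear (fun y => B x y *: w)) /\
  (forall y, linear (fun w : F => B x y *: w)).
Proof.
split=> [w|y]; last by move=> c u v; module.
exact: (linear_scal _ (qfm_linr x)).
Qed.
Lemma contrT_lin x : linear (tlift (fun y (w : F) => B x y *: w)).
Proof. by have [? ?] := contr_bil x; exact: tlift_lin. Qed.
Lemma contrT_pure x y w : tlift (fun y (w : F) => B x y *: w) (tpure y w) = B x y *: w.
Proof. by have [H1 H2] := contr_bil x; exact: (tlift_pure H1 H2). Qed.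
Lemma contr_linr x : linear (contr x).
Proof. exact: (lin_comp (contrT_lin x) pd_lin). Qed.
Lemma contr_linl u : linear (contr^~ u).
Proof.
move=> c x x'; rewrite /contr.
apply: (tens_eq (f := tlift (fun y (w : F) => B (c *: x + x') y *: w))
  (h := fun t => c *: tlift (fun y (w : F) => B x y *: w) t
     + tlift (fun y (w : F) => B x' y *: w) t)).
- exact: contrT_lin.
- by apply: linear_funD; [apply: linear_funZ|]; exact: contrT_lin.
- by move=> y w; rewrite !contrT_pure formDl formZl; module.
Qed.
Lemma contr1 x : contr x 1 = 0.
Proof. by rewrite /contr pd1 (lin0 (contrT_lin x)). Qed.

Lemma contr_gen d d' x y u : gr d x -> gr d' y -> P y ->
  contr x (gn y * u) = B x y *: u + (s * ep d d') *: (gn y * contr x u).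
Proof.
move=> gx gy Py; rewrite /contr (pd_gen_hom _ gy Py) (linD (contrT_lin x)).
rewrite (linZ (contrT_lin x)) contrT_pure -scalerA; congr (_ + s *: _).
apply: (tens_eq (f := fun t => tlift (fun y (w : F) => B x y *: w)
   (tmap (twist d') (fun w : F => gn y * w) t))
  (h := fun t => ep d d' *: (gn y * tlift (fun y (w : F) => B x y *: w) t))).
- apply: (lin_comp (contrT_lin x)).
  by apply: tmap_lin; [exact: twist_lin|exact: FA_mull_lin].
- by apply: linear_funZ; exact: (lin_comp (FA_mull_lin _) (contrT_lin x)).
move=> z w; rewrite tmap_pure; [|exact: twist_lin|exact: FA_mull_lin].
rewrite !contrT_pure -palg_scalerAr scalerA; congr (_ *: _).
move: z; apply: (gr_expand (Q := [set z | B x (twist d' z) = ep d d' * B x z])).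
  apply: (@subspace_eq K K^o g (fun z => B x (twist d' z)) (fun z => ep d d' * B x z)).
    by move=> c z1 z2; rewrite (twist_lin d') qfm_linr.
  by move=> c z1 z2; rewrite qfm_linr /=; rewrite mulrDr mulrCA.
move=> c z gz /=; rewrite (twist_gr _ gz) formZr.
have [->|Bn] := eqVneq (B x z) 0; first by rewrite !mulr0.
have /eqP := form_grP gx gz Bn; rewrite addr_eq0 => /eqP ->.
by rewrite epNl.
Qed.

Lemma contr_grS n d d' x u : gr d x ->
  FAk_gr n d' u -> if n is m.+1 then FAk_gr m (d + d') (contr x u) else contr x u = 0.
Proof.
move=> gx Hu; suff [] : FAk_gr n d' u /\ (if n is m.+1 then FAk_gr m (d + d') (contr x u)
  else contr x u = 0) by [].
apply: (FAk_ind HP (Q := fun n d' => [set u | FAk_gr n d' u /\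
  if n is m.+1 then FAk_gr m (d + d') (contr x u) else contr x u = 0]) _ _ _ Hu);
  last first.
- move=> m d2 a v Da [Hv IH]; split; first exact: FAk_gr_cons (gv a) Hv.
  rewrite (contr_gen _ gx (gv a)); last exact/(span_of_vec HP).
  apply: (subsD (FAk_gr_subspace _ _ _ _)).
    have [->|Bn] := eqVneq (B x (e a)) 0.
      by rewrite scale0r; exact: subs0 (FAk_gr_subspace _ _ _ _).
    rewrite addrA (form_grP gx (gv a) Bn) add0r.
    exact: (subsZ (FAk_gr_subspace _ _ _ _)).
  apply: (subsZ (FAk_gr_subspace _ _ _ _)).
  case: m Hv IH => [|m] Hv IH.
    by rewrite IH mulr0; exact: subs0 (FAk_gr_subspace _ _ _ _).
  by rewrite addrCA; exact: FAk_gr_cons (gv a) IH.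
- by split; [exact: FAk_gr1|exact: contr1].
- move=> m d2; apply: subspaceI; first exact: FAk_gr_subspace.
  case: m => [|m]; last exact: (subspace_pre (contr_linr x) (FAk_gr_subspace _ _ _ _)).
  by apply: subspace_eq; [exact: contr_linr|exact: linear_fun0].
Qed.

Lemma contr_mul n d d' x (w v : F) : gr d x -> FAk_gr n d' w ->
  contr x (w * v) = contr x w * v + (s ^+ n * ep d d') *: (w * contr x v).
Proof.
move=> gx; apply: (FAk_ind HP (Q := fun n d' => [set w |
  contr x (w * v) = contr x w * v + (s ^+ n * ep d d') *: (w * contr x v)])).
- move=> m c; apply: subspace_eq; first exact: (lin_comp (contr_linr x) (FA_mulr_lin v)).
  apply: linear_funD; first exact: (lin_comp (FA_mulr_lin v) (contr_linr x)).
  by apply: linear_funZ; exact: FA_mulr_lin.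
- by rewrite /= !mul1r contr1 mul0r add0r ep0r scale1r.
- move=> m c a u Da /= IH; have Pa : P (e a) by apply/(span_of_vec HP).
  rewrite -mulrA !(contr_gen _ gx (gv a) Pa) IH.
  rewrite mulrDl mulrDr -!palg_scalerAl -!palg_scalerAr !mulrA epDr exprS.
  by module.
Qed.

Lemma contr_anti d d' x y u : gr d x -> gr d' y ->
  contr x (contr y u) = (s * ep d d') *: contr y (contr x u).
Proof.
move=> gx gy; apply: (FA_ind HP (Q := [set u |
  contr x (contr y u) = (s * ep d d') *: contr y (contr x u)])).
- apply: subspace_eq; first exact: (lin_comp (contr_linr x) (contr_linr y)).
  by apply: linear_funZ; exact: (lin_comp (contr_linr y) (contr_linr x)).
- by rewrite /= !contr1 !(lin0 (contr_linr _)) scaler0.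
move=> a v Da /= IH; have Pa : P (e a) by apply/(span_of_vec HP).
rewrite (contr_gen _ gy (gv a) Pa) (contr_gen _ gx (gv a) Pa).
rewrite !(linD (contr_linr _)) !(linZ (contr_linr _)).
rewrite !(contr_gen _ gy (gv a) Pa) !(contr_gen _ gx (gv a) Pa) IH.
rewrite -!palg_scalerAr.
have F1 : B y (e a) * (1 - s * s * ep d d' * ep d (deg a)) = 0.
  have [->|Bn] := eqVneq (B y (e a)) 0; first by rewrite mul0r.
  have /eqP := form_grP gy (gv a) Bn; rewrite addr_eq0 => /eqP ->.
  by rewrite sg_sqr mul1r epNr epV subrr mulr0.
have F2 : B x (e a) * (s * ep d' (deg a) - s * ep d d') = 0.
  have [->|Bn] := eqVneq (B x (e a)) 0; first by rewrite mul0r.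
  have /eqP := form_grP gx (gv a) Bn; rewrite addr_eq0 => /eqP ->.
  by rewrite epNl subrr mulr0.
apply: (cert0 (Z := (B y (e a) * (1 - s * s * ep d d' * ep d (deg a))) *: contr x v
  + (B x (e a) * (s * ep d' (deg a) - s * ep d d')) *: contr y v)).
  by module.
by rewrite F1 F2 !scale0r addr0.
Qed.

End Contraction.

Section Iota.
Variables (K : fieldType) (Gam : zmodType) (eps : commutation_factor K Gam).
Variables (g : quadColorLie eps) (E : hbasis g).
Notation I := (bidx E).
Notation e := (@bvec _ _ _ _ E).
Notation B := (@qfm _ _ _ g).
Notation deg := (@bdeg _ _ _ _ E).
Notation gr := (@qgr _ _ _ g).
Notation ep := (ep eps).
Notation gv := (@bvec_gr _ _ _ _ E).
Let HT : span_of E [set: g] [set: bideg Gam] := @span_ofT _ _ _ g E.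

Section Incl.
Variables (P : set g) (D : set (bideg Gam)) (HP : span_of E P D).
Variable k : algkind.
Hypothesis kbr0 : forall x y : g, kbr k x y = 0.
Hypothesis kfm0 : forall x y : g, kfm k x y = 0.
Let PT : forall d, D d -> [set: bideg Gam] d. Proof. by []. Qed.

Lemma contr_incl x (u : FA k P) :
  FAincl setT (contr E x u) = contr E x (FAincl setT u).
Proof.
move: x; apply: (gr_expand E).
  apply: subspace_eq.
    exact: (lin_comp (FAincl_lin HP HT PT (k := k)) (contr_linl E u)).
  exact: contr_linl.
move=> d x gx; apply: (FA_ind HP (Q := [set u |
  FAincl setT (contr E x u) = contr E x (FAincl setT u)])).
- apply: subspace_eq.
    exact: (lin_comp (FAincl_lin HP HT PT (k := k)) (contr_linr HP kbr0 kfm0 x)).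
  exact: (lin_comp (contr_linr HT kbr0 kfm0 x) (FAincl_lin HP HT PT (k := k))).
- rewrite /= (FAincl1 HP HT PT) (contr1 HP) // (contr1 HT) //.
  exact: (lin0 (FAincl_lin HP HT PT (k := k))).
move=> a v Da /= IH; have Pa : P (e a) by apply/(span_of_vec HP).
rewrite (contr_gen HP kbr0 kfm0 _ gx (gv a) Pa) (FAinclM HP HT PT) (FAincl_gen HP HT PT) //.
rewrite (contr_gen HT kbr0 kfm0 _ gx (gv a)) // -IH.
rewrite (linD (FAincl_lin HP HT PT (k := k))) !(linZ (FAincl_lin HP HT PT (k := k))).
by rewrite (FAinclM HP HT PT) (FAincl_gen HP HT PT).
Qed.
End Incl.

(** The defining properties determine the map: the Leibniz rule for the product of 1 with itself
    forces the value 0 at 1, and then words are treated letter by letter. *)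
Lemma iotaE : @iota _ _ _ g = @contr _ _ _ g E setT Ext.
Proof.
have kb (x y : g) : kbr Ext x y = 0 by []; have kf (x y : g) : kfm Ext x y = 0 by [].
rewrite /iota; apply: xget_unique.
  split.
  - by move=> w; exact: contr_linl.
  - by move=> x; exact: (contr_linr HT kb kf).
  - move=> x y; rewrite -[gen Ext setT y]mulr1.
    move: x; apply: (gr_expand E).
      apply: subspace_eq; first exact: contr_linl.
      exact: (linear_scal (V := FA Ext [set: g]) _ (qfm_linl y)).
    move=> d x gx /=; move: y; apply: (gr_expand E).
      apply: subspace_eq; last exact: (linear_scal (V := FA Ext [set: g]) _ (qfm_linr x)).
      apply: (lin_comp (contr_linr HT kb kf x)); apply: (lin_comp (FA_mulr_lin _)).
      by move=> c y1 y2; rewrite (gen_lin HT).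
    move=> d' y gy /=; rewrite (contr_gen HT kb kf _ gx gy) //.
    by rewrite (contr1 HT) // mulr0 scaler0 addr0.
  - move=> d n d' x w v gx gw; exact: (contr_mul HT kb kf v gx gw).
move=> f [fl fr fg fm]; apply/funext => x; apply/funext => w; move: x; apply: (gr_expand E).
  by apply: subspace_eq; [exact: fl|exact: contr_linl].
move=> d x gx /=.
have f1 : f x 1 = 0.
  have := fm d 0%N 0 x 1 1 gx (FAk_gr1 _ _).
  by rewrite !mulr1 ep0r expr0 mul1r scale1r mul1r -{1}[f x 1]addr0 => /addrI /esym.
apply: (FA_ind HT (Q := [set w | f x w = contr E x w])).
- by apply: subspace_eq; [exact: fr|exact: (contr_linr HT kb kf)].
- by rewrite /= f1 (contr1 HT).
- move=> a v _ /= IH; rewrite (fm _ _ _ _ _ _ gx (FAk_gr_gen setT Ext (gv a))) fg IH.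
  by rewrite (contr_gen HT kb kf _ gx (gv a)) // expr1 -palg_scalerAl mul1r.
Qed.
End Iota.

(** * Symmetrization as a recursion on the word length *)

Section SymmetrizationMap.
Variables (K : fieldType) (Gam : zmodType) (eps : commutation_factor K Gam).
Variables (g : quadColorLie eps) (E : hbasis g).
Hypothesis char0 : forall n, n.+1%:R != 0 :> K.
Notation I := (bidx E).
Notation e := (@bvec _ _ _ _ E).
Notation deg := (@bdeg _ _ _ _ E).
Notation gr := (@qgr _ _ _ g).
Notation ep := (ep eps).
Notation lext := (@lext _ _ _ g E _).

Variables (P : set g) (D : set (bideg Gam)) (HP : span_of E P D).
Variables k k' : algkind.
Hypothesis kbr0 : forall x y : g, kbr k x y = 0.
Hypothesis kfm0 : forall x y : g, kfm k x y = 0.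
Notation F := (FA k P).
Notation F' := (FA k' P).
Notation gn := (gen k P).
Notation s := (sg K k).
Notation pd := (@pd _ _ _ g E P k).

Definition word n (x : 'I_n -> g) : F := \prod_(i < n) gn (x i).
(** The factor produced by moving letter [i] to the front, past the letters before it. *)
Definition pcoef n (delta : 'I_n -> bideg Gam) (i : 'I_n) : K :=
  s ^+ i * \prod_(j < n | (j < i)%N) ep (delta j) (delta i).

Lemma pcoef0 n (delta : 'I_n.+1 -> bideg Gam) : pcoef delta ord0 = 1.
Proof. by rewrite /pcoef expr0 mul1r big_pred0. Qed.

Lemma lift_lift0 n (i : 'I_n.+1) (j : 'I_n) :
  lift (lift ord0 i) (lift ord0 j) = lift ord0 (lift i j).
Proof. by apply: val_inj; rewrite /= /bump /= !add1n ltnS addnS. Qed.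

Lemma lift_ord0 n (i : 'I_n.+1) : lift (lift ord0 i) ord0 = ord0.
Proof. by apply: val_inj. Qed.

Lemma pd_word n (x : 'I_n.+1 -> g) delta : homog P x delta ->
  pd (word x) = \sum_(i < n.+1) pcoef delta i *: tpure (x i) (word (fun j => x (lift i j))).
Proof.
elim: n x delta => [|n IH] x delta hx; rewrite /word big_ord_recl.
  rewrite (pd_gen_hom HP kbr0 kfm0 _ (hx _).2 (hx _).1) big_ord0 (pd1 HP) //.
  rewrite lin0; last by apply: tmap_lin; [exact: twist_lin|exact: FA_mull_lin].
  by rewrite scaler0 addr0 big_ord_recl big_ord0 addr0 pcoef0 scale1r /= big_ord0.
rewrite (pd_gen_hom HP kbr0 kfm0 _ (hx _).2 (hx _).1) [RHS]big_ord_recl.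
congr (_ + _).
  by rewrite pcoef0 scale1r.
rewrite -/(word (fun i => x (lift ord0 i))) (IH _ (fun i => delta (lift ord0 i))); last first.
  by move=> i; exact: hx.
have tl : linear (tmap (twist E (delta ord0)) (fun w : F => gn (x ord0) * w)).
  by apply: tmap_lin; [exact: twist_lin|exact: FA_mull_lin].
rewrite (linsumZ tl) scaler_sumr; apply: eq_bigr => i _.
rewrite tmap_pure; [|exact: twist_lin|exact: FA_mull_lin].
rewrite (twist_gr E _ (hx _).2) tpureZl !scalerA; congr (_ *: tpure _ _).
  rewrite /pcoef [in RHS]big_mkcond big_ord_recl /= -big_mkcond /=.
  by rewrite /bump add1n exprS /=; ring.
rewrite /word /= big_ord_recl lift_ord0; congr (_ * _).
by apply: eq_bigr => j _; rewrite lift_lift0.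
Qed.

(** The augmentation, or constant term: all generators act by zero on K. *)
Definition aug (u : F) : K := @act _ _ _ _ E P k K^o (fun _ _ => 0) u 1.
Let aug_hyp (a b : I) (v : K^o) : D (deg a) -> D (deg b) ->
  (0 : K^o) = (s * ep (deg a) (deg b)) *: (0 : K^o) +
   lext (fun _ => (0 : K^o)) (kbr k (e a) (e b)) + kfm k (e a) (e b) *: v.
Proof.
by move=> _ _; rewrite kbr0 kfm0 (lin0 (lext_linear _)) scale0r scaler0 !addr0.
Qed.
Let zero_lin (a : I) : linear (fun _ : K^o => (0 : K^o)). Proof. exact: linear_fun0. Qed.
Lemma aug_lin : scalar aug.
Proof. exact: (act_linl HP zero_lin aug_hyp). Qed.
Lemma aug1 : aug 1 = 1. Proof. exact: (act1 HP zero_lin aug_hyp). Qed.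
Lemma aug_gen x u : P x -> aug (gn x * u) = 0.
Proof.
move=> Px; rewrite /aug (actM HP zero_lin aug_hyp) (act_gen HP zero_lin aug_hyp) //.
exact: (lext_linE E (@linear_fun0 K K^o g) x).
Qed.

Definition gnl (y : g) : F' := lext (fun a => gen k' P (e a)) y.
Lemma gnl_lin : linear gnl. Proof. exact: lext_linear. Qed.
Lemma gnlE y : P y -> gnl y = gen k' P y.
Proof. by move=> Py; rewrite (gen_lext HP k' Py). Qed.

Definition ml : tens g F' -> F' := tlift (fun y w => gnl y * w).
Lemma ml_bil : (forall w : F', linear (fun y => gnl y * w)) /\
  (forall y, linear (fun w : F' => gnl y * w)).
Proof.
split=> [w|y]; first exact: (lin_comp (FA_mulr_lin w) gnl_lin).
exact: FA_mull_lin.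
Qed.
Lemma ml_lin : linear ml. Proof. by have [? ?] := ml_bil; exact: tlift_lin. Qed.
Lemma ml_pure y w : ml (tpure y w) = gnl y * w.
Proof. by have [H1 H2] := ml_bil; exact: (tlift_pure H1 H2). Qed.

(* The symmetrization of a word of length n is the mean over its letters y of *)
(* y times the symmetrization of the remaining word, up to sign.              *)
Fixpoint symm (n : nat) (u : F) : F' :=
  if n is m.+1 then n%:R^-1 *: ml (tmap id (symm m) (pd u)) else aug u *: (1 : F').

Lemma symm_lin n : linear (symm n).
Proof.
elim: n => [|n IH] /=; first exact: (linear_scal _ aug_lin).
apply: linear_funZ; apply: (lin_comp ml_lin).
apply: (lin_comp (tmap_lin (@lin_id K g) IH)); exact: (pd_lin HP kbr0 kfm0).
Qed.

(** In [s ^+ t] the permutation is read as its parity, so this is the signature for [Ext] and 1 for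
    [Sym]. *)
Definition symm_word n (x : 'I_n -> g) (delta : 'I_n -> bideg Gam) : F' :=
  n`!%:R^-1 *: \sum_(t : 'S_n) (s ^+ t * pfac eps delta t) *: \prod_(i < n) gen k' P (x (t i)).

Lemma lift_perm_inj n (i : 'I_n.+1) : injective (@lift_perm n ord0 i).
Proof.
move=> t t' H; apply/perm.permP => j.
have := lift_perm_lift ord0 i t j; rewrite H lift_perm_lift.
by move/lift_inj.
Qed.

Lemma sum_lift_perm (V : nmodType) n (f : 'S_n.+1 -> V) :
  \sum_t f t = \sum_(i < n.+1) \sum_(t : 'S_n) f (lift_perm ord0 i t).
Proof.
rewrite pair_bigA /= (reindex (fun p : 'I_n.+1 * 'S_n => lift_perm ord0 p.1 p.2)) //=.
apply: onW_bij; apply: inj_card_bij.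
  move=> [i t] [j t'] /= H.
  have ij : i = j by have := lift_perm_id ord0 i t; rewrite H lift_perm_id.
  by move: H; rewrite ij => /lift_perm_inj ->.
by rewrite card_prod card_ord !card_Sn factS.
Qed.

(** Placing letter [i] first creates its inversions with the letters before it; the other inversions
    are those of [t] on the remaining letters. *)
Lemma pfac_lift n (delta : 'I_n.+1 -> bideg Gam) i (t : 'S_n) :
  pfac eps delta (lift_perm ord0 i t) =
  \prod_(j < n.+1 | (j < i)%N) ep (delta j) (delta i) *
  pfac eps (fun j => delta (lift i j)) t.
Proof.
set u := lift_perm ord0 i t.
have ui : (u^-1)%g i = ord0 by rewrite -(lift_perm_id ord0 i t) -/u permK.
have ul j : (u^-1)%g (lift i j) = lift ord0 ((t^-1)%g j).
  by rewrite -{1}[j](permKV t) -(lift_perm_lift ord0 i t) -/u permK.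
rewrite /pfac (bigD1_ord i) //= big_pred0 ?mul1r; last first.
  by move=> j; rewrite ui ltn0 andbF.
have step j : \prod_(l < n.+1 | (lift i j < l)%N && ((u^-1)%g l < (u^-1)%g (lift i j))%N)
      ep (delta (lift i j)) (delta l) =
    (if (lift i j < i)%N then ep (delta (lift i j)) (delta i) else 1) *
    \prod_(l < n | (j < l)%N && ((t^-1)%g l < (t^-1)%g j)%N)
       ep (delta (lift i j)) (delta (lift i l)).
  rewrite big_mkcond (bigD1_ord i) //= ui ul; congr (_ * _).
    by rewrite /= /bump /= andbT.
  rewrite -big_mkcond; apply: eq_bigl => l.
  by rewrite ?ul /= !ltnNge !leq_bump2 ?negbK.
under eq_bigr => j _ do rewrite step.
rewrite big_split /=; congr (_ * _).
rewrite [RHS]big_mkcond (bigD1_ord i) //= ltnn mul1r.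
by [].
Qed.

Lemma symm_wordS n (x : 'I_n.+1 -> g) delta :
  n.+1%:R^-1 *: (\sum_(i < n.+1) pcoef delta i *:
    (gen k' P (x i) * symm_word (fun j => x (lift i j)) (fun j => delta (lift i j)))) =
  symm_word x delta.
Proof.
have C : n.+1`!%:R^-1 = n.+1%:R^-1 * n`!%:R^-1 :> K by rewrite factS natrM invfM.
rewrite /symm_word sum_lift_perm C -scalerA; congr (_ *: _).
rewrite scaler_sumr; apply: eq_bigr => i _.
rewrite -palg_scalerAr scalerA mulrC -scalerA; congr (_ *: _).
rewrite mulr_sumr scaler_sumr; apply: eq_bigr => t _.
rewrite -palg_scalerAr scalerA; congr (_ *: _); last first.
  rewrite [RHS]big_ord_recl lift_perm_id; congr (_ * _).
  by apply: eq_bigr => j _; rewrite lift_perm_lift.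
rewrite pfac_lift /pcoef odd_lift_perm /=.
have sgn_xor (b1 b2 : bool) : s ^+ (b1 (+) b2) = s ^+ b1 * s ^+ b2.
  by case: b1 b2 => [] []; rewrite /= ?expr0 ?expr1 ?mulr1 ?mul1r ?sg_sqr.
have sgn_odd m : s ^+ odd m = s ^+ m.
  elim: m => // m IH; rewrite exprS -IH /=; case: (odd m) => /=.
    by rewrite expr1 sg_sqr.
  by rewrite mulr1.
rewrite sgn_xor sgn_odd; move: (pfac _ _ _) (\prod_(_ < _ | _) _) (s ^+ i) (s ^+ t).
by move=> u1 u2 u3 u4; ring.
Qed.

Lemma symm_wordE m n (x : 'I_n -> g) delta : homog P x delta ->
  symm m (word x) = if m == n then symm_word x delta else 0.
Proof.
elim: m n x delta => [|m IH] [|n] x delta hx.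
- rewrite /= /word big_ord0 aug1 scale1r /symm_word fact0 invr1 scale1r.
  rewrite (big_pred1 (1%g : 'S_0)); last first.
    by move=> t; apply/esym/eqP/perm.permP => -[].
  by rewrite odd_perm1 expr0 /pfac !big_ord0 mulr1 scale1r.
- by rewrite /= /word big_ord_recl aug_gen ?scale0r //; exact: (hx _).1.
- rewrite /= /word big_ord0 (pd1 HP) // lin0; last exact: (tmap_lin (@lin_id K g) (symm_lin m)).
  by rewrite (lin0 ml_lin) scaler0.
- rewrite [symm _ _]/(m.+1%:R^-1 *: ml (tmap id (symm m) (pd (word x)))) (pd_word hx).
  rewrite (linsumZ (tmap_lin (@lin_id K g) (symm_lin m))) (linsumZ ml_lin) eqSS.
  have hl i : homog P (fun j => x (lift i j)) (fun j => delta (lift i j)).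
    by move=> j; exact: hx.
  case: (eqVneq m n) IH => [->|/negbTE mn] IH; last first.
    rewrite big1 => [|i _]; first exact: scaler0.
    rewrite (tmap_pure (@lin_id K g) (symm_lin m)) (IH _ _ _ (hl i)) /= mn.
    by rewrite tpure0r (lin0 ml_lin) scaler0.
  rewrite -symm_wordS; congr (_ *: _); apply: eq_bigr => i _; congr (_ *: _).
  rewrite (tmap_pure (@lin_id K g) (symm_lin n)) ml_pure gnlE; last exact: (hx i).1.
  by rewrite (IH n _ _ (hl i)) eqxx.
Qed.

(** [symm m] kills words of length other than [m] ([symm_wordE]), so the sum is finite on each
    element and restricts to [symm n] on words of length [n]. *)
Definition symmT (u : F) : F' := \sum_(m \in [set: nat]) symm m u.

Lemma FAk_gr_word n d (Q : set F) : subspace Q ->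
  (forall x delta, homog P x delta -> \sum_(i < n) delta i = d -> Q (word x)) ->
  forall u, FAk_gr n d u -> Q u.
Proof.
move=> sQ H; apply: spanS_ind => // u [x [delta [hx hd ->]]].
exact: H hx hd.
Qed.

Lemma word_ind (Q : set F) : subspace Q ->
  (forall n (x : 'I_n -> g) delta, homog P x delta -> Q (word x)) -> forall u, Q u.
Proof.
move=> sQ H u; apply: (spanS_ind sQ _ (FA_gr_spanning HP u)) => {}u [d].
apply: spanS_ind => // {}u [n _]; apply: FAk_gr_word => // x delta hx _.
exact: H hx.
Qed.

Lemma symm_fin u : exists N, forall m, (N <= m)%N -> symm m u = 0.
Proof.
apply: (word_ind (Q := [set u | exists N, forall m, (N <= m)%N -> symm m u = 0])) u.
  split=> [|c x y [N1 H1] [N2 H2]].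
    by exists 0%N => m _; rewrite (lin0 (symm_lin m)).
  exists (maxn N1 N2) => m; rewrite geq_max => /andP[/H1 X /H2 Y].
  by rewrite symm_lin X Y scaler0 addr0.
move=> n x delta hx; exists n.+1 => m nm; rewrite (symm_wordE m hx).
by case: eqP => // mn; rewrite mn ltnn in nm.
Qed.

Lemma symmT_finE u N : (forall m, (N <= m)%N -> symm m u = 0) ->
  symmT u = \sum_(m <- seq.iota 0 N) symm m u.
Proof.
move=> H; apply: fsbig_supp_seq; first exact: seq.iota_uniq.
by move=> m; rewrite seq.mem_iota /= add0n -leqNgt => /H.
Qed.

Lemma symmT_lin : linear symmT.
Proof.
move=> c x y; have [N1 H1] := symm_fin x; have [N2 H2] := symm_fin y.
have X m : (maxn N1 N2 <= m)%N -> symm m x = 0 by rewrite geq_max => /andP[/H1].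
have Y m : (maxn N1 N2 <= m)%N -> symm m y = 0 by rewrite geq_max => /andP[_ /H2].
rewrite (symmT_finE X) (symmT_finE Y) (symmT_finE (N := maxn N1 N2)); last first.
  by move=> m Nm; rewrite symm_lin X // Y // scaler0 addr0.
rewrite scaler_sumr -big_split; apply: eq_bigr => m _ /=; exact: symm_lin.
Qed.

Lemma symmT_gr n d u : FAk_gr n d u -> symmT u = symm n u.
Proof.
apply: (@FAk_gr_word n d [set u | symmT u = symm n u]).
  by apply: subspace_eq; [exact: symmT_lin|exact: symm_lin].
move=> x delta hx _ /=; rewrite /symmT (fsbig_supp_seq (s := [:: n])) //.
  by rewrite big_seq1.
by move=> m; rewrite inE (symm_wordE m hx) => /negbTE ->.
Qed.

Lemma symmT_word n (x : 'I_n -> g) delta : homog P x delta ->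
  symmT (word x) = symm_word x delta.
Proof.
move=> hx; rewrite (@symmT_gr n (\sum_(i < n) delta i)).
  by rewrite (symm_wordE n hx) eqxx.
by apply: spanS_sub; exists x, delta.
Qed.

Lemma symmT_unique (f : F -> F') : linear f ->
  (forall n (x : 'I_n -> g) delta, homog P x delta -> f (word x) = symm_word x delta) ->
  f = symmT.
Proof.
move=> fl H; apply/funext => u; apply: (word_ind (Q := [set u | f u = symmT u])) u.
  by apply: subspace_eq => //; exact: symmT_lin.
by move=> n x delta hx /=; rewrite (H _ _ _ hx) (symmT_word hx).
Qed.

Lemma pd_span n d u : FAk_gr n.+1 d u ->
  spanS [set t | exists y w d1 d2, [/\ P y, gr d1 y, FAk_gr n d2 w, d1 + d2 = d
    & t = tpure y w]] (pd u).
Proof.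
have pl := pd_lin HP kbr0 kfm0.
apply: (@FAk_gr_word n.+1 d [set u | spanS _ (pd u)]).
  exact: (subspace_pre pl (spanS_subspace _)).
move=> x delta hx hd /=; rewrite (pd_word hx).
apply: (subssum (spanS_subspace _)) => i _; apply: (subsZ (spanS_subspace _)).
apply: spanS_sub; exists (x i), (word (fun j => x (lift i j))), (delta i),
  (\sum_(j < n) delta (lift i j)); split=> //; [exact: (hx i).1|exact: (hx i).2| |].
  apply: spanS_sub; exists (fun j => x (lift i j)), (fun j => delta (lift i j)).
  by split=> // j; exact: hx.
by rewrite -hd [RHS](bigD1_ord i).
Qed.

(** This recursion replaces sums over permutations: the commutation formula [symm_comm] and the
    Euler identity [Phi1_euler] are deduced from it. *)
Lemma symmT_rec n d u : FAk_gr n.+1 d u ->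
  n.+1%:R *: symmT u = ml (tmap id symmT (pd u)).
Proof.
move=> hu; rewrite (symmT_gr hu) [symm _ _]/(n.+1%:R^-1 *: ml (tmap id (symm n) (pd u))).
rewrite scalerA mulfV // scale1r; congr ml.
apply: (spanS_ind (Q := [set t | tmap id (symm n) t = tmap id symmT t]) _ _ (pd_span hu)).
  apply: subspace_eq; apply: tmap_lin; try exact: lin_id; first exact: symm_lin.
  exact: symmT_lin.
move=> t [y [w [d1 [d2 [_ _ hw _ ->]]]]] /=.
rewrite (tmap_pure (@lin_id K g) (symm_lin n)) (tmap_pure (@lin_id K g) symmT_lin).
by rewrite (symmT_gr hw).
Qed.

Lemma symmT1 : symmT 1 = 1.
Proof. by rewrite (symmT_gr (FAk_gr1 P k)) /= aug1 scale1r. Qed.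

End SymmetrizationMap.

Section SymmetrizationE.
Variables (K : fieldType) (Gam : zmodType) (eps : commutation_factor K Gam).
Variables (g : quadColorLie eps) (E : hbasis g).
Hypothesis char0 : forall n, n.+1%:R != 0 :> K.
Variables (P : set g) (D : set (bideg Gam)) (HP : span_of E P D).

Lemma quantizationE : @quantization _ _ _ g P = @symmT _ _ _ g E P Ext Cliff.
Proof.
have kb (x y : g) : kbr Ext x y = 0 by []; have kf (x y : g) : kfm Ext x y = 0 by [].
rewrite /quantization; apply: xget_unique.
  split=> [|n x delta hx]; first exact: (symmT_lin HP _ kb kf).
  exact: (symmT_word HP Cliff kb kf hx).
move=> f [fl H]; apply: (symmT_unique HP kb kf fl) => n x delta hx.
exact: H.
Qed.

Lemma symmetrizationE : @symmetrization _ _ _ g P = @symmT _ _ _ g E P Sym Env.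
Proof.
have kb (x y : g) : kbr Sym x y = 0 by []; have kf (x y : g) : kfm Sym x y = 0 by [].
rewrite /symmetrization; apply: xget_unique.
  split=> [|n x delta hx]; first exact: (symmT_lin HP _ kb kf).
  rewrite [LHS](symmT_word HP Env kb kf hx) /symm_word; congr (_ *: _).
  by apply: eq_bigr => t _; rewrite expr1n mul1r.
move=> f [fl H]; apply: (symmT_unique HP kb kf fl) => n x delta hx.
rewrite [LHS](H _ _ _ hx) /symm_word; congr (_ *: _).
by apply: eq_bigr => t _; rewrite expr1n mul1r.
Qed.
End SymmetrizationE.

(** * Parity, degrees and short words under symmetrization *)

Section SymmetrizationProperties.
Variables (K : fieldType) (Gam : zmodType) (eps : commutation_factor K Gam).
Variables (g : quadColorLie eps) (E : hbasis g).
Hypothesis char0 : forall n, n.+1%:R != 0 :> K.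
Notation e := (@bvec _ _ _ _ E).
Notation B := (@qfm _ _ _ g).
Notation deg := (@bdeg _ _ _ _ E).
Notation gr := (@qgr _ _ _ g).
Notation ep := (ep eps).
Notation gv := (@bvec_gr _ _ _ _ E).

(** In the Clifford algebra only the parity of the word length survives the relations, and the signs
    in graded commutators depend on nothing more. *)
Definition FApar (k : algkind) (P : set g) (p : bool) (d : bideg Gam) : set (FA k P) :=
  spanS (\bigcup_(n in [set n | odd n = p]) @FAk_gr _ _ _ g k P n d).

Lemma FApar_subspace k P p d : subspace (@FApar k P p d).
Proof. exact: spanS_subspace. Qed.
Lemma FAk_gr_par k P n d (u : FA k P) : FAk_gr n d u -> FApar (odd n) d u.
Proof. by move=> H; apply: spanS_sub; exists n. Qed.
Lemma FApar_gr k P p d (u : FA k P) : FApar p d u -> FA_gr d u.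
Proof.
apply: spanS_ind; first exact: spanS_subspace.
by move=> {}u [n _]; exact: FAk_gr_FA.
Qed.

Section Words.
Variables (P : set g) (D : set (bideg Gam)) (HP : span_of E P D).
Variables k k' : algkind.
Hypothesis kbr0 : forall x y : g, kbr k x y = 0.
Hypothesis kfm0 : forall x y : g, kfm k x y = 0.
Notation F := (FA k P).
Notation gn := (gen k P).
Notation gn' := (gen k' P).
Notation s := (sg K k).
Notation pd := (@pd _ _ _ g E P k).
Notation contr := (@contr _ _ _ g E P k).
Notation pdT := (@pdT _ _ _ g E P k).
Notation symmT := (@symmT _ _ _ g E P k k').
Notation ml := (@ml _ _ _ g E P k').
Let mll : linear ml := @ml_lin _ _ _ _ E P k'.

Lemma FAparM p p' d d' (u v : F) : FApar p d u -> FApar p' d' v ->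
  FApar (p (+) p') (d + d') (u * v).
Proof.
move=> Hu Hv.
apply: (spanS_ind (Q := [set u | FApar (p (+) p') (d + d') (u * v)]) _ _ Hu).
  by apply: (subspace_pre (FA_mulr_lin _)); exact: spanS_subspace.
move=> u1 [n np Hn].
apply: (spanS_ind (Q := [set v | FApar (p (+) p') (d + d') (u1 * v)]) _ _ Hv).
  by apply: (subspace_pre (FA_mull_lin _)); exact: spanS_subspace.
move=> v1 [m mp Hm] /=; apply: spanS_sub; exists (n + m)%N; last exact: FAk_grM.
by rewrite /= oddD np mp.
Qed.

Lemma pd0 d u : FAk_gr 0 d u -> pd u = 0.
Proof.
have pl := pd_lin HP kbr0 kfm0.
apply: (@FAk_gr_word _ _ _ g P k 0 d [set u | pd u = 0]).
  by apply: subspace_eq => //; exact: linear_fun0.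
by move=> x delta hx _ /=; rewrite /word big_ord0 (pd1 HP).
Qed.

Lemma symmT_recE n d u : FAk_gr n d u -> n%:R *: symmT u = ml (tmap id symmT (pd u)).
Proof.
case: n => [|n] hu; last exact: (symmT_rec char0 HP k' kbr0 kfm0 hu).
rewrite scale0r (pd0 hu) (lin0 (tmap_lin (@lin_id K g) (symmT_lin HP k' kbr0 kfm0))).
by rewrite (lin0 mll).
Qed.

Lemma symmT_par n d u : FAk_gr n d u -> FApar (odd n) d (symmT u).
Proof.
elim: n d u => [|n IH] d u hu.
  apply: (@FAk_gr_word _ _ _ g P k 0 d [set u | FApar false d (symmT u)]) u hu.
    by apply: (subspace_pre (symmT_lin HP k' kbr0 kfm0)); exact: spanS_subspace.
  move=> x delta hx; rewrite big_ord0 /word big_ord0 => <- /=.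
  by rewrite (symmT1 HP k' kbr0 kfm0); exact: (FAk_gr_par (FAk_gr1 P k')).
have -> : symmT u = n.+1%:R^-1 *: ml (tmap id symmT (pd u)).
  by rewrite -(symmT_recE hu) scalerA mulVf // scale1r.
apply: subsZ; first exact: spanS_subspace.
have tl : linear (fun t => ml (tmap id symmT t)).
  apply: (lin_comp mll); apply: tmap_lin; first exact: lin_id.
  exact: (symmT_lin HP k' kbr0 kfm0).
apply: (spanS_ind (Q := [set t | FApar (odd n.+1) d (ml (tmap id symmT t))]) _ _
   (pd_span HP kbr0 kfm0 hu)).
  by apply: (subspace_pre tl); exact: spanS_subspace.
move=> t [y [w [d1 [d2 [Py gy hw <- ->]]]]] /=.
rewrite (tmap_pure (@lin_id K g) (symmT_lin HP k' kbr0 kfm0)) ml_pure (gnlE HP k' Py).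
have := IH _ _ hw; apply: (spanS_ind (Q := [set v | FApar (~~ odd n) (d1 + d2) (gn' y * v)])).
  by apply: (subspace_pre (FA_mull_lin _)); exact: spanS_subspace.
move=> v [m mp hv] /=; apply: spanS_sub; exists m.+1; first by rewrite /= mp.
exact: FAk_gr_cons.
Qed.

Lemma symmT_FA_gr d u : FA_gr d u -> FA_gr d (symmT u).
Proof.
apply: (spanS_ind (Q := [set u | FA_gr d (symmT u)])).
  by apply: (subspace_pre (symmT_lin HP k' kbr0 kfm0)); exact: spanS_subspace.
by move=> v [n _ hv]; exact: FApar_gr (symmT_par hv).
Qed.

Lemma symmT_gen d x : gr d x -> P x -> symmT (gn x) = gn' x.
Proof.
move=> gx Px; have := symmT_recE (FAk_gr_gen P k gx); rewrite scale1r => ->.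
rewrite -[gn x]mulr1 (pd_gen_hom HP kbr0 kfm0 _ gx Px) (pd1 HP) //.
rewrite (lin0 (tmap_lin (twist_lin E d) (FA_mull_lin (gn x)))) scaler0 addr0.
rewrite (tmap_pure (@lin_id K g) (symmT_lin HP k' kbr0 kfm0)) ml_pure (gnlE HP k' Px).
by rewrite (symmT1 HP k' kbr0 kfm0) mulr1.
Qed.

Lemma symmT_gen2 d d' x y : gr d x -> gr d' y -> P x -> P y ->
  symmT (gn x * gn y) = 2%:R^-1 *: (gn' x * gn' y + (s * ep d d') *: (gn' y * gn' x)).
Proof.
move=> gx gy Px Py.
have h2 : @FAk_gr _ _ _ g k P 2 (d + d') (gn x * gn y).
  exact: FAk_gr_cons gx (FAk_gr_gen P k gy).
have two0 := char0 1; have := symmT_recE h2 => /(congr1 (fun v => 2%:R^-1 *: v)).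
rewrite scalerA mulVf // scale1r => ->; congr (_ *: _).
have sl := symmT_lin HP k' kbr0 kfm0.
rewrite (pd_gen_hom HP kbr0 kfm0 _ gx Px) -[gn y]mulr1 (pd_gen_hom HP kbr0 kfm0 _ gy Py) (pd1 HP) //.
rewrite (lin0 (tmap_lin (twist_lin E d') (FA_mull_lin (gn y)))) scaler0 addr0.
rewrite (tmap_pure (twist_lin E d) (FA_mull_lin (gn x))) (twist_gr E _ gy) !mulr1.
rewrite (linD (tmap_lin (@lin_id K g) sl)) (linZ (tmap_lin (@lin_id K g) sl)) tpureZl.
rewrite (linZ (tmap_lin (@lin_id K g) sl)) !(tmap_pure (@lin_id K g) sl).
rewrite (linD mll) !(linZ mll) !ml_pure !(gnlE HP k') //.
by rewrite (symmT_gen gx) // (symmT_gen gy) // scalerA.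
Qed.

Lemma pd_contr d x u : gr d x -> pd (contr x u) = s *: tmap (twist E d) (contr x) (pd u).
Proof.
move=> gx; have pl := pd_lin HP kbr0 kfm0; have cl := contr_linr HP kbr0 kfm0 x.
have tl := tmap_lin (twist_lin E d) cl.
apply: (FA_ind HP (Q := [set u | pd (contr x u) = s *: tmap (twist E d) (contr x) (pd u)])).
- apply: subspace_eq; first exact: (lin_comp pl cl).
  by apply: linear_funZ; exact: (lin_comp tl pl).
- by rewrite /= (contr1 HP) // (lin0 pl) (pd1 HP) // (lin0 tl) scaler0.
move=> a v Da /= IH; have Pa : P (e a) by apply/(span_of_vec HP).
rewrite (contr_gen HP kbr0 kfm0 _ gx (gv a) Pa) (linD pl) !(linZ pl) !(pd_gen HP kbr0 kfm0) //.
rewrite (linD tl) (linZ tl) (tmap_pure (twist_lin E d) cl) (twist_gr E _ (gv a)) tpureZl IH.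
have pc t : tmap (twist E d) (contr x) (pdT a t) = B x (e a) *: t
    + (s * ep d (deg a)) *: pdT a (tmap (twist E d) (contr x) t).
  apply: (tens_eq (f := fun t => tmap (twist E d) (contr x) (pdT a t))
   (h := fun t => B x (e a) *: t
    + (s * ep d (deg a)) *: pdT a (tmap (twist E d) (contr x) t))).
  - exact: (lin_comp tl (@pdT_lin _ _ _ _ E P k a)).
  - apply: linear_funD; first by apply: linear_funZ; exact: lin_id.
    by apply: linear_funZ; exact: (lin_comp (@pdT_lin _ _ _ _ E P k a) tl).
  move=> y w; rewrite !pdT_pure !(tmap_pure (twist_lin E d) cl) pdT_pure.
  rewrite (contr_gen HP kbr0 kfm0 _ gx (gv a) Pa) tpureDr !tpureZr.
  move: y; apply: (gr_expand E).
    apply: subspace_eq.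
      apply: linear_funD; apply: linear_funZ.
        apply: (lin_comp (tpure_linl w)); exact: (lin_comp (twist_lin E d) (twist_lin E (deg a))).
      apply: (lin_comp (tpure_linl _)); exact: (lin_comp (twist_lin E d) (twist_lin E (deg a))).
    apply: linear_funD; apply: linear_funZ; first exact: tpure_linl.
    apply: (lin_comp (tpure_linl _)); exact: (lin_comp (twist_lin E (deg a)) (twist_lin E d)).
  move=> d2 y gy /=; rewrite !(twist_gr E _ gy) !(linZ (twist_lin E _)) !(twist_gr E _ gy).
  rewrite !tpureZl; congr (_ + _); last by module.
  have [->|Bn] := eqVneq (B x (e a)) 0; first by rewrite !scale0r.
  have /eqP := form_grP gx (gv a) Bn; rewrite addr_eq0 => /eqP ->.
  by rewrite !scalerA -mulrA epNl epV mulr1.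
rewrite pc (linZ (@pdT_lin _ _ _ _ E P k a)); have S : s * s - 1 = 0 by rewrite sg_sqr subrr.
apply: (cert0 (Z := - ((s * s - 1) * B x (e a)) *: pd v
   )); last by rewrite S mul0r oppr0 scale0r.
by module.
Qed.

End Words.
End SymmetrizationProperties.

(** * Quantization, contraction and normal ordering *)

Section Quantization.
Variables (K : fieldType) (Gam : zmodType) (eps : commutation_factor K Gam).
Variables (g : quadColorLie eps) (E : hbasis g).
Hypothesis char0 : forall n, n.+1%:R != 0 :> K.
Notation B := (@qfm _ _ _ g).
Notation gr := (@qgr _ _ _ g).
Notation ep := (ep eps).
Notation gM := (@gM _ _ _ g).
Notation gP := (@gP _ _ _ g).
Notation span_M := (span_M E).
Notation span_P := (span_P E).
Let HT : span_of E [set: g] [set: bideg Gam] := @span_ofT _ _ _ g E.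
Notation gC x := (gen Cliff [set: g] x).

Let kb (x y : g) : kbr Ext x y = 0. Proof. by []. Qed.
Let kf (x y : g) : kfm Ext x y = 0. Proof. by []. Qed.

Section Commutator.
Variables (P : set g) (D : set (bideg Gam)) (HP : span_of E P D).
Let PT : forall d, D d -> [set: bideg Gam] d. Proof. by []. Qed.
Notation L := (FA Ext P).
Notation symmT := (@symmT _ _ _ g E P Ext Cliff).
Notation contr := (@contr _ _ _ g E P Ext).
Notation pd := (@pd _ _ _ g E P Ext).
Notation ml := (@ml _ _ _ g E P Cliff).
Let mll : linear ml := @ml_lin _ _ _ _ E P Cliff.
Let sl : linear symmT := symmT_lin HP Cliff kb kf.
Let il : linear (@FAincl _ _ _ g Cliff P setT) := FAincl_lin HP HT PT (k := Cliff).
Notation C u := (@FAincl _ _ _ g Cliff P setT (symmT u)).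
Let Phi t := @FAincl _ _ _ g Cliff P setT (ml (tmap id symmT t)).

Let Phi_lin : linear Phi.
Proof. exact: (lin_comp il (lin_comp mll (tmap_lin (@lin_id K g) sl))). Qed.
Let Phi_pure y w : P y -> Phi (tpure y w) = gC y * C w.
Proof.
move=> Py; rewrite /Phi (tmap_pure (@lin_id K g) sl) ml_pure (gnlE HP Cliff Py).
by rewrite (FAinclM HP HT PT) (FAincl_gen HP HT PT).
Qed.

(** By the recursion, (n + 1) q(u) is the sum of y q(w) over [pd u]. Moving x past y produces 2 B(x,
    y) q(w), in total 2 q(iota_x u). Moving it past q(w) produces, by induction, [pd_contr] and the
    recursion for iota_x u of length n, the further 2 n q(iota_x u). Dividing by n + 1 gives the
    formula. *)
Lemma symm_comm n d d' x (u : L) : gr d' x -> FAk_gr n d u ->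
  gC x * C u = ((-1) ^+ n * ep d' d) *: (C u * gC x) + 2%:R *: C (contr x u).
Proof.
move=> gx; have cl := contr_linr HP kb kf x.
have Cl : linear (fun u : L => C u) := lin_comp il sl.
elim: n d u => [|n IH] d u hu.
  apply: (@FAk_gr_word _ _ _ g P Ext 0 d [set u | gC x * C u =
    ((-1) ^+ 0 * ep d' d) *: (C u * gC x) + 2%:R *: C (contr x u)]) u hu.
    apply: subspace_eq; first exact: (lin_comp (FA_mull_lin _) Cl).
    apply: linear_funD; apply: linear_funZ; first exact: (lin_comp (FA_mulr_lin _) Cl).
    exact: (lin_comp Cl cl).
  move=> y delta hy; rewrite big_ord0 => <- /=; rewrite /word big_ord0 (contr1 HP) //.
  rewrite (symmT1 HP Cliff kb kf) (FAincl1 HP HT PT) (lin0 Cl) mulr1 mul1r ep0r.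
  by rewrite mulr1 scale1r scaler0 addr0.
have key t : spanS [set t | exists y w d1 d2, [/\ P y, gr d1 y, FAk_gr n d2 w, d1 + d2 = d
      & t = tpure y w]] t ->
    gC x * Phi t = ((-1) ^+ n.+1 * ep d' d) *: (Phi t * gC x)
      + (2%:R *: C (tlift (fun y (w : L) => B x y *: w) t)
      - 2%:R *: Phi (tmap (twist E d') (contr x) t)).
  have tl := tmap_lin (twist_lin E d') cl.
  apply: (spanS_ind (Q := [set t | gC x * Phi t = ((-1) ^+ n.+1 * ep d' d) *: (Phi t * gC x)
      + (2%:R *: C (tlift (fun y (w : L) => B x y *: w) t)
      - 2%:R *: Phi (tmap (twist E d') (contr x) t))])).
    apply: subspace_eq; first exact: (lin_comp (FA_mull_lin _) Phi_lin).
    apply: linear_funD.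
      by apply: linear_funZ; exact: (lin_comp (FA_mulr_lin _) Phi_lin).
    apply: linear_funB; apply: linear_funZ; last exact: (lin_comp Phi_lin tl).
    exact: (lin_comp Cl (@contrT_lin _ _ _ g P Ext x)).
  move=> {}t [y [w [d1 [d2 [Py gy hw <- ->]]]]] /=.
  rewrite (tmap_pure (twist_lin E d') cl) (twist_gr E _ gy) tpureZl (linZ Phi_lin).
  rewrite !Phi_pure // (@contrT_pure _ _ _ g P Ext x y w) (linZ Cl) mulrA.
  rewrite (gen_comm HT (k := Cliff) _ _ _ gx gy) // /kbr (gen0 HT) /kfm addr0 mulrDl.
  rewrite -palg_scalerAl -mulrA (IH _ _ hw) mulrDr -!palg_scalerAr -palg_scalerAl mul1r.
  by rewrite !mulrA epDr exprS /=; module.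
have := key _ (pd_span HP kb kf hu).
rewrite -[tlift _ _]/(contr x u).
have pc := pd_contr HP kb kf u gx.
have -> : tmap (twist E d') (contr x) (pd u) = - pd (contr x u).
  by rewrite pc /= scaleN1r opprK.
have hc : FAk_gr n (d' + d) (contr x u) := contr_grS HP kb kf gx hu.
rewrite (linN Phi_lin) /Phi -(symmT_recE char0 HP Cliff kb kf hc).
rewrite -(symmT_recE char0 HP Cliff kb kf hu) !(linZ il) => H.
apply: (scalerI (char0 n)); rewrite palg_scalerAr H -palg_scalerAl.
by module.
Qed.

End Commutator.

Section GlobalMap.
Variables k k' : algkind.
Hypothesis kbr0 : forall x y : g, kbr k x y = 0.
Hypothesis kfm0 : forall x y : g, kfm k x y = 0.
Notation sM := (@symmT _ _ _ g E gM k k').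
Notation sP := (@symmT _ _ _ g E gP k k').
Let sMl : linear sM := symmT_lin span_M k' kbr0 kfm0.
Let sPl : linear sP := symmT_lin span_P k' kbr0 kfm0.

Definition qq : tens (FA k gM) (FA k gP) -> tens (FA k' gM) (FA k' gP) := tmap sM sP.
Lemma qq_lin : linear qq. Proof. exact: tmap_lin. Qed.
Lemma qq_pure a b : qq (tpure a b) = tpure (sM a) (sP b).
Proof. exact: (tmap_pure sMl sPl). Qed.

Lemma qq_hcomp c w : @hcomp _ _ (triF g k) c w -> @hcomp _ _ (triF g k') c (qq w).
Proof.
apply: (spanS_ind (Q := [set w | @hcomp _ _ (triF g k') c (qq w)])).
  by apply: (subspace_pre qq_lin); exact: spanS_subspace.
move=> {}w [al [be [a [b [H ha hb ->]]]]] /=; rewrite qq_pure; apply: spanS_sub.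
exists al, be, (sM a), (sP b); split=> //.
  exact: (symmT_FA_gr char0 span_M k' kbr0 kfm0).
exact: (symmT_FA_gr char0 span_P k' kbr0 kfm0).
Qed.

(** The normal ordered map before completion: split, symmetrize the two factors separately, multiply
    back. The normal ordered maps on the completions are its limits ([approx_qg]). *)
Definition qg (y : FA k [set: g]) : FA k' [set: g] :=
  @tmu _ _ (triF g k') (qq (split E y)).

Lemma qg_lin : linear qg.
Proof.
exact: (lin_comp (@tmuF_lin _ _ _ g E k') (lin_comp qq_lin (@split_lin _ _ _ g E k))).
Qed.

Lemma qg_tmu w : qg (@tmu _ _ (triF g k) w) = @tmu _ _ (triF g k') (qq w).
Proof. by rewrite /qg tmu_splitK. Qed.

Lemma qg_J n y : J (F := triF g k) n y -> J (F := triF g k') n (qg y).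
Proof.
move=> Jy; have [s [_ _ yE]] := hin_sum (triF_good E k) y.
rewrite yE (linsum qg_lin); apply: (subssum (J_subspace (triF_good E k') n)) => c _.
have [cn|nc] := ltP c.2%:Z n.
  rewrite (J_hin Jy cn) (lin0 (@tmuF_lin _ _ _ g E k)) (lin0 qg_lin).
  exact: subs0 (J_subspace (triF_good E k') n).
rewrite qg_tmu; apply: (J_tmu (triF_good E k') nc); apply: qq_hcomp.
exact: (hin_comp (triF_good E k)).
Qed.

Lemma qg_null z : null (F := triF g k) z -> null (F := triF g k') (fun N => qg (z N)).
Proof.
by move=> nz n; have [N0 H] := nz n; exists N0 => N /H; exact: qg_J.
Qed.

Lemma qg_hom_fam d (u : hfam (triF g k)) : hom_fam d u ->
  hom_fam d ((fun c => qq (u c)) : hfam (triF g k')).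
Proof.
move=> [hu du]; split=> [c|c /du ->]; first exact: qq_hcomp.
exact: (lin0 qq_lin).
Qed.

Lemma qg_trunc d u N : trunc (F := triF g k') d (fun c => qq (u c)) N =
  qg (trunc (F := triF g k) d u N).
Proof.
rewrite /trunc (linsum qg_lin); apply: eq_bigr => r _; by rewrite qg_tmu.
Qed.

Lemma qg_gen2 d d' x y : gr d x -> gr d' y ->
  qg (gen k setT x * gen k setT y) =
  if (d.1 <= 0) == (d'.1 <= 0) then
    2%:R^-1 *: (gen k' setT x * gen k' setT y
       + (sg K k * ep d d') *: (gen k' setT y * gen k' setT x))
  else if d.1 <= 0 then gen k' setT x * gen k' setT y
  else (sg K k * ep d d') *: (gen k' setT y * gen k' setT x).
Proof.
move=> gx gy.
have PM c z : gr c z -> c.1 <= 0 -> gM z by move=> gz H; exact: (span_of_gr span_M H gz).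
have PPp c z : gr c z -> (c.1 <= 0) = false -> gP z.
  move=> gz /negbT H; apply: (span_of_gr span_P (d := c) _ gz).
  by rewrite /degP /= ltNge.
have tM z : gM z -> gen k setT z = FAincl setT (gen k gM z).
  by move=> Pz; rewrite (FAincl_gen span_M HT).
have tP z : gP z -> gen k setT z = FAincl setT (gen k gP z).
  by move=> Pz; rewrite (FAincl_gen span_P HT).
have i1M : FAincl setT (1 : FA k gM) = 1 by exact: (FAincl1 span_M HT).
have i1P : FAincl setT (1 : FA k gP) = 1 by exact: (FAincl1 span_P HT).
have j1M : FAincl setT (1 : FA k' gM) = 1 by exact: (FAincl1 span_M HT).
have j1P : FAincl setT (1 : FA k' gP) = 1 by exact: (FAincl1 span_P HT).
have mix z z' c c' : gr c z -> gr c' z' -> gM z -> gP z' ->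
    qg (gen k setT z * gen k setT z') = gen k' setT z * gen k' setT z'.
  move=> gz gz' Pz Pz'; rewrite (tM _ Pz) (tP _ Pz').
  rewrite -(tmuF_pure E) qg_tmu qq_pure (symmT_gen char0 span_M k' kbr0 kfm0 gz) //.
  rewrite (symmT_gen char0 span_P k' kbr0 kfm0 gz') // (tmuF_pure E).
  by rewrite (FAincl_gen span_M HT) // (FAincl_gen span_P HT).
case dx : (d.1 <= 0); case dy : (d'.1 <= 0) => /=.
- have Px := PM _ _ gx dx; have Py := PM _ _ gy dy.
  rewrite (tM _ Px) (tM _ Py) -(FAinclM span_M HT) // -[FAincl setT _]mulr1 -i1P.
  rewrite -(tmuF_pure E) qg_tmu qq_pure (symmT_gen2 char0 span_M k' kbr0 kfm0 gx gy) //.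
  rewrite (symmT1 span_P k' kbr0 kfm0) (tmuF_pure E) j1P mulr1.
  have il := @incM_lin _ _ _ g E k'.
  by rewrite (linZ il) (linD il) (linZ il) !(FAinclM span_M HT) // !(FAincl_gen span_M HT).
- exact: (mix _ _ _ _ gx gy (PM _ _ gx dx) (PPp _ _ gy dy)).
- rewrite (gen_swap HT kbr0 kfm0 gx gy) (linZ qg_lin); congr (_ *: _).
  exact: (mix _ _ _ _ gy gx (PM _ _ gy dy) (PPp _ _ gx dx)).
- have Px := PPp _ _ gx dx; have Py := PPp _ _ gy dy.
  rewrite (tP _ Px) (tP _ Py) -(FAinclM span_P HT) // -[FAincl setT _]mul1r -i1M.
  rewrite -(tmuF_pure E) qg_tmu qq_pure (symmT_gen2 char0 span_P k' kbr0 kfm0 gx gy) //.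
  rewrite (symmT1 span_M k' kbr0 kfm0) (tmuF_pure E) j1M mul1r.
  have il := @incP_lin _ _ _ g E k'.
  by rewrite (linZ il) (linD il) (linZ il) !(FAinclM span_P HT) // !(FAincl_gen span_P HT).
Qed.

End GlobalMap.

Notation qqL := (@qq Ext Cliff).
Notation qgL := (@qg Ext Cliff).

Definition Lw (n : nat) (d : bideg Gam) : set (tens (FA Ext gM) (FA Ext gP)) :=
  spanS [set t | exists k l d1 d2 a b, [/\ (k + l)%N = n, d1 + d2 = d,
    FAk_gr k d1 a, FAk_gr l d2 b & t = tpure a b]].

(** Contraction is a graded derivation and commutes with the inclusions of the algebras of g_- and
    g_+, so [symm_comm] on each factor combines into the same formula for the normal ordered map. *)
Lemma qgL_comm n d d' x w : gr d' x -> Lw n d w ->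
  gC x * @tmu _ _ (triF g Cliff) (qqL w) =
  ((-1) ^+ n * ep d' d) *: (@tmu _ _ (triF g Cliff) (qqL w) * gC x)
  + 2%:R *: qgL (contr E x (@tmu _ _ (triF g Ext) w)).
Proof.
move=> gx.
have tC := @tmuF_lin _ _ _ g E Cliff; have tL := @tmuF_lin _ _ _ g E Ext.
have ql := qq_lin Cliff kb kf; have qgl := qg_lin Cliff kb kf.
have cl := contr_linr HT kb kf x.
apply: (spanS_ind (Q := [set w | gC x * @tmu _ _ (triF g Cliff) (qqL w) =
  ((-1) ^+ n * ep d' d) *: (@tmu _ _ (triF g Cliff) (qqL w) * gC x)
  + 2%:R *: qgL (contr E x (@tmu _ _ (triF g Ext) w))])).
  apply: subspace_eq; first exact: (lin_comp (FA_mull_lin _) (lin_comp tC ql)).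
  apply: linear_funD; apply: linear_funZ.
    exact: (lin_comp (FA_mulr_lin _) (lin_comp tC ql)).
  exact: (lin_comp qgl (lin_comp cl tL)).
move=> {}w [k [l [d1 [d2 [a [b [<- <- ha hb ->]]]]]]] /=.
rewrite (qq_pure Cliff kb kf) !(tmuF_pure E) mulrA (symm_comm span_M gx ha).
have ia : FAk_gr k d1 (FAincl [set: g] a).
  exact: (FAincl_gr span_M HT).
rewrite (contr_mul HT kb kf _ gx ia) -(contr_incl span_M kb kf) -(contr_incl span_P kb kf).
rewrite -!(tmuF_pure E) (linD qgl) (linZ qgl) !qg_tmu !(qq_pure Cliff kb kf) !(tmuF_pure E).
rewrite mulrDl -!palg_scalerAl -!mulrA (symm_comm span_P gx hb) mulrDr -!palg_scalerAr.
by rewrite !mulrA epDr exprD; module.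
Qed.

Lemma qqL_par n d w : Lw n d w -> FApar (odd n) d (@tmu _ _ (triF g Cliff) (qqL w)).
Proof.
apply: (spanS_ind (Q := [set w | FApar (odd n) d (@tmu _ _ (triF g Cliff) (qqL w))])).
  apply: (subspace_pre (lin_comp (@tmuF_lin _ _ _ g E Cliff) (qq_lin Cliff kb kf))).
  exact: spanS_subspace.
move=> {}w [k [l [d1 [d2 [a [b [<- <- ha hb ->]]]]]]] /=.
rewrite (qq_pure Cliff kb kf) (tmuF_pure E) oddD.
have incpar P D (HP : span_of E P D) p d0 (u : FA Cliff P) : FApar p d0 u ->
    FApar p d0 (FAincl [set: g] u).
  apply: (spanS_ind (Q := [set u | FApar p d0 (FAincl [set: g] u)])).
    by apply: (subspace_pre (FAincl_lin HP HT (k := Cliff) _)) => //; exact: spanS_subspace.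
  move=> {}u [m mp hm] /=; apply: spanS_sub; exists m => //.
  exact: (FAincl_gr HP HT).
apply: FAparM; apply: incpar.
- exact: span_M.
- exact: (symmT_par char0 span_M Cliff kb kf ha).
- exact: span_P.
- exact: (symmT_par char0 span_P Cliff kb kf hb).
Qed.

End Quantization.

(** * Vacuum functional and elements commuting with g *)

Section Vacuum.
Variables (K : fieldType) (Gam : zmodType) (eps : commutation_factor K Gam).
Variables (g : quadColorLie eps) (E : hbasis g).
Hypothesis char0 : forall n, n.+1%:R != 0 :> K.
Notation I := (bidx E).
Notation e := (@bvec _ _ _ _ E).
Notation B := (@qfm _ _ _ g).
Notation deg := (@bdeg _ _ _ _ E).
Notation gr := (@qgr _ _ _ g).
Notation ep := (ep eps).
Notation lext := (@lext _ _ _ g E _).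
Notation gv := (@bvec_gr _ _ _ _ E).
Notation gP := (@gP _ _ _ g).
Notation span_P := (span_P E).
Let HT : span_of E [set: g] [set: bideg Gam] := @span_ofT _ _ _ g E.
Notation C := (FA Cliff [set: g]).
Notation gC x := (gen Cliff [set: g] x).
Notation L := (FA Ext [set: g]).
Notation gL x := (gen Ext [set: g] x).
Notation ct := (@contr _ _ _ g E [set: g] Ext).
Notation aug := (@aug _ _ _ g E [set: g] Ext).
Let kb (x y : g) : kbr Ext x y = 0. Proof. by []. Qed.
Let kf (x y : g) : kfm Ext x y = 0. Proof. by []. Qed.

Definition theta (i : int) : K := if 0 < i then 2 else if i == 0 then 1 else 0.
Definition isM (i : int) : K := if i <= 0 then 1 else 0.

Lemma theta_isM i : theta i * isM (- i) = theta i.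
Proof.
rewrite /theta /isM; case: (ltrgtP 0 i) => H; rewrite ?mul0r //.
  by rewrite oppr_le0 ltW // mulr1.
by rewrite -H oppr0 lexx mulr1.
Qed.
(** This identity is what makes the Fock operators satisfy the Clifford relation: it is the total
    contribution of the two contractions between letters of opposite Z-degrees. *)
Lemma theta_sum i : theta i * isM (- i) + theta (- i) * isM i = 2.
Proof.
rewrite -[in isM i](opprK i) !theta_isM /theta oppr_gt0 oppr_eq0.
by case: (ltrgtP 0 i) => H //; rewrite ?addr0 ?add0r.
Qed.

(* The Clifford algebra acts on the exterior algebra by                       *)
(* x |-> pi_- x /\ _ + iota_(theta x), with theta = 2 pi_+ + pi_0, and vac u  *)
(* is the constant term of the image of 1 under u.                            *)
Definition fock (a : I) (u : L) : L :=
  isM (deg a).1 *: (gL (e a) * u) + theta (deg a).1 *: ct (e a) u.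

Lemma fock_lin a : linear (fock a).
Proof.
apply: linear_funD; apply: linear_funZ; first exact: FA_mull_lin.
exact: (contr_linr HT kb kf).
Qed.

Lemma ct_gen a b u : ct (e a) (gL (e b) * u) =
  B (e a) (e b) *: u - ep (deg a) (deg b) *: (gL (e b) * ct (e a) u).
Proof. by rewrite (contr_gen HT kb kf _ (gv a) (gv b)) //= mulN1r scaleNr. Qed.

Lemma fock_rel a b v : setT (deg a) -> setT (deg b) ->
  fock a (fock b v) = (sg K Cliff * ep (deg a) (deg b)) *: fock b (fock a v)
    + lext (fock^~ v) (kbr Cliff (e a) (e b)) + kfm Cliff (e a) (e b) *: v.
Proof.
move=> _ _; rewrite /kbr (lin0 (lext_linear _)) addr0 /kfm /fock.
have cl c := contr_linr HT kb kf (e c).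
rewrite !(linD (cl _)) !(linZ (cl _)) !ct_gen !mulrDr -!palg_scalerAr !mulrA.
rewrite (gen_swap HT kb kf (gv a) (gv b)) (contr_anti HT kb kf v (gv a) (gv b)).
have F : (theta (deg a).1 * isM (deg b).1 + theta (deg b).1 * isM (deg a).1 - 2) * B (e a) (e b) = 0.
  have [->|Bn] := eqVneq (B (e a) (e b)) 0; first by rewrite mulr0.
  have /eqP := form_grP (gv a) (gv b) Bn; rewrite addrC addr_eq0 => /eqP ->.
  by rewrite theta_sum subrr mul0r.
have V := epV eps (deg a) (deg b).
have Bs : B (e b) (e a) = ep (deg b) (deg a) * B (e a) (e b) := qfm_sym (gv b) (gv a).
rewrite Bs -!palg_scalerAl /=.
move: (ep (deg a) (deg b)) (ep (deg b) (deg a)) V => p p' V.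
have V' : p * p' - 1 = 0 by rewrite V subrr.
apply: (cert0 (Z := ((theta (deg a).1 * isM (deg b).1 + theta (deg b).1 * isM (deg a).1 - 2)
     * B (e a) (e b)) *: v
  + (p * p' - 1) *: ((isM (deg a).1 * theta (deg b).1 * B (e a) (e b)) *: v
     - (isM (deg a).1 * theta (deg b).1) *: (gL (e a) * ct (e b) v)))); last first.
  by rewrite F V' !scale0r addr0.
by module.
Qed.

Definition fockA (u : C) (w : L) : L := act fock u w.
Lemma fockA_linl w : linear (fockA^~ w). Proof. exact: (act_linl HT fock_lin fock_rel). Qed.
Lemma fockA_linr u : linear (fockA u).
Proof. exact: (act_linr (P := [set: g]) (k := Cliff) fock_lin). Qed.
Lemma fockA1 w : fockA 1 w = w. Proof. exact: (act1 HT fock_lin fock_rel). Qed.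
Lemma fockAM u v w : fockA (u * v) w = fockA u (fockA v w).
Proof. exact: (actM HT fock_lin fock_rel). Qed.
Lemma fockA_gen a w : fockA (gC (e a)) w = fock a w.
Proof. exact: (act_basis HT fock_lin fock_rel). Qed.

Definition vac (u : C) : K := aug (fockA u 1).

Lemma vac_lin : scalar vac.
Proof.
move=> c u v; rewrite /vac (fockA_linl 1 c u v).
exact: (aug_lin HT kb kf).
Qed.
Lemma vac1 : vac 1 = 1.
Proof. by rewrite /vac fockA1 (aug1 HT kb kf). Qed.

Lemma vac_negM u a : (deg a).1 < 0 -> vac (gC (e a) * u) = 0.
Proof.
move=> da; rewrite /vac fockAM fockA_gen /fock /theta.
rewrite (lt_gtF da) (lt_eqF da) scale0r addr0 /isM (ltW da) scale1r.
exact: (aug_gen HT kb kf).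
Qed.

(** The two-point function of the vacuum functional ([vac_gen2]). *)
Definition kappa (x y : g) : K := B (lext (fun a => theta (deg a).1 *: e a) x) y.
Lemma kappa_linl y : scalar (kappa^~ y).
Proof. by move=> c x x'; rewrite /kappa lext_linear qfm_linl. Qed.
Lemma kappa_linr x : scalar (kappa x). Proof. exact: qfm_linr. Qed.
Lemma kappa_gr d x y : gr d x -> kappa x y = theta d.1 * B x y.
Proof.
move=> gx; rewrite /kappa (lext_eq (h := fun a => theta d.1 *: e a)).
  by rewrite lext_fZ (lext_linE E (@lin_id K g)) formZl.
by move=> a Ba; rewrite ((grP E _ _).1 gx _ Ba).
Qed.

Lemma vac_gen2 x y : vac (gC x * gC y) = kappa x y.
Proof.
have gl : linear (fun x : g => gC x) by move=> c u v; rewrite (gen_lin HT).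
move: x; apply: (gr_expand E).
  apply: (@subspace_eq K K^o g (fun x => vac (gC x * gC y)) (fun x => kappa x y)).
    by move=> c u v; rewrite gl mulrDl -palg_scalerAl vac_lin.
  exact: kappa_linl.
move=> d x gx /=; move: y; apply: (basis_ind (E := E)).
  apply: (@subspace_eq K K^o g (fun y => vac (gC x * gC y)) (fun y => kappa x y)).
    by move=> c u v; rewrite gl mulrDr -palg_scalerAr vac_lin.
  exact: kappa_linr.
move=> b; have Q : subspace [set x : g | vac (gC x * gC (e b)) = kappa x (e b)].
  apply: (@subspace_eq K K^o g (fun x => vac (gC x * gC (e b))) (fun x => kappa x (e b))).
    by move=> c u v; rewrite gl mulrDl -palg_scalerAl vac_lin.
  exact: kappa_linl.
move: x {gx}; apply: (basis_ind Q) => a.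
change (vac (gC (e a) * gC (e b)) = kappa (e a) (e b)).
have al := aug_lin HT kb kf.
rewrite (kappa_gr _ (gv a)) /vac fockAM !fockA_gen {2}/fock (contr1 HT) // scaler0 addr0.
rewrite (linZ (fock_lin a)) (scalarZl al) /fock (scalarD al) !(scalarZl al).
rewrite (aug_gen HT kb kf) // mulr0 add0r ct_gen (contr1 HT) // mulr0 scaler0 subr0.
rewrite (scalarZl al) (aug1 HT kb kf) mulr1.
have [->|Bn] := eqVneq (B (e a) (e b)) 0; first by rewrite !mulr0.
have /eqP := form_grP (gv a) (gv b) Bn; rewrite addrC addr_eq0 => /eqP ->.
by rewrite mulrA [isM _ * _]mulrC theta_isM.
Qed.

Lemma kappa_sym d d' x y : gr d x -> gr d' y ->
  kappa x y + ep d d' * kappa y x = 2 * B x y.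
Proof.
move=> gx gy; rewrite -!vac_gen2 -(scalarZl vac_lin) -(scalarD vac_lin).
rewrite (gen_comm HT (k := Cliff) _ _ _ gx gy) //= mulN1r /kbr (gen0 HT) addr0.
rewrite scaleNr addrAC addNr add0r (scalarZl vac_lin) vac1 mulr1 //.
Qed.

(** A letter of Z-degree 0 acts by exterior multiplication, which has no constant term, plus
    contraction. On the Fock module that contraction graded-commutes with [u] up to half the graded
    commutator of the letter with [u] ([H]), and it kills 1. *)
Lemma vac_g0 a n d u : (deg a).1 = 0 -> FAk_gr n d u ->
  vac (gC (e a) * u) =
  2^-1 * vac (gC (e a) * u - ((-1) ^+ n * ep (deg a) d) *: (u * gC (e a))).
Proof.
move=> da hu; have two0 : (2 : K) != 0 := char0 1.
have cl c := contr_linr HT kb kf (e c).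
have H w : ct (e a) (fockA u w) =
    2^-1 *: fockA (gC (e a) * u - ((-1) ^+ n * ep (deg a) d) *: (u * gC (e a))) w
     + ((-1) ^+ n * ep (deg a) d) *: fockA u (ct (e a) w).
  move: w; apply: (FAk_ind HT (Q := fun n d => [set u | forall w, ct (e a) (fockA u w) =
    2^-1 *: fockA (gC (e a) * u - ((-1) ^+ n * ep (deg a) d) *: (u * gC (e a))) w
     + ((-1) ^+ n * ep (deg a) d) *: fockA u (ct (e a) w)]) _ _ _ hu).
  - move=> m d'; split=> [w|c u1 u2 H1 H2 w].
      rewrite mulr0 mul0r scaler0 subr0 !(lin0 (fockA_linl _)) !scaler0 addr0.
      exact: (lin0 (cl a)).
    rewrite (fockA_linl w c u1 u2) (cl a) H1 H2 (fockA_linl _ c u1 u2).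
    rewrite mulrDr mulrDl -palg_scalerAr -palg_scalerAl.
    rewrite !(linB (fockA_linl w)) !(linD (fockA_linl w)) !(linZ (fockA_linl w)).
    rewrite !(linD (fockA_linl w)) !(linZ (fockA_linl w)).
    by module.
  - move=> w; rewrite !fockA1 mulr1 mul1r ep0r expr0 mul1r !scale1r subrr.
    by rewrite (lin0 (fockA_linl w)) scaler0 add0r.
  - move=> m d' b v _ IH w /=.
    rewrite fockAM fockA_gen.
    have step x : ct (e a) (fock b x) = B (e a) (e b) *: x - ep (deg a) (deg b) *: fock b (ct (e a) x).
      rewrite /fock (linD (cl a)) !(linZ (cl a)) ct_gen (contr_anti HT kb kf x (gv a) (gv b)) /=.
      have F : (isM (deg b).1 - 1) * B (e a) (e b) = 0.
        have [->|Bn] := eqVneq (B (e a) (e b)) 0; first by rewrite mulr0.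
        have := form_grP (gv a) (gv b) Bn => /(congr1 fst); rewrite /= da add0r => ->.
        by rewrite /isM lexx subrr mul0r.
      apply: (cert0 (Z := ((isM (deg b).1 - 1) * B (e a) (e b)) *: x)); last by rewrite F scale0r.
      by module.
    rewrite step IH.
    have -> : gC (e a) * (gC (e b) * v) = (2 * B (e a) (e b)) *: v
        - ep (deg a) (deg b) *: (gC (e b) * (gC (e a) * v)).
      rewrite mulrA (gen_comm HT (k := Cliff) _ _ _ (gv a) (gv b)) //= mulN1r /kbr (gen0 HT) addr0.
      by rewrite mulrDl -!palg_scalerAl mul1r mulrA; module.
    rewrite !(linB (fockA_linl w)) !(linZ (fockA_linl w)) -!mulrA !fockAM !fockA_gen.
    move: (fock a (fockA v w)) => X1.
    rewrite !(linD (fock_lin b)) !(linZ (fock_lin b)).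
    rewrite exprS epDr.
    rewrite !(linB (fock_lin b)) !(linZ (fock_lin b)).
    have T2 : 2^-1 * 2 - 1 = 0 :> K by rewrite mulVf // subrr.
    apply: (cert0 (Z := - ((2^-1 * 2 - 1) * B (e a) (e b)) *: fockA v w)); last first.
      by rewrite T2 mul0r oppr0 scale0r.
    by module.
have al := aug_lin HT kb kf.
rewrite {1}/vac fockAM fockA_gen /fock (scalarD al) (scalarZl al) (aug_gen HT kb kf) //.
rewrite mulr0 add0r (scalarZl al) /theta da ltxx eqxx mul1r H (contr1 HT) //.
by rewrite (lin0 (fockA_linr u)) scaler0 addr0 (scalarZl al).
Qed.

Lemma fockA_P d (b : FA Cliff gP) : FA_gr d b -> 0 < d.1 -> fockA (FAincl setT b) 1 = 0.
Proof.
have PT (d1 : bideg Gam) : degP d1 -> [set: bideg Gam] d1 by [].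
have il := FAincl_lin span_P HT PT (k := Cliff).
move=> hb d0; suff [c [_ H]] : exists c : K, fockA (FAincl setT b) 1 = c *: (1 : L) /\
    (0 < d.1 -> fockA (FAincl setT b) 1 = 0) by exact: H.
apply: (FA_gr_ind span_P (Q := fun d => [set b | exists c : K,
   fockA (FAincl setT b) 1 = c *: (1 : L) /\
    (0 < d.1 -> fockA (FAincl setT b) 1 = 0)]) _ _ _ hb).
- move=> d'; split=> [|k x y [c [H1 H2]] [c' [H3 H4]]].
    by exists 0; rewrite (lin0 il) (lin0 (fockA_linl _)) scale0r.
  exists (k * c + c'); rewrite il (fockA_linl 1 k) H1 H3; split; first by module.
  by move=> p; rewrite -H1 -H3 H2 // H4 // scaler0 addr0.
- by exists 1; rewrite (FAincl1 span_P HT) // fockA1 scale1r.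
- move=> d' a u Da [c [H1 _]] /=; exists 0.
  have da : 0 < (deg a).1 by [].
  suff -> : fockA (FAincl setT (gen Cliff gP (e a) * u)) 1 = 0 by rewrite scale0r.
  rewrite (FAinclM span_P HT) // (FAincl_gen span_P HT) //; last exact/(span_of_vec span_P).
  rewrite fockAM fockA_gen H1 (linZ (fock_lin a)) /fock (contr1 HT) // scaler0 addr0.
  by rewrite /isM leNgt da scale0r scaler0.
Qed.

(** Elements of F(g_+) of positive degree annihilate 1 in the Fock module, hence so does the left
    ideal they generate; the vacuum functional is therefore continuous. *)
Lemma vac_J n u : 0 < n -> J (F := triF g Cliff) n u -> vac u = 0.
Proof.
move=> n0 /(J_span (triF_good E Cliff) (ltW n0)).
apply: (spanS_ind (Q := [set u | vac u = 0])).
  apply: (@subspace_eq K K^o _ vac (fun _ => 0)); first exact: vac_lin.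
  exact: linear_fun0.
move=> {}u [z [d [b [hb nd ->]]]] /=.
change (vac ((z : C) * FAincl setT b) = 0); rewrite /vac fockAM (fockA_P hb) ?(lin0 (fockA_linr z)).
  exact: (scalar0 (aug_lin HT kb kf)).
exact: lt_le_trans nd.
Qed.

End Vacuum.

(** * Elements with small commutators are small up to scalars *)

Section Criterion.
Variables (K : fieldType) (Gam : zmodType) (eps : commutation_factor K Gam).
Variables (g : quadColorLie eps) (E : hbasis g).
Hypothesis char0 : forall n, n.+1%:R != 0 :> K.
Notation I := (bidx E).
Notation e := (@bvec _ _ _ _ E).
Notation e' := (@bdual _ _ _ _ E).
Notation B := (@qfm _ _ _ g).
Notation deg := (@bdeg _ _ _ _ E).
Notation gr := (@qgr _ _ _ g).
Notation ep := (ep eps).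
Notation gv := (@bvec_gr _ _ _ _ E).
Let HT : span_of E [set: g] [set: bideg Gam] := @span_ofT _ _ _ g E.
Notation C := (FA Cliff [set: g]).
Notation gC x := (gen Cliff [set: g] x).
Notation J := (J (F := triF g Cliff)).
Let G := triF_good E Cliff.

Definition cm (n : nat) (d : bideg Gam) (c : I) (u : C) : C :=
  gC (e c) * u - ((-1) ^+ n * ep (deg c) d) *: (u * gC (e c)).

Lemma cm_lin n d c : linear (cm n d c).
Proof.
apply: linear_funB; first exact: FA_mull_lin.
apply: linear_funZ; exact: FA_mulr_lin.
Qed.
Lemma cm_odd n m d c u : odd n = odd m -> cm n d c u = cm m d c u.
Proof. by move=> nm; rewrite /cm -signr_odd nm signr_odd. Qed.

(** Words of length at most [n - 2 s] with the parity of [n]: the length filtration of the Clifford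
    algebra, whose relations shorten words by 2. *)
Definition Fil (s n : nat) (d : bideg Gam) : set C :=
  spanS [set u | exists k j, (k + (j + s).*2 = n)%N /\ FAk_gr k d u].
Lemma Fil_sub s n d : subspace (Fil s n d). Proof. exact: spanS_subspace. Qed.
Lemma Fil_gr n d u : FAk_gr n d u -> Fil 0 n d u.
Proof. by move=> H; apply: spanS_sub; exists n, 0%N; rewrite !addn0. Qed.

Lemma cm_step n d c b u :
  cm n.+1 (deg b + d) c (gC (e b) * u) =
  (2 * B (e c) (e b)) *: u - ep (deg c) (deg b) *: (gC (e b) * cm n d c u).
Proof.
rewrite /cm mulrA (gen_comm HT (k := Cliff) _ _ _ (gv c) (gv b)) // /kbr (gen0 HT) addr0 /kfm.
rewrite mulrDl -!palg_scalerAl mul1r mulrBr -!palg_scalerAr -!mulrA exprS epDr /=.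
by module.
Qed.

Lemma gen_Fil s n d b u : Fil s n d u -> Fil s n.+1 (deg b + d) (gC (e b) * u).
Proof.
apply: (spanS_ind (Q := [set u | Fil s n.+1 (deg b + d) (gC (e b) * u)])).
  by apply: (subspace_pre (FA_mull_lin _)); exact: Fil_sub.
move=> {}u [k [j [<- hu]]] /=; apply: spanS_sub; exists k.+1, j; split=> //.
exact: FAk_gr_cons (gv b) hu.
Qed.

Lemma cm_Fil1 n d c u : FAk_gr n d u -> Fil 1 n.+1 (deg c + d) (cm n d c u).
Proof.
move=> hu; suff [] : FAk_gr n d u /\ Fil 1 n.+1 (deg c + d) (cm n d c u) by [].
apply: (FAk_ind HT (Q := fun n d => [set u | FAk_gr n d u /\
    Fil 1 n.+1 (deg c + d) (cm n d c u)]) _ _ _ hu) => /=.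
- move=> m d'; apply: subspaceI; first exact: FAk_gr_subspace.
  by apply: (subspace_pre (cm_lin m d' c)); exact: Fil_sub.
- split; first exact: FAk_gr1.
  rewrite /cm mulr1 mul1r ep0r expr0 mul1r scale1r subrr; exact: subs0 (Fil_sub _ _ _).
move=> m d' b v _ [hv IH]; split; first exact: FAk_gr_cons (gv b) hv.
rewrite cm_step; apply: subsB; first exact: Fil_sub.
  have [->|Bn] := eqVneq (B (e c) (e b)) 0.
    by rewrite mulr0 scale0r; exact: subs0 (Fil_sub _ _ _).
  have dcb := form_grP (gv c) (gv b) Bn.
  apply: subsZ; first exact: Fil_sub.
  rewrite addrA dcb add0r; apply: spanS_sub; exists m, 0%N; split=> //.
  by rewrite add0n addn2.
apply: subsZ; first exact: Fil_sub.
by rewrite addrCA; exact: gen_Fil.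
Qed.

Lemma cm_Fil s n d c u : Fil s n d u -> Fil s.+1 n.+1 (deg c + d) (cm n d c u).
Proof.
apply: (spanS_ind (Q := [set u | Fil s.+1 n.+1 (deg c + d) (cm n d c u)])).
  by apply: (subspace_pre (cm_lin _ _ _)); exact: Fil_sub.
move=> {}u [k [j [<- hu]]] /=.
rewrite (@cm_odd _ k); last by rewrite oddD odd_double addbF.
have := cm_Fil1 c hu; apply: spanS_mono => v [m [i [H hv]]].
exists m, (i + j)%N; split=> //; lia.
Qed.

(* Up to shorter words, u |-> 1/2 sum_c e^c [e_c, u] multiplies a word by its *)
(* length. Hence an element whose commutators with all the e_c are small is   *)
(* itself small, up to a scalar.                                              *)
Definition leftE (M n : nat) (d : bideg Gam) (u : C) : C :=
  2^-1 *: \sum_(c <- ball E M) gC (e' c) * cm n d c u.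

Lemma leftE_lin M n d : linear (leftE M n d).
Proof.
apply: linear_funZ => a x y; rewrite scaler_sumr -big_split; apply: eq_bigr => c _ /=.
by rewrite cm_lin mulrDr palg_scalerAr.
Qed.

Lemma lin1M (a b : K) (x y : C) : (a *: x + b *: (1 : C)) * y = a *: (x * y) + b *: y.
Proof. by rewrite mulrDl -!palg_scalerAl mul1r. Qed.

Lemma two0 : (2 : K) != 0. Proof. exact: (char0 1). Qed.
Lemma bdual_deg c : gr (- deg c) (e' c). Proof. exact: bdual_gr. Qed.

(** The new letter adds one to the length: the sum of B(e_c, e_b) e^c rebuilds e_b when the ball
    contains its degree. What remains are commutators of [u], which are shorter words. *)
Lemma leftE_step M n d b u : (`|(deg b).1| <= M)%N -> FAk_gr n d u ->
  Fil 1 n.+1 (deg b + d) (leftE M n.+1 (deg b + d) (gC (e b) * u) - gC (e b) * u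
     - gC (e b) * leftE M n d u).
Proof.
move=> bM hu.
have H : leftE M n.+1 (deg b + d) (gC (e b) * u) - gC (e b) * u
     - gC (e b) * leftE M n d u =
   - \sum_(c <- ball E M) (ep (deg c) (deg b) * B (e' c) (e b)) *: cm n d c u.
  rewrite /leftE.
  have gl : linear (fun x : g => gC x) by move=> a x y; rewrite (gen_lin HT).
  have H1 c : gC (e' c) * cm n.+1 (deg b + d) c (gC (e b) * u) =
     2 *: (B (e c) (e b) *: (gC (e' c) * u)) + (gC (e b) * (gC (e' c) * cm n d c u))
     - 2 *: ((ep (deg c) (deg b) * B (e' c) (e b)) *: cm n d c u).
    rewrite cm_step mulrBr -!palg_scalerAr (mulrA (gC (e' c)) (gC (e b))).
    rewrite (gen_comm HT (k := Cliff) _ _ _ (bdual_deg c) (gv b)) // /kbr (gen0 HT) addr0 /kfm.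
    rewrite lin1M -mulrA epNl /=.
    have V := epV eps (deg c) (deg b).
    apply: (cert0 (Z := (ep (deg c) (deg b) * ep (deg b) (deg c) - 1) *: (gC (e b) * (gC (e' c) * cm n d c u)))); last first.
      by rewrite V subrr scale0r.
    by module.
  rewrite (eq_bigr _ (fun c _ => H1 c)) sumrB big_split /= -!scaler_sumr -mulr_sumr.
  have -> : \sum_(c <- ball E M) B (e c) (e b) *: (gC (e' c) * u) = gC (e b) * u.
    rewrite -{2}(ball_dual_exp E (gv b) bM) (linsumZ gl) mulr_suml.
    by apply: eq_bigr => c _; rewrite palg_scalerAl.
  rewrite -palg_scalerAr.
  have T2 : 2^-1 * 2 - 1 = 0 :> K by rewrite mulVf ?two0 // subrr.
  move: (\sum_(c <- _) _ *: _) => X.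
  apply: (cert0 (Z := (2^-1 * 2 - 1) *: (gC (e b) * u - X))); last by rewrite T2 scale0r.
  by module.
rewrite H; apply: subsN; first exact: Fil_sub.
apply: subssum => [|c _]; first exact: Fil_sub.
have [->|Bn] := eqVneq (B (e' c) (e b)) 0.
  by rewrite mulr0 scale0r; exact: subs0 (Fil_sub _ _ _).
apply: subsZ; first exact: Fil_sub.
have /eqP := form_grP (bdual_deg c) (gv b) Bn; rewrite addrC subr_eq0 => /eqP ->.
exact: cm_Fil1.
Qed.

Lemma leftE_Fil n d u : FAk_gr n d u ->
  exists M0, forall M, (M0 <= M)%N -> Fil 1 n d (leftE M n d u - n%:R *: u).
Proof.
move=> hu; pose Q n d : set C := [set u | FAk_gr n d u /\
    exists M0, forall M, (M0 <= M)%N -> Fil 1 n d (leftE M n d u - n%:R *: u)].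
suff: Q n d u by case.
apply: (FAk_ind HT (Q := Q) _ _ _ hu); rewrite {}/Q /=.
- move=> m d'; apply: subspaceI; first exact: FAk_gr_subspace.
  split=> [|a x y [M1 H1] [M2 H2]].
    exists 0%N => M _; rewrite (lin0 (leftE_lin _ _ _)) scaler0 subr0.
    exact: subs0 (Fil_sub _ _ _).
  exists (maxn M1 M2) => M; rewrite geq_max => /andP[/H1 F1 /H2 F2].
  have -> : leftE M m d' (a *: x + y) - m%:R *: (a *: x + y) =
     a *: (leftE M m d' x - m%:R *: x) + (leftE M m d' y - m%:R *: y).
    by rewrite leftE_lin; module.
  exact: (Fil_sub _ _ _).2.
- split; first exact: FAk_gr1.
  exists 0%N => M _; rewrite scale0r subr0 /leftE big1 ?scaler0; first exact: subs0 (Fil_sub _ _ _).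
  by move=> c _; rewrite /cm mulr1 mul1r ep0r expr0 mul1r scale1r subrr mulr0.
move=> m d' b v _ [hv [M0 IH]]; split; first exact: FAk_gr_cons (gv b) hv.
exists (maxn M0 `|(deg b).1|) => M; rewrite geq_max => /andP[/IH F1 bM].
have F2 := leftE_step bM hv; have F3 := gen_Fil b F1.
have -> : leftE M m.+1 (deg b + d') (gC (e b) * v) - m.+1%:R *: (gC (e b) * v) =
  (leftE M m.+1 (deg b + d') (gC (e b) * v) - gC (e b) * v - gC (e b) * leftE M m d' v)
  + gC (e b) * (leftE M m d' v - m%:R *: v).
  rewrite mulrBr -(palg_scalerAr m%:R) -natr1.
  by module.
by apply: (subsD (Fil_sub _ _ _)).
Qed.

(* Letters of positive degree are moved to the right, so that J n is stable.  *)
Definition mixE (M n : nat) (d : bideg Gam) (u : C) : C :=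
  2^-1 *: \sum_(c <- ball E M)
    if 0 <= (deg c).1 then gC (e' c) * cm n d c u
    else ((-1) ^+ n.+1 * ep (- deg c) (deg c + d)) *: (cm n d c u * gC (e' c)).

Lemma cm_dual_Fil s n d c u : Fil s n d u ->
  Fil s.+1 n.+1 (- deg c + d)
    (gC (e' c) * u - ((-1) ^+ n * ep (- deg c) d) *: (u * gC (e' c))).
Proof.
move=> hu; have gl : linear (fun x : g => gC x) by move=> a x y; rewrite (gen_lin HT).
have dM : (`|(- deg c).1| <= `|(deg c).1|)%N by rewrite /= abszN.
rewrite -(ball_exp E (bdual_deg c) dM) (linsumZ gl) mulr_suml mulr_sumr scaler_sumr -sumrB.
apply: subssum => [|a _]; first exact: Fil_sub.
have [->|Bn] := eqVneq (B (e' c) (e' a)) 0.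
  by rewrite !scale0r mul0r mulr0 scaler0 subr0; exact: subs0 (Fil_sub _ _ _).
have /eqP := form_grP (bdual_deg c) (bdual_deg a) Bn.
rewrite addr_eq0 opprK => /eqP ca; rewrite ca.
rewrite -palg_scalerAl -palg_scalerAr scalerA mulrC -scalerA -scalerBr.
apply: subsZ; first exact: Fil_sub.
exact: cm_Fil.
Qed.

Lemma mixE_Fil n d u : Fil 0 n d u ->
  exists M0, forall M, (M0 <= M)%N -> Fil 1 n d (mixE M n d u - n%:R *: u).
Proof.
have S := Fil_sub 1 n d.
apply: (spanS_ind (Q := [set u | exists M0, forall M, (M0 <= M)%N ->
   Fil 1 n d (mixE M n d u - n%:R *: u)])).
  have ml M : linear (mixE M n d).
    apply: linear_funZ => a x y; rewrite scaler_sumr -big_split; apply: eq_bigr => c _ /=.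
    rewrite cm_lin; case: ifP => _; first by rewrite mulrDr palg_scalerAr.
    by rewrite mulrDl -palg_scalerAl; module.
  split=> [|a x y [M1 H1] [M2 H2]].
    by exists 0%N => M _; rewrite (lin0 (ml _)) scaler0 subr0; exact: subs0 S.
  exists (maxn M1 M2) => M; rewrite geq_max => /andP[/H1 F1 /H2 F2].
  have -> : mixE M n d (a *: x + y) - n%:R *: (a *: x + y) =
     a *: (mixE M n d x - n%:R *: x) + (mixE M n d y - n%:R *: y).
    by rewrite ml; module.
  exact: S.2.
move=> {}u [k [j [nE hu]]]; have [M0 H0] := leftE_Fil hu.
have on : odd n = odd k by rewrite -nE addn0 oddD odd_double addbF.
exists M0 => M /H0 F.
have F1 : Fil 1 n d (leftE M n d u - k%:R *: u).
  have -> : leftE M n d u = leftE M k d u.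
    by congr (_ *: _); apply: eq_bigr => c _; rewrite (cm_odd _ _ _ on).
  move: F; apply: spanS_mono => v [m [i [H hv]]].
  by exists m, (i + j)%N; split=> //; lia.
have F2 : Fil 1 n d ((n%:R - k%:R) *: u).
  case: j nE => [|j] nE.
    have -> : n = k by lia.
    by rewrite subrr scale0r; exact: subs0 (Fil_sub _ _ _).
  apply: subsZ => //; apply: spanS_sub; exists k, j; split=> //; lia.
have F3 : Fil 1 n d (mixE M n d u - leftE M n d u).
  rewrite -scalerBr -sumrB; apply: subsZ => //; apply: subssum => // c _.
  case: ifP => _; first by rewrite subrr; exact: subs0 S.
  have hn : Fil 0 n d u by apply: spanS_sub; exists k, j.
  have := cm_dual_Fil c (cm_Fil c hn).
  rewrite addKr -opprB => H; apply: subsN => //.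
  by move: H; apply: spanS_mono => v [m [i [Hm hv]]]; exists m, i; split=> //; lia.
have -> : mixE M n d u - n%:R *: u = (mixE M n d u - leftE M n d u)
    + (leftE M n d u - k%:R *: u) - (n%:R - k%:R) *: u by module.
by apply: subsB => //; apply: subsD.
Qed.

Let Jsub n : subspace (J n) := J_subspace G n.
Let gC_gr d x : gr d x -> tgr G d (gC x).
Proof. exact: FA_gr_gen. Qed.

Lemma cm_J i c m d u : J i u -> J (i + Num.min 0 (deg c).1) (cm m d c u).
Proof.
move=> Ju; apply: (subsB (Jsub _)).
  apply: (J_ideal G); apply: (J_mono _ Ju); rewrite gerDl ge_min lexx //.
apply: (subsZ (Jsub _)).
apply: (J_mono _ (J_mulr Ju (gC_gr (gv c)))).
by rewrite lerD2l ge_min lexx orbT.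
Qed.

(** For negative [deg c] the weaker hypothesis suffices, because right multiplication by [e' c]
    regains exactly [- deg c]. *)
Lemma mixE_J M i m d u : (forall c, J (i + Num.min 0 (deg c).1) (cm m d c u)) ->
  J i (mixE M m d u).
Proof.
move=> H; apply: (subsZ (Jsub _)); apply: (subssum (Jsub _)) => c _; case: ifP => dc.
  by apply: (J_ideal G); have := H c; rewrite min_l // addr0.
apply: (subsZ (Jsub _)); have := J_mulr (H c) (gC_gr (bdual_deg c)).
by rewrite min_r ?addrK // ltW // ltNge dc.
Qed.

(** Induction on the length. The element w = mixE u - n u consists of shorter words, its commutators
    are again small, and mixE u itself is in [J i]. If w is close to a scalar v, then u is close to
    - v / n. Odd elements end with length 1, where there is no scalar. *)
Lemma cm_crit n d i u : Fil 0 n d u ->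
  (forall c, J (i + Num.min 0 (deg c).1) (cm n d c u)) ->
  exists v, [/\ @FAk_gr _ _ _ g Cliff setT 0 d v, odd n -> v = 0 & J i (u - v)].
Proof.
elim/ltn_ind: n u => n IH u hu Hc.
have [n0|n0] := posnP n.
  exists u; rewrite subrr; split=> //; [|by rewrite n0|exact: subs0].
  move: hu; apply: (spanS_ind (Q := FAk_gr 0 d)); first exact: FAk_gr_subspace.
  move=> v [k [j [kj hv]]]; suff <- : k = 0%N by [].
  by lia.
have [M0 H] := mixE_Fil hu; set w := mixE M0 n d u - n%:R *: u.
have hw : Fil 1 n d w by apply: H.
have JE := mixE_J M0 Hc.
have nn : (n%:R : K) != 0 by case: (n) n0 => // m _; exact: char0.
have uE v : u - v = n%:R^-1 *: (mixE M0 n d u - (w + n%:R *: v)).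
  rewrite /w opprD opprB addrA [_ + (_ - _)]addrCA subrr addr0 -scalerBr scalerA.
  by rewrite mulVf // scale1r.
have Jw c : J (i + Num.min 0 (deg c).1) (cm n d c w).
  rewrite (linB (cm_lin n d c)) [X in _ - X](linZ (cm_lin n d c)); apply: (subsB (Jsub _)).
    exact: cm_J.
  exact: (subsZ (Jsub _)).
have [v [hv vo Jv]] : exists v, [/\ @FAk_gr _ _ _ g Cliff setT 0 d v, odd n -> v = 0 & J i (w - v)].
  move: (w) hw Jw => y hw Jw.
  have [n1|[m nE]] : n = 1%N \/ exists m, n = m.+2.
    by case: (n) n0 => // -[|m] _; [left|right; exists m].
    exists 0; split=> //; first by apply: subs0; exact: FAk_gr_subspace.
    rewrite subr0; have -> : y = 0; last exact: subs0.
    move: hw; apply: (spanS_ind (subspace_0 _)) => x [k [j [kj _]]].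
    by lia.
  have on : odd n = odd m by rewrite nE /= negbK.
  have hw' : Fil 0 m d y.
    by move: hw; apply: spanS_mono => x [k [j [kj hy]]]; exists k, j; split=> //; lia.
  have mn : (m < n)%N by rewrite nE ltnW.
  have [c|v [hv vo Jv]] := IH m mn y hw'; first by rewrite (cm_odd _ _ _ (esym on)).
  by exists v; split=> //=; rewrite on.
exists (- n%:R^-1 *: v); split.
- by apply: subsZ => //; exact: FAk_gr_subspace.
- by move=> /vo ->; rewrite scaler0.
rewrite uE; apply: (subsZ (Jsub _)); apply: (subsB (Jsub _)) => //.
by rewrite scalerA mulrN divff // scaleN1r.
Qed.

Lemma FApar_Fil p d u : @FApar _ _ _ g Cliff setT p d u -> exists n, odd n = p /\ Fil 0 n d u.
Proof.
apply: (spanS_ind (Q := [set u | exists n, odd n = p /\ Fil 0 n d u])).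
  split; first by exists (p : nat); rewrite oddb; split=> //; exact: subs0 (Fil_sub _ _ _).
  have mono n m v : odd n = odd m -> (n <= m)%N -> Fil 0 n d v -> Fil 0 m d v.
    move=> o nm; apply: spanS_mono => y [k [j [kj hy]]].
    exists k, (j + (m - n)./2)%N; split=> //; lia.
  move=> a x y [n [on Fx]] [m [om Fy]].
  exists (maxn n m); split; first by case: leqP.
  apply: (Fil_sub 0 _ d).2; [apply: mono Fx|apply: mono Fy]; rewrite ?leq_maxl ?leq_maxr //.
    by case: leqP => //; rewrite on om.
  by case: leqP => //; rewrite on om.
by move=> {}u [n np hu]; exists n; split=> //; exact: Fil_gr.
Qed.

(** The hypothesis holds separately for each [c], while [cm_crit] needs all [c] at once. Outside a
    fixed ball nothing has to be assumed: for large positive degree the commutator is in [J i] by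
    homogeneity, and for very negative degree the required index is at most 0. *)
Lemma cm_null_uniform p d z : (forall N, @FApar _ _ _ g Cliff setT p d (z N)) ->
  (forall c, null (F := triF g Cliff) (fun N => cm p d c (z N))) ->
  forall i : int, exists N0, forall N, (N0 <= N)%N ->
    exists v, [/\ @FAk_gr _ _ _ g Cliff setT 0 d v, p -> v = 0 & J i (z N - v)].
Proof.
move=> hz nz i; pose M1 := (`|i| + `|d.1|)%N.
have [N0 HN] : exists N0, forall N, (N0 <= N)%N -> forall c, c \in ball E M1 -> J i (cm p d c (z N)).
  elim: (ball E M1) => [|c s [N1 H1]]; first by exists 0%N.
  have [N2 H2] := nz c i; exists (maxn N1 N2) => N; rewrite geq_max => /andP[/H1 A /H2 A'] b.
  by rewrite inE => /orP[/eqP -> //|/A].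
exists N0 => N /HN Hb; have [n [on hn]] := FApar_Fil (hz N).
have [c|v [hv vo Jv]] := cm_crit (i := i) hn _; last by exists v; rewrite -on.
rewrite (@cm_odd n p) ?on ?oddb //.
have [cM|cM] := boolP (c \in ball E M1).
  by apply: (J_mono _ (Hb c cM)); rewrite gerDl ge_min lexx.
have [c0|c0] := lerP 0 (deg c).1.
  have di : i <= (deg c + d).1.
    rewrite bidegD /=; move: c0 cM; rewrite mem_ball /M1 -ltnNge; move: (deg c).1 (d.1) => x y; lia.
  rewrite addr0; apply: (J_mono di).
  have hg := FApar_gr (hz N).
  apply: (J_hom (G := G)); apply: (subsB (tgr_subspace G _)); first exact: (FA_gr_cons (gv c) hg).
  apply: (subsZ (tgr_subspace G _)); rewrite addrC; apply: FA_grM; first exact: hg.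
  exact: (FA_gr_gen _ _ (gv c)).
by apply: J_le0; move: c0 cM; rewrite mem_ball /M1 -ltnNge; move: (deg c).1 (d.1) => x y; lia.
Qed.

Lemma FAk0_scalar d v : @FAk_gr _ _ _ g Cliff setT 0 d v -> exists k : K, v = k *: (1 : C) /\ (d != 0 -> v = 0).
Proof.
apply: (spanS_ind (Q := [set v | exists k : K, v = k *: (1 : C) /\ (d != 0 -> v = 0)])).
  split; first by exists 0; rewrite scale0r.
  move=> a x y [k [xE x0]] [k' [yE y0]]; exists (a * k + k'); split.
    by rewrite xE yE scalerA -scalerDl.
  by move=> dn; rewrite x0 // y0 // scaler0 addr0.
move=> {}v [x [delta [_ <- ->]]]; rewrite !big_ord0; exists 1; rewrite scale1r; split=> //.
by rewrite eqxx.
Qed.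

Lemma crit_null p d z : p || (d != 0) -> (forall N, @FApar _ _ _ g Cliff setT p d (z N)) ->
  (forall c, null (F := triF g Cliff) (fun N => cm p d c (z N))) -> null (F := triF g Cliff) z.
Proof.
move=> pd hz nz i; have [N0 H] := cm_null_uniform hz nz i; exists N0 => N /H [v [hv vp Jv]].
have [k [_ v0]] := FAk0_scalar hv.
suff v00 : v = 0 by rewrite v00 subr0 in Jv.
by case/orP: pd => [/vp|/v0].
Qed.

Lemma crit_vac d z : (forall N, @FApar _ _ _ g Cliff setT false d (z N)) ->
  (forall c, null (F := triF g Cliff) (fun N => cm 0 d c (z N))) ->
  null (F := triF g Cliff) (fun N => z N - vac E (z N) *: (1 : C)).
Proof.
(* The level is at least 1 so that the vacuum functional kills the error and identifies the
   scalar. *)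
move=> hz nz i; have [N0 H] := cm_null_uniform hz nz (Num.max 1 i); exists N0 => N /H [v [hv _ Jv]].
have [k [vE _]] := FAk0_scalar hv.
have /eqP : vac E (z N - v) = 0.
  by apply: (@vac_J _ _ _ _ E (Num.max 1 i)) => //; rewrite lt_max ltr01.
rewrite (scalarB (vac_lin E)) subr_eq0 => /eqP ->.
rewrite vE (scalarZl (vac_lin E)) vac1 mulr1 -vE.
by apply: (J_mono _ Jv); rewrite le_max lexx orbT.
Qed.

End Criterion.

(** * The algebra W *)

Section MiddleExchange.
Variable K : fieldType.

Lemma tens_hom_indr (A X : lmodType K) (Jx : choiceType) (gX : Jx -> set X)
  (GX : grading gX) (Q : set (tens A X)) : subspace Q ->
  (forall a d x, gX d x -> Q (tpure a x)) -> forall w, Q w.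
Proof.
move=> sQ H; apply: tens_ind => // a x; have [s [_ _ ->]] := gpr_fin GX x.
rewrite (linsum (tpure_linr _)); apply: subssum => // d _.
by apply: H; exact: gpr_in.
Qed.
Lemma tens_hom_indl (A X : lmodType K) (Jx : choiceType) (gA : Jx -> set A)
  (GA : grading gA) (Q : set (tens A X)) : subspace Q ->
  (forall a d x, gA d a -> Q (tpure a x)) -> forall w, Q w.
Proof.
move=> sQ H; apply: tens_ind => // a x; have [s [_ _ ->]] := gpr_fin GA a.
rewrite (linsum (tpure_linl _)); apply: subssum => // d _.
by apply: H; exact: gpr_in.
Qed.

Lemma tlift_linf (A B V : lmodType K) (f1 f2 f : A -> B -> V) (k : K) :
  (forall b, linear (f1^~ b)) -> (forall a, linear (f1 a)) ->
  (forall b, linear (f2^~ b)) -> (forall a, linear (f2 a)) ->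
  (forall a b, f a b = k *: f1 a b + f2 a b) ->
  forall w, tlift f w = k *: tlift f1 w + tlift f2 w.
Proof.
move=> l1 r1 l2 r2 fE.
have fl b : linear (f^~ b) by move=> c x y; rewrite !fE (l1 b) (l2 b); module.
have fr a : linear (f a) by move=> c x y; rewrite !fE (r1 a) (r2 a); module.
have L1 := tlift_lin l1 r1; have L2 := tlift_lin l2 r2; have L := tlift_lin fl fr.
apply: tens_eq => // [|a b]; first by apply: linear_funD => //; exact: linear_funZ.
by rewrite !tlift_pure.
Qed.

Section GradedExtension.
Variables (V W : lmodType K) (Jv : choiceType) (gr : Jv -> set V) (G : grading gr).
Definition gext (f : Jv -> V -> W) (v : V) : W := \sum_(j \in [set: Jv]) f j (gpr G j v).

Lemma gextE (f : Jv -> V -> W) v s : (forall j, f j 0 = 0) -> uniq s ->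
  (forall j, j \notin s -> gpr G j v = 0) -> gext f v = \sum_(j <- s) f j (gpr G j v).
Proof. by move=> f0 us Hs; apply: fsbig_supp_seq => // j /Hs ->. Qed.

Lemma gext_lin (f : Jv -> V -> W) : (forall j, linear (f j)) -> linear (gext f).
Proof.
move=> fl k x y; have f0 j : f j 0 = 0 := lin0 (fl j).
have [s [us Hs _]] := gpr_fin G x; have [t [ut Ht _]] := gpr_fin G y.
pose r := undup (s ++ t); have ur : uniq r by exact: undup_uniq.
have Hx j : j \notin r -> gpr G j x = 0.
  by rewrite mem_undup mem_cat negb_or => /andP[/Hs].
have Hy j : j \notin r -> gpr G j y = 0.
  by rewrite mem_undup mem_cat negb_or => /andP[_ /Ht].
rewrite !(@gextE _ _ r) //; last first.
  by move=> j jr; rewrite (gpr_lin G) Hx // Hy // scaler0 addr0.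
rewrite scaler_sumr -big_split; apply: eq_bigr => j _ /=.
by rewrite (gpr_lin G) (fl j).
Qed.

Lemma gext_hom (f : Jv -> V -> W) d v : (forall j, f j 0 = 0) -> gr d v -> gext f v = f d v.
Proof.
move=> f0 gv; rewrite (@gextE _ _ [:: d]) //; last first.
  by move=> j; rewrite inE (gpr_id _ _ gv) => /negbTE ->.
by rewrite big_seq1 (gpr_id _ _ gv) eqxx.
Qed.

Lemma gext_linf (f1 f2 f : Jv -> V -> W) (k : K) :
  (forall j, f1 j 0 = 0) -> (forall j, f2 j 0 = 0) ->
  (forall j x, f j x = k *: f1 j x + f2 j x) ->
  forall v, gext f v = k *: gext f1 v + gext f2 v.
Proof.
move=> z1 z2 fE v; have [s [us Hs _]] := gpr_fin G v.
rewrite !(@gextE _ _ s) //; last by move=> j; rewrite fE z1 z2 scaler0 addr0.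
by rewrite scaler_sumr -big_split; apply: eq_bigr => j _; rewrite fE.
Qed.
End GradedExtension.

Section Twist.
Variables (X Y : lmodType K) (Jx Jy : choiceType) (gX : Jx -> set X) (gY : Jy -> set Y).
Variables (GX : grading gX) (GY : grading gY) (chi : Jx -> Jy -> K).
Let f x y : tens X Y := gext GX (fun d x => gext GY (fun d' y => chi d d' *: tpure x y) y) x.
Let inl x d : linear (fun y => gext GY (fun d' y => chi d d' *: tpure x y) y : tens X Y).
Proof. by apply: gext_lin => j; apply: linear_funZ; exact: tpure_linr. Qed.
Let inr y d : linear (fun x => gext GY (fun d' y => chi d d' *: tpure x y) y : tens X Y).
Proof.
move=> k x x'; apply: gext_linf => [j|j|j z]; rewrite ?tpure0r ?scaler0 //.
by rewrite tpure_linl; module.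
Qed.
Let fl y : linear (f^~ y).
Proof. by apply: gext_lin => d; exact: inr. Qed.
Let fr x : linear (f x).
Proof.
move=> k y y'; apply: gext_linf => [j|j|j z]; try exact: (lin0 (inr _ _)).
exact: inl.
Qed.
Definition ttwist : tens X Y -> tens X Y := tlift f.
Lemma ttwist_lin : linear ttwist. Proof. exact: tlift_lin. Qed.
Lemma ttwist_hom d d' x y : gX d x -> gY d' y ->
  ttwist (tpure x y) = chi d d' *: tpure x y.
Proof.
move=> gx gy; rewrite /ttwist tlift_pure // /f (gext_hom _ _ gx); last first.
  by move=> j; exact: (lin0 (inr _ _)).
by rewrite (gext_hom _ _ gy) // => j; rewrite tpure0r scaler0.
Qed.

Variables (A Z V : lmodType K) (q : A -> X -> Y -> Z -> V).
Hypotheses (q1 : forall x y z, linear (fun a => q a x y z))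
  (q2 : forall a y z, linear (fun x => q a x y z))
  (q3 : forall a x z, linear (fun y => q a x y z))
  (q4 : forall a x y, linear (fun z => q a x y z)).

Let m a z t := tlift (fun x y => q a x y z) t.
Let m_lin a z : linear (m a z). Proof. exact: tlift_lin. Qed.
Let m_lina z t : linear (fun a => m a z t).
Proof. by move=> k a a'; apply: tlift_linf => // x y; exact: q1. Qed.
Let m_linz a t : linear (fun z => m a z t).
Proof. by move=> k z z'; apply: tlift_linf => // x y; exact: q4. Qed.
Let h a x y z := m a z (ttwist (tpure x y)).
Let h2 a y z : linear (fun x => h a x y z).
Proof. exact: (lin_comp (m_lin a z) (lin_comp ttwist_lin (tpure_linl y))). Qed.
Let h3 a x z : linear (fun y => h a x y z).
Proof. exact: (lin_comp (m_lin a z) (lin_comp ttwist_lin (tpure_linr x))). Qed.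

(** The exchange of the two middle factors of (A (x) X) (x) (Y (x) Z), weighted by [chi], followed
    by [q]. It yields both the product of W and its triangular decomposition. *)
Definition exch (t1 : tens A X) (t2 : tens Y Z) : V :=
  tlift (fun a x => tlift (fun y z => h a x y z) t2) t1.
Let n_lin a x : linear (fun t2 => tlift (fun y z => h a x y z) t2).
Proof. by apply: tlift_lin => [z|y]; [exact: h3|exact: m_linz]. Qed.
Let n_lina x t2 : linear (fun a => tlift (fun y z => h a x y z) t2).
Proof.
move=> k a a'; apply: tlift_linf => [z|y|z|y|y z].
- exact: h3.
- exact: m_linz.
- exact: h3.
- exact: m_linz.
exact: m_lina.
Qed.
Let n_linx a t2 : linear (fun x => tlift (fun y z => h a x y z) t2).
Proof.
move=> k x x'; apply: tlift_linf => [z|y|z|y|y z].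
- exact: h3.
- exact: m_linz.
- exact: h3.
- exact: m_linz.
exact: h2.
Qed.
Lemma exch_linl t2 : linear (exch^~ t2).
Proof. by apply: tlift_lin => [x|a]; [exact: n_lina|exact: n_linx]. Qed.
Lemma exch_linr t1 : linear (exch t1).
Proof. by move=> k t t'; apply: tlift_linf => // a x; exact: n_lin. Qed.
Lemma exch_hom d d' a x y z : gX d x -> gY d' y ->
  exch (tpure a x) (tpure y z) = chi d d' *: q a x y z.
Proof.
move=> gx gy; rewrite /exch (tlift_pure (fun x => n_lina x _) (fun a => n_linx a _)).
rewrite (tlift_pure (h3 a x) (fun y => m_linz a (ttwist (tpure x y)))).
by rewrite /h (ttwist_hom gx gy) (linZ (m_lin a z)) /m tlift_pure.
Qed.
End Twist.

End MiddleExchange.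

(** * The product of W and its triangular decomposition *)

Section WeilAlgebra.
Variables (K : fieldType) (Gam : zmodType) (eps : commutation_factor K Gam).
Variables (g : quadColorLie eps) (E : hbasis g).
Notation ep := (ep eps).
Notation bideg := (bideg Gam).

Lemma grading_iff (V : lmodType K) (J : choiceType) (gr gr' : J -> set V) :
  (forall j v, gr j v <-> gr' j v) -> grading gr -> grading gr'.
Proof.
move=> H [pr l i id f]; apply: (@Grading _ _ _ _ pr) => //.
- by move=> j v; apply/H; exact: i.
- by move=> j j' v /H /id.
Qed.

Section OneSet.
Variables (P : set g) (D : set bideg) (HP : span_of E P D).
Hypothesis DD : forall d d', D d -> D d' -> D (d + d').
Notation W := (WA P).
Notation "u ** v" := (@WA_mul _ _ _ g P u v) (at level 40, left associativity).
Let GE : grading (@FA_gr _ _ _ g Env P) := FA_grading HP Env DD.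
Let GC : grading (@FA_gr _ _ _ g Cliff P) := FA_grading HP Cliff DD.

(** [xget] returns a map with the prescribed properties as soon as one exists, and [exch] with the
    commutation factor provides it. *)
Lemma WA_mul_spec : [/\ forall v, linear (fun w : W => w ** v), forall w, linear (fun v : W => w ** v) &
  forall (a c : FA Env P) (b e : FA Cliff P) d d', FA_gr d b -> FA_gr d' c ->
   tpure a b ** tpure c e = ep d d' *: tpure (a * c) (b * e)].
Proof.
pose S := [set m : W -> W -> W | [/\ forall v, linear (m^~ v),
    forall w, linear (m w)
    & forall (a c : FA Env P) (b e : FA Cliff P) d d',
        @FA_gr _ _ _ g Cliff P d b -> @FA_gr _ _ _ g Env P d' c ->
        m (tpure a b) (tpure c e) = ep d d' *: tpure (a * c) (b * e)]].
suff : S (@WA_mul _ _ _ g P) by [].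
apply: xgetPex.
pose q (a : FA Env P) (b : FA Cliff P) (c : FA Env P) (e : FA Cliff P) : W := tpure (a * c) (b * e).
have q1 b c e : linear (fun a => q a b c e).
  exact: (lin_comp (tpure_linl _) (FA_mulr_lin _)).
have q2 a c e : linear (fun b => q a b c e).
  exact: (lin_comp (tpure_linr _) (FA_mulr_lin _)).
have q3 a b e : linear (fun c => q a b c e).
  exact: (lin_comp (tpure_linl _) (FA_mull_lin _)).
have q4 a b c : linear (fun e => q a b c e).
  exact: (lin_comp (tpure_linr _) (FA_mull_lin _)).
exists (exch GC GE ep q); split=> [v|w|a c b e d d' hb hc].
- exact: exch_linl.
- exact: exch_linr.
- exact: exch_hom.
Qed.
Lemma WA_mul_linl v : linear (fun w : W => w ** v). Proof. by have [H _ _] := WA_mul_spec; exact: H. Qed.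
Lemma WA_mul_linr w : linear (fun v : W => w ** v). Proof. by have [_ H _] := WA_mul_spec; exact: H. Qed.
Lemma WA_mul_hom (a c : FA Env P) (b e : FA Cliff P) d d' : FA_gr d b -> FA_gr d' c ->
   tpure a b ** tpure c e = ep d d' *: tpure (a * c) (b * e).
Proof. by have [_ _ H] := WA_mul_spec; exact: H. Qed.
Lemma WA_ind (Q : set W) : subspace Q ->
  (forall d d' (a : FA Env P) (b : FA Cliff P), FA_gr d a -> FA_gr d' b -> Q (tpure a b)) ->
  forall w, Q w.
Proof.
move=> sQ H; apply: (tens_hom_indl GE sQ) => a d b ha.
have [s [_ _ ->]] := gpr_fin GC b; rewrite (linsum (tpure_linr _)).
by apply: subssum => // d' _; apply: (H d d') => //; exact: gpr_in.
Qed.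

Lemma WA_mulUx (a c : FA Env P) (e : FA Cliff P) : tpure a (1 : FA Cliff P) ** tpure c e = tpure (a * c) e.
Proof.
have [s [_ _ ->]] := gpr_fin GE c.
rewrite (linsum (tpure_linl _)) (linsum (WA_mul_linr _)) mulr_sumr (linsum (tpure_linl _)).
apply: eq_bigr => d _; rewrite (WA_mul_hom _ _ (FA_gr1 P Cliff) (gpr_in GE d c)).
by rewrite ep0l scale1r mul1r.
Qed.
Lemma WA_mulxC (a : FA Env P) (b e : FA Cliff P) : tpure a b ** tpure (1 : FA Env P) e = tpure a (b * e).
Proof.
have [s [_ _ ->]] := gpr_fin GC b.
rewrite (linsum (tpure_linr _)) (linsum (WA_mul_linl _)) mulr_suml (linsum (tpure_linr _)).
apply: eq_bigr => d _; rewrite (WA_mul_hom _ _ (gpr_in GC d b) (FA_gr1 P Env)).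
by rewrite ep0r scale1r mulr1.
Qed.

Lemma WA_mulA u v w : u ** (v ** w) = u ** v ** w.
Proof.
move: u; apply: WA_ind.
  apply: subspace_eq; first exact: WA_mul_linl.
  exact: (lin_comp (WA_mul_linl _) (WA_mul_linl _)).
move=> d1 d1' a1 b1 ha1 hb1; move: v; apply: WA_ind.
  apply: subspace_eq; first exact: (lin_comp (WA_mul_linr _) (WA_mul_linl _)).
  exact: (lin_comp (WA_mul_linl _) (WA_mul_linr _)).
move=> d2 d2' a2 b2 ha2 hb2; move: w; apply: WA_ind.
  apply: subspace_eq; first exact: (lin_comp (WA_mul_linr _) (WA_mul_linr _)).
  exact: WA_mul_linr.
move=> d3 d3' a3 b3 ha3 hb3 /=.
rewrite (WA_mul_hom _ _ hb2 ha3) (WA_mul_hom _ _ hb1 ha2).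
rewrite (linZ (WA_mul_linr _)) (linZ (WA_mul_linl _)).
rewrite (WA_mul_hom _ _ hb1 (FA_grM ha2 ha3)) (WA_mul_hom _ _ (FA_grM hb1 hb2) ha3).
rewrite !mulrA !scalerA epDl epDr; congr (_ *: _).
by ring.
Qed.

Definition WA_grading : grading (@WA_gr _ _ _ g P).
Proof.
apply: (grading_iff _ (tens_grading GE GC (fun d d' => d + d'))) => d w; split.
  by apply: spanS_mono => {}w [d1 [d2 [a [b [H ha hb ->]]]]]; exists a, b, d1, d2.
by apply: spanS_mono => {}w [a [b [d1 [d2 [ha hb H ->]]]]]; exists d1, d2, a, b.
Defined.

Lemma WA_gr_pure d1 d2 (a : FA Env P) (b : FA Cliff P) : FA_gr d1 a -> FA_gr d2 b ->
  WA_gr (d1 + d2) (tpure a b).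
Proof. by move=> ha hb; apply: spanS_sub; exists a, b, d1, d2. Qed.

Lemma WA_grM d d' (u v : W) : WA_gr d u -> WA_gr d' v -> WA_gr (d + d') (u ** v).
Proof.
move=> hu hv.
apply: (spanS_ind (Q := [set u | WA_gr (d + d') (u ** v)]) _ _ hu).
  by apply: (subspace_pre (WA_mul_linl _)); exact: spanS_subspace.
move=> u' [a [b [d1 [d2 [ha hb <- ->]]]]].
apply: (spanS_ind (Q := [set v | WA_gr (d1 + d2 + d') (tpure a b ** v)]) _ _ hv).
  by apply: (subspace_pre (WA_mul_linr _)); exact: spanS_subspace.
move=> v' [c [e [d3 [d4 [hc he <- ->]]]]] /=.
rewrite (WA_mul_hom _ _ hb hc) addrACA; apply: subsZ; first exact: spanS_subspace.
by apply: WA_gr_pure; exact: FA_grM.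
Qed.

Lemma WA_gr_support (R : set bideg) :
  (forall k d (u : FA k P), FA_gr d u -> ~ R d -> u = 0) ->
  (forall d d', R d -> R d' -> R (d + d')) ->
  forall d (w : W), WA_gr d w -> ~ R d -> w = 0.
Proof.
move=> H RD d w hw nR; move: hw; apply: (spanS_ind (subspace_0 _)).
move=> {}w [a [b [d1 [d2 [ha hb dE ->]]]]].
have [R1|n1] := pselect (R d1); last by rewrite (H _ _ _ ha n1) tpure0l.
have [R2|n2] := pselect (R d2); last by rewrite (H _ _ _ hb n2) tpure0r.
by case: nR; rewrite -dE; exact: RD.
Qed.
End OneSet.

Notation gM := (@gM _ _ _ g).
Notation gP := (@gP _ _ _ g).
Notation degM_add := (@degM_add Gam).
Notation degP_add := (@degP_add Gam).
Notation degT_add := (@degT_add Gam).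
Notation span_M := (span_M E).
Notation span_P := (span_P E).
Let HT : span_of E [set: g] [set: bideg] := @span_ofT _ _ _ g E.
Notation W := (WA [set: g]).
Notation "u ** v" := (@WA_mul _ _ _ g setT u v) (at level 40, left associativity).

Section Inclusion.
Variables (P : set g) (D : set bideg) (HP : span_of E P D).
Hypothesis DD : forall d d', D d -> D d' -> D (d + d').
Notation inc k := (@FAincl _ _ _ g k P setT).
Let DT d : D d -> [set: bideg] d. Proof. by []. Qed.
Let il k : linear (inc k) := FAincl_lin HP HT DT (k := k).

Lemma WAincl_lin : linear (@WAincl _ _ _ g P setT).
Proof. exact: (tmap_lin (il (k := Env)) (il (k := Cliff))). Qed.
Lemma WAincl_pure a b : @WAincl _ _ _ g P setT (tpure a b) = tpure (inc Env a) (inc Cliff b).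
Proof. exact: (tmap_pure (il (k := Env)) (il (k := Cliff))). Qed.
Lemma WAinclM u v : @WAincl _ _ _ g P setT (WA_mul u v) = WAincl setT u ** WAincl setT v.
Proof.
have ml := WA_mul_linl HP DD; have mr := WA_mul_linr HP DD.
have Ml := WA_mul_linl HT degT_add; have Mr := WA_mul_linr HT degT_add.
move: u; apply: (WA_ind HP DD).
  apply: subspace_eq; first exact: (lin_comp WAincl_lin (ml _)).
  exact: (lin_comp (Ml _) WAincl_lin).
move=> d1 d1' a1 b1 ha1 hb1; move: v; apply: (WA_ind HP DD).
  apply: subspace_eq; first exact: (lin_comp WAincl_lin (mr _)).
  exact: (lin_comp (Mr _) WAincl_lin).
move=> d2 d2' a2 b2 ha2 hb2 /=.
rewrite (WA_mul_hom HP DD _ _ hb1 ha2) (linZ WAincl_lin) !WAincl_pure.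
rewrite (WA_mul_hom HT degT_add _ _ (FAincl_FA_gr HP HT DT hb1) (FAincl_FA_gr HP HT DT ha2)).
by rewrite !(FAinclM HP HT DT).
Qed.
Lemma WAincl_gr d u : WA_gr d u -> WA_gr d (@WAincl _ _ _ g P setT u).
Proof.
apply: (spanS_ind (Q := [set u | WA_gr d (@WAincl _ _ _ g P setT u)])).
  by apply: (subspace_pre WAincl_lin); exact: spanS_subspace.
move=> {}u [a [b [d1 [d2 [ha hb <- ->]]]]] /=; rewrite WAincl_pure.
by apply: WA_gr_pure; exact: (FAincl_FA_gr HP HT DT).
Qed.
End Inclusion.

Let GPE : grading (@FA_gr _ _ _ g Env gP) := FA_grading span_P Env degP_add.
Let GMC : grading (@FA_gr _ _ _ g Cliff gM) := FA_grading span_M Cliff degM_add.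
Notation TW := (tens (WA gM) (WA gP)).
Notation tmuU := (@tmu _ _ (triF g Env)).
Notation tmuC := (@tmu _ _ (triF g Cliff)).
Notation tmuW := (@tmu _ _ (triW g)).

Let q (a : FA Env gM) (c : FA Env gP) (b : FA Cliff gM) (e : FA Cliff gP) : TW :=
  tpure (tpure a b) (tpure c e).
Let q1 c b e : linear (fun a => q a c b e).
Proof. exact: (lin_comp (tpure_linl _) (tpure_linl _)). Qed.
Let q2 a b e : linear (fun c => q a c b e).
Proof. exact: (lin_comp (tpure_linr _) (tpure_linl _)). Qed.
Let q3 a c e : linear (fun b => q a c b e).
Proof. exact: (lin_comp (tpure_linl _) (tpure_linr _)). Qed.
Let q4 a c b : linear (fun e => q a c b e).
Proof. exact: (lin_comp (tpure_linr _) (tpure_linr _)). Qed.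
Notation regroup := (exch GPE GMC ep q).
Let rl t : linear (regroup^~ t). Proof. exact: (exch_linl GPE GMC ep q1 q2 q3 q4). Qed.
Let rr t : linear (regroup t). Proof. exact: (exch_linr GPE GMC ep q1 q2 q3 q4). Qed.
Let rhom d d' a c b e : FA_gr d c -> FA_gr d' b ->
  regroup (tpure a c) (tpure b e) = ep d d' *: q a c b e.
Proof. exact: (exch_hom GPE GMC ep q1 q2 q3 q4). Qed.

(** The decompositions of U and Cl are combined by carrying the g_+ part of U past the g_- part of
    Cl; the commutation factor this costs is undone by the product of W ([tmuW_regroup]). *)
Definition splitW (w : W) : TW :=
  tlift (fun u v => regroup (split E u) (split E v)) w.
Let sUl : linear (@split _ _ _ g E Env) := @split_lin _ _ _ g E Env.
Let sCl : linear (@split _ _ _ g E Cliff) := @split_lin _ _ _ g E Cliff.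
Let sl v : linear (fun u => regroup (split E u) (split E v)).
Proof. exact: (lin_comp (rl _) sUl). Qed.
Let sr u : linear (fun v => regroup (split E u) (split E v)).
Proof. exact: (lin_comp (rr _) sCl). Qed.
Lemma splitW_lin : linear splitW. Proof. exact: tlift_lin. Qed.
Lemma splitW_pure u v : splitW (tpure u v) = regroup (split E u) (split E v).
Proof. exact: tlift_pure. Qed.

Let Ml := WA_mul_linl HT degT_add.
Let Mr := WA_mul_linr HT degT_add.
Lemma tmuW_bil : (forall b, linear (fun a : WA gM => WAincl setT a ** @WAincl _ _ _ g gP setT b : W)) /\
  (forall a, linear (fun b : WA gP => @WAincl _ _ _ g gM setT a ** WAincl setT b : W)).
Proof.
split=> [b|a]; first exact: (lin_comp (Ml _) (WAincl_lin span_M)).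
exact: (lin_comp (Mr _) (WAincl_lin span_P)).
Qed.
Lemma tmuW_lin : linear tmuW.
Proof. by have [? ?] := tmuW_bil; exact: tlift_lin. Qed.
Lemma tmuW_pure a b : tmuW (tpure a b) = WAincl setT a ** WAincl setT b.
Proof. by have [H1 H2] := tmuW_bil; exact: (tlift_pure H1 H2). Qed.

Lemma tmuW_q d d' a c b e : FA_gr d c -> FA_gr d' b ->
  tmuW (q a c b e) = ep d' d *: tpure (FAincl setT a * FAincl setT c) (FAincl setT b * FAincl setT e).
Proof.
move=> hc hb; rewrite tmuW_pure (WAincl_pure span_M) (WAincl_pure span_P).
by rewrite (WA_mul_hom HT degT_add _ _ (d := d') (d' := d)) //;
  [exact: (FAincl_FA_gr span_M HT)|exact: (FAincl_FA_gr span_P HT)].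
Qed.

Lemma tmuW_regroup t1 t2 : tmuW (regroup t1 t2) = tpure (tmuU t1) (tmuC t2).
Proof.
have tU := @tmuF_lin _ _ _ g E Env; have tC := @tmuF_lin _ _ _ g E Cliff.
move: t1; apply: (tens_hom_indr GPE).
  apply: subspace_eq; first exact: (lin_comp tmuW_lin (rl _)).
  exact: (lin_comp (tpure_linl _) tU).
move=> a d c hc; move: t2; apply: (tens_hom_indl GMC).
  apply: subspace_eq; first exact: (lin_comp tmuW_lin (rr _)).
  exact: (lin_comp (tpure_linr _) tC).
move=> b d' e hb /=; rewrite (rhom _ _ hc hb) (linZ tmuW_lin) (tmuW_q _ _ hc hb).
by rewrite scalerA epV scale1r !(tmuF_pure E).
Qed.

Lemma tmuWK w : tmuW (splitW w) = w.
Proof.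
apply: (tens_eq (f := tmuW \o splitW) (h := id)) => //.
  exact: (lin_comp tmuW_lin splitW_lin).
by move=> u v; rewrite /= splitW_pure tmuW_regroup !split_tmuK.
Qed.

Lemma splitWK t : splitW (tmuW t) = t.
Proof.
have ll : linear (splitW \o tmuW) := lin_comp splitW_lin tmuW_lin.
move: t; apply: tens_ind; first by apply: subspace_eq; [exact: ll|exact: lin_id].
move=> w1 w2; move: w1; apply: (WA_ind span_M degM_add).
  apply: subspace_eq; first exact: (lin_comp ll (tpure_linl _)).
  exact: tpure_linl.
move=> d1 d a b _ hb; move: w2; apply: (WA_ind span_P degP_add).
  apply: subspace_eq; first exact: (lin_comp ll (tpure_linr _)).
  exact: tpure_linr.
move=> d' d2 c e hc _ /=.
rewrite -[tpure (tpure a b) _]/(q a c b e) (tmuW_q _ _ hc hb) (linZ splitW_lin) splitW_pure.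
rewrite -!(tmuF_pure E) !tmu_splitK (rhom _ _ hc hb).
by rewrite scalerA epV scale1r.
Qed.

Definition triW_good : tri_good (triW g).
Proof.
apply: (@TriGood K Gam (triW g) splitW).
- exact: splitW_lin.
- exact: tmuWK.
- exact: splitWK.
- exact: (WA_grading span_M degM_add).
- exact: (WA_grading span_P degP_add).
- move=> d a ha /negP nR.
  apply: (WA_gr_support (P := gM) (R := @degM Gam) _ degM_add ha nR) => k d0 u hu /negP H.
  exact: (FA_gr_M E hu H).
- move=> d a ha /negP nR.
  apply: (WA_gr_support (P := gP) (R := [set d | 0 <= d.1]) _ _ ha nR).
    by move=> k d0 u hu /negP H; exact: (FA_gr_P E hu H).
  by move=> d0 d1; exact: addr_ge0.
- exact: (WAincl_lin span_M).
- exact: (WAincl_lin span_P).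
- exact: Ml.
- exact: Mr.
- exact: (WA_mulA HT degT_add).
- exact: (WA_grading HT degT_add).
- by move=> d a; exact: (WAincl_gr span_M).
- by move=> d a; exact: (WAincl_gr span_P).
- by move=> d d' u v; exact: (WA_grM HT degT_add).
- move=> d d' b b' hb hb'; exists (WA_mul b b'); first exact: (WA_grM span_P degP_add).
  by apply: esym; exact: (WAinclM span_P degP_add).
Defined.

End WeilAlgebra.

(** * Products and sums of convergent sequences *)

Section CompletionMore.
Variables (K : fieldType) (Gam : zmodType) (F : triangular K Gam) (G : tri_good F).
Notation J := (@J K Gam F).
Infix "**" := (@tmul K Gam F) (at level 40, left associativity).
Implicit Types (z y : nat -> tg F) (u v : hfam F).

Lemma hom_fam_hsum d (A : choiceType) (f : A -> tg F) :
  (forall a, tgr G d (f a)) -> hom_fam d (hsum F f).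
Proof.
move=> fd; split=> [c|c cd].
  have S : subspace (@hcomp _ _ F c) by exact: hcomp_subspace.
  by rewrite /hsum; elim/big_ind: _ => [|x y|a _]; [exact: subs0|exact: subsD|exact: (hin_comp G)].
by rewrite /hsum fsbig1 // => a _; exact: (hin_hom (fd a) cd).
Qed.

Lemma hom_famD d u v : hom_fam d u -> hom_fam d v -> hom_fam d (u + v : hfam F).
Proof.
move=> [hu du] [hv dv]; split=> [c|c cd]; last first.
    by transitivity (u c + v c); [|rewrite du // dv //; exact: addr0].
  have S : subspace (@hcomp _ _ F c) by exact: hcomp_subspace.
  change (@hcomp _ _ F c (u c + v c)).
  exact: (subsD S).
Qed.

(** Any approximations of degree 0 differ from the truncations of [u] and [v] by null sequences, and
    the telescoped difference of the products is null. *)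
Lemma approx_hmul2 z y u v : hom_fam 0 u -> hom_fam 0 v ->
  (forall N, tgr G 0 (z N)) -> (forall N, tgr G 0 (y N)) ->
  approx z u -> approx y v -> approx (fun N => z N ** y N) (hmul F u v).
Proof.
move=> hu hv gz gy az ay; apply: (approx_ext G (approx_hmul G hu hv)).
have nz := approx_null G (approx_trunc G hu) az; have ny := approx_null G (approx_trunc G hv) ay.
have n1 := null_mull G z ny.
have n2 := null_mulr (G := G) nz (fun N => trunc_gr G N hv).
apply: (null_ext (N0 := 0) _ (nullD G n1 n2)) => N _ /=.
rewrite (linB (mul_linr G _)) (linB (mul_linl G _)).
by rewrite [RHS]addrC addrA subrK.
Qed.

(* Only finitely many terms are not in J n, so that a sum of null sequences   *)
(* over growing balls is null.                                                *)
Lemma null_ball (A : eqType) (b : nat -> seq A) (f : A -> nat -> tg F) :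
  (forall N, uniq (b N)) -> (forall a, null (f a)) ->
  (forall n : int, exists s : seq A, forall N a, a \in b N -> a \notin s -> J n (f a N)) ->
  null (fun N => \sum_(a <- b N) f a N).
Proof.
move=> ub nf H n; have [s Hs] := H n.
have [N0 HN] : exists N0, forall N, (N0 <= N)%N -> forall a, a \in s -> J n (f a N).
  elim: s {Hs} => [|a s [N1 H1]]; first by exists 0%N.
  have [N2 H2] := nf a n; exists (maxn N1 N2) => N; rewrite geq_max => /andP[/H1 X /H2 Y] c.
  by rewrite inE => /orP[/eqP -> //|/X].
exists N0 => N /HN Hn; apply: (subs_seq (J_subspace G n)) => a ab.
by have [/Hn //|as_] := boolP (a \in s); exact: Hs.
Qed.

End CompletionMore.

Section NormalOrderedLimit.
Variables (K : fieldType) (Gam : zmodType) (eps : commutation_factor K Gam).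
Variables (g : quadColorLie eps) (E : hbasis g).
Hypothesis char0 : forall n, n.+1%:R != 0 :> K.
Variables k k' : algkind.
Hypothesis kbr0 : forall x y : g, kbr k x y = 0.
Hypothesis kfm0 : forall x y : g, kfm k x y = 0.

Lemma approx_qg d z (u : hfam (triF g k)) : hom_fam d u -> approx z u ->
  approx (F := triF g k') (fun N => qg E k' (z N)) (fun c => qq E k' (u c)).
Proof.
move=> hu az; have hq := qg_hom_fam E char0 k' kbr0 kfm0 hu.
apply: (approx_ext (triF_good E k') (approx_trunc (triF_good E k') hq)).
have n0 := approx_null (triF_good E k) (approx_trunc (triF_good E k) hu) az.
apply: (null_ext (N0 := 0) _ (qg_null E char0 k' kbr0 kfm0 n0)) => N _.
by rewrite (qg_trunc E k' kbr0 kfm0) (linB (qg_lin E k' kbr0 kfm0)).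
Qed.
End NormalOrderedLimit.

(** * The embeddings of U and Cl into W *)

Section Embeddings.
Variables (K : fieldType) (Gam : zmodType) (eps : commutation_factor K Gam).
Variables (g : quadColorLie eps) (E : hbasis g).
Notation ep := (ep eps).
Notation bideg := (bideg Gam).
Notation gM := (@gM _ _ _ g).
Notation gP := (@gP _ _ _ g).
Notation degT_add := (@degT_add Gam).
Notation span_M := (span_M E).
Notation span_P := (span_P E).
Let HT : span_of E [set: g] [set: bideg] := @span_ofT _ _ _ g E.
Notation U := (FA Env [set: g]).
Notation C := (FA Cliff [set: g]).
Notation "u ** v" := (@WA_mul _ _ _ g setT u v) (at level 40, left associativity).
Notation JU := (J (F := triF g Env)).
Notation JC := (J (F := triF g Cliff)).
Notation JW := (J (F := triW g)).
Let GW := triW_good E.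
Let GU := triF_good E Env.
Let GC := triF_good E Cliff.

Lemma J_pureC n (x : U) (y : C) : JC n y -> JW n (tpure x y).
Proof.
have [n0|/ltW n0] := lerP 0 n; last by move=> _; exact: J_le0.
move=> /(J_span GC n0); apply: (spanS_ind (Q := [set y | JW n (tpure x y)])).
  by apply: (subspace_pre (tpure_linr _)); exact: (J_subspace GW).
move=> {}y [z [d [b [hb nd ->]]]] /=.
change (JW n (tpure x ((z : C) * FAincl setT b))).
rewrite -(WA_mulxC HT degT_add).
have -> : tpure (1 : U) (FAincl setT b) = WAincl setT (tpure (1 : FA Env gP) b).
  by rewrite (WAincl_pure span_P) // (FAincl1 span_P HT).
apply: (J_mulp GW (d := d)) => //.
by rewrite -[d]add0r; apply: WA_gr_pure => //; exact: FA_gr1.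
Qed.

(** The factor of U(g_+) at the right end of [x] sits to the left of [y]. For homogeneous [y] the
    product of W moves it to the far right at the cost of a commutation factor. *)
Lemma J_pureU n (x : U) (y : C) : JU n x -> JW n (tpure x y).
Proof.
have [n0|/ltW n0] := lerP 0 n; last by move=> _; exact: J_le0.
move=> /(J_span GU n0); apply: (spanS_ind (Q := [set x | JW n (tpure x y)])).
  by apply: (subspace_pre (tpure_linl _)); exact: (J_subspace GW).
move=> {}x [z [d [b [hb nd ->]]]] /=.
change (JW n (tpure ((z : U) * FAincl setT b) y)).
have hib : FA_gr d (FAincl [set: g] b) by exact: (FAincl_FA_gr span_P HT).
have [s [_ _ ->]] := gpr_fin (Gg GC) y; rewrite (linsum (tpure_linr _)).
apply: (subssum (J_subspace GW n)) => d' _.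
have hy : FA_gr d' (gpr (Gg GC) d' y) := gpr_in (Gg GC) d' y.
move: (gpr _ _ _) hy => {}y hy.
have -> : tpure ((z : U) * FAincl setT b) y =
   ep d d' *: (tpure z y ** WAincl setT (tpure b (1 : FA Cliff gP))).
  rewrite (WAincl_pure span_P) // (FAincl1 span_P HT) //.
  by rewrite (WA_mul_hom HT degT_add _ _ hy hib) scalerA epV scale1r mulr1.
apply: (subsZ (J_subspace GW n)); apply: (J_mulp GW (d := d)) => //.
by rewrite -[d]addr0; apply: WA_gr_pure => //; exact: FA_gr1.
Qed.

Definition jC (w : tens (FA Cliff gM) (FA Cliff gP)) : tens (WA gM) (WA gP) :=
  tmap (fun a : FA Cliff gM => tpure (1 : FA Env gM) a)
       (fun b : FA Cliff gP => tpure (1 : FA Env gP) b) w.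
Definition jU (w : tens (FA Env gM) (FA Env gP)) : tens (WA gM) (WA gP) :=
  tmap (fun a : FA Env gM => tpure a (1 : FA Cliff gM))
       (fun b : FA Env gP => tpure b (1 : FA Cliff gP)) w.
Lemma jC_lin : linear jC. Proof. by apply: tmap_lin; exact: tpure_linr. Qed.
Lemma jU_lin : linear jU. Proof. by apply: tmap_lin; exact: tpure_linl. Qed.

Lemma tmu_jC w : @tmu _ _ (triW g) (jC w) = tpure (1 : U) (@tmu _ _ (triF g Cliff) w).
Proof.
have tC := @tmuF_lin _ _ _ g E Cliff.
move: w; apply: tens_eq => [||a b].
- exact: (lin_comp (tmuW_lin E) jC_lin).
- exact: (lin_comp (tpure_linr _) tC).
rewrite /jC tmap_pure; [|exact: tpure_linr|exact: tpure_linr].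
rewrite (tmuW_pure E) (tmuF_pure E) (WAincl_pure span_M) // (WAincl_pure span_P) //.
by rewrite (FAincl1 span_P HT) // (FAincl1 span_M HT) // (WA_mulxC HT degT_add).
Qed.
Lemma tmu_jU w : @tmu _ _ (triW g) (jU w) = tpure (@tmu _ _ (triF g Env) w) (1 : C).
Proof.
have tU := @tmuF_lin _ _ _ g E Env.
move: w; apply: tens_eq => [||a b].
- exact: (lin_comp (tmuW_lin E) jU_lin).
- exact: (lin_comp (tpure_linl _) tU).
rewrite /jU tmap_pure; [|exact: tpure_linl|exact: tpure_linl].
rewrite (tmuW_pure E) (tmuF_pure E) (WAincl_pure span_M) // (WAincl_pure span_P) //.
by rewrite (FAincl1 span_P HT) // (FAincl1 span_M HT) // (WA_mulUx HT degT_add).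
Qed.

Lemma jC_hcomp c w : @hcomp _ _ (triF g Cliff) c w -> @hcomp _ _ (triW g) c (jC w).
Proof.
apply: (spanS_ind (Q := [set w | @hcomp _ _ (triW g) c (jC w)])).
  by apply: (subspace_pre jC_lin); exact: spanS_subspace.
move=> {}w [al [be [a [b [H ha hb ->]]]]] /=.
rewrite /jC tmap_pure; [|exact: tpure_linr|exact: tpure_linr].
apply: spanS_sub; exists al, be, (tpure (1 : FA Env gM) a : WA gM), (tpure (1 : FA Env gP) b : WA gP).
  split=> //.
  by rewrite -[(_, al)]add0r; apply: WA_gr_pure => //; exact: FA_gr1.
by rewrite -[(_, be)]add0r; apply: WA_gr_pure => //; exact: FA_gr1.
Qed.
Lemma jU_hcomp c w : @hcomp _ _ (triF g Env) c w -> @hcomp _ _ (triW g) c (jU w).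
Proof.
apply: (spanS_ind (Q := [set w | @hcomp _ _ (triW g) c (jU w)])).
  by apply: (subspace_pre jU_lin); exact: spanS_subspace.
move=> {}w [al [be [a [b [H ha hb ->]]]]] /=.
rewrite /jU tmap_pure; [|exact: tpure_linl|exact: tpure_linl].
apply: spanS_sub; exists al, be, (tpure a (1 : FA Cliff gM) : WA gM), (tpure b (1 : FA Cliff gP) : WA gP).
  split=> //.
  by rewrite -[(_, al)]addr0; apply: WA_gr_pure => //; exact: FA_gr1.
by rewrite -[(_, be)]addr0; apply: WA_gr_pure => //; exact: FA_gr1.
Qed.

Lemma hom_fam_hinC d (u : hatC g) : hom_fam (F := triF g Cliff) d u -> hom_fam d (hinC u).
Proof.
move=> [hu du]; split=> [c|c /du cd]; first exact: jC_hcomp.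
by rewrite [LHS]/(jC (u c)) cd; exact: (lin0 jC_lin).
Qed.
Lemma hom_fam_hinU d (u : hatU g) : hom_fam (F := triF g Env) d u -> hom_fam d (hinU u).
Proof.
move=> [hu du]; split=> [c|c /du cd]; first exact: jU_hcomp.
by rewrite [LHS]/(jU (u c)) cd; exact: (lin0 jU_lin).
Qed.

Lemma null_pureC z : null (F := triF g Cliff) z -> null (F := triW g) (fun N => tpure (1 : U) (z N)).
Proof. by move=> nz n; have [N0 H] := nz n; exists N0 => N /H; exact: J_pureC. Qed.
Lemma null_pureU z : null (F := triF g Env) z -> null (F := triW g) (fun N => tpure (z N) (1 : C)).
Proof. by move=> nz n; have [N0 H] := nz n; exists N0 => N /H; exact: J_pureU. Qed.

Lemma approx_hinC d z (u : hatC g) : hom_fam (F := triF g Cliff) d u -> approx z u ->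
  approx (F := triW g) (fun N => tpure (1 : U) (z N)) (hinC u).
Proof.
move=> hu az; have hq := hom_fam_hinC hu.
apply: (approx_ext GW (approx_trunc GW hq)).
have n0 := approx_null GC (approx_trunc GC hu) az.
apply: (null_ext (N0 := 0) _ (null_pureC n0)) => N _.
rewrite (linB (tpure_linr _)) /trunc (linsum (tpure_linr _)); congr (_ - _).
by apply: eq_bigr => r _; rewrite -tmu_jC.
Qed.
Lemma approx_hinU d z (u : hatU g) : hom_fam (F := triF g Env) d u -> approx z u ->
  approx (F := triW g) (fun N => tpure (z N) (1 : C)) (hinU u).
Proof.
move=> hu az; have hq := hom_fam_hinU hu.
apply: (approx_ext GW (approx_trunc GW hq)).
have n0 := approx_null GU (approx_trunc GU hu) az.
apply: (null_ext (N0 := 0) _ (null_pureU n0)) => N _.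
rewrite (linB (tpure_linl _)) /trunc (linsum (tpure_linl _)); congr (_ - _).
by apply: eq_bigr => r _; rewrite -tmu_jU.
Qed.

End Embeddings.

(** * The square of the cubic element *)

Section NormalOrderedQuadratics.
Variables (K : fieldType) (Gam : zmodType) (eps : commutation_factor K Gam).
Variables (g : quadColorLie eps) (E : hbasis g).
Hypothesis char0 : forall n, n.+1%:R != 0 :> K.
Notation e := (@bvec _ _ _ _ E).
Notation e' := (@bdual _ _ _ _ E).
Notation B := (@qfm _ _ _ g).
Notation deg := (@bdeg _ _ _ _ E).
Notation gr := (@qgr _ _ _ g).
Notation ep := (ep eps).
Notation gv := (@bvec_gr _ _ _ _ E).
Notation gd := (@bdual_gr _ _ _ _ E).
Let HT : span_of E [set: g] [set: bideg Gam] := @span_ofT _ _ _ g E.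
Notation C := (FA Cliff [set: g]).
Notation gC x := (gen Cliff [set: g] x).
Notation gL x := (gen Ext [set: g] x).
Notation J := (J (F := triF g Cliff)).
Notation kappa := (kappa E).
Let G := triF_good E Cliff.
Let kb (x y : g) : kbr Ext x y = 0. Proof. by []. Qed.
Let kf (x y : g) : kfm Ext x y = 0. Proof. by []. Qed.

Lemma genT_lin k : linear (fun x : g => gen k [set: g] x).
Proof. by move=> a x y; rewrite (gen_lin HT). Qed.

Lemma form_coef (c c' : K) d d' x y : gr d x -> gr d' y -> (d + d' = 0 -> c = c') ->
  c * B x y = c' * B x y.
Proof.
move=> gx gy H; have [->|Bn] := eqVneq (B x y) 0; first by rewrite !mulr0.
by rewrite H //; exact: form_grP gx gy Bn.
Qed.

(** The normal ordered product :yz:. *)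
Definition no (y z : g) : C := gC y * gC z - kappa y z *: (1 : C).

Lemma no_linl z : linear (no^~ z).
Proof.
apply: linear_funB; first exact: (lin_comp (FA_mulr_lin _) (genT_lin Cliff)).
exact: (linear_scal (V := C) _ (kappa_linl E z)).
Qed.
Lemma no_linr y : linear (no y).
Proof.
apply: linear_funB; first exact: (lin_comp (FA_mull_lin _) (genT_lin Cliff)).
exact: (linear_scal (V := C) _ (kappa_linr E y)).
Qed.
Lemma vac_no y z : vac E (no y z) = 0.
Proof.
rewrite (scalarB (vac_lin E)) (scalarZl (vac_lin E)) vac1 mulr1.
by rewrite (vac_gen2 E) subrr.
Qed.

Lemma gC_comm d d' x y : gr d x -> gr d' y ->
  gC x * gC y = (2 * B x y) *: (1 : C) - ep d d' *: (gC y * gC x).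
Proof.
move=> gx gy; rewrite (gen_comm HT (k := Cliff) _ _ _ gx gy) // /kbr (gen0 HT) addr0.
by rewrite /= mulN1r scaleNr addrC.
Qed.

Lemma no_sym d d' y z : gr d y -> gr d' z -> no z y = - ep d' d *: no y z.
Proof.
move=> gy gz; rewrite /no (gC_comm gz gy).
have -> : kappa z y = 2 * B z y - ep d' d * kappa y z by rewrite -(kappa_sym E gz gy) addrK.
by module.
Qed.

(** A nonzero pairing forces opposite Z-degrees. Then theta is 1 for letters on the same side, 0 for
    a pair already in normal order and 2 for a reversed pair, which is the correction made by
    antisymmetrizing, keeping or reordering the pair. *)
Lemma qgL2 y z : qg E Cliff (gL y * gL z) = no y z.
Proof.
have ql := qg_lin E Cliff kb kf.
move: y; apply: (gr_expand E).
  apply: subspace_eq; last exact: no_linl.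
  exact: (lin_comp ql (lin_comp (FA_mulr_lin _) (genT_lin Ext))).
move=> d y gy /=; move: z; apply: (gr_expand E).
  apply: subspace_eq; last exact: no_linr.
  exact: (lin_comp ql (lin_comp (FA_mull_lin _) (genT_lin Ext))).
move=> d' z gz /=; rewrite (qg_gen2 E char0 Cliff kb kf gy gz) /no (kappa_gr E _ gy).
have T2 : 2^-1 * 2 - 1 = 0 :> K by rewrite mulVf ?subrr //; exact: (char0 1).
have G1 := gC_comm gy gz; move: (gC y * gC z) (gC z * gC y) G1 => u v uE.
have vE : ep d d' *: v = (2 * B y z) *: (1 : C) - u.
  by rewrite uE opprB addrC subrK.
rewrite !mulN1r !scaleNr vE {uE vE v}; set b := B y z.
case: eqP => [dd|dd].
  have tb : theta K d.1 * b = b.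
    rewrite -[RHS]mul1r; apply: form_coef gy gz _ => /(congr1 fst); rewrite /= => /eqP.
    rewrite addr_eq0 => /eqP d0; rewrite d0; rewrite d0 oppr_le0 in dd.
    have -> : d'.1 = 0 by apply/eqP; rewrite eq_le; case: (ltrgtP d'.1 0) dd.
    by rewrite oppr0 /theta ltxx eqxx.
  rewrite tb; apply: (cert0 (Z := (2^-1 * 2 - 1) *: (u - b *: (1 : C)))); last by rewrite T2 scale0r.
  by module.
case: ifP => d0.
  have -> : theta K d.1 * b = 0; last by rewrite scale0r subr0.
  rewrite -[RHS](mul0r b); apply: form_coef gy gz _ => /(congr1 fst); rewrite /= => /eqP.
  rewrite addr_eq0 => /eqP d1; move: d0 dd; rewrite d1 oppr_le0 /theta oppr_gt0 oppr_eq0.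
  by case: (ltrgtP d'.1 0).
have -> : theta K d.1 = 2 by rewrite /theta ltNge d0.
by module.
Qed.

Lemma vac_qgL2 d u : @FAk_gr _ _ _ g Ext setT 2 d u -> vac E (qg E Cliff u) = 0.
Proof.
have ql := qg_lin E Cliff kb kf.
apply: (spanS_ind (Q := [set u | vac E (qg E Cliff u) = 0])).
  apply: (@subspace_eq K K^o _ (fun u => vac E (qg E Cliff u)) (fun _ => 0)).
    by move=> a x y; rewrite ql (vac_lin E).
  exact: linear_fun0.
move=> {}u [x [delta [_ _ ->]]] /=.
by rewrite !big_ord_recl big_ord0 mulr1 qgL2 vac_no.
Qed.

Lemma scal_par d (c : K) : (c != 0 -> d = 0) -> FApar false d (c *: (1 : C)).
Proof.
have [-> _|c0 ->//] := eqVneq c 0.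
  by rewrite scale0r; apply: subs0; exact: FApar_subspace.
by apply: subsZ; [exact: FApar_subspace|exact: (FAk_gr_par (FAk_gr1 _ _))].
Qed.

Lemma no_par d d' y z : gr d y -> gr d' z -> FApar false (d + d') (no y z).
Proof.
move=> gy gz; apply: subsB; first exact: FApar_subspace.
  apply: (FAk_gr_par (n := 2)).
  by have := FAk_gr_cons gy (FAk_gr_gen setT Cliff gz).
apply: scal_par => k0; apply: (form_grP gy gz); move: k0; rewrite (kappa_gr E _ gy).
by apply: contra_neq => ->; rewrite mulr0.
Qed.

Lemma no_comm d1 d2 d y z w : gr d1 y -> gr d2 z -> gr d w ->
  no y z * gC w - ep (d1 + d2) d *: (gC w * no y z) =
  (2 * B z w) *: gC y - (2 * ep d2 d * B y w) *: gC z.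
Proof.
move=> gy gz gw; rewrite /no mulrBl mulrBr -palg_scalerAl -palg_scalerAr mul1r mulr1.
have kE : ep (d1 + d2) d * kappa y z = kappa y z.
  rewrite (kappa_gr E _ gy) mulrCA -[in RHS](mul1r (B y z)); congr (_ * _).
  by apply: form_coef gy gz _ => ->; rewrite ep0l.
have -> : gC y * gC z * gC w = (2 * B z w) *: gC y - ep d2 d *: (gC y * gC w * gC z).
  by rewrite -!mulrA (gC_comm gz gw) mulrBr -!palg_scalerAr mulr1.
have -> : gC y * gC w * gC z = (2 * B y w) *: gC z - ep d1 d *: (gC w * (gC y * gC z)).
  by rewrite (gC_comm gy gw) mulrBl -!palg_scalerAl mul1r !mulrA.
rewrite epDl; move: kE; rewrite epDl; move: (kappa y z) => kp kE.
apply: (cert0 (Z := (ep d1 d * ep d2 d * kp - kp) *: gC w)); last by rewrite kE subrr scale0r.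
by module.
Qed.

Lemma no_Jr d d' y z : gr d y -> gr d' z -> J d'.1 (no y z).
Proof.
move=> gy gz; have [d0|d0] := lerP d'.1 0; first exact: J_le0.
apply: (subsB (J_subspace G _)).
  apply: (J_ideal G); apply: (J_hom (G := G)); exact: FA_gr_gen.
have -> : kappa y z = 0; last by rewrite scale0r; exact: subs0 (J_subspace G _).
rewrite (kappa_gr E _ gy) -(mul0r (B y z)); apply: form_coef gy gz _ => /(congr1 fst) /=.
move=> /eqP; rewrite addr_eq0 => /eqP ->.
by rewrite /theta oppr_gt0 oppr_eq0; case: (ltrgtP d'.1 0) d0.
Qed.
Lemma no_Jl d d' y z : gr d y -> gr d' z -> J d.1 (no y z).
Proof.
move=> gy gz; rewrite (no_sym gz gy); apply: (subsZ (J_subspace G _)).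
exact: no_Jr gz gy.
Qed.

(* The approximations of the anticommutator of x with phi'.                   *)
Definition Gam_ (N : nat) (x : g) : C := 2^-1 *: \sum_(a <- ball E N) no (qbr x (e' a)) (e a).

Lemma vac_Gam N x : vac E (Gam_ N x) = 0.
Proof.
rewrite (scalarZl (vac_lin E)) (scalarsum (vac_lin E)) big1 ?mulr0 // => a _.
exact: vac_no.
Qed.
Lemma Gam_par N d x : gr d x -> FApar false d (Gam_ N x).
Proof.
move=> gx; apply: subsZ; first exact: FApar_subspace.
apply: subssum => [|a _]; first exact: FApar_subspace.
have := no_par (qbr_gr gx (gd a)) (gv a); by rewrite subrK.
Qed.

(** Commuting a normal ordered pair with y leaves single letters. Invariance of B identifies their
    coefficients with coordinates of y and [x, y], and the two bounds make the truncated expansions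
    of these vectors exact, so the identity holds without error term. *)
Lemma Gam_comm N d d' x y : gr d x -> gr d' y ->
  (`|d'.1| <= N)%N -> (`|(d + d')%R.1| <= N)%N ->
  Gam_ N x * gC y - ep d d' *: (gC y * Gam_ N x) = 2 *: gC (qbr x y).
Proof.
move=> gx gy d'N dN; have two := char0 1.
rewrite /Gam_ -palg_scalerAl -palg_scalerAr mulr_suml mulr_sumr.
have H a : no (qbr x (e' a)) (e a) * gC y - ep d d' *: (gC y * no (qbr x (e' a)) (e a)) =
   2 *: (B (e a) y *: gC (qbr x (e' a)) + B (qbr x y) (e' a) *: gC (e a)).
  have := no_comm (qbr_gr gx (gd a)) (gv a) gy; rewrite subrK => ->.
  have -> : B (qbr x y) (e' a) = - (ep (deg a) d' * B (qbr x (e' a)) y).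
    rewrite (qbr_skew gx (gd a)) formNl formZl (qfm_inv (e' a) x y) (qfm_sym (gd a) (qbr_gr gx gy)).
    rewrite epNr epNl epDl mulrN opprK.
    have V1 := epV eps d (deg a); have V2 := epV eps d' (deg a).
    move: (B (qbr x y) (e' a)) => b.
    have -> : ep (deg a) d' * (ep (deg a) d * (ep d (deg a) * ep d' (deg a) * b)) =
      (ep d (deg a) * ep (deg a) d) * ((ep d' (deg a) * ep (deg a) d') * b) by ring.
    by rewrite V1 V2 !mul1r.
  by module.
have -> : 2^-1 *: (\sum_(i <- ball E N) no (qbr x (e' i)) (e i) * gC y) - ep d d' *: (2^-1 *:
    (\sum_(i <- ball E N) gC y * no (qbr x (e' i)) (e i))) =
  2^-1 *: (\sum_(a <- ball E N) (no (qbr x (e' a)) (e a) * gC y - ep d d' *: (gC y * no (qbr x (e' a)) (e a)))).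
  by rewrite sumrB -scaler_sumr; module.
rewrite (eq_bigr _ (fun a _ => H a)) -scaler_sumr scalerA mulVf // scale1r big_split /=.
rewrite -(linsumZ (lin_comp (genT_lin Cliff) (qbr_linr x))) /= (ball_dual_exp E gy) //.
rewrite -(linsumZ (genT_lin Cliff)) (ball_exp E (qbr_gr gx gy)) //.
by module.
Qed.

(** Both truncations converge to the same element. This allows a truncation to be enlarged by a
    fixed amount where exact commutation needs room. *)
Lemma Gam_shift_null j d x : gr d x -> null (F := triF g Cliff) (fun N => Gam_ (N + j) x - Gam_ N x).
Proof.
move=> gx; pose f a : tg (triF g Cliff) := no (qbr x (e' a)) (e a).
have A i : approx (F := triF g Cliff) (fun N => \sum_(a <- ball E (N + i)) f a) (hsum (triF g Cliff) f).
  apply: (approx_hsum G) => [N|n]; first exact: ball_uniq.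
  exists (`|n| + `|d.1|)%N => N a Nn; rewrite mem_ball -ltnNge => aN.
  have [a0|a0] := lerP 0 (deg a).1.
    apply: (J_mono _ (no_Jr (qbr_gr gx (gd a)) (gv a))).
    by move: a0 Nn aN; move: (deg a).1 d.1 => p q; lia.
  apply: (J_mono _ (no_Jl (qbr_gr gx (gd a)) (gv a))).
  rewrite bidegD /=.
  by move: a0 Nn aN; move: (deg a).1 d.1 => p q; lia.
have := nullZ G (2^-1) (approx_null G (A j) (A 0%N)).
by apply: (null_ext (N0 := 0)) => N _; rewrite addn0 scalerBr.
Qed.

End NormalOrderedQuadratics.

(** * The Kac-Peterson cocycle as a vacuum value *)

Section KacPeterson.
Variables (K : fieldType) (Gam : zmodType) (eps : commutation_factor K Gam).
Variables (g : quadColorLie eps) (E : hbasis g).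
Hypothesis char0 : forall n, n.+1%:R != 0 :> K.
Notation I := (bidx E).
Notation e := (@bvec _ _ _ _ E).
Notation e' := (@bdual _ _ _ _ E).
Notation B := (@qfm _ _ _ g).
Notation deg := (@bdeg _ _ _ _ E).
Notation gr := (@qgr _ _ _ g).
Notation ep := (ep eps).
Notation gv := (@bvec_gr _ _ _ _ E).
Notation gd := (@bdual_gr _ _ _ _ E).
Notation kappa := (kappa E).
Notation degM := (@degM Gam).
Notation degP := (@degP Gam).

Lemma gproj_hom (D : set (bideg Gam)) d x : gr d x ->
  gproj D x = if `[< D d >] then x else 0.
Proof.
move=> gx; pose u d' : g := if d' == d then x else 0.
have u0 c : c \notin [:: d] -> u c = 0 by rewrite inE /u => /negbTE ->.
have ud : decomposes (@qgr _ _ _ g) u x.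
  split; first exact: (finite_supp u0).
    by move=> c; rewrite /u; case: eqP => [->//|_]; exact: gr0.
  by rewrite (fsbig_supp_seq _ u0) // big_seq1 /u eqxx.
rewrite /gproj; have -> : components (@qgr _ _ _ g) x = u.
  rewrite /components; apply: xget_unique => // v vd.
  have [w [_ wu]] := (qgr_sum g).2 x.
  by rewrite -(wu _ vd) (wu _ ud).
rewrite fsbig_mkcond.
rewrite (fsbig_supp_seq (s := [:: d])) //; last first.
  by move=> c /u0 uc; rewrite /patch uc; case: ifP.
rewrite big_seq1 /patch /u eqxx.
by case: asboolP => H; [rewrite mem_set|rewrite memNset].
Qed.

(** The two indicator functions are the index ranges of the two traces in [psiKP]. The last term
    comes from the value 1 of [theta] in degree 0 and cancels after summation. *)
Lemma theta_diff (i p : int) :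
  theta K (- p) - theta K (- (i + p)) =
  2 * ((p < 0) && (- i <= p))%:R - 2 * ((0 < p) && (p <= - i))%:R
  + (if 0 < i then 1 else if i < 0 then -1 else 0) * ((p == 0)%:R - (p == - i)%:R).
Proof.
have E1 : (0 < - (i + p)) = (p < - i) by lia.
have E2 : (- (i + p) == 0) = (p == - i) by lia.
rewrite /theta E1 E2 oppr_gt0 oppr_eq0 {E1 E2}.
by case: (ltrgtP p 0) => Hp; case: (ltrgtP i 0) => Hi; case: (ltrgtP p (- i)) => Hq;
  (try by exfalso; lia); rewrite /=; ring.
Qed.

Section Pair.
Variables (d d' : bideg Gam) (x y : g).
Hypotheses (gx : gr d x) (gy : gr d' y).
Let t (x y : g) a := B (qbr x (qbr y (e' a))) (e a).
Notation brxy a := (qbr_gr gx (qbr_gr gy (gd a))).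

(** The vacuum value of the truncated bracket of gamma(x) and gamma(y) ([vac_brG]). *)
Definition kp_sum N := \sum_(a <- ball E N)
  (kappa (qbr x (qbr y (e' a))) (e a) + ep d (d' - deg a) * kappa (qbr y (e' a)) (qbr x (e a))).

Lemma kp_term a : kappa (qbr x (qbr y (e' a))) (e a)
  + ep d (d' - deg a) * kappa (qbr y (e' a)) (qbr x (e a)) =
  (theta K (d.1 + d'.1 - (deg a).1) - theta K (d'.1 - (deg a).1)) * t x y a.
Proof.
rewrite (kappa_gr E _ (brxy a)) (kappa_gr E _ (qbr_gr gy (gd a))).
rewrite -(qfm_inv (qbr y (e' a)) x) (qbr_skew (qbr_gr gy (gd a)) gx) formNl formZl.
have V := epV eps d (d' - deg a).
rewrite -[(d + (d' - deg a)).1]/(d.1 + (d'.1 - (deg a).1)) addrA -/(t x y a).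
move: (ep d (d' - deg a)) (ep (d' - deg a) d) V => p p' V.
have -> : p * (theta K (d' - deg a).1 * - (p' * t x y a)) = - (p * p') * (theta K (d' - deg a).1 * t x y a) by ring.
by rewrite V mulrBl mulN1r.
Qed.

Lemma t_deg a : d + d' != 0 -> t x y a = 0.
Proof.
move=> dd; rewrite -(mul0r (t x y a)) -[LHS](mul1r (t x y a)).
apply: (form_coef (brxy a) (gv a)); rewrite addrA subrK => /eqP.
by rewrite (negbTE dd).
Qed.

Lemma trans a : d + d' = 0 ->
  t x y a = ep d d' * (ep (deg a) (deg a) * B (qbr y (qbr x (e a))) (e' a)).
Proof.
move=> dd; rewrite /t (qbr_skew gx (qbr_gr gy (gd a))) formNl formZl qfm_inv.
rewrite (qbr_skew gy (gd a)) formNl formZl qfm_inv.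
rewrite (qfm_sym (gd a) (qbr_gr gy (qbr_gr gx (gv a)))) addrA [d' + d]addrC dd add0r.
have -> : d' = - d by apply/eqP; rewrite -addr_eq0 addrC dd.
rewrite !epE.
have V := epV eps d (deg a); have S := ep_sqr eps d.
move: (B _ _) (ep d (deg a)) (ep (deg a) d) V => b p p' V.
have -> : - (ep d d * p' * - (p * (ep (deg a) (deg a) * b))) =
  (p * p') * (ep d d * (ep (deg a) (deg a) * b)) by ring.
by rewrite V mul1r.
Qed.

End Pair.

Lemma tr_ball d d' x y n : gr d x -> gr d' y -> (`|d'.1| <= n)%N ->
  trEps (E := E) [set: I] (qbr x \o gproj degM \o qbr y \o gproj degP) =
  \sum_(a <- ball E n | (0 < (deg a).1) && (d'.1 + (deg a).1 <= 0))
    ep (deg a) (deg a) * B (qbr x (qbr y (e a))) (e' a).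
Proof.
move=> gx gy dn; rewrite /trEps.
pose F a := if (0 < (deg a).1) && (d'.1 + (deg a).1 <= 0) then
    ep (deg a) (deg a) * B (qbr x (qbr y (e a))) (e' a) else 0.
have FE a : ep (deg a) (deg a) *
    B ((qbr x \o gproj degM \o qbr y \o gproj degP) (e a)) (e' a) = F a.
  rewrite /= (gproj_hom _ (gv a)) /F; case: asboolP => [a0|/negP a0]; last first.
    rewrite (negbTE a0) /= br0r (gproj_hom _ (gr0 g 0)) if_same br0r.
    by rewrite (scalar0 (qfm_linl _)) mulr0.
  have a0' : 0 < (deg a).1 by [].
  rewrite (gproj_hom _ (qbr_gr gy (gv a))) a0' /=.
  case: asboolP => [H|/negP H]; first by rewrite ifT.
  rewrite ifF; last exact/negbTE.
  by rewrite br0r (scalar0 (qfm_linl _)) mulr0.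
rewrite (@fsbig_supp_seq K K^o _ (ball E n)); [|exact: ball_uniq|].
  by rewrite [RHS]big_mkcond /=; apply: eq_bigr => a _; exact: FE.
move=> a; rewrite FE mem_ball /F -ltnNge; case: ifP => // H1 H2; exfalso.
by move: H1 H2 dn; move: (deg a).1 d'.1 => p q; lia.
Qed.

Lemma psiKP0 d d' x y : gr d x -> gr d' y -> d + d' != 0 -> psiKP E d d' x y = 0.
Proof.
move=> gx gy dd.
have H a : B (qbr x (qbr y (e a))) (e' a) = 0.
  rewrite -[LHS]mul1r -[RHS](mul0r (B (qbr x (qbr y (e a))) (e' a))).
  apply: (form_coef (qbr_gr gx (qbr_gr gy (gv a))) (gd a)).
  by rewrite addrA addrK => /eqP; rewrite (negbTE dd).
have H' a : B (qbr y (qbr x (e a))) (e' a) = 0.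
  rewrite -[LHS]mul1r -[RHS](mul0r (B (qbr y (qbr x (e a))) (e' a))).
  apply: (form_coef (qbr_gr gy (qbr_gr gx (gv a))) (gd a)).
  by rewrite addrA addrK addrC => /eqP; rewrite (negbTE dd).
rewrite /psiKP (tr_ball gx gy (leqnn _)) (tr_ball gy gx (leqnn _)).
rewrite !big1 ?mulr0 ?subrr // => a _; first by rewrite H' mulr0.
by rewrite H mulr0.
Qed.

(** Invariance turns each summand into a difference of two values of [theta] times B([x, [y, e^a]],
    e_a). By [theta_diff] the sum is twice the difference of the two projected traces, and a
    cyclicity argument removes the boundary terms. *)
Lemma KP_vac d d' x y N : gr d x -> gr d' y -> (`|d.1| <= N)%N -> (`|d'.1| <= N)%N ->
  kp_sum d d' x y N = 4 * psiKP E d d' x y.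
Proof.
move=> gx gy dN dN'; have [dd|dd] := eqVneq (d + d') 0; last first.
  rewrite (psiKP0 gx gy dd) mulr0 /kp_sum big1 // => a _.
  by rewrite (kp_term gx gy) (t_deg gx gy _ dd) mulr0.
pose t a := B (qbr x (qbr y (e' a))) (e a).
have d'E : d'.1 = - d.1 by apply/eqP; rewrite -addr_eq0 addrC; move/(congr1 fst): dd => /= ->.
have T1 : trEps (E := E) [set: I] (qbr x \o gproj degM \o qbr y \o gproj degP) =
    \sum_(a <- ball E N | ((deg a).1 < 0) && (- d.1 <= (deg a).1)) t a.
  rewrite (tr_ball gx gy dN') d'E.
  pose f (u v : g) : K^o := B (qbr x (qbr y u)) v.
  rewrite -(@canonical_sym _ _ _ _ E K^o f (fun i => (0 < i) && (- d.1 + i <= 0))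
     (fun i => (i < 0) && (- d.1 <= i))) //.
  - by move=> v c u u'; rewrite /f qbr_linr qbr_linr qfm_linl.
  - by move=> v c u u'; rewrite /f qfm_linr.
  - by move=> i _; rewrite oppr_gt0 -opprD oppr_le0 -lerBlDl sub0r.
have T2 : ep d d' * trEps (E := E) [set: I] (qbr y \o gproj degM \o qbr x \o gproj degP) =
    \sum_(a <- ball E N | (0 < (deg a).1) && ((deg a).1 <= - d.1)) t a.
  rewrite (tr_ball gy gx dN) mulr_sumr; apply: eq_big => a.
    by rewrite -lerBrDl sub0r.
  by move=> _; rewrite -(trans gx gy _ dd).
(* Cyclicity of the graded trace: ad x ad y on the slice of degree 0 factors through ad y and ad x
   between two finite-dimensional slices, and reversing the order moves the trace to the other
   slice. *)
have cyc : \sum_(a <- ball E N | (deg a).1 == 0) t a = \sum_(a <- ball E N | (deg a).1 == - d.1) t a.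
  have bE a : (deg a).1 == 0 ->
      t a = \sum_(b <- ball E N) B (qbr y (e' a)) (e' b) * B (qbr x (e b)) (e a).
    move=> /eqP a0; have aN : (`|(d' - deg a)%R.1| <= N)%N by rewrite /= a0 subr0.
    rewrite /t -{1}(ball_exp E (qbr_gr gy (gd a)) aN) (linsumZ (qbr_linr x)) form_suml.
    by apply: eq_bigr => b _; rewrite formZl.
  rewrite (eq_bigr _ bE) exchange_big /= [RHS]big_mkcond /=; apply: eq_bigr => b _.
  have sE a : B (qbr x (e b)) (e a) = ep (d + deg b) (d + deg b) * B (e a) (qbr x (e b)).
    rewrite (qfm_sym (qbr_gr gx (gv b)) (gv a)).
    apply: form_coef (gv a) (qbr_gr gx (gv b)) _ => /eqP.
    by rewrite addr_eq0 => /eqP ->; rewrite epNr.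
  have [b0|b0] := eqVneq (deg b).1 (- d.1); last first.
    rewrite big1 // => a /eqP a0; rewrite sE -(mul0r (B (e a) (qbr x (e b)))) mulrA.
    apply: form_coef (gv a) (qbr_gr gx (gv b)) _ => /(congr1 fst) /= /eqP.
    by rewrite a0 add0r addrC addr_eq0 (negbTE b0).
  rewrite (eq_bigr (fun a => ep (d + deg b) (d + deg b) * (B (e a) (qbr x (e b)) * B (qbr y (e' a)) (e' b)))); last first.
    by move=> a _; rewrite sE mulrC mulrA.
  rewrite -mulr_sumr big_mkcond /=.
  rewrite (eq_bigr (fun a => B (B (e a) (qbr x (e b)) *: qbr y (e' a)) (e' b))); last first.
    move=> a _; rewrite formZl; case: eqP => // a0; apply/esym.
    rewrite -(mul0r (B (e a) (qbr x (e b)))) mulrC.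
    apply: form_coef (gv a) (qbr_gr gx (gv b)) _ => /(congr1 fst) /=.
    by rewrite b0 subrr addr0 => /a0.
  rewrite -form_suml -(linsumZ (qbr_linr y)) (ball_dual_exp E (qbr_gr gx (gv b))); last first.
    by rewrite /= b0 subrr.
  rewrite /t (trans gx gy _ dd) mulrA; congr (_ * _).
  have -> : d' = - d by apply/eqP; rewrite -addr_eq0 addrC dd.
  have V := epV eps d (deg b).
  rewrite !epE; move: (ep d (deg b)) (ep (deg b) d) V => p p' V.
  by transitivity ((p * p') * (ep d d * ep (deg b) (deg b))); [ring|rewrite V mul1r].
rewrite /kp_sum /psiKP -mulrA T2 T1.
pose s : K := if 0 < d.1 then 1 else if d.1 < 0 then -1 else 0.
pose ch (b : bool) : K := b%:R.
rewrite (eq_bigr (fun a => 2 * (ch (((deg a).1 < 0) && (- d.1 <= (deg a).1)) * t a)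
   - 2 * (ch ((0 < (deg a).1) && ((deg a).1 <= - d.1)) * t a)
   + s * (ch ((deg a).1 == 0) * t a - ch ((deg a).1 == - d.1) * t a))); last first.
  move=> a _; rewrite (kp_term gx gy) d'E -/(t a) addrN add0r.
  transitivity ((2 * ch (((deg a).1 < 0) && (- d.1 <= (deg a).1)) - 2 * ch ((0 < (deg a).1) && ((deg a).1 <= - d.1))
    + s * (ch ((deg a).1 == 0) - ch ((deg a).1 == - d.1))) * t a); last by ring.
  by congr (_ * _); rewrite -opprD; exact: theta_diff.
rewrite big_split sumrB /= -!mulr_sumr sumrB.
have chE (P : pred int) : \sum_(a <- ball E N) ch (P (deg a).1) * t a = \sum_(a <- ball E N | P (deg a).1) t a.
  rewrite [RHS]big_mkcond /=; apply: eq_bigr => a _; rewrite /ch.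
  by case: (P _); rewrite ?mul1r ?mul0r.
rewrite (chE (fun i => (i < 0) && (- d.1 <= i))) (chE (fun i => (0 < i) && (i <= - d.1))).
rewrite (chE (fun i => i == 0)) (chE (fun i => i == - d.1)) cyc subrr mulr0 addr0.
have T4 : 4 * 2^-1 - 2 = 0 :> K.
  have -> : 4 = 2 * 2 :> K by rewrite -natrM.
  by rewrite mulfK ?subrr //; exact: (char0 1).
move: (\sum_(a <- _ | _) _) (\sum_(a <- _ | _) _) => u v.
apply/eqP; rewrite -subr_eq0; apply/eqP.
transitivity (- (4 * 2^-1 - 2) * (v - u)); first by ring.
by rewrite T4 oppr0 mul0r.
Qed.
End KacPeterson.

(** * Commutators with the quantized tensors *)

Section ContractionLimits.
Variables (K : fieldType) (Gam : zmodType) (eps : commutation_factor K Gam).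
Variables (g : quadColorLie eps) (E : hbasis g).
Hypothesis char0 : forall n, n.+1%:R != 0 :> K.
Notation e := (@bvec _ _ _ _ E).
Notation e' := (@bdual _ _ _ _ E).
Notation B := (@qfm _ _ _ g).
Notation deg := (@bdeg _ _ _ _ E).
Notation gr := (@qgr _ _ _ g).
Notation ep := (ep eps).
Notation gv := (@bvec_gr _ _ _ _ E).
Notation gd := (@bdual_gr _ _ _ _ E).
Notation span_P := (span_P E).
Notation gM := (@gM _ _ _ g).
Notation gP := (@gP _ _ _ g).
Let HT : span_of E [set: g] [set: bideg Gam] := @span_ofT _ _ _ g E.
Notation C := (FA Cliff [set: g]).
Notation L := (FA Ext [set: g]).
Notation gC x := (gen Cliff [set: g] x).
Notation gL x := (gen Ext [set: g] x).
Notation JL := (J (F := triF g Ext)).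
Notation contr := (@contr _ _ _ g E setT Ext).
Notation qgL := (qg E Cliff).
Notation Gam_ := (Gam_ E).
Let GC := triF_good E Cliff.
Let GL := triF_good E Ext.
Let kb (x y : g) : kbr Ext x y = 0. Proof. by []. Qed.
Let kf (x y : g) : kfm Ext x y = 0. Proof. by []. Qed.
Let cl x : linear (contr x) := contr_linr HT kb kf x.

Lemma contr_FAgr d d' x u : gr d' x -> @FA_gr _ _ _ g Ext setT d u ->
  FA_gr (d' + d) (contr x u).
Proof.
move=> gx; apply: (spanS_ind (Q := [set u | FA_gr (d' + d) (contr x u)])).
  by apply: (subspace_pre (cl x)); exact: spanS_subspace.
move=> {}u [[|n] _ hu] /=; last exact: (FAk_gr_FA (contr_grS HT kb kf gx hu)).
have -> : contr x u = 0 by exact: (contr_grS HT kb kf gx hu).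
by apply: subs0; exact: FA_gr_subspace.
Qed.

(** Contracting a product z b either leaves b intact or replaces it by an element whose degree is
    changed by that of x. Contraction is thus continuous up to a fixed shift. *)
Lemma contr_J n d' x y : gr d' x -> JL n y -> JL (n - `|d'.1|) (contr x y).
Proof.
move=> gx; have [n0|n0] := lerP 0 n; last first.
  by move=> _; apply: J_le0; rewrite subr_le0 (le_trans (ltW n0)) // normr_ge0.
move=> /(J_span GL n0); apply: (spanS_ind (Q := [set y | JL (n - `|d'.1|) (contr x y)])).
  by apply: (subspace_pre (cl x)); exact: (J_subspace GL).
move=> {}y [z [d [b [hb nd ->]]]] /=.
change (JL (n - `|d'.1|) (contr x ((z : L) * FAincl setT b))).
have hib : FA_gr d (FAincl [set: g] b) by exact: (FAincl_FA_gr span_P HT).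
have [s [_ _ ->]] := gpr_fin (Gg GL) z; rewrite mulr_suml (linsum (cl x)).
apply: (subssum (J_subspace GL _)) => d1 _.
have : FA_gr d1 (gpr (Gg GL) d1 z) := gpr_in (Gg GL) d1 z.
apply: (spanS_ind (Q := [set z : L | JL (n - `|d'.1|) (contr x (z * FAincl [set: g] b))])).
  by apply: (subspace_pre (lin_comp (cl x) (FA_mulr_lin _))); exact: (J_subspace GL).
move=> {}z [m _ hz] /=; rewrite (contr_mul HT kb kf _ gx hz).
apply: (subsD (J_subspace GL _)).
  apply: (@J_mono _ _ _ _ n); first by rewrite gerBl normr_ge0.
  by apply: (J_mulp GL (d := d)).
apply: (subsZ (J_subspace GL _)); apply: (J_ideal GL).
have dd : n - `|d'.1| <= (d' + d).1.
  by rewrite bidegD /=; move: nd; move: d.1 d'.1 => p q; lia.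
by apply: (J_mono dd); apply: (J_hom (G := GL)); exact: contr_FAgr.
Qed.

(** [KP_sharp] does not place psi in degree 0, so its homogeneous parts are first treated one by
    one. *)
Definition restrict (d : bideg Gam) (u : hatL g) : hatL g := fun c => if c.1 == d then u c else 0.

Section Family.
Variables (n : nat) (u : hatL g) (hu : hatLk n u).

Lemma hatLk_hcomp c : @hcomp _ _ (triF g Ext) c (u c).
Proof. by case: hu => [[H _] _]. Qed.
Lemma restrict_hom d : hom_fam (F := triF g Ext) d (restrict d u).
Proof.
split=> [c|c /negbTE cd]; rewrite /restrict ?cd //.
have S : subspace (@hcomp _ _ (triF g Ext) c) by exact: hcomp_subspace.
by case: ifP => _; [exact: hatLk_hcomp|exact: subs0].
Qed.
Lemma restrict_trunc d N : trunc (F := triF g Ext) d (restrict d u) N = trunc (F := triF g Ext) d u N.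
Proof. by apply: eq_bigr => r _; rewrite /restrict /= eqxx. Qed.

Definition wN d N : tens (FA Ext gM) (FA Ext gP) := \sum_(r <- seq.iota 0 N) u (d, r).
Lemma truncE d N : trunc (F := triF g Ext) d u N = @tmu _ _ (triF g Ext) (wN d N).
Proof. by rewrite /trunc /wN (linsum (tmu_lin GL)). Qed.
Lemma wN_Lw d N : Lw n d (wN d N).
Proof.
apply: subssum => [|r _]; first exact: spanS_subspace.
have := hu.2 (d, r); apply: spanS_mono => w [k [l [al [be [a [b [kl ab ha hb ->]]]]]]].
exists k, l, (d.1 - r%:Z, al), (r%:Z, be), a, b; split=> //.
by rewrite bidegD /= subrK ab -surjective_pairing.
Qed.

(** Polynomial approximations of the degree [d] part of the quantization of [u]. *)
Definition QN d N : C := qgL (trunc (F := triF g Ext) d u N).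
Lemma QNE d N : QN d N = @tmu _ _ (triF g Cliff) (qq E Cliff (wN d N)).
Proof. by rewrite /QN truncE qg_tmu. Qed.
Lemma QN_par d N : FApar (odd n) d (QN d N).
Proof. by rewrite QNE; exact: (qqL_par E char0 (wN_Lw d N)). Qed.
Lemma QN_comm d N d' x : gr d' x ->
  gC x * QN d N = ((-1) ^+ n * ep d' d) *: (QN d N * gC x)
    + 2 *: qgL (contr x (trunc (F := triF g Ext) d u N)).
Proof. by move=> gx; rewrite QNE truncE (qgL_comm E char0 gx (wN_Lw d N)). Qed.

Lemma contr_trunc d d' x : gr d' x ->
  approx (F := triF g Ext) (fun N => contr x (trunc (F := triF g Ext) d u N))
    (restrict (d' + d) (hiota x u)).
Proof.
move=> gx; have H := approx_hext GL (restrict_hom d) (cl x) (fun m y => contr_J gx (y := y) (n := m)).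
suff HE : hext (triF g Ext) (contr x) (restrict d u) = restrict (d' + d) (hiota x u).
  by move=> m; have [N0 HN] := H m; exists N0 => N /HN H1 c cm; rewrite -HE -H1 // restrict_trunc.
apply/funext => c; rewrite /hext /restrict /hiota /hext (iotaE E).
have tC c' : FA_gr (d' + c'.1) (contr x (@tmu _ _ (triF g Ext) (u c'))).
  apply: contr_FAgr => //; exact: (hcomp_tgr GL (hatLk_hcomp c')).
have l0 : hin (triF g Ext) (contr x (@tmu _ _ (triF g Ext) 0)) c = 0.
  by rewrite (lin0 (tmu_lin GL)) (lin0 (cl x)) (lin0 (hin_lin GL c)).
case: eqP => cd.
  apply: eq_fsbigr => c' _; case: eqP => // c'd; rewrite l0.
  apply/esym/(hin_hom (G := GL) (tC c')); apply/eqP; rewrite cd => /addrI H1.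
  exact: c'd (esym H1).
rewrite fsbig1 // => c' _; case: eqP => // c'd.
by apply: (hin_hom (G := GL) (tC c')); apply/eqP; rewrite c'd.
Qed.
End Family.

Lemma bracket_sum_approx d x : gr d x ->
  approx (F := triF g Ext) (fun N => \sum_(a <- ball E N) gL (qbr x (e' a)) * gL (e a))
    (hsum (triF g Ext) (fun a => gL (qbr x (e' a)) * gL (e a))).
Proof.
move=> gx; apply: (approx_hsum GL) => [N|n]; first exact: ball_uniq.
exists (`|n| + `|d.1|)%N => N a Nn; rewrite mem_ball -ltnNge => aN.
have [a0|a0] := lerP 0 (deg a).1.
  apply: (J_ideal GL); apply: (J_mono _ (J_hom (G := GL) (FA_gr_gen _ _ (gv a)))).
  by move: a0 Nn aN; move: (deg a).1 d.1 => p q; lia.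
have gxa := qbr_gr gx (gd a).
rewrite (gen_swap HT kb kf gxa (gv a)); apply: (subsZ (J_subspace GL _)); apply: (J_ideal GL).
apply: (J_mono _ (J_hom (G := GL) (FA_gr_gen _ _ gxa))); rewrite bidegD /=.
by move: a0 Nn aN; move: (deg a).1 d.1 => p q; lia.
Qed.

Lemma qgL_bracket_sum N x :
  qgL (2^-1 *: \sum_(a <- ball E N) gL (qbr x (e' a)) * gL (e a)) = Gam_ N x.
Proof.
have ql := qg_lin E Cliff kb kf; rewrite (linZ ql) (linsum ql); congr (_ *: _).
by apply: eq_bigr => a _; rewrite (qgL2 E char0).
Qed.

Section StructureTensor.
Variables (phi : hatL g) (hphi : structure_tensor E phi).
Notation Phi := (QN phi 0).
Let h3 : hatLk 3 phi. Proof. by case: hphi. Qed.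

Lemma phi_hom : hom_fam (F := triF g Ext) 0 phi.
Proof. by case: hphi => H1 H2 _; split=> [c|[d r]]; [exact: (hatLk_hcomp h3)|exact: H2]. Qed.
Lemma Phi_par N : FApar true 0 (Phi N). Proof. exact: (QN_par h3). Qed.

Lemma phi_contr d x : gr d x -> null (F := triF g Ext) (fun N =>
  2 *: contr x (trunc (F := triF g Ext) 0 phi N)
  - 2^-1 *: \sum_(a <- ball E N) gL (qbr x (e' a)) * gL (e a)).
Proof.
move=> gx; case: hphi => _ _ H.
have A1 := approx_hext GL phi_hom (cl x) (fun m y => contr_J gx (y := y) (n := m)).
have {A1} := approxZ GL 2 A1; have := approxZ GL (2^-1) (bracket_sum_approx gx).
have -> : 2 *: hext (triF g Ext) (contr x) phi = 2^-1 *: hsum (triF g Ext) (fun a => gL (qbr x (e' a)) * gL (e a)).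
  have := H x; rewrite /hiota (iotaE E) => ->.
  by rewrite /lam scaleNr opprK.
by move=> A2 A1; exact: (approx_null GL A1 A2).
Qed.

(** By [QN_comm] the anticommutator is twice the quantized contraction of phi by x, and the
    definition of phi makes this contraction a multiple of lambda(ad_x), whose quantization is
    approximated by [Gam_]. *)
Lemma phi_comm d x : gr d x ->
  null (F := triF g Cliff) (fun N => gC x * Phi N + Phi N * gC x - Gam_ N x).
Proof.
move=> gx; have ql := qg_lin E Cliff kb kf.
apply: (null_ext (N0 := 0) _ (qg_null E char0 Cliff kb kf (phi_contr gx))) => N _.
rewrite (linB ql) (linZ ql) qgL_bracket_sum (QN_comm h3 0 N gx) ep0r mulr1.
by congr (_ - _); module.
Qed.
End StructureTensor.

Lemma qgL1 d z : gr d z -> qgL (gL z) = gC z.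
Proof.
move=> gz.
have i1M k : FAincl setT (1 : FA k gM) = 1 by exact: (FAincl1 (span_M E) HT).
have i1P k : FAincl setT (1 : FA k gP) = 1 by exact: (FAincl1 span_P HT).
have [d0|d0] := boolP (d.1 <= 0).
  have Pz : gM z := span_of_gr (span_M E) (d := d) d0 gz.
  have gE k : gen k setT z = FAincl setT (gen k gM z) by rewrite (FAincl_gen (span_M E) HT).
  rewrite !gE -[FAincl _ _]mulr1 -i1P -(tmuF_pure E) qg_tmu (qq_pure E Cliff kb kf).
  rewrite (symmT_gen char0 (span_M E) Cliff kb kf gz) // (symmT1 span_P Cliff kb kf).
  by rewrite (tmuF_pure E) i1P mulr1.
have Pz : gP z by apply: (span_of_gr span_P (d := d) _ gz); rewrite /degP /= ltNge.
have gE k : gen k setT z = FAincl setT (gen k gP z) by rewrite (FAincl_gen span_P HT).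
rewrite !gE -[FAincl _ _]mul1r -i1M -(tmuF_pure E) qg_tmu (qq_pure E Cliff kb kf).
rewrite (symmT_gen char0 span_P Cliff kb kf gz) // (symmT1 (span_M E) Cliff kb kf).
by rewrite (tmuF_pure E) i1M mul1r.
Qed.

Section KPSharp.
Variables (psi : hatL g) (hpsi : KP_sharp E psi).
Let h2 : hatLk 2 psi. Proof. by case: hpsi. Qed.

(** The contraction of psi by x is the vector z dual to psi_KP(x, .), which is homogeneous of the
    degree of x. Parts of psi of nonzero degree therefore contract to zero, and their quantizations
    asymptotically commute with g. *)
Lemma psi_comm d x : gr d x -> exists z, [/\ gr d z,
  forall d' y, gr d' y -> psiKP E d d' x y = B z y,
  null (F := triF g Cliff) (fun N => gC x * QN psi 0 N - QN psi 0 N * gC x - 2 *: gC z)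
  & forall d', d' != 0 ->
  null (F := triF g Cliff) (fun N => gC x * QN psi d' N - ep d d' *: (QN psi d' N * gC x))].
Proof.
move=> gx; have [_ /(_ _ _ gx) [z zE zB]] := hpsi; exists z.
have gz : gr d z.
  apply/(grP E) => a; apply: contra_neq_eq => da.
  rewrite -(zB _ _ (gd a)) (psiKP0 E gx (gd a)) // subr_eq0 eq_sym //.
have ql := qg_lin E Cliff kb kf.
have gLz : tgr GL d (gL z) := FA_gr_gen _ _ gz.
split=> // [|d' d0].
  have A := contr_trunc h2 0 gx.
  have RE : restrict (d + 0) (hiota x psi) = hin (triF g Ext) (gL z).
    apply/funext => c; rewrite /restrict addr0 zE; case: eqP => // /eqP cd.
    by rewrite (hin_hom gLz cd).
  rewrite RE in A; have n0 := approx_null GL A (@approx_hin _ _ (triF g Ext) (gL z)).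
  apply: (null_ext (N0 := 0) _ (nullZ GC 2 (qg_null E char0 Cliff kb kf n0))) => N _.
  rewrite (linB ql) (QN_comm h2 0 N gx) ep0r.
  rewrite (qgL1 gz).
  by module.
have A := contr_trunc h2 d' gx.
have RE : restrict (d + d') (hiota x psi) = 0.
  apply/funext => c; rewrite /restrict zE; case: eqP => // cd.
  apply: (hin_hom gLz); rewrite cd -{2}[d]addr0; apply: contra_neq d0.
  exact: addrI.
rewrite RE in A; have A0 : approx (F := triF g Ext) (fun _ => 0) 0.
  by move=> n; exists 0%N => N _ c _; exact: (lin0 (hin_lin GL c)).
have n0 := approx_null GL A A0.
apply: (null_ext (N0 := 0) _ (nullZ GC 2 (qg_null E char0 Cliff kb kf n0))) => N _.
rewrite subr0 (QN_comm h2 d' N gx).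
by module.
Qed.
End KPSharp.

End ContractionLimits.

(** * The square of phi' up to its vacuum value *)

Section CliffordSquare.
Variables (K : fieldType) (Gam : zmodType) (eps : commutation_factor K Gam).
Variables (g : quadColorLie eps) (E : hbasis g).
Hypothesis char0 : forall n, n.+1%:R != 0 :> K.
Notation e := (@bvec _ _ _ _ E).
Notation e' := (@bdual _ _ _ _ E).
Notation B := (@qfm _ _ _ g).
Notation deg := (@bdeg _ _ _ _ E).
Notation gr := (@qgr _ _ _ g).
Notation ep := (ep eps).
Notation gv := (@bvec_gr _ _ _ _ E).
Notation gd := (@bdual_gr _ _ _ _ E).
Let HT : span_of E [set: g] [set: bideg Gam] := @span_ofT _ _ _ g E.
Notation C := (FA Cliff [set: g]).
Notation gC x := (gen Cliff [set: g] x).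
Notation J := (J (F := triF g Cliff)).
Notation null := (null (F := triF g Cliff)).
Notation Gam_ := (Gam_ E).
Notation kappa := (kappa E).
Notation no := (no E).
Let G := triF_good E Cliff.

Lemma Gam_swap N d d' x y : gr d x -> gr d' y ->
  (`|d'.1| <= N)%N -> (`|(d + d')%R.1| <= N)%N ->
  Gam_ N x * gC y = ep d d' *: (gC y * Gam_ N x) + 2 *: gC (qbr x y).
Proof.
by move=> gx gy h1 h2; have := Gam_comm E char0 gx gy h1 h2 => <-; rewrite addrC subrK.
Qed.

Lemma Gam_no N d d1 d2 x u v : gr d x -> gr d1 u -> gr d2 v ->
  (`|d1.1| <= N)%N -> (`|(d + d1)%R.1| <= N)%N ->
  (`|d2.1| <= N)%N -> (`|(d + d2)%R.1| <= N)%N ->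
  Gam_ N x * no u v - ep d (d1 + d2) *: (no u v * Gam_ N x) =
  2 *: (gC (qbr x u) * gC v + ep d d1 *: (gC u * gC (qbr x v))).
Proof.
move=> gx gu gw n1 n2 n3 n4; set X := Gam_ N x.
have Xu : X * gC u = ep d d1 *: (gC u * X) + 2 *: gC (qbr x u).
  exact: Gam_swap.
have Xv : X * gC v = ep d d2 *: (gC v * X) + 2 *: gC (qbr x v).
  exact: Gam_swap.
clearbody X.
have kE : ep d (d1 + d2) * kappa u v = kappa u v.
  rewrite (kappa_gr E _ gu) mulrCA -[in RHS](mul1r (B u v)); congr (_ * _).
  by apply: form_coef gu gw _ => ->; rewrite ep0r.
have uv : X * (gC u * gC v) = ep d (d1 + d2) *: (gC u * gC v * X)
    + 2 *: (gC (qbr x u) * gC v + ep d d1 *: (gC u * gC (qbr x v))).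
  rewrite mulrA Xu mulrDl -!palg_scalerAl -mulrA Xv mulrDr -!palg_scalerAr mulrA epDr.
  by module.
rewrite /no mulrBr mulrBl -palg_scalerAr -palg_scalerAl mulr1 mul1r uv.
move: kE; move: (kappa u v) => k kE.
apply: (cert0 (Z := (ep d (d1 + d2) * k - k) *: X)); last by rewrite kE subrr scale0r.
by module.
Qed.

Section Bracket.
Variables (d d' : bideg Gam) (x y : g).
Hypotheses (gx : gr d x) (gy : gr d' y).
Let j := (`|d.1| + `|d'.1|)%N.
(** The first factor is truncated later by [j], so that it commutes exactly with all the letters
    occurring in [Gam_ N y]. *)
Definition brG N : C := Gam_ (N + j) x * Gam_ N y - ep d d' *: (Gam_ N y * Gam_ (N + j) x).

Lemma brGE N : brG N = \sum_(a <- ball E N)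
  (gC (qbr x (qbr y (e' a))) * gC (e a) + ep d (d' - deg a) *: (gC (qbr y (e' a)) * gC (qbr x (e a)))).
Proof.
rewrite /brG; have -> : Gam_ N y = 2^-1 *: \sum_(a <- ball E N) no (qbr y (e' a)) (e a) by [].
set M := (N + j)%N; have XE d1 d2 u v := @Gam_no M d d1 d2 x u v gx.
move: (Gam_ M x) XE => X XE.
rewrite -palg_scalerAl -palg_scalerAr mulr_suml mulr_sumr.
transitivity (2^-1 *: \sum_(a <- ball E N) (X * no (qbr y (e' a)) (e a)
   - ep d d' *: (no (qbr y (e' a)) (e a) * X))).
  by rewrite sumrB -scaler_sumr; module.
rewrite scaler_sumr; apply: eq_big_seq => a; rewrite mem_ball => aN.
have := XE _ _ _ _ (qbr_gr gy (gd a)) (gv a); rewrite subrK => ->.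
- by rewrite scalerA mulVf ?scale1r //; exact: (char0 1).
- by rewrite bidegD /= /M /j; move: aN; move: (deg a).1 d.1 d'.1 => p q r; lia.
- by rewrite !bidegD /= /M /j; move: aN; move: (deg a).1 d.1 d'.1 => p q r; lia.
- by rewrite /M /j; move: aN; move: (deg a).1 d.1 d'.1 => p q r; lia.
- by rewrite !bidegD /= /M /j; move: aN; move: (deg a).1 d.1 d'.1 => p q r; lia.
Qed.

Lemma vac_brG N : vac E (brG N) = kp_sum E d d' x y N.
Proof.
rewrite brGE (scalarsum (vac_lin E)); apply: eq_bigr => a _.
by rewrite (scalarD (vac_lin E)) (scalarZl (vac_lin E)) !(vac_gen2 E).
Qed.

(** Each gamma acts on letters as twice the adjoint action, so the bracket acts as 4 times ad [x, y]
    by the Jacobi identity, exactly as 2 gamma([x, y]) does. *)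
Lemma brG_comm c N : (`|(deg c).1| + j <= N)%N ->
  cm 0 (d + d') c (brG N - 2 *: Gam_ N (qbr x y)) = 0.
Proof.
move=> cN; rewrite /brG; set X := Gam_ (N + j) x; set Y := Gam_ N y; set Z := Gam_ N (qbr x y).
have [b1 b2 b3 b4] : [/\ (`|(deg c).1| <= N)%N, (`|(d + deg c)%R.1| <= N)%N,
    (`|(d' + deg c)%R.1| <= N)%N & (`|(d + d' + deg c)%R.1| <= N)%N].
  by rewrite !bidegD /=; move: cN; rewrite /j; move: (deg c).1 d.1 d'.1 => p q r; split; lia.
have b5 : (`|(d + (d' + deg c))%R.1| <= N + j)%N by rewrite addrA; apply: leq_trans b4 (leq_addr _ _).
have b6 : (`|(d' + (d + deg c))%R.1| <= N)%N by rewrite addrCA addrA.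
have XC w dw : gr dw w -> (`|dw.1| <= N + j)%N -> (`|(d + dw)%R.1| <= N + j)%N ->
    X * gC w = ep d dw *: (gC w * X) + 2 *: gC (qbr x w).
  by move=> gw h1 h2; exact: Gam_swap.
have YC w dw : gr dw w -> (`|dw.1| <= N)%N -> (`|(d' + dw)%R.1| <= N)%N ->
    Y * gC w = ep d' dw *: (gC w * Y) + 2 *: gC (qbr y w).
  by move=> gw h1 h2; exact: Gam_swap.
have ZC : Z * gC (e c) = ep (d + d') (deg c) *: (gC (e c) * Z) + 2 *: gC (qbr (qbr x y) (e c)).
  exact: (Gam_swap (qbr_gr gx gy) (gv c) b1 b4).
have Xc := XC _ _ (gv c) (leq_trans b1 (leq_addr _ _)) (leq_trans b2 (leq_addr _ _)).
have Yc := YC _ _ (gv c) b1 b3.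
have Xyc := XC _ _ (qbr_gr gy (gv c)) (leq_trans b3 (leq_addr _ _)) b5.
have Yxc := YC _ _ (qbr_gr gx (gv c)) b2 b6.
clearbody X Y Z.
have XYc : X * Y * gC (e c) = (ep d' (deg c) * ep d (deg c)) *: (gC (e c) * (X * Y))
    + (2 * ep d' (deg c)) *: (gC (qbr x (e c)) * Y)
    + (2 * ep d (d' + deg c)) *: (gC (qbr y (e c)) * X) + 4 *: gC (qbr x (qbr y (e c))).
  rewrite -mulrA Yc mulrDr -!palg_scalerAr Xyc mulrA Xc mulrDl -!palg_scalerAl -mulrA.
  by module.
have YXc : Y * X * gC (e c) = (ep d (deg c) * ep d' (deg c)) *: (gC (e c) * (Y * X))
    + (2 * ep d (deg c)) *: (gC (qbr y (e c)) * X)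
    + (2 * ep d' (d + deg c)) *: (gC (qbr x (e c)) * Y) + 4 *: gC (qbr y (qbr x (e c))).
  rewrite -mulrA Xc mulrDr -!palg_scalerAr Yxc mulrA Yc mulrDl -!palg_scalerAl -mulrA.
  by module.
have Jac : gC (qbr (qbr x y) (e c)) = gC (qbr x (qbr y (e c))) - ep d d' *: gC (qbr y (qbr x (e c))).
  rewrite (qbr_jacobi gx gy (gv c)).
  have gl := genT_lin E Cliff; rewrite (linD gl) (linZ gl); module.
have key : (X * Y - ep d d' *: (Y * X) - 2 *: Z) * gC (e c) =
   ep (d + d') (deg c) *: (gC (e c) * (X * Y - ep d d' *: (Y * X) - 2 *: Z)).
  rewrite !mulrBl !mulrBr -!palg_scalerAl -!palg_scalerAr XYc YXc ZC Jac !epDr epDl.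
  have V := epV eps d d'; have V2 := epV eps d' (deg c).
  apply: (cert0 (Z := (2 * ep d' (deg c) * (1 - ep d d' * ep d' d)) *: (gC (qbr x (e c)) * Y))); last first.
    by rewrite V subrr mulr0 scale0r.
  by module.
rewrite /cm expr0 mul1r key scalerA epV scale1r subrr //.
Qed.

Lemma brG_par N : FApar false (d + d') (brG N - 2 *: Gam_ N (qbr x y)).
Proof.
have S := @FApar_subspace _ _ _ g Cliff setT false (d + d').
apply: (subsB S); last by apply: (subsZ S); apply: Gam_par => //; exact: qbr_gr.
apply: (subsB S); first exact: (FAparM (Gam_par E _ gx) (Gam_par E _ gy)).
by apply: (subsZ S); rewrite addrC; exact: (FAparM (Gam_par E _ gy) (Gam_par E _ gx)).
Qed.

Lemma brG_null : null (fun N => brG N - 2 *: Gam_ N (qbr x y) - (4 * psiKP E d d' x y) *: (1 : C)).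
Proof.
have H := crit_vac (E := E) char0 brG_par (fun c => null_eq0 G (@brG_comm c)).
apply: (null_ext (N0 := j) _ H) => N jN.
rewrite (scalarB (vac_lin E)) (scalarZl (vac_lin E)) vac_Gam mulr0 subr0 vac_brG.
rewrite (KP_vac E char0 gx gy) //; apply: leq_trans jN; rewrite /j ?leq_addr ?leq_addl //.
Qed.
End Bracket.

Lemma Gam_bracket_null d d' x y : gr d x -> gr d' y ->
  null (fun N => Gam_ N x * Gam_ N y - ep d d' *: (Gam_ N y * Gam_ N x)
     - 2 *: Gam_ N (qbr x y) - (4 * psiKP E d d' x y) *: (1 : C)).
Proof.
move=> gx gy; have n1 := brG_null gx gy; set j := (`|d.1| + `|d'.1|)%N in n1.
have n2 := Gam_shift_null E j gx.
have n3 := null_mulr (G := G) n2 (fun N => FApar_gr (Gam_par E N gy)).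
have n4 := nullZ G (ep d d') (null_mull G (fun N => Gam_ N y) n2).
apply: (null_ext (N0 := 0) _ (nullB G n1 (nullB G n3 n4))) => N _ /=.
rewrite /brG -/j.
move: (Gam_ (N + j) x) (Gam_ N x) (Gam_ N y) (Gam_ N (qbr x y)) => a b c f.
by rewrite mulrBl (mulrBr c); module.
Qed.

Section Main.
Variables (phi psi : hatL g) (hphi : structure_tensor E phi) (hpsi : KP_sharp E psi).
Notation Phi := (QN E phi 0).
Notation Pi := (QN E psi 0).
Let h2 : hatLk 2 psi. Proof. by case: hpsi. Qed.

(** The graded commutators of both sides with e_c agree in the limit, the anomaly 4 psi_KP(x, e_c)
    matching 2 B(z, e_c) on each of the two orders of z and e_c. Being odd, the difference has no
    scalar part. *)
Lemma Theta_null d x z : gr d x -> gr d z ->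
  (forall d' y, gr d' y -> psiKP E d d' x y = B z y) ->
  null (fun N => Gam_ N x * Phi N - Phi N * Gam_ N x - 2 *: gC z).
Proof.
move=> gx gz zB.
have PhiP := Phi_par char0 hphi; have GamP N := Gam_par E N gx.
apply: (crit_null char0 (E := E) (p := true) (d := d)) => [//|N|c].
  have S := @FApar_subspace _ _ _ g Cliff setT true d.
  apply: (subsB S); last by apply: (subsZ S); exact: (FAk_gr_par (FAk_gr_gen setT Cliff gz)).
  by apply: (subsB S); [have := FAparM (GamP N) (PhiP N)|have := FAparM (PhiP N) (GamP N)];
    rewrite ?addr0 ?add0r.
have n1 := Gam_bracket_null gx (gv c).
have n2 := phi_comm char0 hphi (gv c).
have n3 := nullZ G 2 (phi_comm char0 hphi (qbr_gr gx (gv c))).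
have n4 := null_mull G (fun N => Gam_ N x) n2.
have n5 := nullZ G (ep d (deg c)) (null_mulr (G := G) n2 (fun N => FApar_gr (GamP N))).
(* By the Jacobi identity the commutator of e_c with [gamma(x), phi'] involves only
   [gamma(x), gamma(e_c)] and gamma([x, e_c]); this combination replaces both by their limits. *)
have n6 := nullZ G (ep (deg c) d) (nullD G (nullB G (nullB G n4 n5) n3) n1).
apply: (null_ext (N0 := (`|(deg c).1| + `|d.1|)%N) _ n6) => N cN.
have Xc : Gam_ N x * gC (e c) = ep d (deg c) *: (gC (e c) * Gam_ N x) + 2 *: gC (qbr x (e c)).
  apply: (Gam_swap gx (gv c)).
    exact: leq_trans (leq_addr _ _) cN.
  by rewrite bidegD /=; move: cN; move: (deg c).1 d.1 => p q; lia.
have zc : gC z * gC (e c) = (2 * B z (e c)) *: (1 : C) - ep d (deg c) *: (gC (e c) * gC z) := gC_comm E gz (gv c).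
rewrite (zB _ _ (gv c)) /cm /=.
rewrite [(-1) ^+ 1]expr1 mulN1r scaleNr opprK.
move: (Gam_ N x) (Phi N) (Gam_ N (e c)) (Gam_ N (qbr x (e c))) Xc => X P Y Z Xc.
have V := epV eps (deg c) d.
move: (ep d (deg c)) (ep (deg c) d) V Xc zc => p p' V Xc zc.
have XPc : X * P * gC (e c) = X * (gC (e c) * P + P * gC (e c)) - p *: (gC (e c) * (X * P))
    - 2 *: (gC (qbr x (e c)) * P).
  by rewrite mulrDr !mulrA Xc mulrDl -!palg_scalerAl; module.
have PXc : P * X * gC (e c) = p *: ((gC (e c) * P + P * gC (e c)) * X) - p *: (gC (e c) * (P * X))
    + 2 *: (P * gC (qbr x (e c))).
  by rewrite mulrDl -!mulrA Xc mulrDr -!palg_scalerAr; module.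
rewrite !mulrBr !mulrBl -!palg_scalerAl -!palg_scalerAr XPc PXc zc.
move: (gC (e c) * P + P * gC (e c)) => A.
apply: (cert0 (Z := (1 - p' * p) *: (gC (e c) * (X * P) - gC (e c) * (P * X) - 2 *: (gC (e c) * gC z)))); last first.
  by rewrite V subrr scale0r.
by module.
Qed.

(** The commutator of e_c with phi'^2 is [gamma(e_c), phi'], since phi' is odd, and [Theta_null]
    equates it with the commutator of e_c with the quantized psi^#. The difference is a scalar,
    found from vacuum values: the quantization of a quadratic element has vacuum value 0. *)
Lemma Phi_square_null : null (fun N =>
  Phi N * Phi N - Pi N - vac E (Phi N * Phi N) *: (1 : C)).
Proof.
have PhiP := Phi_par char0 hphi.
have S := @FApar_subspace _ _ _ g Cliff setT false 0.
have zp N : FApar false 0 (Phi N * Phi N - Pi N).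
  apply: (subsB S); last exact: (QN_par E char0 h2 0 N).
  by have := FAparM (PhiP N) (PhiP N); rewrite addr0.
have H := crit_vac (E := E) char0 zp; apply: (null_ext (N0 := 0) _ (H _)) => [N _|c].
  rewrite (scalarB (vac_lin E)); have -> : vac E (Pi N) = 0; last by rewrite subr0.
  rewrite /QN (truncE E); apply: (vac_qgL2 E char0 (d := 0)).
  have := wN_Lw h2 0 N; apply: (spanS_ind (Q := [set w | @FAk_gr _ _ _ g Ext setT 2 0 (@tmu _ _ (triF g Ext) w)])).
    by apply: (subspace_pre (@tmuF_lin _ _ _ g E Ext)); exact: spanS_subspace.
  move=> w [k [l [d1 [d2 [a [b [<- <- ha hb ->]]]]]]] /=; rewrite (tmuF_pure E).
  by apply: FAk_grM; [exact: (FAincl_gr (span_M E) HT)|exact: (FAincl_gr (span_P E) HT)].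
have [z [gz zB n1 _]] := psi_comm char0 hpsi (gv c).
have n2 := Theta_null (gv c) gz zB.
have n3 := phi_comm char0 hphi (gv c).
have n4 := null_mulr (G := G) n3 (fun N => FApar_gr (PhiP N)).
have n5 := null_mull G Phi n3.
apply: (null_ext (N0 := 0) _ (nullB G (nullD G (nullB G n4 n5) n2) n1)) => N _.
rewrite /cm expr0 mul1r ep0r scale1r.
move: (Gam_ N (e c)) (Phi N) (Pi N) => X P Q.
rewrite /= !mulrBr !mulrBl !mulrDr !mulrDl !mulrA; module.
Qed.
End Main.
End CliffordSquare.

(** * Homogeneity of the quantized tensors *)

Section PsiDegree.
Variables (K : fieldType) (Gam : zmodType) (eps : commutation_factor K Gam).
Variables (g : quadColorLie eps) (E : hbasis g).
Hypothesis char0 : forall n, n.+1%:R != 0 :> K.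
Let kb (x y : g) : kbr Ext x y = 0. Proof. by []. Qed.
Let kf (x y : g) : kfm Ext x y = 0. Proof. by []. Qed.
Let GL := triF_good E Ext.
Let GC := triF_good E Cliff.

Lemma hqE (u : hatL g) : hq u = (fun c => qq E Cliff (u c)).
Proof.
apply/funext => c; rewrite /hq (quantizationE (span_M E)).
by rewrite (quantizationE (span_P E)).
Qed.

Lemma hom_fam_hq_phi (phi : hatL g) : structure_tensor E phi ->
  hom_fam (F := triF g Cliff) 0 (hq phi).
Proof. by move=> H; rewrite hqE; exact: (qg_hom_fam E char0 Cliff kb kf (phi_hom H)). Qed.

(** A part of nonzero degree asymptotically commutes with g, and by [crit_null] there are no scalars
    in that degree, so its quantization vanishes. *)
Lemma hom_fam_hq_psi (psi : hatL g) : KP_sharp E psi -> hom_fam (F := triF g Cliff) 0 (hq psi).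
Proof.
move=> hpsi; have h2 : hatLk 2 psi by case: hpsi.
rewrite hqE; split=> [c|[d r] /= d0].
  by apply: (qq_hcomp E char0 Cliff kb kf); exact: (hatLk_hcomp h2).
have H := restrict_hom h2 d.
have A := approx_qg E char0 Cliff kb kf H (approx_trunc GL H).
have A0 : approx (F := triF g Cliff) (fun _ => 0) 0.
  by move=> n; exists 0%N => N _ c _; exact: (lin0 (hin_lin GC c)).
have n0 : null (F := triF g Cliff) (QN E psi d).
  apply: (crit_null (E := E) char0 (p := false) (d := d)) => [//|N|c].
    exact: (QN_par E char0 h2 d N).
  have [z [_ _ _ nz]] := psi_comm char0 hpsi (bvec_gr c).
  apply: (null_ext (N0 := 0) _ (nz d d0)) => N _.
  by rewrite /cm expr0 mul1r.
have : (fun c => qq E Cliff (restrict d psi c)) = 0 :> hfam (triF g Cliff).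
  apply: (approx_eq GC A A0); apply: (null_ext (N0 := 0) _ n0) => N _.
  by rewrite subr0 /QN restrict_trunc.
by move=> /(congr1 (fun f => f (d, r))); rewrite /restrict /= eqxx.
Qed.
End PsiDegree.

(** * The adjoint trace of the Casimir element of g_0 *)

Section AdjointAction.
Variables (K : fieldType) (Gam : zmodType) (eps : commutation_factor K Gam).
Variables (g : quadColorLie eps) (E : hbasis g).
Notation e := (@bvec _ _ _ _ E).
Notation e' := (@bdual _ _ _ _ E).
Notation B := (@qfm _ _ _ g).
Notation deg := (@bdeg _ _ _ _ E).
Notation ep := (ep eps).
Notation gv := (@bvec_gr _ _ _ _ E).
Notation gd := (@bdual_gr _ _ _ _ E).
Notation g0 := (@g0 _ _ _ g).

Lemma ad_term_lin (t : aterm K g0) : linear (ad_term t).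
Proof.
elim: t => [x|||s Hs t Ht|s Hs t Ht|a s Hs] /=.
- exact: qbr_linr.
- exact: linear_fun0.
- exact: lin_id.
- exact: linear_funD.
- exact: (lin_comp Hs Ht).
- exact: linear_funZ.
Qed.

Lemma ad_term_rel s t : @grel _ _ _ _ g0 Env s t -> forall w, ad_term s w = ad_term t w.
Proof.
have key k s' t' : @grel _ _ _ _ g0 k s' t' -> k = Env -> forall w, ad_term s' w = ad_term t' w.
  case=> {k s' t'} // [k a x y z zE _ w|d d' x y z gx gy zE _ w] /=.
    by rewrite zE (qbr_linl w).
  move: w; apply: (gr_expand E).
    apply: subspace_eq; first exact: (lin_comp (qbr_linr _) (qbr_linr _)).
    apply: linear_funD; last exact: qbr_linr.
    by apply: linear_funZ; exact: (lin_comp (qbr_linr _) (qbr_linr _)).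
  by move=> d'' w gw /=; rewrite zE (qbr_jacobi gx gy gw) addrC.
by move=> H w; exact: (key _ _ _ H).
Qed.

Lemma ad_term_cong s t : acong (@grel _ _ _ _ g0 Env) s t -> forall w, ad_term s w = ad_term t w.
Proof.
elim=> //= {s t}.
- exact: ad_term_rel.
- by move=> s t u _ H1 _ H2 w; rewrite H1 H2.
- by move=> s s' t t' _ H1 _ H2 w; rewrite H1 H2.
- by move=> s s' t t' _ H1 _ H2 w; rewrite H1 H2.
- by move=> a s s' _ H w; rewrite H.
- by move=> s t u w; rewrite addrA.
- by move=> s t w; rewrite addrC.
- by move=> s w; rewrite add0r.
- by move=> s w; rewrite scaleN1r addNr.
- by move=> s t u w; rewrite (linD (ad_term_lin s)).
- by move=> a b s w; rewrite scalerA.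
- by move=> s w; rewrite scale1r.
- by move=> a s t w; rewrite scalerDr.
- by move=> a b s w; rewrite scalerDl.
- by move=> a s t w; rewrite (linZ (ad_term_lin s)).
Qed.

Lemma adU0E t w : adU0 (pcls (@grel _ _ _ _ g0 Env) t) w = ad_term t w.
Proof. by apply: ad_term_cong; exact: acong_repr. Qed.
Lemma adU0D (u v : FA Env g0) w : adU0 (u + v) w = adU0 u w + adU0 v w.
Proof. by rewrite -(pclsK u) -(pclsK v) -[pcls _ _ + _]/(padd _ _) paddE !adU0E. Qed.
Lemma adU0_0 w : adU0 (0 : FA Env g0) w = 0.
Proof. exact: (adU0E (Azero K g0)). Qed.
Lemma adU0M (u v : FA Env g0) w : adU0 (u * v) w = adU0 u (adU0 v w).
Proof. by rewrite -(pclsK u) -(pclsK v) pcls_mul !adU0E. Qed.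
Lemma adU0_gen x w : g0 x -> adU0 (gen Env g0 x) w = qbr x w.
Proof. by move=> gx; rewrite (genE Env gx) adU0E. Qed.

Lemma deg0_dual a : (deg a).1 = 0 -> g0 (e' a).
Proof.
move=> a0; apply: (span_of_gr (@span_of_gpart _ _ _ g E (@deg0 Gam)) (d := - deg a)).
  by rewrite /deg0 /= a0 oppr0.
exact: gd.
Qed.
Lemma deg0_vec a : (deg a).1 = 0 -> g0 (e a).
Proof.
move=> a0; have Da : deg0 (deg a) by [].
exact: (span_of_gr (@span_of_gpart _ _ _ g E (@deg0 Gam)) Da (gv a)).
Qed.

Lemma fsbig_I0 (V : lmodType K) (F : bidx E -> V) :
  \sum_(a \in I0 E) F a = \sum_(a <- ball E 0) F a.
Proof.
rewrite fsbig_mkcond (fsbig_supp_seq (ball_uniq E 0)) => [|a].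
  apply: eq_big_seq => a; rewrite mem_ball leqn0 absz_eq0 => /eqP a0.
  by rewrite /patch mem_set.
rewrite mem_ball leqn0 absz_eq0 /patch => /eqP a0; rewrite memNset //.
Qed.

Lemma adU0_Omega w : adU0 (Omega0 E) w = \sum_(a <- ball E 0) qbr (e' a) (qbr (e a) w).
Proof.
rewrite /Omega0 fsbig_I0.
suff key : forall s : seq (bidx E), {subset s <= ball E 0} ->
   adU0 (\sum_(a <- s) gen Env g0 (e' a) * gen Env g0 (e a)) w =
   \sum_(a <- s) qbr (e' a) (qbr (e a) w) by exact: key.
elim=> [|a s IH] sub; first by rewrite !big_nil adU0_0.
have a0 : (deg a).1 = 0.
  by have := sub a (mem_head _ _); rewrite mem_ball leqn0 absz_eq0 => /eqP.
rewrite !big_cons adU0D adU0M !adU0_gen; [|exact: deg0_vec|exact: deg0_dual].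
by rewrite IH // => b bs; apply: sub; rewrite inE bs orbT.
Qed.

Lemma trEps_Omega : trEps (I0 E) (adU0 (Omega0 E)) =
  \sum_(a <- ball E 0) \sum_(b <- ball E 0) B (qbr (e' a) (qbr (e a) (e' b))) (e b).
Proof.
rewrite /trEps (@fsbig_I0 K^o) exchange_big /=.
transitivity (\sum_(b <- ball E 0) \sum_(a <- ball E 0)
   ep (deg b) (deg b) * B (qbr (e' a) (qbr (e a) (e b))) (e' b)).
  apply: eq_bigr => b _; rewrite adU0_Omega form_suml mulr_sumr //.
rewrite exchange_big [RHS]exchange_big /=; apply: eq_bigr => a _.
pose f (u v : g) : K^o := B (qbr (e' a) (qbr (e a) u)) v.
have := @canonical_sym _ _ _ _ E K^o f xpredT xpredT 0.
by apply=> // [v c u u'|v c u u']; rewrite /f ?qbr_linr ?qbr_linr ?qfm_linl ?qfm_linr.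
Qed.

(** The canonical element is eps-symmetric and the bracket is eps-skew, so the sum equals its
    opposite. *)
Lemma canonical_bracket : (forall n, n.+1%:R != 0 :> K) ->
  \sum_(a <- ball E 0) ep (deg a) (deg a) *: qbr (e a) (e' a) = 0.
Proof.
move=> char0; set S := LHS.
have H : S = - S.
  transitivity (\sum_(a <- ball E 0) qbr (e' a) (e a)).
    exact: (@canonical_sym _ _ _ _ E g (@qbr _ _ _ g) xpredT xpredT 0 (@qbr_linl _ _ _ g) (@qbr_linr _ _ _ g)).
  rewrite /S -sumrN; apply: eq_bigr => a _.
  by rewrite (qbr_skew (gd a) (gv a)) epNl.
apply: (scalerI (char0 1)); rewrite scaler0 -[2%:R]/(1 + 1) scalerDl !scale1r {2}H.
by rewrite subrr.
Qed.

End AdjointAction.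

(** * The vacuum value of the square of phi' *)

Section VacuumOfSquare.
Variables (K : fieldType) (Gam : zmodType) (eps : commutation_factor K Gam).
Variables (g : quadColorLie eps) (E : hbasis g).
Hypothesis char0 : forall n, n.+1%:R != 0 :> K.
Notation I := (bidx E).
Notation e := (@bvec _ _ _ _ E).
Notation e' := (@bdual _ _ _ _ E).
Notation B := (@qfm _ _ _ g).
Notation deg := (@bdeg _ _ _ _ E).
Notation gr := (@qgr _ _ _ g).
Notation ep := (ep eps).
Notation gv := (@bvec_gr _ _ _ _ E).
Notation gd := (@bdual_gr _ _ _ _ E).
Notation gM := (@gM _ _ _ g).
Notation gP := (@gP _ _ _ g).
Notation span_M := (span_M E).
Notation span_P := (span_P E).
Let HT : span_of E [set: g] [set: bideg Gam] := @span_ofT _ _ _ g E.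
Notation C := (FA Cliff [set: g]).
Notation gC x := (gen Cliff [set: g] x).
Notation J := (J (F := triF g Cliff)).
Notation Gam_ := (Gam_ E).
Notation no := (no E).
Notation vac := (vac E).
Let G := triF_good E Cliff.
Let kb (x y : g) : kbr Ext x y = 0. Proof. by []. Qed.
Let kf (x y : g) : kfm Ext x y = 0. Proof. by []. Qed.
Let vl := vac_lin E.

Lemma vac_J1 u : J 1 u -> vac u = 0.
Proof. by apply: (@vac_J _ _ _ _ E 1); exact: ltr01. Qed.

Lemma vac_half d d' p x u : gr d' x -> d'.1 = 0 -> FApar p d u ->
  vac (gC x * u) = 2^-1 * vac (gC x * u - ((-1) ^+ p * ep d' d) *: (u * gC x)).
Proof.
move=> gx d0; apply: (spanS_ind (Q := [set u | vac (gC x * u) =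
   2^-1 * vac (gC x * u - ((-1) ^+ p * ep d' d) *: (u * gC x))])).
  apply: (@subspace_eq K K^o _ (fun u => vac (gC x * u))
     (fun u => 2^-1 * vac (gC x * u - ((-1) ^+ p * ep d' d) *: (u * gC x)))).
    by move=> a v w; rewrite (FA_mull_lin _ a v w) vl.
  move=> a v w; rewrite mulrDr mulrDl -palg_scalerAl -palg_scalerAr.
  rewrite !(scalarB vl) !(scalarZl vl) !(scalarD vl) !(scalarZl vl) /=.
  by rewrite -[_ *: _]/(_ * _); ring.
move=> {}u [n np hu] /=; rewrite -np signr_odd.
have [s [us _ xE]] := basis_exp E x; rewrite xE.
have gl := genT_lin E Cliff.
rewrite (linsumZ gl) mulr_suml mulr_sumr scaler_sumr -sumrB !(scalarsum vl) mulr_sumr.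
apply: eq_bigr => a _; rewrite -palg_scalerAl -palg_scalerAr.
have [Ba|Ba] := eqVneq (B x (e' a)) 0; first by rewrite Ba !scale0r scaler0 subr0 (scalar0 vl) mulr0.
have da : deg a = d' := ((grP E _ _).1 gx) _ Ba.
have Q (b c : K) (v1 v2 : C) : b *: v1 - c *: (b *: v2) = b *: (v1 - c *: v2) by module.
rewrite Q !(scalarZl vl).
by rewrite (vac_g0 char0 _ hu) da // mulrCA.
Qed.

(* The words that begin with a letter of negative degree.                     *)
Definition Neg : set C := spanS [set y | exists (c : I) (v : C), (deg c).1 < 0 /\ y = gC (e c) * v].
Lemma vac_Neg y : Neg y -> vac y = 0.
Proof.
apply: (spanS_ind (Q := [set y | vac y = 0])).
  apply: (@subspace_eq K K^o _ vac (fun _ => 0)); first exact: vl.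
  exact: linear_fun0.
by move=> {}y [c [v [c0 ->]]] /=; exact: vac_negM.
Qed.
Lemma Neg_mulr y v : Neg y -> Neg (y * v).
Proof.
apply: (spanS_ind (Q := [set y | Neg (y * v)])).
  by apply: (subspace_pre (FA_mulr_lin _)); exact: spanS_subspace.
move=> {}y [c [w [c0 ->]]] /=; apply: spanS_sub; exists c, (w * v); split=> //.
by rewrite mulrA.
Qed.

(** A word in g_- of negative degree contains a letter of negative degree; the letters of degree 0
    before it can be moved behind it, since they pair to zero with it. *)
Lemma Neg_incl d (a : FA Cliff gM) : FA_gr d a -> d.1 < 0 -> Neg (FAincl setT a).
Proof.
have il := @incM_lin _ _ _ g E Cliff.
apply: (FA_gr_ind span_M (Q := fun d => [set a | d.1 < 0 -> Neg (FAincl setT a)])).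
- move=> c; split=> [_|k x y Hx Hy H]; first by rewrite (lin0 il); apply: subs0; exact: spanS_subspace.
  by rewrite il; apply: (spanS_subspace _).2; [exact: Hx|exact: Hy].
- by rewrite /= ltxx.
move=> d' b u Db IH /= H.
rewrite (FAinclM span_M HT) // (FAincl_gen span_M HT) //; last exact/(span_of_vec span_M).
have [b0|b0] := boolP ((deg b).1 < 0); first by apply: spanS_sub; exists b, (FAincl setT u).
have Db' : (deg b).1 <= 0 := Db.
have b00 : (deg b).1 = 0 by apply/eqP; rewrite eq_le Db' leNgt.
have /IH : d'.1 < 0 by move: H; rewrite b00 add0r.
apply: (spanS_ind (Q := [set u | Neg (gC (e b) * u)])).
  by apply: (subspace_pre (FA_mull_lin _)); exact: spanS_subspace.
move=> y [c [v [c0 ->]]] /=; rewrite mulrA (gC_comm E (gv b) (gv c)).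
have -> : 2 * B (e b) (e c) = 0.
  have [->|Bn] := eqVneq (B (e b) (e c)) 0; first by rewrite mulr0.
  have /(congr1 fst) /= := form_grP (gv b) (gv c) Bn.
  by rewrite b00 add0r => cc; move: c0; rewrite cc ltxx.
rewrite scale0r add0r -scaleNr -palg_scalerAl; apply: subsZ; first exact: spanS_subspace.
by apply: spanS_sub; exists c, (gC (e b) * v); rewrite mulrA.
Qed.

Lemma Gam_J0 N d x : gr d x -> d.1 = 0 -> J 1 (Gam_ N x - Gam_ 0 x).
Proof.
move=> gx d0; rewrite /Gam_ -scalerBr; apply: (subsZ (J_subspace G _)).
pose f a := no (qbr x (e' a)) (e a); pose F a := if a \in ball E 0 then f a else 0.
have -> : \sum_(a <- ball E 0) no (qbr x (e' a)) (e a) = \sum_(a <- ball E N) F a.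
  transitivity (\sum_(a <- ball E 0) F a).
    by apply: eq_big_seq => a aI; rewrite /F aI.
  apply: big_supp; try exact: ball_uniq.
    by move=> a /negbTE aI; rewrite /F aI.
  move=> a aN; rewrite /F; case: ifP => //; move: aN; rewrite !mem_ball leqn0 => aN /eqP a0.
  by rewrite a0 in aN.
rewrite -sumrB; apply: (subssum (J_subspace G _)) => a _; rewrite /F; case: ifP => aI.
  by rewrite subrr; exact: subs0 (J_subspace G _).
rewrite subr0; have a0 : (deg a).1 != 0 by rewrite -absz_eq0 -leqn0 -mem_ball aI.
have [a1|a1] := lerP 1 (deg a).1.
  exact: (J_mono a1 (no_Jr E (qbr_gr gx (gd a)) (gv a))).
apply: (J_mono _ (no_Jl E (qbr_gr gx (gd a)) (gv a))); rewrite bidegD /= d0.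
by move: a0 a1; move: (deg a).1 => p; lia.
Qed.

(** By [vac_half] the first letter of each normal ordered pair in gamma(x) is traded for half a
    commutator with the rest, which leaves a two-point function in degree 0. *)
Lemma vac_Gam0 d x y : gr d x -> gr (- d) y -> d.1 = 0 ->
  vac (Gam_ 0 x * Gam_ 0 y) =
  2^-1 * ep d d * \sum_(b <- ball E 0) B (qbr y (qbr x (e' b))) (e b).
Proof.
move=> gx gy d0; set Y := Gam_ 0 y.
have YP : FApar false (- d) Y := Gam_par E 0 gy.
have vY : vac Y = 0 := vac_Gam E 0 y.
have YX w d' : gr d' w -> d'.1 = 0 -> Y * gC w = ep (- d) d' *: (gC w * Y) + 2 *: gC (qbr y w).
  by move=> gw w0; apply: Gam_swap => //; rewrite /= ?d0 w0.
clearbody Y; have two := char0 1.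
have no_term u v d1 d2 : gr d1 u -> gr d2 v -> d1.1 = 0 -> d2.1 = 0 ->
    vac (no u v * Y) = ep d1 (d2 - d) * B v (qbr y u).
  move=> gu gw u0 v0; rewrite /no mulrBl -palg_scalerAl mul1r (scalarB vl) (scalarZl vl) vY mulr0 subr0.
  have vYP : FApar true (d2 - d) (gC v * Y) := FAparM (FAk_gr_par (FAk_gr_gen setT Cliff gw)) YP.
  rewrite -mulrA (vac_half gu u0 vYP) expr1.
  have -> : gC u * (gC v * Y) - (-1 * ep d1 (d2 - d)) *: (gC v * Y * gC u) =
     (2 * B u v) *: Y + (2 * ep d1 (d2 - d)) *: (gC v * gC (qbr y u)).
    rewrite -[gC v * Y * _]mulrA (YX _ _ gu u0) mulrDr -!palg_scalerAr !mulrA.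
    rewrite (gC_comm E gu gw) mulrBl -!palg_scalerAl mul1r epDr epNl epNr.
    have V := epV eps d d1.
    apply: (cert0 (Z := (ep d1 d2 * (ep d d1 * ep d1 d - 1)) *: (gC v * gC u * Y))); last first.
      by rewrite V subrr mulr0 scale0r.
    by module.
  rewrite (scalarD vl) !(scalarZl vl) vY mulr0 add0r (vac_gen2 E) (kappa_gr E _ gw).
  by rewrite v0 /theta ltxx eqxx mul1r mulrA mulrA mulVf // mul1r.
rewrite /Gam_ -palg_scalerAl mulr_suml (scalarZl vl) (scalarsum vl) -mulrA; congr (_ * _).
rewrite mulr_sumr; apply: eq_big_seq => b; rewrite mem_ball leqn0 absz_eq0 => /eqP b0.
have db0 : (d - deg b).1 = 0 by rewrite bidegD /= d0 b0 subr0.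
rewrite (no_term _ _ _ _ (qbr_gr gx (gd b)) (gv b) db0 b0).
have gw := qbr_gr gy (qbr_gr gx (gd b)); rewrite (qfm_sym (gv b) gw).
rewrite addrA addNr add0r epNr mulrA; congr (_ * _).
rewrite epDl !epDr !epNl !epNr.
have V := epV eps d (deg b); have S := ep_sqr eps (deg b).
move: (ep d (deg b)) (ep (deg b) d) V (ep (deg b) (deg b)) S => p p' V s S.
transitivity ((p * p') * (s * s) * ep d d); last by rewrite V S !mul1r.
by ring.
Qed.

Lemma FAk_gr_P_low n d (u : FA Ext gP) : FAk_gr n d u -> d.1 < n%:Z -> u = 0.
Proof.
apply: (FAk_ind span_P (Q := fun n d => [set u | d.1 < n%:Z -> u = 0])) => //.
- by move=> m c; split=> // k x y Hx Hy H; rewrite Hx // Hy // scaler0 addr0.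
move=> m c a v Da IH /= H; rewrite IH ?mulr0 //.
have Da' : 0 < (deg a).1 := Da.
by move: H Da'; move: (deg a).1 c.1 => p q; lia.
Qed.

Section Cubic.
Variables (phi : hatL g) (hphi : structure_tensor E phi).
Notation Phi := (QN E phi 0).
Let h3 : hatLk 3 phi. Proof. by case: hphi. Qed.
Notation sM := (@symmT _ _ _ g E gM Ext Cliff).

(** The components with r > 0 end in a factor of positive degree and, the total degree being 0,
    begin with one of negative degree. The first fact discards them as right factors in a vacuum
    value, the second as left factors. *)
Lemma Phi_tail N : (0 < N)%N -> J 1 (Phi N - Phi 1) /\ Neg (Phi N - Phi 1).
Proof.
case: N => // N _.
have -> : Phi N.+1 - Phi 1 = \sum_(r <- seq.iota 1 N) @tmu _ _ (triF g Cliff) (qq E Cliff (phi (0, r))).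
  have QE M : Phi M = \sum_(r <- seq.iota 0 M) @tmu _ _ (triF g Cliff) (qq E Cliff (phi (0, r))).
    by rewrite QNE /wN (linsum (qq_lin E Cliff kb kf)) (linsum (@tmuF_lin _ _ _ g E Cliff)).
  by rewrite !QE /= big_cons big_seq1 addrC addKr.
have hr r : @hcomp _ _ (triF g Cliff) (0, r) (qq E Cliff (phi (0, r))).
  by apply: (qq_hcomp E char0 Cliff kb kf); exact: (hatLk_hcomp h3).
split.
  apply: (subs_seq (J_subspace G _)) => r; rewrite seq.mem_iota => /andP[r1 _].
  by apply: (J_tmu G _ (hr r)).
apply: subs_seq => [|r]; first exact: spanS_subspace.
rewrite seq.mem_iota => /andP[r1 _]; move: (hr r).
apply: (spanS_ind (Q := [set w | Neg (@tmu _ _ (triF g Cliff) w)])).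
  by apply: (subspace_pre (@tmuF_lin _ _ _ g E Cliff)); exact: spanS_subspace.
move=> w [al [be [a [b [_ ha _ ->]]]]] /=; rewrite (tmuF_pure E).
by apply: Neg_mulr; apply: (Neg_incl ha); rewrite /= sub0r oppr_lt0.
Qed.

Lemma phi00 : exists2 a : FA Ext gM, FAk_gr 3 0 a & phi (0, 0%N) = tpure a (1 : FA Ext gP).
Proof.
have [_ /(_ (0, 0%N))] := h3.
apply: (spanS_ind (Q := [set w | exists2 a : FA Ext gM, FAk_gr 3 0 a & w = tpure a (1 : FA Ext gP)])).
  split; first by exists 0; [apply: subs0; exact: FAk_gr_subspace|rewrite tpure0l].
  move=> k x y [a ha ->] [a' ha' ->]; exists (k *: a + a'); last by rewrite tpure_linl.
  have S : subspace (@FAk_gr _ _ _ g Ext gM 3 0) by exact: FAk_gr_subspace.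
  exact: S.2.
move=> w [k [l [al [be [a [b [kl ab ha hb ->]]]]]]] /=.
case: l kl hb => [|l] kl hb; last first.
  have -> : b = 0 by apply: (FAk_gr_P_low hb).
  by exists 0; [apply: subs0; exact: FAk_gr_subspace|rewrite tpure0l tpure0r].
rewrite addn0 in kl; rewrite kl in ha.
have [be0|be0] := eqVneq be 0; last first.
  have -> : b = 0.
    move: hb; apply: (spanS_ind (subspace_0 _)) => v [x [delta [_]]].
    by rewrite !big_ord0 => /(congr1 snd) H0; case/eqP: be0; exact: esym H0.
  by exists 0; [apply: subs0; exact: FAk_gr_subspace|rewrite tpure0l tpure0r].
have [c ->] : exists c : K, b = c *: (1 : FA Ext gP).
  move: hb; apply: (spanS_ind (Q := [set b | exists c : K, b = c *: (1 : FA Ext gP)])).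
    split; first by exists 0; rewrite scale0r.
    by move=> t x y [c1 ->] [c2 ->]; exists (t * c1 + c2); rewrite scalerDl scalerA.
  by move=> v [x [delta [_ _ ->]]] /=; rewrite big_ord0; exists 1; rewrite scale1r.
exists (c *: a); last by rewrite tpureZl tpureZr.
apply: subsZ; first exact: FAk_gr_subspace.
have al0 : al = 0.
  have ab' : al + be = 0 by exact: ab.
  by rewrite -ab' be0 addr0.
by move: ha; rewrite al0.
Qed.

(** Euler's identity for a cubic element: the symmetrization recursion gives the length 3, and each
    contraction it contains is half an anticommutator by [symm_comm]. Only letters of g_0 occur. *)
Lemma Phi1_euler : 3 *: Phi 1 = 2^-1 *: \sum_(a <- ball E 0)
  gC (e' a) * (gC (e a) * Phi 1 + Phi 1 * gC (e a)).
Proof.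
have [u hu pu] := phi00.
have il := @incM_lin _ _ _ g E Cliff.
have sl : linear sM := symmT_lin span_M Cliff kb kf.
have PhiE : Phi 1 = FAincl setT (sM u).
  rewrite QNE /wN /= big_seq1 pu (qq_pure E Cliff kb kf) (symmT1 span_P Cliff kb kf).
  by rewrite (tmuF_pure E) (FAincl1 span_P HT) // mulr1.
have two := char0 1.
have CE a : gC (e a) * Phi 1 + Phi 1 * gC (e a) =
    2 *: FAincl setT (sM (@contr _ _ _ g E gM Ext (e a) u)).
  rewrite PhiE (symm_comm char0 span_M (gv a) hu) ep0r; by module.
rewrite (eq_bigr _ (fun a _ => congr1 (fun v => gC (e' a) * v) (CE a))).
rewrite (eq_bigr (fun a => 2 *: (gC (e' a) * FAincl setT (sM (@contr _ _ _ g E gM Ext (e a) u))))); last first.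
  by move=> a _; rewrite palg_scalerAr.
rewrite -scaler_sumr scalerA mulVf // scale1r PhiE -(linZ il).
rewrite (symmT_recE char0 span_M Cliff kb kf hu) /contr.
move: (pd_span span_M kb kf hu).
have mll := @ml_lin _ _ _ _ E gM Cliff.
have tl := tmap_lin (@lin_id K g) sl.
have cl x := @contrT_lin _ _ _ g gM Ext x.
apply: (spanS_ind (Q := [set t | FAincl setT (@ml _ _ _ g E gM Cliff (tmap id sM t)) =
  \sum_(a <- ball E 0) gC (e' a) * FAincl setT (sM (tlift (fun y (w : FA Ext gM) => B (e a) y *: w) t))])).
  apply: subspace_eq; first exact: (lin_comp il (lin_comp mll tl)).
  apply: linear_funsum => a; apply: (lin_comp (FA_mull_lin _)).
  exact: (lin_comp il (lin_comp sl (cl (e a)))).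
move=> t [y [w [d1 [d2 [Py gy hw dd ->]]]]] /=.
have gl := genT_lin E Cliff.
rewrite (tmap_pure (@lin_id K g) sl) ml_pure (gnlE span_M Cliff Py).
rewrite (FAinclM span_M HT) // (FAincl_gen span_M HT) //.
have [y0|y0] := eqVneq d1.1 0.
  have d10 : (`|d1.1| <= 0)%N by rewrite y0.
  rewrite -{1}(ball_dual_exp E gy d10) (linsumZ gl) mulr_suml; apply: eq_bigr => a _.
  by rewrite (@contrT_pure _ _ _ g gM Ext) (linZ sl) (linZ il) -palg_scalerAl palg_scalerAr.
(* A letter of nonzero degree in g_- has negative degree, so the rest of the word would have
   positive degree in the algebra of g_-, which is impossible unless it is zero. *)
have [w0|yz] : w = 0 \/ y = 0; last first.
- rewrite yz (lin0 gl) mul0r big1 // => a _.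
  by rewrite (@contrT_pure _ _ _ g gM Ext) form0r scale0r (lin0 sl) (lin0 il) mulr0.
- rewrite w0 (lin0 sl) (lin0 il) mulr0 big1 // => a _.
  by rewrite (@contrT_pure _ _ _ g gM Ext) scaler0 (lin0 sl) (lin0 il) mulr0.
have [yz|yn] := eqVneq y 0; first by right.
left; apply: (FA_gr_M E (FAk_gr_FA hw)).
have d1M : d1.1 <= 0.
  have [a Ba] : exists a, B y (e' a) != 0.
    apply: contrapT => /forallNP H; case/eqP: yn; have [s [_ _ ->]] := basis_exp E y.
    rewrite big1 // => a _; have /negP := H a; rewrite negbK => /eqP ->.
    by rewrite scale0r.
  have := (grP E _ _).1 gy _ Ba => <-.
  exact: ((span_M y).1 Py a Ba).
rewrite -ltNge; move: dd => /(congr1 fst) /= ; move: y0 d1M; move: d1.1 d2.1 => p q; lia.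
Qed.

Lemma Phi1_comm_J d x : gr d x -> d.1 = 0 ->
  J 1 (gC x * Phi 1 + Phi 1 * gC x - Gam_ 0 x).
Proof.
move=> gx d0; have [N0 HN] := phi_comm char0 hphi gx 1.
have [T _] := Phi_tail (ltn0Sn N0); have H := HN _ (leqnSn N0).
have GJ := Gam_J0 N0.+1 gx d0.
have T2 : J 1 ((Phi N0.+1 - Phi 1) * gC x).
  have := J_mulr T (FA_gr_gen setT Cliff gx : tgr G d (gC x)); by rewrite d0 addr0.
have T1 : J 1 (gC x * (Phi N0.+1 - Phi 1)) := J_ideal G (gC x) T.
have S := J_subspace G 1.
have := subsD S (subsB S (subsB S H T1) T2) GJ.
move: (Gam_ N0.+1 x) (Gam_ 0 x) (Phi N0.+1) (Phi 1) => X Y P Q.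
rewrite mulrBr mulrBl; congr (J 1 _).
by module.
Qed.

(** [Phi1_euler] gives 3 <phi'^2> as half the sum of <e^a gamma(e_a) phi'>. Moving e^a around by
    [vac_half] gives a factor 1/2 and the products <gamma(e_a) gamma(e^a)>, each half of a trace by
    [vac_Gam0]; the terms with [e_a, e^a] cancel by [canonical_bracket]. Altogether 1/3 1/2 1/4 =
    1/24. *)
Lemma vac_Phi_square N : (0 < N)%N ->
  vac (Phi N * Phi N) = 24^-1 * trEps (I0 E) (adU0 (Omega0 E)).
Proof.
move=> N0; have [TJ TN] := Phi_tail N0.
have PhiP := Phi_par char0 hphi; have two : (2 : K) != 0 := char0 1.
have Jr d n (u v : C) : d.1 = 0 -> J n u -> FA_gr d v -> J n (u * v).
  by move=> d0 Ju hv; have := J_mulr Ju (hv : tgr G d v); rewrite d0 addr0.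
have -> : vac (Phi N * Phi N) = vac (Phi 1 * Phi 1).
  have -> : Phi N * Phi N = Phi 1 * Phi 1 + (Phi 1 * (Phi N - Phi 1) + (Phi N - Phi 1) * Phi N).
    move: (Phi N) (Phi 1) => P Q; rewrite mulrBl mulrBr; module.
  rewrite !(scalarD vl) (vac_J1 (J_ideal G (Phi 1) TJ)) add0r.
  by rewrite (vac_Neg (Neg_mulr _ TN)) addr0.
have term a : a \in ball E 0 ->
    vac (gC (e' a) * (gC (e a) * Phi 1 + Phi 1 * gC (e a)) * Phi 1) =
    4^-1 * (\sum_(b <- ball E 0) B (qbr (e' a) (qbr (e a) (e' b))) (e b))
     - ep (deg a) (deg a) * vac (gC (qbr (e a) (e' a)) * Phi 1).
  rewrite mem_ball leqn0 absz_eq0 => /eqP a0; have a0' : (- deg a).1 = 0 by rewrite /= a0 oppr0.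
  set A := gC (e a) * Phi 1 + Phi 1 * gC (e a).
  have JA : J 1 (A - Gam_ 0 (e a)) := Phi1_comm_J (gv a) a0.
  have JA' := Phi1_comm_J (gd a) a0'.
  have Phi0 : FA_gr 0 (Phi 1) := FApar_gr (PhiP 1).
  have -> : vac (gC (e' a) * A * Phi 1) = vac (gC (e' a) * (Gam_ 0 (e a) * Phi 1)).
    have -> : gC (e' a) * A * Phi 1 = gC (e' a) * (Gam_ 0 (e a) * Phi 1)
        + gC (e' a) * ((A - Gam_ 0 (e a)) * Phi 1).
      move: (Gam_ 0 (e a)) A (Phi 1) {JA JA' Phi0} => X A P.
      by rewrite mulrBl mulrBr !mulrA; module.
    by rewrite (scalarD vl) (vac_J1 (J_ideal G _ (Jr 0 _ _ _ erefl JA Phi0))) addr0.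
  have GP := Gam_par E 0 (gv a).
  have XP : FApar true (deg a) (Gam_ 0 (e a) * Phi 1) by have := FAparM GP (PhiP 1); rewrite addr0.
  rewrite (vac_half (gd a) a0' XP) expr1 epNl.
  have Xc : Gam_ 0 (e a) * gC (e' a) = ep (deg a) (- deg a) *: (gC (e' a) * Gam_ 0 (e a)) + 2 *: gC (qbr (e a) (e' a)).
    by apply: (Gam_swap E char0 (gv a) (gd a)); rewrite /= a0 ?oppr0 ?addr0.
  have v2 := vac_Gam0 (gv a) (gd a) a0.
  rewrite epNr in Xc.
  have jX : vac (Gam_ 0 (e a) * (gC (e' a) * Phi 1 + Phi 1 * gC (e' a) - Gam_ 0 (e' a))) = 0.
    exact: (vac_J1 (J_ideal G _ JA')).
  move: (Gam_ 0 (e a)) (Gam_ 0 (e' a)) (Phi 1) Xc v2 jX {JA JA' Phi0 GP XP} => X Y P Xc v2 jX.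
  have -> : gC (e' a) * (X * P) - (-1 * ep (deg a) (deg a)) *: (X * P * gC (e' a)) =
     ep (deg a) (deg a) *: (X * (gC (e' a) * P + P * gC (e' a) - Y)) + ep (deg a) (deg a) *: (X * Y)
     - (2 * ep (deg a) (deg a)) *: (gC (qbr (e a) (e' a)) * P).
    rewrite mulrBr mulrDr !mulrA Xc mulrDl -!palg_scalerAl.
    have S := ep_sqr eps (deg a).
    apply: (cert0 (Z := (1 - ep (deg a) (deg a) * ep (deg a) (deg a)) *: (gC (e' a) * X * P))); last first.
      by rewrite S subrr scale0r.
    by module.
  rewrite (scalarB vl) (scalarD vl) !(scalarZl vl) jX mulr0 add0r v2.
  move: (\sum_(b <- _) _) (vac _) => s v.
  have S := ep_sqr eps (deg a).
  have V4 : 4^-1 = 2^-1 * 2^-1 :> K by rewrite -invfM -natrM.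
  have T2 : 2^-1 * 2 = 1 :> K by rewrite mulVf.
  rewrite V4; move: (ep (deg a) (deg a)) S (2^-1) T2 => p S h T2.
  transitivity (h * h * (p * p) * s - (h * 2) * (p * v)); first by ring.
  by rewrite S T2 mulr1 mul1r.
have three : (3 : K) != 0 := char0 2.
have E3 : 3 * vac (Phi 1 * Phi 1) = 2^-1 * (4^-1 *
   \sum_(a <- ball E 0) \sum_(b <- ball E 0) B (qbr (e' a) (qbr (e a) (e' b))) (e b)).
  rewrite -(scalarZl vl) palg_scalerAl Phi1_euler -palg_scalerAl (scalarZl vl); congr (_ * _).
  rewrite mulr_suml (scalarsum vl) (eq_big_seq _ term) sumrB -mulr_sumr.
  have -> : \sum_(a <- ball E 0) ep (deg a) (deg a) * vac (gC (qbr (e a) (e' a)) * Phi 1) = 0; last by rewrite subr0.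
  have gl := genT_lin E Cliff.
  transitivity (vac (gC (\sum_(a <- ball E 0) ep (deg a) (deg a) *: qbr (e a) (e' a)) * Phi 1)).
    rewrite (linsumZ gl) mulr_suml (scalarsum vl); apply: eq_bigr => a _.
    by rewrite -palg_scalerAl (scalarZl vl).
  by rewrite (canonical_bracket E char0) (lin0 gl) mul0r (scalar0 vl).
rewrite trEps_Omega; apply: (mulfI three); rewrite E3 !mulrA; congr (_ * _).
have V24 : 24^-1 = 3^-1 * (2^-1 * 4^-1) :> K by rewrite -!invfM -!natrM.
by rewrite V24 [RHS]mulrA mulfV // mul1r.
Qed.

End Cubic.
End VacuumOfSquare.

(** * The square of the Dirac operator *)

Section WeilSums.
Variables (K : fieldType) (Gam : zmodType) (eps : commutation_factor K Gam).
Variables (g : quadColorLie eps) (E : hbasis g).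
Hypothesis char0 : forall n, n.+1%:R != 0 :> K.
Notation I := (bidx E).
Notation e := (@bvec _ _ _ _ E).
Notation e' := (@bdual _ _ _ _ E).
Notation B := (@qfm _ _ _ g).
Notation deg := (@bdeg _ _ _ _ E).
Notation ep := (ep eps).
Notation gv := (@bvec_gr _ _ _ _ E).
Notation gd := (@bdual_gr _ _ _ _ E).
Let HT : span_of E [set: g] [set: bideg Gam] := @span_ofT _ _ _ g E.
Notation degT_add := (@degT_add Gam).
Notation U := (FA Env [set: g]).
Notation C := (FA Cliff [set: g]).
Notation W := (WA [set: g]).
Notation gU x := (gen Env [set: g] x).
Notation gC x := (gen Cliff [set: g] x).
Notation gS x := (gen Sym [set: g] x).
Notation "u ** v" := (@WA_mul _ _ _ g setT u v) (at level 40, left associativity).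
Notation JW := (J (F := triW g)).
Notation nullW := (null (F := triW g)).
Notation Gam_ := (Gam_ E).
Notation no := (no E).
Notation kappa := (kappa E).
Let GW := triW_good E.
Let GU := triF_good E Env.
Let GC := triF_good E Cliff.
Let kbS (x y : g) : kbr Sym x y = 0. Proof. by []. Qed.
Let kfS (x y : g) : kfm Sym x y = 0. Proof. by []. Qed.
Let gUl := genT_lin E Env.
Let two : (2 : K) != 0. Proof. exact: (char0 1). Qed.
Let h2 : 2^-1 * 2 - 1 = 0 :> K. Proof. by rewrite mulVf ?subrr. Qed.

Lemma J_pure_hom n d d' (x : U) (y : C) : FA_gr d x -> FA_gr d' y ->
  (n <= d.1) || (n <= d'.1) -> JW n (tpure x y).
Proof.
move=> hx hy /orP[H|H].
  by apply: (J_pureU E); exact: (J_mono H (J_hom (G := GU) hx)).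
by apply: (J_pureC E); exact: (J_mono H (J_hom (G := GC) hy)).
Qed.

Definition diracA N : W := \sum_(a <- ball E N) tpure (gU (e' a)) (gC (e a)).
Definition casimir N : U := \sum_(a <- ball E N) theta K (deg a).1 *: (gU (e' a) * gU (e a)).

Lemma diracA_term a : WA_gr 0 (tpure (gU (e' a)) (gC (e a))).
Proof.
by have := WA_gr_pure (FA_gr_gen setT Env (gd a)) (FA_gr_gen setT Cliff (gv a)); rewrite addNr.
Qed.

(** Normal ordering reverses the terms of negative degree, and [canonical_sym] converts these into a
    second copy of the terms of positive degree, hence the weight 2. In degree 0 the two orders
    being averaged have equal sums, hence the weight 1. *)
Lemma casimir_qg N : qg E Env (\sum_(a <- ball E N) gS (e' a) * gS (e a)) = casimir N.
Proof.
have ql := qg_lin E Env kbS kfS; rewrite (linsum ql).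
pose X a := gU (e' a) * gU (e a); pose Y a := ep (deg a) (deg a) *: (gU (e a) * gU (e' a)).
have can (P P' : pred int) : (forall i, P' i = P (- i)) ->
    \sum_(a <- ball E N | P (deg a).1) Y a = \sum_(a <- ball E N | P' (deg a).1) X a.
  move=> PP'; apply: (@canonical_sym _ _ _ _ E U (fun u v => gU u * gU v) P P') => [y|x|i _].
  - exact: (lin_comp (FA_mulr_lin _) gUl).
  - exact: (lin_comp (FA_mull_lin _) gUl).
  - exact: PP'.
pose i1 (b : bool) : K := b%:R.
have tE a : qg E Env (gS (e' a) * gS (e a)) = i1 (0 < (deg a).1) *: X a
    + i1 ((deg a).1 < 0) *: Y a + i1 ((deg a).1 == 0) *: (2^-1 *: (X a + Y a)).
  rewrite (qg_gen2 E char0 Env kbS kfS (gd a) (gv a)) /= mul1r epNl -/(X a) -/(Y a) oppr_le0 /i1.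
  case: (ltrgtP (deg a).1 0) => H; rewrite ?scale0r ?scale1r ?addr0 ?add0r //.
have thE a : theta K (deg a).1 *: X a = 2 *: (i1 (0 < (deg a).1) *: X a) + i1 ((deg a).1 == 0) *: X a.
  by rewrite /theta /i1; case: (ltrgtP (deg a).1 0) => H /=; move: (X a) => v; module.
have i1E (P : pred int) (Z : I -> U) : \sum_(a <- ball E N) i1 (P (deg a).1) *: Z a = \sum_(a <- ball E N | P (deg a).1) Z a.
  rewrite [RHS]big_mkcond /=; apply: eq_bigr => a _; rewrite /i1.
  by case: (P _); rewrite ?scale1r ?scale0r.
rewrite /casimir (eq_bigr _ (fun a _ => tE a)) (eq_bigr _ (fun a _ => thE a)) !big_split /= -scaler_sumr.
rewrite (i1E (fun i => 0 < i)) (i1E (fun i => i < 0)) !(i1E (fun i => i == 0)).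
rewrite (can (fun i => i < 0) (fun i => 0 < i)); last by move=> i; rewrite oppr_lt0.
rewrite -scaler_sumr big_split /= (can (fun i => i == 0) (fun i => i == 0)); last by move=> i; rewrite oppr_eq0.
move: (\sum_(a <- _ | _) X a) (\sum_(a <- _ | _) X a) => u v.
by apply: (cert0 (Z := (2^-1 * 2 - 1) *: v)); [module|rewrite h2 scale0r].
Qed.

(** The common summand of the mixed terms and of the normal ordered part of the square: a structure
    constant times e^c (x) :e_a e_b:. *)
Definition triple (c a b : I) : W := B (qbr (e c) (e' b)) (e' a) *: tpure (gU (e' c)) (no (e a) (e b)).

(** A nonzero structure constant forces deg c = deg a + deg b. If [a] or [c] is far out, then e^c,
    e_a or e_b has Z-degree at least [n], and the term is small on that account. *)
Lemma triple_J n N c a b : (`|n| + `|n| <= N)%N ->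
  (a \notin ball E N) || (c \notin ball E N) -> JW n (triple c a b).
Proof.
move=> nN H; rewrite /triple.
have [->|Bn] := eqVneq (B (qbr (e c) (e' b)) (e' a)) 0.
  by rewrite scale0r; exact: subs0 (J_subspace GW n).
have dE := form_grP (qbr_gr (gv c) (gd b)) (gd a) Bn.
have {}dE : (deg c).1 = (deg a).1 + (deg b).1.
  by move/(congr1 fst): dE => /= /eqP; rewrite subr_eq0 subr_eq addrC => /eqP ->; rewrite addrC.
apply: (subsZ (J_subspace GW n)).
have [c1|c1] := lerP n (- (deg c).1).
  apply: (J_pureU E); apply: (@J_mono _ _ _ n (- deg c).1); first exact: c1.
  exact: (J_hom (G := GU) (FA_gr_gen _ _ (gd c))).
have [a1|a1] := lerP n (deg a).1; first by apply: (J_pureC E); exact: (J_mono a1 (no_Jl E (gv a) (gv b))).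
have [b1|b1] := lerP n (deg b).1; first by apply: (J_pureC E); exact: (J_mono b1 (no_Jr E (gv a) (gv b))).
exfalso; move: H nN c1 a1 b1 dE; rewrite !mem_ball -!ltnNge.
by move: (deg a).1 (deg b).1 (deg c).1 => p q r H; lia.
Qed.

Lemma cross_gam N : \sum_(c <- ball E N) tpure (gU (e' c)) (Gam_ N (e c)) =
  2^-1 *: \sum_(c <- ball E N) \sum_(b <- ball E N) \sum_(a <- ball E (N + N)) triple c a b.
Proof.
rewrite scaler_sumr; apply: eq_big_seq => c; rewrite mem_ball => cN.
rewrite /Gam_ tpureZr (linsum (tpure_linr _)); congr (_ *: _).
apply: eq_big_seq => b; rewrite mem_ball => bN.
have cb : (`|(deg c - deg b)%R.1| <= N + N)%N.
  by rewrite bidegD /=; move: cN bN; move: (deg c).1 (deg b).1 => p q; lia.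
rewrite -{1}(ball_exp E (qbr_gr (gv c) (gd b)) cb) (linsumZ (no_linl E _)) (linsum (tpure_linr _)).
by apply: eq_bigr => a _; rewrite tpureZr.
Qed.

(** The two-point functions contract the double sum to the Casimir element. The normal ordered part
    is averaged with its copy under exchange of a and b; skew-symmetry of :e_a e_b: leaves the
    brackets [e^a, e^b], whose expansion in the dual basis gives the structure constants by
    invariance. *)
Lemma diracA_square N : diracA N ** diracA N = tpure (casimir N) (1 : C)
  - 2^-1 *: \sum_(a <- ball E N) \sum_(b <- ball E N) \sum_(c <- ball E (N + N)) triple c a b.
Proof.
have Ml := WA_mul_linl HT degT_add; have Mr := WA_mul_linr HT degT_add.
pose P a b : W := ep (deg b) (deg a) *: tpure (gU (e' a) * gU (e' b)) (no (e a) (e b)).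
pose Q a b : W := (ep (deg b) (deg a) * kappa (e a) (e b)) *: tpure (gU (e' a) * gU (e' b)) (1 : C).
have AA : diracA N ** diracA N = \sum_(a <- ball E N) \sum_(b <- ball E N) (Q a b + P a b).
  rewrite /diracA (linsum (Ml _)); apply: eq_bigr => a _.
  rewrite (linsum (Mr _)); apply: eq_bigr => b _.
  rewrite (WA_mul_hom HT degT_add _ _ (FA_gr_gen _ _ (gv a)) (FA_gr_gen _ _ (gd b))) epNr.
  have -> : gC (e a) * gC (e b) = kappa (e a) (e b) *: (1 : C) + no (e a) (e b) by rewrite addrC subrK.
  by rewrite tpureDr tpureZr scalerDr scalerA.
rewrite AA; under eq_bigr => a _ do rewrite big_split.
rewrite big_split /=; congr (_ + _).
  rewrite /casimir (linsum (tpure_linl _)); apply: eq_big_seq => a; rewrite mem_ball => aN.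
  transitivity (theta K (deg a).1 *: tpure (gU (e' a) * gU (\sum_(b <- ball E N) B (e b) (e a) *: e' b)) (1 : C)).
    rewrite (linsumZ gUl) mulr_sumr (linsum (tpure_linl _)) scaler_sumr; apply: eq_bigr => b _.
    rewrite -palg_scalerAr tpureZl scalerA; congr (_ *: _).
    rewrite (kappa_gr E _ (gv a)) (qfm_sym (gv a) (gv b)).
    have V := epV eps (deg b) (deg a).
    transitivity ((ep (deg b) (deg a) * ep (deg a) (deg b)) * (theta K (deg a).1 * B (e b) (e a))); first by ring.
    by rewrite V mul1r.
  by rewrite (ball_dual_exp E (gv a) aN) tpureZl.
set S := \sum_(a <- ball E N) _.
have S1 : S = \sum_(a <- ball E N) \sum_(b <- ball E N) - tpure (gU (e' b) * gU (e' a)) (no (e a) (e b)).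
  rewrite /S exchange_big /=; apply: eq_bigr => a _; apply: eq_bigr => b _.
  rewrite /P (no_sym E (gv a) (gv b)) tpureZr scalerA mulrN epV scaleN1r //.
have S2 : 2 *: S = - \sum_(a <- ball E N) \sum_(b <- ball E N) \sum_(c <- ball E (N + N)) triple c a b.
  rewrite -[2]/(1 + 1 : K) scalerDl scale1r {2}S1 /S -big_split -sumrN /=; apply: eq_big_seq => a; rewrite mem_ball => aN.
  rewrite -big_split -sumrN /=; apply: eq_big_seq => b; rewrite mem_ball => bN.
  have -> : P a b - tpure (gU (e' b) * gU (e' a)) (no (e a) (e b)) =
      ep (deg b) (deg a) *: tpure (gU (qbr (e' a) (e' b))) (no (e a) (e b)).
    rewrite /P (gen_comm HT (k := Env) _ _ _ (gd a) (gd b)) // /kfm scale0r addr0 /kbr !epNl.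
    rewrite tpureDl tpureZl.
    have V := epV eps (deg b) (deg a).
    apply: (cert0 (Z := (ep (deg b) (deg a) * ep (deg a) (deg b) - 1) *: tpure (gU (e' b) * gU (e' a)) (no (e a) (e b)))); last first.
      by rewrite V subrr scale0r.
    by rewrite /= mul1r; module.
  have ab : (`|(- deg a - deg b)%R.1| <= N + N)%N.
    by rewrite bidegD /=; move: aN bN; move: (deg a).1 (deg b).1 => p q; lia.
  rewrite -{1}(ball_dual_exp E (qbr_gr (gd a) (gd b)) ab) (linsumZ gUl) (linsum (tpure_linl _)).
  rewrite scaler_sumr -sumrN; apply: eq_bigr => c _.
  rewrite tpureZl scalerA /triple -scaleNr; congr (_ *: _).
  by rewrite qfm_inv (qbr_skew (gd b) (gd a)) formNr formZr opprK !epNl.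
rewrite -scalerN -S2 scalerA mulVf // scale1r //.
Qed.

Lemma ball_split N (F : I -> W) : \sum_(a <- ball E (N + N)) F a =
  \sum_(a <- ball E N) F a + \sum_(a <- ball E (N + N) | a \notin ball E N) F a.
Proof.
rewrite (bigID (fun a => a \in ball E N)) /=; congr (_ + _).
rewrite big_mkcond /=; transitivity (\sum_(a <- ball E N) if a \in ball E N then F a else 0).
  apply: big_supp; try exact: ball_uniq.
    move=> a aN; case: ifP => // aN'; move: aN; rewrite !mem_ball in aN' *.
    by rewrite (leq_trans aN' (leq_addr _ _)).
  by move=> a /negbTE ->.
by apply: eq_big_seq => a ->.
Qed.

(** The two triple sums differ only in which index runs over the larger ball. The common part
    cancels, and every remaining term has [a] or [c] outside the smaller ball, so it is small by
    [triple_J]. *)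
Lemma triple_null : nullW (fun N =>
  \sum_(c <- ball E N) \sum_(b <- ball E N) \sum_(a <- ball E (N + N)) triple c a b
  - \sum_(a <- ball E N) \sum_(b <- ball E N) \sum_(c <- ball E (N + N)) triple c a b).
Proof.
move=> n; exists (`|n| + `|n|)%N => N nN.
have S := J_subspace GW n.
under eq_bigr => c _ do under eq_bigr => b _ do rewrite ball_split.
under [X in _ - X]eq_bigr => a _ do under eq_bigr => b _ do rewrite ball_split.
under eq_bigr => c _ do rewrite big_split.
under [X in _ - X]eq_bigr => c _ do rewrite big_split.
rewrite !big_split /=.
have -> : \sum_(c <- ball E N) \sum_(b <- ball E N) \sum_(a <- ball E N) triple c a b =
    \sum_(a <- ball E N) \sum_(b <- ball E N) \sum_(c <- ball E N) triple c a b.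
  rewrite exchange_big [RHS]exchange_big /=; apply: eq_bigr => b _.
  by rewrite exchange_big.
rewrite opprD addrACA subrr add0r; apply: (subsB S).
  apply: (subssum S) => c _; apply: (subssum S) => b _; apply: (subssum S) => a aN.
  by apply: (triple_J _ nN); rewrite aN.
apply: (subssum S) => a _; apply: (subssum S) => b _; apply: (subssum S) => c cN.
by apply: (triple_J _ nN); rewrite cN orbT.
Qed.

Section Dirac.
Variables (phi : hatL g) (hphi : structure_tensor E phi).
Notation Phi := (QN E phi 0).

Lemma cross_term N : diracA N ** tpure (1 : U) (Phi N) + tpure (1 : U) (Phi N) ** diracA N =
  \sum_(c <- ball E N) tpure (gU (e' c)) (gC (e c) * Phi N + Phi N * gC (e c)).
Proof.
have Ml := WA_mul_linl HT degT_add; have Mr := WA_mul_linr HT degT_add.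
rewrite /diracA (linsum (Ml _)) (linsum (Mr _)) -big_split; apply: eq_bigr => c _ /=.
rewrite (WA_mulxC HT degT_add) tpureDr.
rewrite (WA_mul_hom HT degT_add _ _ (FApar_gr (Phi_par char0 hphi N)) (FA_gr_gen _ _ (gd c))).
by rewrite ep0l scale1r mul1r.
Qed.

(** For each fixed c this is [phi_comm]. For c far out the summand is small whatever the truncation,
    one of e^c and the Clifford factor having large positive degree, so [null_ball] sums the
    errors. *)
Lemma cross_null : nullW (fun N => diracA N ** tpure (1 : U) (Phi N) + tpure (1 : U) (Phi N) ** diracA N
  - \sum_(c <- ball E N) tpure (gU (e' c)) (Gam_ N (e c))).
Proof.
pose f c N : tg (triW g) := tpure (gU (e' c)) (gC (e c) * Phi N + Phi N * gC (e c) - Gam_ N (e c)).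
have nf : nullW (fun N => \sum_(c <- ball E N) f c N).
  apply: (null_ball GW) => [N|c|n]; first exact: ball_uniq.
    by move=> n; have [N0 H] := phi_comm char0 hphi (gv c) n; exists N0 => N /H; exact: (J_pureC E).
  exists (ball E `|n|) => N c _; rewrite mem_ball -ltnNge => cn.
  have hP := FApar_gr (Phi_par char0 hphi N); have hc := FA_gr_gen setT Cliff (gv c).
  have hf : FA_gr (deg c) (gC (e c) * Phi N + Phi N * gC (e c) - Gam_ N (e c)).
    have S : subspace (@FA_gr _ _ _ g Cliff setT (deg c)) by exact: FA_gr_subspace.
    apply: (subsB S); last exact: (FApar_gr (Gam_par E N (gv c))).
    by apply: (subsD S); [have := FA_grM hc hP|have := FA_grM hP hc]; rewrite ?addr0 ?add0r.
  apply: (J_pure_hom (FA_gr_gen _ _ (gd c)) hf).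
  by move: cn; rewrite /=; move: (deg c).1 => p; lia.
apply: (null_ext (N0 := 0) _ nf) => N _; rewrite cross_term -sumrB.
by apply: eq_bigr => c _; rewrite /f (linB (tpure_linr _)).
Qed.

Lemma dirac_linear_part : nullW (fun N => diracA N ** diracA N
  + (diracA N ** tpure (1 : U) (Phi N) + tpure (1 : U) (Phi N) ** diracA N)
  - tpure (casimir N) (1 : C)).
Proof.
apply: (null_ext (N0 := 0) _ (nullD GW cross_null (nullZ GW (2^-1) triple_null))) => N _.
rewrite diracA_square cross_gam; move: (diracA N ** _ + _) => X.
by module.
Qed.
End Dirac.

End WeilSums.

(** * Assembly of the square of the Dirac operator *)

Section DiracSquare.
Variables (K : fieldType) (Gam : zmodType) (eps : commutation_factor K Gam).
Variables (g : quadColorLie eps) (E : hbasis g).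
Hypothesis char0 : forall n, n.+1%:R != 0 :> K.
Notation e := (@bvec _ _ _ _ E).
Notation e' := (@bdual _ _ _ _ E).
Notation deg := (@bdeg _ _ _ _ E).
Notation gv := (@bvec_gr _ _ _ _ E).
Notation gd := (@bdual_gr _ _ _ _ E).
Notation U := (FA Env [set: g]).
Notation C := (FA Cliff [set: g]).
Notation gS x := (gen Sym [set: g] x).
Let HT : span_of E [set: g] [set: bideg Gam] := @span_ofT _ _ _ g E.
Notation degT_add := (@degT_add Gam).
Let GW := triW_good E.
Let GS := triF_good E Sym.
Let kb (x y : g) : kbr Ext x y = 0. Proof. by []. Qed.
Let kf (x y : g) : kfm Ext x y = 0. Proof. by []. Qed.
Let kbS (x y : g) : kbr Sym x y = 0. Proof. by []. Qed.
Let kfS (x y : g) : kfm Sym x y = 0. Proof. by []. Qed.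

Lemma Omega_approx : hom_fam (F := triF g Env) 0 (Omega' E) /\
  approx (F := triF g Env) (casimir E) (Omega' E).
Proof.
pose s a : tg (triF g Sym) := gS (e' a) * gS (e a).
have hQE : Omega' E = (fun c => qq E Env (hsum (triF g Sym) s c)).
  apply/funext => c; rewrite /Omega' /hQ (symmetrizationE (span_M E)).
  by rewrite (symmetrizationE (span_P E)).
have hs : hom_fam (F := triF g Sym) 0 (hsum (triF g Sym) s).
  apply: (hom_fam_hsum (G := GS)) => a.
  by have := FA_grM (FA_gr_gen setT Sym (gd a)) (FA_gr_gen setT Sym (gv a)); rewrite addNr.
have as_ : approx (F := triF g Sym) (fun N => \sum_(a <- ball E N) s a) (hsum (triF g Sym) s).
  apply: (approx_hsum GS) => [N|n]; first exact: ball_uniq.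
  exists `|n|%N => N a Nn; rewrite mem_ball -ltnNge => aN.
  have [a0|a0] := lerP 0 (deg a).1.
    apply: (J_ideal GS); apply: (J_mono _ (J_hom (G := GS) (FA_gr_gen _ _ (gv a)))).
    by move: a0 Nn aN; move: (deg a).1 => p; lia.
  rewrite /s (gen_swap HT kbS kfS (gd a) (gv a)); apply: (subsZ (J_subspace GS _)).
  apply: (J_ideal GS); apply: (J_mono _ (J_hom (G := GS) (FA_gr_gen _ _ (gd a)))).
  by rewrite /=; move: a0 Nn aN; move: (deg a).1 => p; lia.
rewrite hQE; split; first exact: (qg_hom_fam E char0 Env kbS kfS hs).
have A := approx_qg E char0 Env kbS kfS hs as_.
by move=> n; have [N0 H] := A n; exists N0 => N /H; rewrite (casimir_qg E char0).
Qed.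

Lemma QN_approx (u : hatL g) : hom_fam (F := triF g Cliff) 0 (hq u) ->
  approx (F := triF g Cliff) (QN E u 0) (hq u).
Proof.
move=> hu n; have [N0 H] := approx_trunc (triF_good E Cliff) hu n.
exists N0 => N /H; rewrite (hqE E u) (qg_trunc E Cliff kb kf); exact.
Qed.

(** Both sides are limits of explicit truncations. Their difference is the sum of two null
    sequences: [dirac_linear_part] for the terms involving generators of U, and [Phi_square_null]
    for the pure Clifford terms. *)
Theorem dirac_square (phi psi : hatL g) : structure_tensor E phi -> KP_sharp E psi ->
  hmul (triW g) (dirac E phi) (dirac E phi) =
    hinU (Omega' E) + hinC (hq psi)
    + (24^-1 * trEps (I0 E) (adU0 (Omega0 E))) *: hin (triW g) (WA_one g setT).
Proof.
move=> hphi hpsi; set c := _ * trEps _ _.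
have Ml := WA_mul_linl HT degT_add; have Mr := WA_mul_linr HT degT_add.
have fphi := hom_fam_hq_phi char0 hphi; have fpsi := hom_fam_hq_psi char0 hpsi.
pose f a : tg (triW g) := tpure (gen Env setT (e' a)) (gen Cliff setT (e a)).
have hf a : tgr GW 0 (f a) := diracA_term a.
have hD : hom_fam (F := triW g) 0 (dirac E phi).
  apply: (hom_famD (hom_fam_hsum (G := GW) hf)); exact: (hom_fam_hinC fphi).
have aA : approx (F := triW g) (diracA E) (hsum (triW g) f).
  apply: (approx_hsum GW) => [N|n]; first exact: ball_uniq.
  exists `|n|%N => N a Nn; rewrite mem_ball -ltnNge => aN.
  apply: (J_pure_hom E (FA_gr_gen _ _ (gd a)) (FA_gr_gen _ _ (gv a))).
  by move: Nn aN; rewrite /=; move: (deg a).1 => p; lia.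
have aD : approx (F := triW g) (fun N => diracA E N + tpure (1 : U) (QN E phi 0 N)) (dirac E phi).
  by apply: (approxD GW aA); exact: (approx_hinC E fphi (QN_approx fphi)).
have gA N : tgr GW 0 (diracA E N + tpure (1 : U) (QN E phi 0 N)).
  apply: (subsD (tgr_subspace GW 0)).
    by apply: (subssum (tgr_subspace GW 0)) => a _; exact: hf.
  have := WA_gr_pure (FA_gr1 setT Env) (FApar_gr (Phi_par char0 hphi N)); by rewrite addr0.
have [fOm aOm] := Omega_approx.
have aR := approxD GW (approxD GW (approx_hinU E fOm aOm) (approx_hinC E fpsi (QN_approx fpsi)))
   (approxZ GW c (@approx_hin _ _ (triW g) (WA_one g setT))).
apply: (approx_eq GW (approx_hmul2 hD hD gA gA aD aD) aR).
have n1 := dirac_linear_part char0 hphi.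
have n2 := null_pureC E (Phi_square_null char0 hphi hpsi).
(* The truncation of phi at 0 is the empty sum; the vacuum value has its final form only from 1
   on. *)
apply: (null_ext (N0 := 1) _ (nullD GW n1 n2)) => N N0.
rewrite (vac_Phi_square char0 hphi N0) -/c.
change (@WA_mul _ _ _ g setT (diracA E N + tpure (1 : U) (QN E phi 0 N)) (diracA E N + tpure (1 : U) (QN E phi 0 N))
  - (tpure (casimir E N) (1 : C) + tpure (1 : U) (QN E psi 0 N) + c *: tpure (1 : U) (1 : C)) =
  (WA_mul (diracA E N) (diracA E N)
  + (WA_mul (diracA E N) (tpure (1 : U) (QN E phi 0 N)) + WA_mul (tpure (1 : U) (QN E phi 0 N)) (diracA E N))
  - tpure (casimir E N) (1 : C))
  + tpure (1 : U) (QN E phi 0 N * QN E phi 0 N - QN E psi 0 N - c *: (1 : C))).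
rewrite (linD (Ml _)) !(linD (Mr _)) (WA_mulxC HT degT_add) !(linB (tpure_linr _)) tpureZr.
move: (WA_mul _ _) (WA_mul _ _) (WA_mul _ _) => X Y Z.
by module.
Qed.
End DiracSquare.

Local Open Scope complex_scope.

Theorem theorem65 (R : realType) (Gam : zmodType)
    (eps : commutation_factor R[i] Gam) (g : quadColorLie eps) (E : hbasis g)
    (phi psi : hatL g)
    (hphi : structure_tensor E phi) (hpsi : KP_sharp E psi) :
  hmul (triW g) (dirac E phi) (dirac E phi) =
    hinU (Omega' E) + hinC (hq psi)
    + (24^-1 * trEps (I0 E) (adU0 (Omega0 E)))
        *: hin (triW g) (WA_one g setT).
Proof.
by apply: dirac_square => // n; rewrite pnatr_eq0.
Qed.
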